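(* Let $p\in[-d,2]$. Let $Z$ be an invariant $\mathbb R^d$-valued random field on $\mathbb R^d$, let $\Phi$ be an invariant locally square-integrable random measure on $\mathbb R^d$, and let $\Psi(B):=\int\mathbf 1\{x+Z(x)\in B\}\,\Phi(dx)$ for Borel $B\subseteq\mathbb R^d$. Suppose that there are $\gamma>d+\max(p,0)$ and $c>0$ such that $$\mathbb E_0^\Phi[\|Z(0)\|^\gamma]<\infty,\qquad \mathbb E_{0,y}^\Phi[\|Z(0)\|^\gamma]\le c\quad(y\in\mathbb R^d),$$ $$\int\frac{\kappa(y)^{\frac{\gamma-2q}{\gamma}}}{1+\|y\|^{2q-p}}\,\alpha_\Phi(dy)<\infty\qquad\text{for every } q\in\mathbb N\text{ with } q<\tfrac{d+p}2,$$ where $$\kappa(y):=\sup_{A_1,A_2\subseteq\mathbb R^d\text{ Borel}}\big|\mathbb P_{0,y}^\Phi(Z(y)\in A_1,Z(0)\in A_2)-\mathbb P_0^\Phi(Z(0)\in A_1)\,\mathbb P_0^\Phi(Z(0)\in A_2)\big|,\quad y\in\mathbb R^d.$$ Then $\Psi$ is $p$-uniform if $\Phi$ is $p$-uniform. If $p<2$, then also $\Psi$ is beyond $p$-uniform if $\Phi$ is beyond $p$-uniform.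
   Context: $d\in\mathbb N=\{1,2,\dots\}$, $\lambda_d$ is Lebesgue measure, $B_r=\{x\in\mathbb R^d:\|x\|<r\}$. $(\Omega,\mathcal A,\mathbb P)$ is a probability space with a measurable flow $\{\theta_x:x\in\mathbb R^d\}$ ($\theta_0=\mathrm{id}$, $\theta_{x+y}=\theta_x\theta_y$, $(\omega,x)\mapsto\theta_x\omega$ measurable) preserving $\mathbb P$. A random measure $\Phi$ is a random element of the space of locally finite (nonnegative) measures on $\mathbb R^d$, invariant if $\Phi(\theta_x\omega,B)=\Phi(\omega,B+x)$, and locally square-integrable if $\mathbb E[\Phi(B_1)^2]<\infty$. A random field $Z$ is (jointly measurable and) invariant if $Z(\theta_z\omega,x)=Z(\omega,x+z)$. With $\hat f(k)=\int e^{-i\langle k,x\rangle}f(x)\,dx$ and $\Phi(f)=\int f\,d\Phi$, the Bartlett spectral measure $\hat\beta_\Phi$ is the unique locally finite measure on $\mathbb R^d$ with $\mathrm{Cov}[\Phi(f),\Phi(g)]=(2\pi)^{-d}\int\hat f\,\overline{\hat g}\,d\hat\beta_\Phi$ for all bounded measurable compactly supported $f,g$. For $p\in[-d,\infty)$, $\Phi$ is $p$-uniform if $\varepsilon^{-d}\hat\beta_\Phi(B_\varepsilon)=O(\varepsilon^p)$ as $\varepsilon\to0$, and beyond $p$-uniform if this holds with $o(\varepsilon^p)$. The reduced second moment measure is $\alpha_\Phi(B)=\mathbb E\big[\iint\mathbf 1\{x\in[0,1)^d,\,x-y\in B\}\,\Phi(dx)\Phi(dy)\big]$. With $\gamma_\Phi$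 the intensity ($\mathbb E[\Phi]=\gamma_\Phi\lambda_d$), the first-order Palm measure is $\mathbb P_0^\Phi(A)=\gamma_\Phi^{-1}\mathbb E\big[\int_{[0,1)^d}\mathbf 1\{\theta_x\omega\in A\}\,\Phi(dx)\big]$; the second-order Palm probability measures $(\mathbb P_{0,y}^\Phi)_{y\in\mathbb R^d}$ are determined $\alpha_\Phi$-a.e. by $\mathbb E\big[\iint f(\omega,x,y)\,\Phi(dx)\Phi(dy)\big]=\iiint f(\theta_{-x}\omega,x,x+y)\,\mathbb P_{0,y}^\Phi(d\omega)\,\alpha_\Phi(dy)\,dx$ for measurable $f\ge0$. $\mathbb E_0^\Phi,\mathbb E_{0,y}^\Phi$ are the expectations. *)

(* Defs.v *)
From HB Require Import structures.
From mathcomp Require Import all_boot all_order all_algebra.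
From mathcomp Require Import all_classical all_reals all_analysis measurable_realfun.
From mathcomp Require Import complex.

Set Implicit Arguments.
Unset Strict Implicit.
Unset Printing Implicit Defensive.

Import Order.TTheory GRing.Theory Num.Theory.
Import numFieldNormedType.Exports.

Local Open Scope classical_set_scope.
Local Open Scope ring_scope.

Definition borel_rV_display : measure_display.
Proof. exact: default_measure_display. Qed.

(* R^n is 'rV[R]_n with its Borel sigma-algebra. *)
Section borel_sigma_algebra_rV.
Context {R : realType} {n : nat}.
Local Notation borel := (<<s @open 'rV[R]_n >>).

Let borel0 : borel set0. Proof. exact: sigma_algebra0. Qed.

Let borelC A : borel A -> borel (~` A). Proof. exact: sigma_algebraC. Qed.

Let borel_bigcup (F : (set 'rV[R]_n)^nat) :
  (forall i, borel (F i)) -> borel (\bigcup_i F i).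
Proof. exact: sigma_algebra_bigcup. Qed.

HB.instance Definition _ := isMeasurable.Build borel_rV_display 'rV[R]_n
  borel0 borelC borel_bigcup.

End borel_sigma_algebra_rV.

Section borel_rV.
Context {R : realType} {n : nat}.
Local Notation E := 'rV[R]_n.

Lemma open_measurable_rV (U : set E) : open U -> measurable U.
Proof. by move=> oU; exact: sub_sigma_algebra. Qed.

Lemma measurable_coord (i : 'I_n) : measurable_fun setT (fun x : E => x 0 i).
Proof.
apply: (measurability _ (RGenOInfty.measurableE R)) => _ [_ [a ->] <-].
rewrite setTI; apply: open_measurable_rV.
apply: open_comp; last exact: rray_open.
by move=> x _; exact: coord_continuous.
Qed.

Lemma measurable_fun_rV d (T : measurableType d) (f : T -> E) :
  (forall i, measurable_fun setT (fun t => f t 0 i)) -> measurable_fun setT f.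
Proof.
move=> mf.
apply: (measurability (@open E)) => // _ [U oU <-]; rewrite setTI.
pose box (q : 'rV[rat]_n * nat) : set E :=
  [set x | forall i, `|x 0 i - ratr (q.1 0 i)| < q.2.+1%:R^-1].
have mbox q : measurable (f @^-1` box q).
  rewrite (_ : _ @^-1` _ = \bigcap_(i in [set: 'I_n])
      ((fun t => f t 0 i) @^-1` ball (ratr (q.1 0 i) : R) q.2.+1%:R^-1)).
    apply: fin_bigcap_measurable => // i _.
    rewrite -[X in measurable X]setTI; apply: mf => //.
    exact: measurable_ball.
  apply/seteqP; split=> t /= h i; first by move=> _; rewrite /ball/= distrC.
  by rewrite distrC; exact: h.
rewrite (_ : _ @^-1` _ = \bigcup_q
    (if `[< box q `<=` U >] then f @^-1` box q else set0)).
  apply: countable_bigcupT_measurable => [|q]; last by case: ifP.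
  exact: countableP.
apply/seteqP; split=> [t /= Uft|t [q _]]; last first.
  by case: asboolP => // boxU; exact: boxU.
have /nbhs_ballP[e /= e0 eU] : nbhs (f t) U by exact: open_nbhs_nbhs.
have [k ke] : exists k : nat, (2 * k.+1%:R^-1 : R) < e.
  exists (Num.truncn (2 / e)).
  by rewrite ltr_pdivrMr// mulrC -ltr_pdivrMr// truncnS_gt.
have k0 : (0 : R) < k.+1%:R^-1 by rewrite invr_gt0.
have /choice[q hq] (i : 'I_n) : exists r : rat, `|f t 0 i - ratr r| < k.+1%:R^-1.
  have /rat_in_itvoo[r] : f t 0 i < f t 0 i + k.+1%:R^-1 by rewrite ltrDl.
  rewrite in_itv/= => /andP[h1 h2]; exists r.
  by rewrite distrC ger0_norm ?ltrBlDl // subr_ge0 ltW.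
exists (\row_i q i, k) => //; case: asboolP => [_|[]].
  by move=> i /=; rewrite mxE.
move=> x /= hx; apply: eU; split => // i j; rewrite (ord1 i) /ball/=.
apply: lt_trans ke; rewrite mulr_natl mulr2n.
apply: le_lt_trans (ler_distD (ratr (q j)) _ _) _; apply: ltrD => //.
by have := hx j; rewrite /= mxE distrC.
Qed.

End borel_rV.

Section image_measure.
Context d1 d2 (T1 : measurableType d1) (T2 : measurableType d2) (R : realType).
Variables (m : {measure set T1 -> \bar R}) (f : {mfun T1 >-> T2}).

Definition image_measure : set T2 -> \bar R := pushforward m f.

Let image_measure0 : image_measure set0 = 0%E.
Proof. exact: measure0. Qed.

Let image_measure_ge0 A : (0 <= image_measure A)%E.
Proof. exact: measure_ge0. Qed.

Let image_measure_sigma_additive : semi_sigma_additive image_measure.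
Proof. exact: measure_semi_sigma_additive. Qed.

HB.instance Definition _ := isMeasure.Build _ _ _ image_measure
  image_measure0 image_measure_ge0 image_measure_sigma_additive.

End image_measure.

Section lebesgue_measure_rV.
Context {R : realType}.

Definition snoc_rV n (p : 'rV[R]_n * measurableTypeR R) : 'rV[R]_n.+1 :=
  \row_i if unlift ord_max i is Some j then p.1 0 j else p.2.

Let measurable_snoc_rV n : measurable_fun setT (@snoc_rV n).
Proof.
apply: measurable_fun_rV => i; rewrite /snoc_rV.
under eq_fun do rewrite mxE.
case: unliftP => [j _|_]; last exact: measurable_snd.
exact: (measurableT_comp (measurable_coord j) measurable_fst).
Qed.

HB.instance Definition _ n :=
  isMeasurableFun.Build _ _ _ _ (@snoc_rV n) (@measurable_snoc_rV n).

(* Lebesgue measure on R^n as an iterated product; R^0 is a point of mass 1. *)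
Fixpoint lebesgue_rV n : {measure set 'rV[R]_n -> \bar R} :=
  match n return {measure set 'rV[R]_n -> \bar R} with
  | 0 => \d_(0 : 'rV[R]_0)
  | n'.+1 => image_measure (lebesgue_rV n' \x lebesgue_measure)%E (@snoc_rV n')
  end.

End lebesgue_measure_rV.

Definition locally_finite (R : realType) (n : nat)
    (m : {measure set 'rV[R]_n -> \bar R}) : Prop :=
  forall B : set 'rV[R]_n, measurable B -> bounded_set B -> (m B < +oo)%E.

Section locally_finite_kernel.
Context {R : realType} {n : nat} d (X : measurableType d).
Variable k : R.-ker X ~> 'rV[R]_n.
Hypothesis k_lf : forall x, locally_finite (k x).

Let mball m : measurable (ball (0 : 'rV[R]_n) m.+1%:R).
Proof. by apply: open_measurable_rV; exact: ball_open. Qed.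

Let ball_bounded m : bounded_set (ball (0 : 'rV[R]_n) m.+1%:R).
Proof.
exists m.+1%:R; split=> // M mM x /=.
by rewrite mx_norm_ball /ball_/= sub0r normrN => /lt_trans/(_ mM)/ltW.
Qed.

Lemma measurable_xsection_locally_finite (A : set (X * 'rV[R]_n)) :
  measurable A -> measurable_fun setT (fun x => k x (xsection A x)).
Proof.
move=> mA.
apply: (@emeasurable_fun_cvg _ _ _ _
    (fun m x => mrestr (k x) (mball m) (xsection A x))) => [m|x _].
  have [] // := @measurable_prod_subset_xsection_kernel _ _ _ _ _ k _ (mball m) _ A mA.
  move=> x; have kx := k_lf x (mball m) (@ball_bounded m).
  exists (fine (k x (ball 0 m.+1%:R)) + 1) => B mB.
  rewrite (@le_lt_trans _ _ (k x (ball 0 m.+1%:R)))//.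
    by rewrite /mrestr le_measure ?inE//; exact: measurableI.
  by rewrite EFinD fineK ?ge0_fin_numE// lteDl// ?lte_fin// ge0_fin_numE.
rewrite [X in _ --> k x X](_ : _ =
    \bigcup_m (xsection A x `&` ball (0 : 'rV[R]_n) m.+1%:R)); last first.
  rewrite -setI_bigcupr [X in _ `&` X](_ : _ = setT) ?setIT//.
  apply/seteqP; split=> // y _; exists (Num.truncn `|y|) => //.
  by rewrite mx_norm_ball /ball_/= sub0r normrN truncnS_gt.
apply: nondecreasing_cvg_mu => [m||m1 m2 m12].
- by apply: measurableI => //; exact: measurable_xsection.
- apply: bigcup_measurable => m _.
  by apply: measurableI => //; exact: measurable_xsection.
- by apply/subsetPset; apply: setIS; apply: le_ball; rewrite ler_nat.
Qed.

Import HBNNSimple.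

Lemma measurable_integral_locally_finite (D : set 'rV[R]_n)
    (f : X * 'rV[R]_n -> \bar R) : measurable D ->
  (forall t, (0 <= f t)%E) -> measurable_fun setT f ->
  measurable_fun setT (fun x => \int[k x]_(y in D) f (x, y))%E.
Proof.
move=> mD f0 mf; pose g := (f \_ (setT `*` D))%E.
have g0 t : (0 <= g t)%E by rewrite /g patchE; case: ifP.
have mg : measurable_fun setT g.
  have mTD : measurable ([set: X] `*` D) by exact: measurableX.
  apply: (measurable_restrictT f mTD).1. exact: measurable_funTS.
rewrite (_ : (fun x => _) = (fun x => \int[k x]_y g (x, y)))%E; last first.
  apply/funext => x; rewrite integral_mkcond; apply: eq_integral => y _.
  by rewrite /g !patchE in_setX in_setT.
pose g_ := nnsfun_approx measurableT mg.
apply: (@measurable_fun_xsection_integral _ _ _ _ _ g k g_).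
- by move=> a b ab; exact/nd_nnsfun_approx.
- by move=> z; exact/cvg_nnsfun_approx.
- move=> m r; apply: measurable_xsection_locally_finite.
  exact: measurable_funPTI.
Qed.

End locally_finite_kernel.

Section integral_sigma_additive.
Context d d' (T : measurableType d) (T' : measurableType d') (R : realType).
Local Open Scope ereal_scope.

Lemma integral_semi_sigma_additive (m : {measure set T -> \bar R}) (D : set T)
    (k : T -> set T' -> \bar R) : measurable D ->
  (forall t, semi_sigma_additive (k t)) -> (forall t A, 0 <= k t A) ->
  (forall A, measurable A -> measurable_fun D (k ^~ A)) ->
  semi_sigma_additive (fun A => \int[m]_(t in D) k t A).
Proof.
move=> mD k_sigma k0 mk F mF tF mUF.
rewrite [X in _ --> X](_ : _ = \sum_(i <oo) \int[m]_(t in D) k t (F i)).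
  apply: is_cvg_ereal_nneg_natsum => i _; exact: integral_ge0.
rewrite -integral_nneseries//; last by move=> i; exact: mk.
by apply: eq_integral => t _; apply/esym/cvg_lim => //; exact: k_sigma.
Qed.

End integral_sigma_additive.

Section euclidean_space.
Context {R : realType} {n : nat}.
Implicit Types x y : 'rV[R]_n.

Definition dotv x y : R := \sum_i x 0 i * y 0 i.

(* The norm `|x| of the library on 'rV[R]_n is the sup norm. *)
Definition norm2 x : R := Num.sqrt (dotv x x).

Definition ball2 (r : R) : set 'rV[R]_n := [set x | norm2 x < r].

Definition unit_cube : set 'rV[R]_n := [set x | forall i, 0 <= x 0 i < 1].

Lemma measurable_unit_cube : measurable unit_cube.
Proof.
rewrite (_ : unit_cube = \bigcap_(i in [set: 'I_n])
    ((fun x : 'rV[R]_n => x 0 i) @^-1` `[0, 1[%classic)).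
  apply: fin_bigcap_measurable => // i _; rewrite -[X in measurable X]setTI.
  by apply: measurable_coord => //; exact: measurable_itv.
apply/seteqP; split=> x /= h i; first by move=> _ /=; rewrite in_itv/=.
by have := h i I; rewrite /= in_itv/=.
Qed.

End euclidean_space.

Section fourier.
Context {R : realType}.
Local Open Scope complex_scope.

Definition expi (t : R) : R[i] := cos t +i* sin t.

Definition cintegrable d (T : measurableType d) (m : {measure set T -> \bar R})
    (F : T -> R[i]) : Prop :=
  m.-integrable setT (fun x => (complex.Re (F x))%:E) /\
  m.-integrable setT (fun x => (complex.Im (F x))%:E).

Definition cintegral d (T : measurableType d) (m : {measure set T -> \bar R})
    (F : T -> R[i]) : R[i] :=
  (\int[m]_x complex.Re (F x)) +i* (\int[m]_x complex.Im (F x)).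

Definition fourier n (f : 'rV[R]_n -> R) (k : 'rV[R]_n) : R[i] :=
  cintegral (lebesgue_rV n) (fun x => expi (- dotv k x) * (f x)%:C).

End fourier.

Section flow.
Context d (Omega : measurableType d) (R : realType) (n : nat).

Record measurable_flow := MeasurableFlow {
  flow_fun :> 'rV[R]_n -> Omega -> Omega ;
  flow0 : flow_fun 0 = id ;
  flowD : forall x y, flow_fun (x + y) = flow_fun x \o flow_fun y ;
  flow_measurable :
    measurable_fun setT (fun p : Omega * 'rV[R]_n => flow_fun p.2 p.1) }.

Definition preserves (theta : measurable_flow) (P : probability Omega R) :=
  forall x A, measurable A -> P (theta x @^-1` A) = P A.

(* A kernel w |-> Phi w is the same as a measurable map into the space of
   measures with the sigma-algebra generated by the evaluations. *)
Record random_measure := RandomMeasure {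
  random_measure_kernel :> R.-ker Omega ~> 'rV[R]_n ;
  random_measure_locally_finite :
    forall w, locally_finite (random_measure_kernel w) }.

Definition invariant_measure (theta : measurable_flow) (Phi : random_measure) :=
  forall w x B, measurable B ->
    Phi (theta x w) B = Phi w [set b + x | b in B].

Definition random_field := {mfun (Omega * 'rV[R]_n)%type >-> 'rV[R]_n}.

Definition invariant_field (theta : measurable_flow) (Z : random_field) :=
  forall w x z, Z (theta z w, x) = Z (w, x + z).

End flow.

Section displacement.
Context d (Omega : measurableType d) (R : realType) (n : nat).
Variable Z : random_field Omega R n.

Definition displace (w : Omega) (x : 'rV[R]_n) : 'rV[R]_n := x + Z (w, x).

Let measurable_displace w : measurable_fun setT (displace w).
Proof.
apply: measurable_fun_rV => i; rewrite /displace.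
under eq_fun do rewrite mxE.
apply: measurable_funD; first exact: measurable_coord.
apply: (measurableT_comp (measurable_coord i)).
by apply: measurableT_comp => //; exact: measurable_pair1.
Qed.

HB.instance Definition _ w :=
  isMeasurableFun.Build _ _ _ _ (displace w) (@measurable_displace w).

(* B |-> \int 1{x + Z(w, x) \in B} Phi w (dx) *)
Definition transport (Phi : random_measure Omega R n) (w : Omega) :
  {measure set 'rV[R]_n -> \bar R} := image_measure (Phi w) (displace w).

End displacement.

Section moment_measures.
Context d (Omega : measurableType d) (R : realType) (n : nat).
Variables (P : probability Omega R) (theta : measurable_flow Omega R n).
Variable Phi : random_measure Omega R n.
Local Open Scope ereal_scope.

Let locally_finite_Phi := random_measure_locally_finite Phi.

(* E[Phi] = intensity * Lebesgue, evaluated at the unit cube *)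
Definition intensity : R := fine (\int[P]_w Phi w unit_cube).

(* The first-order Palm measure; it is the zero measure if intensity = 0. *)
Definition palm (A : set Omega) : \bar R :=
  (intensity^-1)%:E *
  \int[P]_w \int[Phi w]_(x in unit_cube) (\1_A (theta x w))%:E.

Let palm0 : palm set0 = 0.
Proof.
rewrite /palm integral0_eq ?mule0// => w _.
by rewrite integral0_eq// => x _; rewrite indic0.
Qed.

Let intensityV_ge0 : 0 <= (intensity^-1)%:E.
Proof. by rewrite lee_fin invr_ge0 fine_ge0// integral_ge0. Qed.

Let palm_ge0 A : 0 <= palm A.
Proof. by rewrite mule_ge0// integral_ge0// => w _; exact: integral_ge0. Qed.

Let indic_sigma_additive d' (T : measurableType d') (t : T) :
  semi_sigma_additive (fun A : set T => (\1_A t)%:E : \bar R).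
Proof. exact: (@measure_semi_sigma_additive _ _ _ (dirac t)). Qed.

Let palm_sigma_additive : semi_sigma_additive palm.
Proof.
move=> F mF tF mUF.
rewrite [X in X @ _ --> _](_ : _ = fun k => (intensity^-1)%:E *
    \sum_(0 <= i < k)
      \int[P]_w \int[Phi w]_(x in unit_cube) (\1_(F i) (theta x w))%:E); last first.
  apply/funext => k; rewrite ge0_sume_distrr// => i _.
  by apply: integral_ge0 => w _; exact: integral_ge0.
apply: cvgeZl => //.
have mtheta w : measurable_fun setT (theta ^~ w).
  exact: (measurableT_comp (flow_measurable theta) (measurable_pair1 w)).
apply: (@integral_semi_sigma_additive _ _ _ _ _ _ _
  (fun w A => \int[Phi w]_(x in unit_cube) (\1_A (theta x w))%:E)) => //.
- move=> w; apply: (@integral_semi_sigma_additive _ _ _ _ _ _ _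
    (fun x A => (\1_A (theta x w))%:E)) => //.
  + exact: measurable_unit_cube.
  + move=> A mA; apply: measurable_funTS; apply/measurable_EFinP.
    exact: measurableT_comp.
- by move=> w A; exact: integral_ge0.
- move=> A mA.
  apply: (@measurable_integral_locally_finite _ _ _ _ Phi locally_finite_Phi _
    (fun p => (\1_A (theta p.2 p.1))%:E)) => //.
    exact: measurable_unit_cube.
  apply/measurable_EFinP; apply: measurableT_comp => //.
  exact: flow_measurable.
Qed.

HB.instance Definition _ := isMeasure.Build _ _ _ palm
  palm0 palm_ge0 palm_sigma_additive.

Definition reduced_moment (B : set 'rV[R]_n) : \bar R :=
  \int[P]_w \int[Phi w]_(x in unit_cube) \int[Phi w]_y (\1_B (x - y)%R)%:E.

Let reduced_moment0 : reduced_moment set0 = 0.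
Proof.
rewrite /reduced_moment integral0_eq// => w _.
rewrite integral0_eq// => x _.
by rewrite integral0_eq// => y _; rewrite indic0.
Qed.

Let reduced_moment_ge0 B : 0 <= reduced_moment B.
Proof.
apply: integral_ge0 => w _; apply: integral_ge0 => x _.
exact: integral_ge0.
Qed.

Let Phi1 (p : Omega * 'rV[R]_n) := Phi p.1.

Let measurable_Phi1 U : measurable U -> measurable_fun setT (Phi1 ^~ U).
Proof.
by move=> mU; exact: (measurableT_comp (measurable_kernel Phi U mU)).
Qed.

HB.instance Definition _ := isKernel.Build _ _ _ _ _ Phi1 measurable_Phi1.

Let reduced_moment_sigma_additive : semi_sigma_additive reduced_moment.
Proof.
have msub : measurable_fun setT (fun p : 'rV[R]_n * 'rV[R]_n => p.1 - p.2)%R.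
  apply: measurable_fun_rV => i.
  under eq_fun do rewrite !mxE.
  apply: measurable_funB.
    exact: (measurableT_comp (measurable_coord i) measurable_fst).
  exact: (measurableT_comp (measurable_coord i) measurable_snd).
have mfull B : measurable B ->
    measurable_fun setT (fun p : Omega * 'rV[R]_n =>
      \int[Phi p.1]_y (\1_B (p.2 - y)%R)%:E).
  move=> mB'.
  apply: (@measurable_integral_locally_finite _ _ _ _ Phi1 _ setT
    (fun q => (\1_B (q.1.2 - q.2)%R)%:E)) => //.
    by move=> p; exact: locally_finite_Phi.
  apply/measurable_EFinP; apply: measurableT_comp => //.
  apply: (measurableT_comp msub
    (g := fun q : (Omega * 'rV[R]_n) * 'rV[R]_n => (q.1.2, q.2))).
  apply: measurable_fun_pair; last exact: measurable_snd.
  by apply: measurableT_comp; [exact: measurable_snd|exact: measurable_fst].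
apply: (@integral_semi_sigma_additive _ _ _ _ _ _ _
  (fun w B => \int[Phi w]_(x in unit_cube) \int[Phi w]_y (\1_B (x - y)%R)%:E))
  => //.
- move=> w /=; apply: (@integral_semi_sigma_additive _ _ _ _ _ (Phi w) unit_cube
    (fun x B => \int[Phi w]_y (\1_B (x - y)%R)%:E)) => //.
  + exact: measurable_unit_cube.
  + move=> x /=; apply: (@integral_semi_sigma_additive _ _ _ _ _ (Phi w) setT
      (fun y B => (\1_B (x - y)%R)%:E)) => //.
    move=> B mB'; apply/measurable_EFinP; apply: measurableT_comp => //.
    exact: (measurableT_comp msub (measurable_pair1 x)).
  + by move=> x B; exact: integral_ge0.
  + move=> B mB'; apply: measurable_funTS.
    exact: (measurableT_comp (mfull B mB') (measurable_pair1 w)).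
- by move=> w B; apply: integral_ge0 => x _; exact: integral_ge0.
- move=> B mB'.
  apply: (@measurable_integral_locally_finite _ _ _ _ Phi locally_finite_Phi _
    (fun p => \int[Phi p.1]_y (\1_B (p.2 - y)%R)%:E)) => //.
  - exact: measurable_unit_cube.
  - by move=> p; exact: integral_ge0.
  - exact: (mfull B mB').
Qed.

HB.instance Definition _ := isMeasure.Build _ _ _ reduced_moment
  reduced_moment0 reduced_moment_ge0 reduced_moment_sigma_additive.

End moment_measures.

Section palm2.
Context d (Omega : measurableType d) (R : realType) (n : nat).
Variables (P : probability Omega R) (theta : measurable_flow Omega R n).
Variable Phi : random_measure Omega R n.
Local Open Scope ereal_scope.

(* P2 y is the second-order Palm measure P_{0,y}; the family is determined
   only up to a null set of the reduced moment measure. *)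
Definition is_palm2 (P2 : R.-pker 'rV[R]_n ~> Omega) : Prop :=
  forall f : Omega * 'rV[R]_n * 'rV[R]_n -> \bar R,
    (forall t, 0 <= f t) -> measurable_fun setT f ->
    \int[P]_w \int[Phi w]_x \int[Phi w]_y f (w, x, y) =
    \int[lebesgue_rV n]_x \int[reduced_moment P Phi]_y \int[P2 y]_w
      f (theta (- x)%R w, x, (x + y)%R).

Definition kappa (P2 : R.-pker 'rV[R]_n ~> Omega) (Z : random_field Omega R n)
    (y : 'rV[R]_n) : R :=
  let P0 := palm P theta Phi in
  sup [set r | exists A1 A2 : set 'rV[R]_n,
    [/\ measurable A1, measurable A2 &
      r = `|fine (P2 y [set w | A1 (Z (w, y)) /\ A2 (Z (w, 0))])
            - fine (P0 [set w | A1 (Z (w, 0))]) *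
              fine (P0 [set w | A2 (Z (w, 0))])|%R]].

End palm2.

(* The measures Phi w below need not be locally finite for every w, as the
   transport of a random measure is locally finite only almost surely. *)
Section hyperuniformity.
Context d (Omega : measurableType d) (R : realType) (n : nat).
Variables (P : probability Omega R).
Variable Phi : Omega -> {measure set 'rV[R]_n -> \bar R}.

Definition locally_square_integrable : Prop :=
  (\int[P]_w (Phi w (ball2 1) ^+ 2) < +oo)%E.

Definition test_function (f : 'rV[R]_n -> R) : Prop :=
  [/\ measurable_fun setT f, bounded_fun f &
      compact (closure [set x | f x != 0])].

Definition linear_statistic (f : 'rV[R]_n -> R) (w : Omega) : R :=
  \int[Phi w]_x f x.

Local Open Scope complex_scope.

(* Test functions are real: the identity for complex ones follows by
   sesquilinearity. The covariance is finite under local square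
   integrability, which is part of p_uniform. *)
Definition is_bartlett_spectral_measure
    (beta : {measure set 'rV[R]_n -> \bar R}) : Prop :=
  locally_finite beta /\
  forall f g, test_function f -> test_function g ->
    let F k := fourier f k * (fourier g k)^* in
    cintegrable beta F /\
    (fine (covariance P (linear_statistic f) (linear_statistic g)))%:C =
      ((2 * pi) ^- n)%:C * cintegral beta F.

Definition p_uniform (p : R) : Prop :=
  locally_square_integrable /\
  exists2 beta, is_bartlett_spectral_measure beta &
    (fun e : R => e ^- n * fine (beta (ball2 e)))
      =O_ ((0 : R)^'+) (fun e : R => e `^ p).

Definition beyond_p_uniform (p : R) : Prop :=
  locally_square_integrable /\
  exists2 beta, is_bartlett_spectral_measure beta &
    (fun e : R => e ^- n * fine (beta (ball2 e)))
      =o_ ((0 : R)^'+) (fun e : R => e `^ p).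

End hyperuniformity.

(* Main.v *)
(* The spectral measure of [Psi], obtained from Riesz' theorem and a Bochner-type
   argument, is tested on balls of radius [1/r] by a smooth bump of scale [r].
   Taylor-expanding the bump at the displaced points gives terms of degree [< (d+p)/2],
   controlled by the spectrum of [Phi], the Palm moments and [kappa], plus a
   remainder bounded by the moments of order [gamma]. *)
Require Import Defs.
From HB Require Import structures.
From mathcomp Require Import all_boot all_order all_algebra.
From mathcomp Require Import all_classical all_reals all_analysis measurable_realfun.
From mathcomp Require Import complex ring lra zify.

Set Implicit Arguments.
Unset Strict Implicit.
Unset Printing Implicit Defensive.

Import Order.TTheory GRing.Theory Num.Theory.
Import numFieldNormedType.Exports.

Local Open Scope classical_set_scope.
Local Open Scope ring_scope.

Notation mfunT := (measurable_fun setT).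
Notation mcomp := measurableT_comp.
Notation mEFin := measurable_EFinP.
Notation mfunM := measurable_funM.
Notation mfunD := measurable_funD.
Notation mfunB := measurable_funB.
Notation mfunX := measurable_funX.
Notation emfunM := emeasurable_funM.
Notation mpair := measurable_fun_pair.
Notation mcst := measurable_cst.
Notation mfst := measurable_fst.
Notation msnd := measurable_snd.
Notation mindic := measurable_indic.
Notation mfunP := measurable_funP.
Notation mtop := measurableT.
Notation int_Zl := ge0_integralZl_EFin.
Notation eq_Rint := eq_Rintegral.
Notation int_ge0 := integral_ge0.
Notation cont_mfun := continuous_measurable_fun.
Notation int_indic := integral_indic.
Notation lstat := linear_statistic.
Notation loc_fin := locally_finite.
Notation meas T R := {measure set T -> \bar R}.
Notation intR mu f := (mu.-integrable setT (EFin \o f)).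
Tactic Notation "via" uconstr(y) := refine (@le_trans _ _ y _ _ _ _).

(** At scale [r] the property to transfer is a variance of order [r^(d-p)]. Four obstacles shape the
    proof. If [q = (d+p)/2] is an integer, this degree belongs to the expansion but the hypothesis
    on [kappa] does not cover it; there a bound [o(r^(2d))] before scaling suffices, and it holds
    because derivatives of the bump have integral zero and so do not see the atom of the spectrum at
    the origin. Under the two-point Palm measures a moment is assumed for the mark at 0 only;
    exchanging the two points yields it at [y] for almost every [y], and pairs of large
    displacements are charged to the point that moves more. The Palm formula concerns nonnegative
    functions, so signed statistics are split, and the cross terms are cancelled only once they are
    known to be finite. Finally the displaced measure is locally finite only almost surely and test
    functions are merely bounded and measurable: the spectral theory is therefore developed for
    abstract bilinear forms on such functions, by periodograms on finer and finer grids, and applied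
    to regular versions of the measures. *)

Lemma eq_ler (R : numDomainType) (x y : R) : x = y -> x <= y.
Proof. by move=> ->. Qed.

(** * Continuous functions with compact support and trapezoidal cutoffs *)

Section compact_support.
Context {R : realType} {n : nat}.
Notation E := 'rV[R]_n.
Implicit Types f g : E -> R.
Definition off_cube (t : R) f := forall x, t <= `|x| -> f x = 0.
Definition Cc f := continuous f /\ exists t, off_cube t f.

Lemma CcD f g : Cc f -> Cc g -> Cc (fun x => f x + g x).
move=> [cf [s fs]] [cg [t gt]]; split.
 by move=> x; exact: (cvgD (cf x) (cg x)).
by exists (Num.max s t) => x; rewrite ge_max => /andP[sx tx]; rewrite fs// gt// addr0.
Qed.

Lemma CcMl (u : E -> R) f : continuous u -> Cc f -> Cc (fun x => u x * f x).
move=> cu [cf [t ft]]; split.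
 by move=> x; exact: (cvgM (cu x) (cf x)).
by exists t => x tx; rewrite ft// mulr0.
Qed.

Lemma CcZ a f : Cc f -> Cc (fun x => a * f x).
Proof. by move=> Cf; apply: (@CcMl (fun=> a)) Cf => x; exact: cst_continuous. Qed.
Lemma continuous_maxr (u v : E -> R) : continuous u -> continuous v ->
 continuous (fun x => Num.max (u x) (v x)).
Proof. by move=> cu cv x; apply: continuous_max; [exact: cu|exact: cv]. Qed.
Lemma continuous_minr (u v : E -> R) : continuous u -> continuous v ->
 continuous (fun x => Num.min (u x) (v x)).
Proof. by move=> cu cv x; apply: continuous_min; [exact: cu|exact: cv]. Qed.
Definition cutoff (t : R) (x : E) : R := Num.max 0 (Num.min 1 (t + 1 - `|x|)).

Lemma Cc_cutoff t : Cc (cutoff t).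
split.
 apply: continuous_maxr; first by move=> x; exact: cst_continuous.
 apply: continuous_minr; first by move=> x; exact: cst_continuous.
 by move=> x; exact: (cvgB (@cst_continuous _ _ (t + 1) x) (@norm_continuous _ _ x)).
exists (t + 1) => x tx; rewrite /cutoff; apply/max_idPl.
by rewrite ge_min subr_le0 tx orbT.
Qed.

Lemma cutoff_ge0 t x : 0 <= cutoff t x.
Proof. by rewrite /cutoff le_max lexx. Qed.
Lemma cutoff_le1 t x : cutoff t x <= 1.
Proof. by rewrite /cutoff ge_max ler01 ge_min lexx. Qed.
Lemma cutoff1 t x : `|x| <= t -> cutoff t x = 1.
move=> xt; rewrite /cutoff min_l; first by rewrite max_r.
by rewrite addrAC lerDr subr_ge0.
Qed.

Lemma cutoff0 t x : t + 1 <= `|x| -> cutoff t x = 0.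
by move=> tx; rewrite /cutoff; apply/max_idPl; rewrite ge_min subr_le0 tx orbT.
Qed.

Lemma cube_compact (t : R) : compact [set x : E | `|x| <= t].
apply: bounded_closed_compact.
 by exists t; split; [exact: num_real|move=> M tM x /= xt; rewrite (le_trans xt)// ltW].
rewrite (_ : [set x | _] = (fun x : E => `|x|) @^-1` [set y : R | y <= t])//.
by apply: closed_comp => [x _|]; [exact: norm_continuous|exact: closed_le].
Qed.
End compact_support.

Lemma continuous_mfun (R : realType) n (g : 'rV[R]_n -> R) :
 continuous g -> mfunT g.
move=> cg; apply: (measurability _ (RGenOInfty.measurableE R)) => _ [_ [a ->] <-].
rewrite setTI; apply: open_measurable_rV.
by apply: open_comp => [x _|]; [exact: cg|exact: rray_open].
Qed.

(** * Riesz representation of positive functionals on [R^n] *)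

Section riesz.
Context {R : realType} {n : nat}.
Notation E := 'rV[R]_n.
Variable L : (E -> R) -> R.
Hypothesis LD : forall f g, Cc f -> Cc g -> L (fun x => f x + g x) = L f + L g.
Hypothesis LZ : forall a f, Cc f -> L (fun x => a * f x) = a * L f.
Hypothesis L0 : forall f, Cc f -> (forall x, 0 <= f x) -> 0 <= L f.
Let L_sum N (h : nat -> E -> R) : (forall i, Cc (h i)) ->
 Cc (fun x => \sum_(i < N) h i x) /\ L (fun x => \sum_(i < N) h i x) = \sum_(i < N) L (h i).
move=> hc; elim: N => [|N [IH1 IH2]].
 under eq_fun do rewrite big_ord0.
 rewrite big_ord0 (_ : (fun=> 0) = fun x : E => 0 * cutoff 0 x).
  by split; [apply: CcZ; exact: Cc_cutoff|rewrite LZ ?mul0r//; exact: Cc_cutoff].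
 by apply/funext => x; rewrite mul0r.
by under eq_fun do rewrite big_ord_recr/=; split; [exact: CcD|rewrite LD// IH2 big_ord_recr].
Qed.
Let LB f g : Cc f -> Cc g -> L (fun x => f x - g x) = L f - L g.
move=> Cf Cg; rewrite (_ : (fun x => f x - g x) = (fun x => f x + (-1) * g x)).
 by rewrite LD ?LZ ?mulN1r//; exact: CcZ.
by apply/funext => x; rewrite mulN1r.
Qed.
Let CcB f g : Cc f -> Cc g -> Cc (fun x : E => f x - g x).
move=> Cf Cg; rewrite (_ : (fun x => f x - g x) = (fun x => f x + (-1) * g x)).
 by apply: CcD => //; exact: CcZ.
by apply/funext => x; rewrite mulN1r.
Qed.
Let leL f g : Cc f -> Cc g -> (forall x, f x <= g x) -> L f <= L g.
by move=> Cf Cg fg; rewrite -subr_ge0 -LB//; apply: L0 => [|x]; [exact: CcB|rewrite subr_ge0].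
Qed.
Let nondecr (g : nat -> E -> R) := forall k x, g k x <= g k.+1 x.
Let nondecr_le (g : nat -> E -> R) : nondecr g -> forall j k x, (j <= k)%N -> g j x <= g k x.
Proof. move=> ng j k x; elim: k => [|k IH]; first by rewrite leqn0 => /eqP ->.
by rewrite leq_eqVlt => /predU1P[->//|/IH]; move/le_trans; apply; exact: ng. Qed.
(** Daniell's upper envelope: increasing sequences of [Cc] functions stand for lower semicontinuous
    functions, here with supremum at least 1 on [A]. Asking for every level [eta < 1] expresses this
    without forming the limit function. *)
Definition riesz_cover (A : set E) (t : R) := exists g : nat -> E -> R,
 [/\ forall k, Cc (g k), forall k x, 0 <= g k x, forall k x, g k x <= g k.+1 x,
   forall k, L (g k) <= t & forall x eta, A x -> eta < 1 -> exists k, eta < g k x].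
Definition riesz_outer (A : set E) : \bar R := ereal_inf [set t%:E | t in riesz_cover A].
Let cover_ge0 A t : riesz_cover A t -> 0 <= t.
Proof. by move=> [g [Cg g0 _ gt _]]; apply: le_trans (gt 0%N); apply: L0. Qed.
(** Dini's argument: on the compact cube carrying [phi], monotonicity makes the pointwise lower
    bound uniform at a single index, and the uniform error is absorbed by a multiple of the cutoff
    whose cost under [L] is at most [e]. *)
Lemma riesz_dini (g : nat -> E -> R) phi t : (forall k, Cc (g k)) ->
 (forall k x, g k x <= g k.+1 x) -> (forall k, L (g k) <= t) -> Cc phi ->
 (forall x, 0 <= g 0%N x) ->
 (forall x e, 0 < e -> exists k, phi x - e < g k x) -> L phi <= t.
move=> Cg ng gt Cphi g0 h; have [cphi [s phis]] := Cphi.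
apply/ler_addgt0Pr => e e0.
have Lc0 : 0 <= L (cutoff s) by apply: L0; [exact: Cc_cutoff|exact: cutoff_ge0].
(* Adding 1 keeps the denominator positive when [L (cutoff s)] vanishes. *)
pose e' := e / (L (cutoff s) + 1).
have e'0 : 0 < e' by rewrite divr_gt0// ltr_wpDl.
have /compact_near_coveringP := @cube_compact R n s.
move=> /(_ nat \oo (fun k x => phi x - e' < g k x)) H.
have {H} [|N _ HN] := H _.
 move=> x xs; have [k kx] := h x e' e'0.
 have ck : {for x, continuous (fun y => g k y - phi y)}.
  exact: (cvgB ((Cg k).1 x) (cphi x)).
 have /ck U : nbhs (g k x - phi x) [set y | - e' < y]
  by apply: open_nbhs_nbhs; split; [exact: open_gt|rewrite /= ltrBrDr addrC].
 exists ([set y | - e' < g k y - phi y], [set j | (k <= j)%N]).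
  by split=> //=; exists k.
 move=> [y j] /= [yU kj]; rewrite (lt_le_trans _ (nondecr_le ng y kj))//.
 by move: yU; lra.
have HNN := HN N (leqnn N).
rewrite (@le_trans _ _ (L (fun x => g N x + e' * cutoff s x)))//.
 apply: leL => //; first by apply: CcD => //; apply: CcZ; exact: Cc_cutoff.
 move=> x; have [xs|sx] := leP `|x| s.
  by have := HNN x xs; rewrite /= (cutoff1 xs); lra.
 rewrite phis ?(ltW sx)//; apply: addr_ge0.
  exact: le_trans (g0 x) (nondecr_le ng x (leq0n N)).
 by apply: mulr_ge0; [exact: ltW|exact: cutoff_ge0].
rewrite LD ?LZ//; [|exact: Cc_cutoff|by apply: CcZ; exact: Cc_cutoff].
rewrite lerD// /e' -mulrA ler_piMr ?(ltW e0)//.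
by rewrite mulrC ler_pdivrMr ?mul1r ?lerDl// ltr_wpDl.
Qed.
Let riesz_outer_ge0 A : (0 <= riesz_outer A)%E.
Proof. by apply: le_ereal_inf_tmp => _ [t /cover_ge0 t0 <-]; rewrite lee_fin. Qed.
Let cover0 : riesz_cover set0 0.
exists (fun _ _ => 0); split=> //.
- move=> _; split; first by move=> x; exact: cst_continuous.
 by exists 0.
- move=> _; rewrite -[leLHS]/(L (fun=> 0)) (_ : (fun=> 0) = fun x => 0 * cutoff 0 x).
  by rewrite LZ ?mul0r//; exact: Cc_cutoff.
 by apply/funext => x; rewrite mul0r.
Qed.
Let riesz_outer0 : riesz_outer set0 = 0%E.
apply/eqP; rewrite eq_le riesz_outer_ge0 andbT.
by apply: ereal_inf_lbound; exists 0.
Qed.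
Let le_riesz_outer : {homo riesz_outer : A B / A `<=` B >-> (A <= B)%E}.
move=> A B AB; apply: ereal_inf_le_tmp => _ [t [g [? ? ? ? h]] <-].
by exists t => //; exists g; split=> // x eta /AB; exact: h.
Qed.
Let riesz_outer_sigma_subadditive : sigma_subadditive riesz_outer.
move=> F; have [->|] := eqVneq (\sum_(i <oo) riesz_outer (F i))%E +oo%E.
 by rewrite leey.
rewrite -ltey => lty.
have Ffin i : riesz_outer (F i) \is a fin_num.
 rewrite ge0_fin_numE//; apply: (le_lt_trans _ lty).
 rewrite (nneseries_split 0 i.+1)// add0n big_mkord big_ord_recr/=.
 apply: le_trans (leeDl _ _); last by rewrite nneseries_ge0.
 by rewrite leeDr// sume_ge0.
apply/lee_addgt0Pr => e e0.
have /choice[g_ hg] (i : nat) : exists gt : (nat -> E -> R) * R,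
 [/\ forall k, Cc (gt.1 k), forall k x, 0 <= gt.1 k x, forall k x, gt.1 k x <= gt.1 k.+1 x,
   (forall k, L (gt.1 k) <= gt.2) /\
   (gt.2%:E <= riesz_outer (F i) + (e / (2 ^ i.+1)%:R)%:E)%E &
   forall x eta, F i x -> eta < 1 -> exists k, eta < gt.1 k x].
 have ei : 0 < e / (2 ^ i.+1)%:R by rewrite divr_gt0// ltr0n expn_gt0.
 have [_ [t [g [h1 h2 h3 h4 h5]] <-] tlt] := lb_ereal_inf_adherent ei (Ffin i).
 by exists (g, t); split=> //=; split=> //; exact: ltW.
(* Diagonal sum: at index [k] only the first [k] covers are used, which keeps [G k] in [Cc]; every
   cover enters eventually, and the total cost is that of the series plus [e] split
   geometrically. *)
pose G k x := \sum_(i < k) (g_ i).1 k x.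
have sumG N k : Cc (fun x => \sum_(i < N) (g_ i).1 k x) /\
  L (fun x => \sum_(i < N) (g_ i).1 k x) = \sum_(i < N) L ((g_ i).1 k).
 by apply: (@L_sum N (fun i => (g_ i).1 k)) => i; have [] := hg i.
set S := (\sum_(i <oo) riesz_outer (F i))%E.
have S0 : (0 <= S)%E by rewrite nneseries_ge0.
have Sfin : S \is a fin_num by rewrite ge0_fin_numE.
apply: ereal_inf_lbound; exists (fine S + e); last by rewrite EFinD fineK.
exists G; split.
- by move=> k; exact: (sumG k k).1.
- by move=> k x; apply: sumr_ge0 => i _; have [_ h2 _ _ _] := hg i.
- move=> k x; rewrite /G big_ord_recr/= ler_wpDr//; first by have [_ h2 _ _ _] := hg k.
 by apply: ler_sum => i _; have [_ _ h3 _ _] := hg i.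
- move=> k; rewrite /G (sumG k k).2 -lee_fin EFinD fineK// -sumEFin.
 via (\sum_(i < k) (riesz_outer (F i) + (e / (2 ^ i.+1)%:R)%:E))%E.
  by apply: lee_sum => i _; have [_ _ _ [h4 h5] _] := hg i; rewrite (le_trans _ h5)// lee_fin.
 rewrite big_split/= leeD//.
  by rewrite /S (nneseries_split 0 k)// add0n big_mkord leeDl// nneseries_ge0.
 apply: le_trans (epsilon_trick0 xpredT (ltW e0)).
 rewrite (nneseries_split 0 k); last by move=> i _; rewrite lee_fin divr_ge0// ltW.
 by rewrite add0n big_mkord leeDl// nneseries_ge0// => i _ _; rewrite lee_fin divr_ge0// ltW.
- move=> x eta [i _ Fix] eta1.
 have [_ h2 h3 _ h5] := hg i; have [k ek] := h5 x eta Fix eta1.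
 exists (maxn i.+1 k); rewrite /G (bigD1 (Ordinal (leq_maxl i.+1 k)))//=.
 rewrite ltr_wpDr//; first by apply: sumr_ge0 => j _; have [_ ? _ _ _] := hg j.
 by rewrite (lt_le_trans ek)// (nondecr_le h3)// leq_maxr.
Qed.

HB.instance Definition _ := isOuterMeasure.Build R E riesz_outer
 riesz_outer0 riesz_outer_ge0 le_riesz_outer riesz_outer_sigma_subadditive.

(** The functions [phi k] increase to the indicator of the half-space and vanish outside it. A cover
    [g] of [X] splits into [phi j * g j], which covers the part in [A], and
    [(1 - phi k) * g (k + j)] with [k] frozen, which covers the rest. Freezing [k] where [a_ k] is
    within [e / 2] of the supremum makes the two costs add up to at most [t + e / 2]. *)
Lemma riesz_cara_coord (i : 'I_n) (a : R) :
 caratheodory_measurable riesz_outer [set x : E | a < x 0 i].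
apply: le_caratheodory_measurable => X.
set A := [set x : E | _].
change (riesz_outer (X `&` A) + riesz_outer (X `&` ~` A) <= riesz_outer X)%E.
have [->|] := eqVneq (riesz_outer X) +oo%E; first by rewrite leey.
rewrite -ltey => Xlty.
have Xfin : riesz_outer X \is a fin_num by rewrite ge0_fin_numE.
apply/lee_addgt0Pr => e e0.
have e20 : 0 < e / 2 by rewrite divr_gt0.
have [_ [t [g [Cg g0 ng gt hg]] <-] tlt] := lb_ereal_inf_adherent e20 Xfin.
pose h (x : E) := Num.max 0 (x 0 i - a).
have h0 x : 0 <= h x by rewrite /h le_max lexx.
have ch : continuous h.
 apply: continuous_maxr; first exact: cst_continuous.
 by move=> x; exact: (cvgB (@coord_continuous _ _ _ _ _ x) (@cst_continuous _ _ a x)).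
pose phi (k : nat) x := Num.min 1 (k%:R * h x).
have cphi k : continuous (phi k).
 apply: continuous_minr; first exact: cst_continuous.
 by move=> x; apply: (@continuousM _ _ (fun=> k%:R) h x); [exact: cst_continuous|exact: ch].
have phi01 k x : 0 <= phi k x <= 1 by rewrite /phi le_min ler01 mulr_ge0//= ge_min lexx.
have phiS k x : phi k x <= phi k.+1 x by rewrite /phi le_min !ge_min lexx/= ler_wpM2r ?orbT// ler_nat.
have phile j k x : (j <= k)%N -> phi j x <= phi k x.
 move=> jk; rewrite /phi le_min !ge_min lexx/=.
 by rewrite ler_wpM2r ?orbT// ler_nat.
have Cgp j k : Cc (fun x => phi k x * g j x) by exact: CcMl.
pose a_ j := L (fun x => phi j x * g j x).
have a_le j : a_ j <= t.
 apply: le_trans (gt j); apply: leL => // x.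
 by rewrite ler_piMl//; have /andP[] := phi01 j x.
have a_S j : a_ j <= a_ j.+1.
 apply: leL => // x; have /andP[p0 _] := phi01 j x.
 by apply: ler_pM.
pose a_sup := sup (range a_).
have a_has_sup : has_sup (range a_) by split; [exists (a_ 0%N), 0%N|exists t => _ [j _ <-]].
have a_ub j : a_ j <= a_sup by apply: (sup_upper_bound a_has_sup); exists j.
have [_ [k _ <-] kgt] := sup_adherent e20 a_has_sup.
have covA : riesz_cover (X `&` A) a_sup.
 exists (fun j x => phi j x * g j x); split => //.
 - by move=> j x; rewrite mulr_ge0//; have /andP[] := phi01 j x.
 - by move=> j x; have /andP[p0 _] := phi01 j x; apply: ler_pM.
 - move=> x eta [Xx Ax] eta1.
  have [j ej] := hg x eta Xx eta1.
  have hx : 0 < h x by rewrite /h lt_max subr_gt0 Ax orbT.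
  pose m := (Num.truncn (h x)^-1).+1.
  exists (maxn j m).
  rewrite (_ : phi _ x = 1) ?mul1r; first by rewrite (lt_le_trans ej)// (nondecr_le ng)// leq_maxl.
  apply/min_idPl; rewrite -ler_pdivrMr// mul1r.
  by apply/ltW/(lt_le_trans (truncnS_gt _)); rewrite ler_nat leq_maxr.
(* The shift to [g (k + j)] makes [phi k * g (k + j)] dominate [phi k * g k], so that the
   subtraction leaves at most [t - a_ k]. *)
have covC : riesz_cover (X `&` ~` A) (t - a_ k).
 exists (fun j x => (1 - phi k x) * g (k + j)%N x); split.
 - move=> j; apply: CcMl => // x; exact: (cvgB (@cst_continuous _ _ (1:R) x) (cphi k x)).
 - by move=> j x; rewrite mulr_ge0// subr_ge0; have /andP[] := phi01 k x.
 - move=> j x; rewrite ler_wpM2l//; first by rewrite subr_ge0; have /andP[] := phi01 k x.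
  by rewrite addnS.
 - move=> j; rewrite (_ : (fun x => _) = fun x => g (k + j)%N x - phi k x * g (k + j)%N x); last first.
   by apply/funext => x; rewrite mulrBl mul1r.
  rewrite LB//; apply: lerB => //; apply: leL => // x.
  apply: ler_wpM2l; first by have /andP[] := phi01 k x.
  by apply: nondecr_le => //; exact: leq_addr.
 - move=> x eta [Xx Ax] eta1; have [j ej] := hg x eta Xx eta1; exists j.
  rewrite (_ : phi k x = 0); last first.
   rewrite /phi (_ : h x = 0) ?mulr0 ?min_r//; apply/max_idPl.
   by rewrite subr_le0 leNgt; apply/negP.
  by rewrite subr0 mul1r (lt_le_trans ej)// (nondecr_le ng)// leq_addl.
via (a_sup%:E + (t - a_ k)%:E)%E.
 by apply: leeD; apply: ereal_inf_lbound; [exists a_sup|exists (t - a_ k)].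
rewrite -(fineK Xfin) -EFinD -EFinD lee_fin.
move: tlt; rewrite -/(riesz_outer X) -(fineK Xfin) -EFinD lte_fin => tlt.
by rewrite -[X in _ < X]/(a_ k) -/a_sup in kgt; lra.
Qed.

(** A map into [R^n] is measurable as soon as its coordinates are; applied to the identity from the
    Caratheodory sigma-algebra, this reduces Borel sets to coordinate half-spaces. *)
Lemma riesz_borel_cara (A : set E) : measurable A -> caratheodory_measurable riesz_outer A.
move=> mA.
have mid : mfunT (id : caratheodory_type riesz_outer -> E).
 apply: measurable_fun_rV => i.
 apply: (measurability _ (RGenOInfty.measurableE R)) => _ [_ [a ->] <-].
 rewrite setTI; have := riesz_cara_coord i a.
 by congr (caratheodory_measurable riesz_outer _); apply/seteqP; split=> x /=; rewrite in_itv/= andbT.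
by have := mid mtop A mA; rewrite setTI.
Qed.
Definition riesz_measure (A : set E) := riesz_outer A.
Let riesz_measure_sigma_additive : semi_sigma_additive riesz_measure.
move=> F mF tF mUF.
pose mu : {outer_measure set E -> \bar R} := riesz_outer.
apply: (@caratheodory_measure_sigma_additive _ _ mu F) => //.
- by move=> i; exact: riesz_borel_cara.
- exact: riesz_borel_cara.
Qed.

HB.instance Definition _ := isMeasure.Build _ _ _ riesz_measure
 riesz_outer0 riesz_outer_ge0 riesz_measure_sigma_additive.
Let riesz_measure_le (A : set E) phi : Cc phi -> (forall x, 0 <= phi x) ->
 (forall x, A x -> 1 <= phi x) -> (riesz_measure A <= (L phi)%:E)%E.
move=> Cphi phi0 A1; apply: ereal_inf_lbound; exists (L phi) => //.
exists (fun _ => phi); split => // x eta /A1 h eta1; exists 0%N.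
exact: lt_le_trans h.
Qed.
Let riesz_measure_ge (A : set E) phi : Cc phi -> (forall x, phi x <= 1) ->
 (forall x, ~ A x -> phi x <= 0) -> ((L phi)%:E <= riesz_measure A)%E.
move=> Cphi phi1 A0; apply: le_ereal_inf_tmp => _ [t [g [Cg g0 ng gt hg]] <-].
rewrite lee_fin; apply: (riesz_dini Cg) => // x e e0.
have [Ax|Ax] := pselect (A x).
 have [|k ek] := hg x (1 - e) Ax; first by rewrite ltrBlDr ltrDl.
 by exists k; apply: le_lt_trans ek; rewrite lerB.
by exists 0%N; rewrite (lt_le_trans _ (g0 0%N x))// ltrBlDr add0r (le_lt_trans (A0 x Ax)).
Qed.

Lemma riesz_measure_locally_finite : loc_fin riesz_measure.
move=> B _ [M [_ HM]].
apply: (@le_lt_trans _ _ (L (cutoff (M + 1)))%:E); last by rewrite ltry.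
apply: riesz_measure_le; [exact: Cc_cutoff|exact: cutoff_ge0|].
by move=> x Bx; rewrite cutoff1// (HM (M + 1))// ltrDl.
Qed.

Lemma Cc_bounded (g : E -> R) : Cc g -> exists2 M, 0 < M & forall x, g x <= M.
move=> [cg [t gt]].
have /compact_bounded [M [_ HM]] : compact (g @` [set x | `|x| <= t]).
 apply: continuous_compact; last exact: cube_compact.
 exact: continuous_subspaceT.
exists (`|M| + 1) => [|x]; first by rewrite ltr_wpDl.
have [xt|tx] := leP `|x| t; last by rewrite gt ?(ltW tx)// addr_ge0.
apply: le_trans (ler_norm _) _; apply: HM; last by exists x.
by rewrite (le_lt_trans (ler_norm _))// ltrDl.
Qed.
Let u (g : E -> R) (delta : R) (i : nat) x := Num.min delta (Num.max 0 (g x - i%:R * delta)).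
Let Cc_u (g : E -> R) delta i : 0 < delta -> (forall x, 0 <= g x) -> Cc g -> Cc (u g delta i).
move=> d0 g0 [cg [t gt]]; split.
 apply: continuous_minr; first exact: cst_continuous.
 apply: continuous_maxr; first exact: cst_continuous.
 by move=> x; exact: (cvgB (cg x) (@cst_continuous _ _ (i%:R * delta) x)).
exists t => x tx; rewrite /u gt// sub0r max_l ?min_r ?(ltW d0)//.
by rewrite oppr_le0 mulr_ge0// ltW.
Qed.
Let sum_u (g : E -> R) delta K x : 0 < delta -> 0 <= g x ->
 \sum_(i < K) u g delta i x = Num.min (K%:R * delta) (g x).
move=> d0 g0; elim: K => [|K IH]; first by rewrite big_ord0 mul0r min_l.
rewrite big_ord_recr/= IH /u -natr1 mulrDl mul1r.
set a := K%:R * delta.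
have [ag|ga] := leP a (g x).
 rewrite max_r ?subr_ge0// addr_minr.
 by rewrite [a + (_ - a)]addrC subrK.
rewrite max_l ?subr_le0 ?(ltW ga)// min_r ?(ltW d0)// addr0.
by rewrite min_r// (le_trans (ltW ga))// lerDl ltW.
Qed.
Let sum_Lu (g : E -> R) delta K : 0 < delta -> Cc g -> (forall x, 0 <= g x) ->
 (forall x, g x <= K%:R * delta) -> \sum_(i < K) L (u g delta i) = L g.
move=> d0 Cg g0 gK.
have -> : g = fun x => \sum_(i < K) u g delta i x by apply/funext => x; rewrite sum_u//; apply/esym/min_idPr.
have [_] : Cc (fun x => \sum_(i < K) u g delta i x) /\
  L (fun x => \sum_(i < K) u g delta i x) = \sum_(i < K) L (u g delta i).
 by apply: L_sum => i; exact: Cc_u.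
have -> : (fun x => \sum_(i < K) u g delta i x) = g by apply/funext => x; rewrite sum_u//; apply/min_idPr.
by move=> ->.
Qed.

(** The function is sliced into layers [u g delta i] of height [delta]. With [A i] the set where [g]
    reaches the top of layer [i], one has [u i.+1 <= delta * 1_(A i) <= u i], so the integral and
    [L g] lie between sums that differ by one layer, and one layer costs at most [delta] times a
    fixed mass. *)
Lemma riesz_integral (g : E -> R) : Cc g -> (forall x, 0 <= g x) ->
 (\int[riesz_measure]_x (g x)%:E = (L g)%:E)%E.
move=> Cg g0; have [cg [t gt]] := Cg; have [M M0 gM] := Cc_bounded Cg.
have mg : mfunT (EFin \o g) by apply/mEFin; exact: continuous_mfun.
have g_gt t' : t <= t' -> forall x, g x <= M * cutoff t' x.
 move=> tt' x; have [xt|tx] := leP `|x| t.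
  by rewrite cutoff1 ?mulr1// (le_trans xt).
 by rewrite gt ?(ltW tx)// mulr_ge0 ?(ltW M0)// cutoff_ge0.
set mu := riesz_measure.
pose cube := [set x : E | `|x| < `|t| + 1].
have mcube : measurable cube.
 apply: open_measurable_rV; rewrite (_ : cube = (fun x : E => `|x|) @^-1` [set y : R | y < `|t| + 1])//.
 by apply: open_comp => [x _|]; [exact: norm_continuous|exact: open_lt].
have mucube : (mu cube < +oo)%E.
 apply: riesz_measure_locally_finite => //; exists (`|t| + 1); split; first exact: num_real.
 by move=> N tN x /= xt; exact: ltW (lt_trans xt tN).
have Lc0 : 0 <= L (cutoff t) by apply: L0; [exact: Cc_cutoff|exact: cutoff_ge0].
have key delta : 0 < delta ->
  (\int[mu]_x (g x)%:E <= (L g)%:E + delta%:E * mu cube)%E /\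
  ((L g)%:E <= \int[mu]_x (g x)%:E + (delta * L (cutoff t))%:E)%E.
 move=> d0.
 pose K := (Num.truncn (M / delta)).+1.
 have MK : M <= K%:R * delta by rewrite -ler_pdivrMr// ltW// truncnS_gt.
 pose A (i : nat) := [set x : E | i.+1%:R * delta <= g x].
 have mA i : measurable (A i).
  rewrite (_ : A i = g @^-1` `[i.+1%:R * delta, +oo[%classic); last first.
   by apply/seteqP; split=> x /=; rewrite in_itv/= andbT.
  by rewrite -[X in measurable X]setTI; apply: continuous_mfun => //; exact: measurable_itv.
 have u_le i x : u g delta i.+1 x <= delta * \1_(A i) x.
  rewrite indicE; have [xA|xA] := boolP (x \in A i); first by rewrite mulr1 ge_min lexx.
  rewrite mulr0 /u ge_min ge_max lexx/= subr_le0.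
  by move/negP: xA; rewrite inE => /negP; rewrite -ltNge => /ltW ->; rewrite orbT.
 have u_ge i x : delta * \1_(A i) x <= u g delta i x.
  rewrite indicE; have [|xA] := boolP (x \in A i).
   rewrite inE /A/= => xA; rewrite mulr1 /u le_min lexx le_max/=.
   by apply/orP; right; rewrite lerBrDl -[X in _ + X]mul1r -mulrDl natr1.
  by rewrite mulr0 /u le_min (ltW d0) le_max lexx.
 have Lu_ge i : (delta%:E * mu (A i) <= (L (u g delta i))%:E)%E.
  rewrite -lee_pdivlMl// -EFinM -LZ; last exact: Cc_u.
  apply: riesz_measure_le => [|x|x Ax]; first by apply: CcZ; exact: Cc_u.
   rewrite mulr_ge0 ?invr_ge0 ?(ltW d0)// /u le_min (ltW d0)/= le_max lexx//.
  rewrite mulrC ler_pdivlMr// mul1r; apply: le_trans (u_ge i x).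
  by rewrite indicE mem_set// mulr1.
 have Lu_le i : ((L (u g delta i.+1))%:E <= delta%:E * mu (A i))%E.
  rewrite -lee_pdivrMl// -EFinM -LZ; last exact: Cc_u.
  apply: riesz_measure_ge => [|x|x Ax]; first by apply: CcZ; exact: Cc_u.
   by rewrite mulrC ler_pdivrMr// mul1r ge_min lexx.
  rewrite mulrC ler_pdivrMr// mul0r (le_trans (u_le i x))//.
  by rewrite indicE memNset// mulr0.
 have intA : (\int[mu]_x (\sum_(i < K) (delta * \1_(A i) x))%:E = \sum_(i < K) delta%:E * mu (A i))%E.
  under eq_integral do rewrite -sumEFin.
  rewrite ge0_integral_sum//.
  - apply: eq_bigr => i _; under eq_integral do rewrite EFinM.
   by rewrite int_Zl ?(ltW d0)//; [rewrite int_indic ?setIT|exact/mEFin].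
  - by move=> i; apply/mEFin; exact: mfunM.
  - by move=> i x _; rewrite lee_fin mulr_ge0 ?(ltW d0).
 have mS : mfunT (fun x => (\sum_(i < K) (delta * \1_(A i) x))%:E).
  apply/mEFin; apply: measurable_sum => i; exact: mfunM.
 split.
  via (\int[mu]_x ((\sum_(i < K) (delta * \1_(A i) x))%:E + (delta * \1_cube x)%:E))%E.
   apply: ge0_le_integral => //.
   - by move=> x _; rewrite lee_fin.
   - by apply: emeasurable_funD => //; apply/mEFin; exact: mfunM.
   - move=> x _; rewrite -EFinD lee_fin indicE.
    have [xc|xc] := boolP (x \in cube); last first.
     rewrite gt ?addr_ge0 ?sumr_ge0// ?mulr_ge0 ?(ltW d0)// => [*|]; first by rewrite mulr_ge0 ?(ltW d0).
     move/negP: xc; rewrite inE /cube /= => /negP; rewrite -leNgt => h.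
     by have := ler_norm t; lra.
    rewrite mulr1 -lerBlDr.
    via (\sum_(i < K) u g delta i.+1 x); last by apply: ler_sum => i _; exact: u_le.
    have := @sum_u g delta K.+1 x d0 (g0 x).
    rewrite big_ord_recl/= min_r; last first.
     by rewrite (le_trans (gM x))// (le_trans MK)// ler_pM2r// ler_nat.
    rewrite -[X in _ - delta <= X](_ : \sum_(i < K) u g delta (bump 0 i) x = _)//.
    by move=> <-; rewrite addrAC gerDr subr_le0 ge_min lexx.
  rewrite ge0_integralD//.
  - rewrite intA leeD//.
    rewrite -(sum_Lu d0 Cg g0 (fun x => le_trans (gM x) MK)) -sumEFin.
    by apply: lee_sum => i _.
   under eq_integral do rewrite EFinM.
   by rewrite int_Zl ?(ltW d0)//; [rewrite int_indic ?setIT|exact/mEFin].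
  - by move=> x _; rewrite lee_fin sumr_ge0// => *; rewrite mulr_ge0 ?(ltW d0).
  - by move=> x _; rewrite lee_fin mulr_ge0 ?(ltW d0).
  - by apply/mEFin; exact: mfunM.
 have -> : L g = L (u g delta 0) + \sum_(i < K) L (u g delta i.+1).
  rewrite -(@sum_Lu g delta K.+1 d0 Cg g0) ?big_ord_recl// => x.
  by rewrite (le_trans (gM x))// (le_trans MK)// ler_pM2r// ler_nat.
 rewrite EFinD addeC; apply: leeD.
  rewrite -sumEFin (@le_trans _ _ (\sum_(i < K) delta%:E * mu (A i))%E)//.
   by apply: lee_sum => i _.
  rewrite -intA; apply: ge0_le_integral => //.
  - by move=> x _; rewrite lee_fin sumr_ge0// => *; rewrite mulr_ge0 ?(ltW d0).
  - move=> x _; rewrite lee_fin.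
   via (\sum_(i < K) u g delta i x); first by apply: ler_sum => i _.
   by rewrite sum_u// ge_min lexx orbT.
 rewrite lee_fin -LZ; last exact: Cc_cutoff.
 apply: leL => [||x]; [exact: Cc_u|by apply: CcZ; exact: Cc_cutoff|].
 have [xt|tx] := leP `|x| t; first by rewrite cutoff1// mulr1 ge_min lexx.
 rewrite /u gt ?(ltW tx)// mul0r subrr maxxx ge_min.
 by rewrite mulr_ge0 ?cutoff_ge0 ?(ltW d0)// orbT.
apply/eqP; rewrite eq_le; apply/andP; split.
 apply/lee_addgt0Pr => e e0.
 have c0 : 0 <= fine (mu cube) by rewrite fine_ge0.
 have [|h _] := key (e / (fine (mu cube) + 1)); first by rewrite divr_gt0// ltr_wpDl.
 apply: (le_trans h); rewrite leeD2l//.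
 rewrite -[X in (_ * X <= _)%E]fineK ?ge0_fin_numE// -EFinM lee_fin.
 by rewrite -mulrA ler_piMr ?(ltW e0)// mulrC ler_pdivrMr ?mul1r ?lerDl// ltr_wpDl.
apply/lee_addgt0Pr => e e0.
have [|_ h] := key (e / (L (cutoff t) + 1)); first by rewrite divr_gt0// ltr_wpDl.
apply: (le_trans h); rewrite leeD2l// lee_fin.
by rewrite -mulrA ler_piMr ?(ltW e0)// mulrC ler_pdivrMr ?mul1r ?lerDl// ltr_wpDl.
Qed.

Theorem riesz_representation :
 exists mu : meas 'rV[R]_n R, loc_fin mu /\
  forall g, Cc g -> (forall x, 0 <= g x) -> (\int[mu]_x (g x)%:E = (L g)%:E)%E.
exists riesz_measure.
by split; [exact: riesz_measure_locally_finite|exact: riesz_integral].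
Qed.
End riesz.

(** * Cubes for the sup norm and measurability of vector operations *)

Section cube.
Context {R : realType} {n : nat}.
Notation E := 'rV[R]_n.
Definition cube (t : R) : set E := [set x | `|x| < t].

Lemma measurable_norm_rV : mfunT (fun x : E => `|x|).
Proof. by apply: continuous_mfun; exact: norm_continuous. Qed.
Lemma mcub t : measurable (cube t).
rewrite (_ : cube t = (fun x : E => `|x|) @^-1` `]-oo, t[%classic).
 by rewrite -[X in measurable X]setTI; apply: measurable_norm_rV.
by apply/seteqP; split=> x; rewrite /cube/= in_itv.
Qed.

Lemma bounded_cube t : bounded_set (cube t).
by exists t; split; [exact: num_real|move=> M tM x /= /lt_trans/(_ tM)/ltW].
Qed.

Lemma le_cube s t : s <= t -> cube s `<=` cube t.
Proof. by move=> st x /= xs; exact: lt_le_trans st. Qed.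
Let normrVE (x : E) : `|x| = \big[Num.max/0]_ij `|x ij.1 ij.2| := mx_normrE x.

Lemma norm_lt_coord (x : E) (t : R) : 0 < t -> (`|x| < t) = [forall i, `|x 0 i| < t].
move=> t0; apply/idP/forallP => [xt i|h].
 by rewrite (le_lt_trans _ xt)// normrVE; exact: (@le_bigmax_cond _ _ _ 0 (0, i) xpredT (fun ij => `|x ij.1 ij.2|)).
rewrite normrVE; apply/bigmax_ltP; split=> // -[j i] _ /=.
by rewrite (ord1 j); exact: h.
Qed.

Lemma norm_ge_coord (x : E) (t : R) : 0 < t -> t <= `|x| -> exists i, t <= `|x 0 i|.
move=> t0 tx; apply/existsP; move: tx; apply: contraTT; rewrite negb_exists => /forallP h.
by rewrite -ltNge norm_lt_coord//; apply/forallP => i; rewrite ltNge; exact: h.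
Qed.

Lemma le_coord_norm (x : E) i : `|x 0 i| <= `|x|.
by rewrite normrVE; exact: (@le_bigmax_cond _ _ _ 0 (0, i) xpredT (fun ij => `|x ij.1 ij.2|)).
Qed.

Lemma norm_le_coord (x : E) (t : R) : 0 <= t -> (forall i, `|x 0 i| <= t) -> `|x| <= t.
move=> t0 h; rewrite normrVE; apply/bigmax_leP; split=> // -[j i] _ /=.
by rewrite (ord1 j).
Qed.

Lemma mfunD_rV d (T : measurableType d) (f g : T -> E) :
 mfunT f -> mfunT g -> mfunT (fun t => f t + g t).
move=> mf mg; apply: measurable_fun_rV => i; under eq_fun do rewrite mxE.
by apply: mfunD; exact: (mcomp (measurable_coord i)).
Qed.

Lemma measurable_funN_rV d (T : measurableType d) (f : T -> E) :
 mfunT f -> mfunT (fun t => - f t).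
move=> mf; apply: measurable_fun_rV => i; under eq_fun do rewrite mxE.
by apply: measurable_funN; exact: (mcomp (measurable_coord i)).
Qed.

Lemma measurable_funB_rV d (T : measurableType d) (f g : T -> E) :
 mfunT f -> mfunT g -> mfunT (fun t => f t - g t).
Proof. by move=> mf mg; apply: mfunD_rV => //; exact: measurable_funN_rV. Qed.
Lemma measurable_dotv (k : E) : mfunT (dotv k).
apply: measurable_sum => i; apply: mfunM; first exact: mcst.
exact: measurable_coord.
Qed.

Lemma locally_finite_sigma_finite (m : meas E R) :
 loc_fin m -> sigma_finite setT m.
move=> lf; exists (fun k => cube k.+1%:R).
 apply/seteqP; split => // x _; exists (Num.truncn `|x|) => //.
 by rewrite /cube/= truncnS_gt.
by move=> k; split; [exact: mcub|apply: lf; [exact: mcub|exact: bounded_cube]].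
Qed.
(** A copy of [m] that carries the proof of local finiteness, so that a sigma-finite structure can
    be attached to it for Fubini's theorem. *)
Definition sf_of (m : meas E R) (lf : loc_fin m) :
 set E -> \bar R := m.

HB.instance Definition _ m (lf : loc_fin m) := Measure.on (sf_of lf).
HB.instance Definition _ m (lf : loc_fin m) :=
 Measure_isSigmaFinite.Build _ _ _ (sf_of lf) (locally_finite_sigma_finite lf).
End cube.

(** * Lebesgue measure on [R^n]: boxes and translations *)

Section lebesgue.
Context {R : realType}.
Local Open Scope ereal_scope.

Lemma measurable_rect n (A : 'I_n -> set R) : (forall i, measurable (A i)) ->
 measurable [set x : 'rV[R]_n | forall i, A i (x 0%R i)].
move=> mA; rewrite (_ : [set x | _] = \bigcap_(i in [set: 'I_n])
  ((fun x : 'rV[R]_n => x 0%R i) @^-1` (A i))).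
 apply: fin_bigcap_measurable => // i _; rewrite -[X in measurable X]setTI.
 exact: measurable_coord.
by apply/seteqP; split=> x /= h i; [move=> _; exact: h|exact: h].
Qed.

Lemma lebesgue_rV_rect n (A : 'I_n -> set R) : (forall i, measurable (A i)) ->
 lebesgue_rV n [set x : 'rV[R]_n | forall i, A i (x 0%R i)] =
 \prod_(i < n) lebesgue_measure (A i).
elim: n A => [|n IH] A mA.
 rewrite big_ord0 /= diracE mem_set//= => i; by case: i.
rewrite big_ord_recr /= /image_measure /pushforward.
rewrite -(IH (fun i => A (widen_ord (leqnSn n) i)))//.
rewrite (_ : _ @^-1` _ = [set x : 'rV[R]_n | forall i, A (widen_ord (leqnSn n) i) (x 0%R i)]
  `*` A ord_max); last first.
 apply/seteqP; split=> -[x t] /=; rewrite /snoc_rV.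
  move=> h; split=> [i|].
   have := h (widen_ord (leqnSn n) i); rewrite mxE.
   rewrite (_ : widen_ord _ i = lift ord_max i) ?liftK//.
   by apply/val_inj => /=; rewrite /bump leqNgt ltn_ord.
  by have := h ord_max; rewrite mxE unlift_none.
 move=> [h1 h2] i; rewrite mxE; case: unliftP => [j ->|->//].
 rewrite (_ : lift ord_max j = widen_ord (leqnSn n) j)//.
 by apply/val_inj => /=; rewrite /bump leqNgt ltn_ord.
have mS := @measurable_rect n (fun i => A (widen_ord (leqnSn n) i)) (fun i => mA _).
by apply: product_measure1E; [exact: mS|exact: mA].
Qed.

Lemma lebesgue_rV_box n (a b : 'I_n -> R) : (forall i, a i <= b i)%R ->
 lebesgue_rV n [set x : 'rV[R]_n | forall i, (a i <= x 0%R i < b i)%R] =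
 (\prod_(i < n) (b i - a i)%R)%:E.
move=> ab; rewrite (_ : [set x | _] = [set x : 'rV[R]_n | forall i, `[a i, b i[%classic (x 0%R i)]); last first.
 by apply/seteqP; split=> x /= h i; have := h i; rewrite in_itv.
rewrite (@lebesgue_rV_rect n (fun i => `[a i, b i[%classic))// -prodEFin; apply: eq_bigr => i _.
rewrite lebesgue_measure_itv/= lte_fin; case: ltP => //.
by rewrite le_eqVlt ltNge ab orbF => /eqP ->; rewrite subrr.
Qed.

Lemma lebesgue_rV_cube_le n (a : 'rV[R]_n) (r : R) : (0 < r)%R ->
 lebesgue_rV n [set x | (`|x + a| < r)%R] <= ((2 * r) ^+ n)%:E.
move=> r0.
via (lebesgue_rV n [set x : 'rV[R]_n | forall i,
  (- a 0%R i - r <= x 0%R i < - a 0%R i + r)%R]).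
 apply: le_measure; rewrite ?inE.
 - rewrite (_ : [set x | _] = (fun x => x + a)%R @^-1` cube r)// -[X in measurable X]setTI.
  apply: (mfunD_rV (@measurable_id _ _ setT) (mcst a)) => //.
  exact: mcub.
 - rewrite (_ : [set x | _] = [set x : 'rV[R]_n | forall i,
   `[- a 0%R i - r, - a 0%R i + r[%classic (x 0%R i)])%R; last first.
   by apply/seteqP; split=> x /= h i; have := h i; rewrite in_itv.
  by apply: (@measurable_rect n (fun i => `[- a 0%R i - r, - a 0%R i + r[%classic%R)).
 - move=> x /=; rewrite norm_lt_coord// => /forallP h i.
  by have := h i; rewrite mxE ltr_norml => /andP[h1 h2]; apply/andP; split; lra.
rewrite lebesgue_rV_box; last by move=> i; lra.
rewrite lee_fin (eq_bigr (fun=> 2 * r)%R) ?prodr_const ?card_ord// => i _; lra.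
Qed.

Lemma lebesgue_lf n : loc_fin (@lebesgue_rV R n).
move=> B mB [M [_ HM]]; pose r := (Num.max 1 (M + 2))%R.
apply: (@le_lt_trans _ _ ((2 * r) ^+ n)%:E); last by rewrite ltry.
apply: le_trans (@lebesgue_rV_cube_le n 0 r _); last by rewrite lt_max ltr01.
apply: le_measure; rewrite ?inE//.
 by under eq_set do rewrite addr0; exact: mcub.
move=> x Bx /=; rewrite addr0 (@le_lt_trans _ _ (M + 1)%R)//.
 by apply: HM => //; rewrite ltrDl.
by rewrite lt_max; apply/orP; right; rewrite ltrD2l ltr1n.
Qed.
Definition lebesgue_sf n : {sigma_finite_measure set 'rV[R]_n -> \bar R} :=
 sf_of (@lebesgue_lf n).

Lemma integral_lebesgue_rVS n (f : 'rV[R]_n.+1 -> \bar R) :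
 mfunT f -> (forall x, 0 <= f x) ->
 \int[lebesgue_rV n.+1]_x f x =
 \int[lebesgue_rV n]_x \int[lebesgue_measure]_t f (snoc_rV (x, t)).
move=> mf f0.
rewrite /= /image_measure ge0_integral_pushforward//= preimage_setT.
rewrite (@fubini_tonelli1 _ _ _ _ _ (lebesgue_sf n) lebesgue_measure)//.
by apply: mcomp => //; exact: mfunP.
Qed.

Opaque lebesgue_rV.

Lemma lebesgue_measure_translation (a : R) (A : set R) : measurable A ->
 lebesgue_measure ((fun x => x + a)%R @^-1` A) = lebesgue_measure A.
move=> mA.
pose tr : measurableTypeR R -> measurableTypeR R := (fun x => x + a)%R.
have mtr : mfunT tr by apply: mfunD.
pose mm := isMeasurableFun.Build _ _ _ _ tr mtr.
pose phi : {mfun measurableTypeR R >-> measurableTypeR R} := HB.pack tr mm.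
apply/esym; apply: (@lebesgue_measure_unique R (image_measure lebesgue_measure phi)) => //.
move=> _ [[x y] _ <-]; rewrite /= /image_measure /pushforward /=.
rewrite (_ : tr @^-1` _ = `]x - a, y - a]%classic)%R; last first.
 by apply/seteqP; split=> z; rewrite /tr/= !in_itv/= => /andP[h1 h2]; apply/andP; split; lra.
rewrite !lebesgue_measure_itv/= !lte_fin ltrD2r; case: ifP => // _.
by rewrite -!EFinD; congr EFin; lra.
Qed.

Lemma integral_lebesgue_translation (a : R) (f : R -> \bar R) :
 mfunT f -> (forall x, 0 <= f x) ->
 \int[lebesgue_measure]_x f (x + a)%R = \int[lebesgue_measure]_x f x.
move=> mf f0.
have mtr : mfunT ((fun x => x + a)%R : measurableTypeR R -> measurableTypeR R) by apply: mfunD.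
have := @ge0_integral_pushforward _ _ (measurableTypeR R) (measurableTypeR R) R _ mtr lebesgue_measure setT f mtop mf.
rewrite preimage_setT => <-; last by move=> ? _; exact: f0.
by apply: eq_measure_integral => A mA _; exact: lebesgue_measure_translation.
Qed.

Lemma integral_lebesgue_rV_translation n (a : 'rV[R]_n) (f : 'rV[R]_n -> \bar R) :
 mfunT f -> (forall x, 0 <= f x) ->
 \int[lebesgue_rV n]_x f (x + a)%R = \int[lebesgue_rV n]_x f x.
elim: n a f => [|n IH] a f mf f0.
 by apply: eq_integral => x _; congr f; apply/rowP => -[].
have mfa : mfunT (fun x : 'rV[R]_n.+1 => f (x + a)%R) by apply: mcomp => //; apply: mfunD_rV => //; exact: mcst.
rewrite (integral_lebesgue_rVS mfa (fun=> f0 _)) (integral_lebesgue_rVS mf f0).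
pose a' : 'rV[R]_n := (\row_i a 0 (lift ord_max i))%R.
have E x t : (snoc_rV (x, t) + a = snoc_rV (x + a', t + a 0 ord_max) :> 'rV[R]_n.+1)%R.
 apply/rowP => i; rewrite !mxE; case: unliftP => [j ->|->//].
 by rewrite !mxE.
under eq_integral do under eq_integral do rewrite E.
have msn : mfunT (@snoc_rV R n) by exact: mfunP.
pose F x := \int[lebesgue_measure]_t f (snoc_rV (x, t)).
have F0 x : 0 <= F x by exact: int_ge0.
have mF : mfunT F
 by apply: (@measurable_fun_fubini_tonelli_F _ _ _ _ _ lebesgue_measure (fun p => f (snoc_rV p))) => //; exact: mcomp.
rewrite -(IH a' F mF F0); apply: eq_integral => x _.
rewrite /F (integral_lebesgue_translation (a 0%R ord_max) (f := fun t => f (snoc_rV (x + a', t)%R)))//.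
apply: mcomp => //; apply: (mcomp msn); exact: pair1_measurable.
Qed.

Lemma Rintegral_lebesgue_rV_translation n (a : 'rV[R]_n) (f : 'rV[R]_n -> R) :
 mfunT f ->
 (\int[lebesgue_rV n]_x f (x + a) = \int[lebesgue_rV n]_x f x)%R.
move=> mf; rewrite /Rintegral; congr fine; rewrite [LHS]integralE [RHS]integralE.
have mf' : mfunT (EFin \o f) by apply/mEFin.
congr (_ - _).
 rewrite (eq_integral (fun x : 'rV[R]_n => (EFin \o f)^\+ (x + a)%R)); last by move=> x _; rewrite ?funeposE ?funenegE.
 by apply: (@integral_lebesgue_rV_translation n a ((EFin \o f)^\+)) => //; exact: measurable_funepos.
rewrite (eq_integral (fun x : 'rV[R]_n => (EFin \o f)^\- (x + a)%R)); last by move=> x _; rewrite ?funeposE ?funenegE.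
 by apply: (@integral_lebesgue_rV_translation n a ((EFin \o f)^\-)) => //; exact: measurable_funeneg.
Qed.
End lebesgue.

(** * Dyadic cells, step functions and grids *)

Section dyadic.
Context {R : realType} {n : nat}.
Notation E := 'rV[R]_n.
Implicit Types (N J : nat) (f g : E -> R).
Definition mesh N : R := (2 ^+ N)^-1.

Lemma mesh_gt0 N : 0 < mesh N. Proof. by rewrite invr_gt0 exprn_gt0. Qed.

Lemma mesh_neq0 N : mesh N != 0. Proof. by rewrite gt_eqF// mesh_gt0. Qed.

Lemma meshK N : 2 ^+ N * mesh N = 1.
Proof. by rewrite mulfV// expf_neq0. Qed.
Definition cell1 N (t : R) : R := (Num.floor (2 ^+ N * t))%:~R * mesh N.
(** The lower corner of the dyadic cell of side [mesh N] around [x]; it serves as a name for the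
    cell. *)
Definition cell N (x : E) : E := \row_i cell1 N (x 0 i).

Lemma cell1_itv N (t : R) : cell1 N t <= t < cell1 N t + mesh N.
have := floor_itv (2 ^+ N * t); rewrite /cell1 => /andP[h1 h2].
have m0 := mesh_gt0 N; apply/andP; split.
 by rewrite ler_pdivrMr ?exprn_gt0// [leRHS]mulrC.
rewrite -[X in _ + X]mul1r -mulrDl ltr_pdivlMr ?exprn_gt0// [ltLHS]mulrC.
by rewrite intrD in h2.
Qed.

Lemma cell1_eq N (m : int) (t : R) : m%:~R * mesh N <= t < (m%:~R + 1) * mesh N ->
 cell1 N t = m%:~R * mesh N.
move=> /andP[h1 h2]; rewrite /cell1; congr (_%:~R * _); apply: floor_def.
rewrite intrD -(ler_pM2r (mesh_gt0 N)) -(ltr_pM2r (mesh_gt0 N)).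
by rewrite mulrAC meshK mul1r h1 h2.
Qed.

Lemma cell1_grid N (m : int) : cell1 N (m%:~R * mesh N) = m%:~R * mesh N.
apply: cell1_eq; rewrite lexx/= ltr_pM2r ?mesh_gt0//.
by rewrite ltrDl.
Qed.

(** The coarse lower corner is an integer multiple of the fine mesh, so rounding first on the finer
    level cannot step below it. *)
Lemma cell1_refine N M (t : R) : cell1 N (cell1 (N + M) t) = cell1 N t.
have /andP[h1 h2] := cell1_itv (N + M) t; have /andP[h3 h4] := cell1_itv N t.
apply: cell1_eq; rewrite -/(cell1 N t) mulrDl mul1r -/(cell1 N t).
rewrite (le_lt_trans h1 h4) andbT.
rewrite {1}/cell1 /cell1.
rewrite (_ : mesh N = 2 ^+ M * mesh (N + M)); last first.
 by rewrite /mesh exprD invfM mulrCA divff ?mulr1// expf_neq0.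
rewrite mulrA ler_pM2r ?mesh_gt0//.
rewrite (_ : 2 ^+ M = ((2 ^ M)%N%:Z)%:~R :> R); last by rewrite -pmulrn natrX.
rewrite -intrM ler_int floor_ge_int intrM -pmulrn natrX exprD [leRHS]mulrAC.
by rewrite ler_pM2r ?exprn_gt0// floor_le.
Qed.

Lemma cell_refine N M (x : E) : cell N (cell (N + M) x) = cell N x.
Proof. by apply/rowP => i; rewrite !mxE cell1_refine. Qed.
Definition in_box J (x : E) := [forall i, - J%:R <= x 0 i < J%:R].

Lemma in_box_norm J x : in_box J x -> `|x| <= J%:R.
move=> /forallP h; apply: norm_le_coord => // i.
by rewrite ler_norml; have /andP[-> /ltW ->] := h i.
Qed.

Lemma norm_in_box J x : `|x| < J%:R -> in_box J x.
move=> xJ; apply/forallP => i; have := le_lt_trans (le_coord_norm x i) xJ.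
by rewrite ltr_norml => /andP[/ltW -> ->].
Qed.
Definition step N J f := (forall x, f x = f (cell N x)) /\ (forall x, ~~ in_box J x -> f x = 0).

Lemma step_refine N M J f : step N J f -> step (N + M) J f.
by move=> [h1 h2]; split=> // x; rewrite [LHS]h1 [RHS]h1 cell_refine.
Qed.

Lemma in_box_le J J' x : (J <= J')%N -> in_box J x -> in_box J' x.
move=> JJ /forallP h; apply/forallP => i; have /andP[h1 h2] := h i.
have : J%:R <= J'%:R :> R by rewrite ler_nat.
by move=> ?; apply/andP; split; lra.
Qed.

Lemma stepD N J f g : step N J f -> step N J g -> step N J (fun x => f x + g x).
move=> [f1 f2] [g1 g2]; split=> x; first by rewrite f1 g1.
by move=> xJ; rewrite f2// g2// addr0.
Qed.

Lemma stepZ N J a f : step N J f -> step N J (fun x => a * f x).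
move=> [f1 f2]; split=> x; first by rewrite f1.
by move=> xJ; rewrite f2// mulr0.
Qed.
(** The number of cells of side [2^-N] in [[-J, J)]. *)
Definition gsize N J := (2 * J * 2 ^ N)%N.
Definition gindex N J := {ffun 'I_n -> 'I_(gsize N J)}.
Definition grid N J (r : gindex N J) : E := \row_i ((r i)%:R * mesh N - J%:R).
Definition bx N (c x : E) : R := [forall i, c 0 i <= x 0 i < c 0 i + mesh N]%:R.

Lemma gridE N J (r : gindex N J) i :
 grid r 0 i = ((r i)%:Z - (J * 2 ^ N)%N%:Z)%:~R * mesh N.
rewrite mxE intrB -!pmulrn mulrBl; congr (_ - _).
by rewrite natrM natrX -mulrA meshK mulr1.
Qed.

Lemma bx_grid N J (r : gindex N J) x : bx N (grid r) x = (cell N x == grid r)%:R.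
rewrite /bx; congr ((nat_of_bool _)%:R); apply/idP/eqP => [/forallP h|<-].
 apply/rowP => i; rewrite gridE !mxE; apply: cell1_eq; rewrite mulrDl mul1r.
 by rewrite -gridE; exact: h.
by apply/forallP => i; rewrite mxE cell1_itv.
Qed.

Lemma grid_inj N J : injective (@grid N J).
move=> r s /rowP h; apply/ffunP => i; have := h i; rewrite !mxE => /addIr/mulIf.
by move=> /(_ (mesh_neq0 N))/eqP; rewrite eqr_nat => /eqP/val_inj.
Qed.

Lemma in_box_grid N J (r : gindex N J) : in_box J (grid r).
apply/forallP => i; rewrite mxE; apply/andP; split.
 by rewrite lerDr mulr_ge0// ltW// mesh_gt0.
rewrite ltrBlDr ltr_pdivrMr ?exprn_gt0// -natrD -natrX -natrM ltr_nat.
by rewrite (leq_trans (ltn_ord _))// /gsize addnn mul2n.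
Qed.

Lemma in_box_cell N J x : in_box J (cell N x) = in_box J x.
apply/forallP/forallP => h i; have := h i; rewrite mxE.
 have /andP[h1 h2] := cell1_itv N (x 0 i).
 move=> /andP[h3 h4]; apply/andP; split; first exact: le_trans h3 h1.
 apply: (lt_le_trans h2).
 move: h4; rewrite /cell1 -[X in _ + X]mul1r -mulrDl ltr_pdivrMr ?exprn_gt0//.
 rewrite ler_pdivrMr ?exprn_gt0// -natrX -natrM !pmulrn ltr_int -intrD1 ler_int.
 by rewrite -lezD1.
move=> /andP[h3 h4]; apply/andP; split; last first.
 by have /andP[h1 h2] := cell1_itv N (x 0 i); exact: le_lt_trans h4.
rewrite /cell1 ler_pdivlMr ?exprn_gt0// -natrX mulNr -natrM pmulrn -intrN ler_int.
rewrite floor_ge_int intrN -pmulrn natrM -mulNr natrX mulrC.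
by rewrite ler_pM2l ?exprn_gt0.
Qed.

Lemma grid_cell N J x : in_box J x -> exists r : gindex N J, grid r = cell N x.
move=> /forallP xJ.
have h i : (`|(Num.floor (2 ^+ N * x 0 i) + (J * 2 ^ N)%N%:Z)%R|%N < gsize N J)%N
  /\ (0 <= Num.floor (2 ^+ N * x 0 i) + (J * 2 ^ N)%N%:Z)%R.
 have /andP[h1 h2] := xJ i.
 have g0 : (- (J * 2 ^ N)%N%:Z <= Num.floor (2 ^+ N * x 0 i))%R.
  rewrite floor_ge_int intrN -pmulrn natrM -mulNr natrX mulrC.
  by rewrite ler_pM2l ?exprn_gt0.
 have g1 : (Num.floor (2 ^+ N * x 0 i) < (J * 2 ^ N)%N%:Z)%R.
  rewrite floor_lt_int -pmulrn natrM natrX mulrC.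
  by rewrite ltr_pM2r ?exprn_gt0.
 rewrite /gsize; split; last by lia.
 move: g0 g1; set a := Num.floor _; set b := (J * 2 ^ N)%N; rewrite -mulnA -/b; lia.
exists [ffun i => Ordinal (h i).1]; apply/rowP => i; rewrite gridE !mxE ffunE/=.
rewrite /cell1 gez0_abs; last exact: (h i).2.
by rewrite addrK.
Qed.

Lemma step_sum N J f : step N J f ->
 forall x, f x = \sum_(r : gindex N J) f (grid r) * bx N (grid r) x.
move=> [f1 f2] x; have [xJ|xJ] := boolP (in_box J x).
 have [r rx] := grid_cell N xJ.
 rewrite (bigD1 r)//= bx_grid rx eqxx mulr1 -f1 big1 ?addr0// => s sr.
 by rewrite bx_grid -rx (inj_eq (@grid_inj N J)) eq_sym (negbTE sr) mulr0.
rewrite f2// big1// => r _; rewrite bx_grid; case: eqP => [h|]; last by rewrite mulr0.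
by move: xJ; rewrite -(in_box_cell N) h in_box_grid.
Qed.
End dyadic.

(** * Orthogonality of the discrete characters *)

Section characters.
Context {R : realType}.
Local Open Scope complex_scope.

Lemma expiD (s t : R) : expi (s + t) = expi s * expi t.
rewrite /expi cosD sinD; apply/eqP; rewrite eq_complex /=.
by rewrite eqxx/= addrC eqxx.
Qed.

Lemma expi0 : expi (0 : R) = 1.
Proof. by rewrite /expi cos0 sin0. Qed.
Lemma expi_sum (I : Type) (r : seq I) (th : I -> R) :
 expi (\sum_(i <- r) th i) = \prod_(i <- r) expi (th i).
Proof. by apply: (big_morph _ expiD expi0). Qed.
Lemma expi_natM (m : nat) (t : R) : expi (m%:R * t) = expi t ^+ m.
elim: m => [|m IH]; first by rewrite mul0r expi0.
by rewrite -natr1 mulrDl mul1r expiD IH exprSr.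
Qed.

Lemma expi_2pi (m : nat) : expi (m%:R * (2 * pi)) = 1 :> R[i].
rewrite expi_natM (_ : expi _ = 1) ?expr1n//.
by rewrite /expi -mulr_natl mulr1 mulr_natl cos2pi sin2pi.
Qed.

Lemma cos_neq1 (t : R) : 0 < t < 2 * pi -> cos t != 1.
move=> /andP[t0 t2]; rewrite (splitr t) cosD -!expr2 cos2sin2.
have : 0 < sin (t / 2) by apply: sin_gt0_pi; rewrite ?divr_gt0// ltr_pdivrMr// mulrC.
by move=> s0; rewrite lt_eqF//; have := exprn_gt0 2 s0; lra.
Qed.

Lemma expi_neq1 (t : R) : 0 < t < 2 * pi -> expi t != 1.
Proof. by move=> /cos_neq1; apply: contra => /eqP[->]. Qed.
Lemma expiNl (t : R) : expi (- t) * expi t = 1.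
Proof. by rewrite -expiD addNr expi0. Qed.

(* The frequencies are centred at 0 so that they exhaust a full period. *)
Lemma sum_expi_period (P u v : nat) : (0 < P)%N -> (u < 4 * P)%N -> (v < 4 * P)%N ->
 \sum_(l < 4 * P) expi ((l%:R - (2 * P)%:R) * (2 * pi / (4 * P)%:R) * (u%:R - v%:R) : R)
 = ((4 * P)%:R * (u == v)%:R)%:C.
move=> P0 uP vP; have P0' : 0 < (4 * P)%:R :> R by rewrite ltr0n muln_gt0.
have [->|neq] := eqVneq u v.
 under eq_bigr do rewrite subrr mulr0 expi0.
 by rewrite sumr_const card_ord mulr1 rmorph_nat.
set c := 2 * pi / _; set w := u%:R - v%:R.
rewrite (eq_bigr (fun l : 'I_(4 * P) => expi (- (2 * P)%:R * c * w) * expi (c * w) ^+ l)); last first.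
 by move=> l _; rewrite -expi_natM -expiD; congr expi; ring.
rewrite -mulr_sumr mulr0 rmorph0.
have zP : expi (c * w) ^+ (4 * P) = 1.
 rewrite -expi_natM (_ : _ * _ = u%:R * (2 * pi) - v%:R * (2 * pi)); last first.
  by rewrite /c /w; field; rewrite pnatr_eq0 -lt0n.
 by rewrite expiD expi_2pi mul1r -[LHS]mulr1 -[X in _ * X](expi_2pi v) expiNl.
have cb (a b : nat) : (b < a)%N -> (a < 4 * P)%N -> expi (c * (a%:R - b%:R)) != 1.
 move=> ba aP; apply: expi_neq1; have p0 := pi_gt0 R.
 have c0 : 0 < c by rewrite divr_gt0// mulr_gt0.
 rewrite mulr_gt0 ?subr_gt0 ?ltr_nat//= -[ltRHS](_ : c * (4 * P)%:R = _); last by rewrite /c mulfVK// gt_eqF.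
 by rewrite ltr_pM2l// (le_lt_trans (y := a%:R))// ?ltr_nat// gerBl.
have z1 : expi (c * w) != 1.
 have [vu|uv] := ltnP v u; first exact: cb.
 have := cb v u; rewrite ltn_neqAle neq uv => /(_ isT vP); apply: contra => /eqP z1.
 rewrite -[X in X == _](_ : expi (- (c * w)) = _); last by congr expi; rewrite /w; ring.
 by have := expiNl (c * w); rewrite z1 mulr1 => ->.
have := subrX1 (expi (c * w)) (4 * P); rewrite zP subrr => /esym/eqP.
by rewrite mulf_eq0 subr_eq0 (negbTE z1)/= => /eqP ->; rewrite mulr0.
Qed.

Lemma Re_sum (I : Type) (r : seq I) (F : I -> R[i]) :
 complex.Re (\sum_(i <- r) F i) = \sum_(i <- r) complex.Re (F i).
Proof. by apply: (big_morph (@complex.Re R)) => // -[a b] [c d]. Qed.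
(** The cosine of a sum is the real part of a product of characters; the sum over multi-frequencies
    then factorises and the one-dimensional orthogonality applies in each coordinate. *)
Lemma sum_cos_period (n P : nat) (u v : 'I_n -> nat) : (0 < P)%N ->
 (forall i, u i < 4 * P)%N -> (forall i, v i < 4 * P)%N ->
 \sum_(l : {ffun 'I_n -> 'I_(4 * P)})
  cos (\sum_i ((l i)%:R - (2 * P)%:R) * (2 * pi / (4 * P)%:R) * ((u i)%:R - (v i)%:R) : R)
 = (4 * P)%:R ^+ n * [forall i, u i == v i]%:R.
move=> P0 uP vP.
rewrite (eq_bigr (fun l : {ffun 'I_n -> 'I_(4 * P)} => complex.Re (\prod_i
  expi (((l i)%:R - (2 * P)%:R) * (2 * pi / (4 * P)%:R) * ((u i)%:R - (v i)%:R) : R)))); last first.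
 by move=> l _; rewrite -expi_sum.
rewrite -Re_sum -(bigA_distr_bigA (fun (i : 'I_n) (l : 'I_(4 * P)) =>
  expi ((l%:R - (2 * P)%:R) * (2 * pi / (4 * P)%:R) * ((u i)%:R - (v i)%:R) : R))).
rewrite (eq_bigr (fun i => ((4 * P)%:R * (u i == v i)%:R)%:C)); last first.
 by move=> i _; rewrite sum_expi_period.
rewrite -rmorph_prod /= big_split/= prodr_const card_ord; congr (_ * _).
case: forallP => [h|h]; first by rewrite big1// => i _; rewrite h.
have [i ni] : exists i, u i != v i by apply/existsP; apply: contra_notT h; rewrite negb_exists => /forallP h i; rewrite -[_ == _]negbK.
by rewrite (bigD1 i)//= (negbTE ni) mul0r.
Qed.

Lemma cosMcos (a b : R) : cos a * cos b = (cos (a - b) + cos (a + b)) / 2.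
Proof. by rewrite cosB cosD; field. Qed.
End characters.

(** The Weierstrass product inequality; it turns the loss per coordinate in the window count into a
    loss of the product. *)
Lemma prod_ge1B (R : realFieldType) (I : finType) (x : I -> R) :
 (forall i, 0 <= x i <= 1) -> 1 - \sum_i (1 - x i) <= \prod_i x i.
move=> x01.
suff [] : 1 - \sum_i (1 - x i) <= \prod_i x i /\ 0 <= \prod_i x i <= 1 by [].
elim/big_rec2 : _ => [|i y1 y2 _ [h1 /andP[h2 h3]]]; first by rewrite subr0 lexx ler01.
have /andP[x0 x1] := x01 i; split; first nra.
by rewrite mulr_ge0// mulr_ile1.
Qed.

(** * Stationary covariance forms on test functions *)

Section covariance_form.
Context {R : realType} {n : nat}.
Notation E := 'rV[R]_n.
Implicit Types (f g : E -> R).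
(** Test functions again, with the closed support replaced by vanishing off a cube, the form in
    which estimates use it. [tf_test_function] and [test_function_tf] identify the two notions. *)
Definition tf f := [/\ mfunT f, exists C, forall x, `|f x| <= C
 & exists t, off_cube t f].

Lemma tfD f g : tf f -> tf g -> tf (fun x => f x + g x).
move=> [mf [C fC] [t ft]] [mg [D gD] [s gs]]; split; first exact: mfunD.
 by exists (C + D) => x; rewrite (le_trans (ler_normD _ _))// lerD.
by exists (Num.max t s) => x; rewrite ge_max => /andP[? ?]; rewrite ft// gs// addr0.
Qed.

Lemma tfZ a f : tf f -> tf (fun x => a * f x).
move=> [mf [C fC] [t ft]]; split; first exact: mfunM.
 by exists (`|a| * C) => x; rewrite normrM ler_wpM2l.
by exists t => x tx; rewrite ft// mulr0.
Qed.

Lemma tfB f g : tf f -> tf g -> tf (fun x => f x - g x).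
move=> tff tfg; rewrite (_ : (fun x => _) = (fun x => f x + (-1) * g x)); last first.
 by apply/funext => x; rewrite mulN1r.
by apply: tfD => //; exact: tfZ.
Qed.

Lemma tf0 : tf (fun=> 0).
Proof. by split=> //; [exists 0 => x; rewrite normr0|exists 0]. Qed.
Lemma tf_sum (I : Type) (r : seq I) (F : I -> E -> R) : (forall i, tf (F i)) ->
 tf (fun x => \sum_(i <- r) F i x).
move=> tF; elim: r => [|i r IH]; first by under eq_fun do rewrite big_nil; exact: tf0.
by under eq_fun do rewrite big_cons; exact: tfD.
Qed.

Lemma tf_shift a f : tf f -> tf (fun x => f (x + a)).
move=> [mf [C fC] [t ft]]; split.
- apply: mcomp => //.
 exact: (mfunD_rV (@measurable_id _ _ setT) (mcst a)).
- by exists C.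
- exists (t + `|a|) => x tx; apply: ft.
 have := ler_normB (x + a) a; rewrite addrK; lra.
Qed.

Lemma tf_bx N c : tf (@bx R n N c).
split.
- rewrite /bx (_ : (fun x => _) = \1_[set x : E | forall i, `[c 0 i, c 0 i + mesh N[%classic (x 0 i)]).
  by apply: mindic; apply: (@measurable_rect _ _ (fun i => `[c 0 i, c 0 i + mesh N[%classic)) => i.
 apply/funext => x; rewrite indicE; congr ((nat_of_bool _)%:R).
 apply/forallP/idP => [h|]; rewrite inE /=.
  by move=> i; rewrite in_itv/=; exact: h.
 by move=> h i; have := h i; rewrite in_itv.
- by exists 1 => x; rewrite /bx; case: forallP; rewrite ?normr0 ?normr1.
- exists (`|c| + 2) => x xc; rewrite /bx; case: forallP => // h.
 suff : `|x| <= `|c| + 1 by lra.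
 apply: norm_le_coord; first by rewrite addr_ge0.
 move=> i; have := h i; have := le_coord_norm c i; rewrite !ler_norml => /andP[h1 h2] /andP[h3 h4].
 have : mesh N <= 1 :> R by rewrite invf_le1 ?exprn_gt0// exprn_ege1// ler1n.
 by move=> ?; apply/andP; split; lra.
Qed.

Lemma measurable_cell1 N : mfunT (@cell1 R N).
apply: mfunM => //; apply: nondecreasing_measurable => // x y xy.
by rewrite ler_int le_floor// ler_pM2l// exprn_gt0.
Qed.

Lemma tf_step N J f : step N J f -> tf f.
move=> sf; rewrite (_ : f = fun x => \sum_(r : gindex N J) f (grid r) * bx N (grid r) x).
 by apply: tf_sum => r; apply: tfZ; exact: tf_bx.
by apply/funext => x; exact: step_sum.
Qed.

(** What the Bochner argument uses; both the covariance and the uncentred second moment of linear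
    statistics satisfy it. [form_cvg0] is continuity under bounded pointwise convergence, and
    [form_var] says that the covariance measure has finite variation on a box, uniformly in the
    mesh. *)
Record covariance_form (B : (E -> R) -> (E -> R) -> R) : Prop := CovarianceForm {
 formD : forall f g h, tf f -> tf g -> tf h ->
  B (fun x => f x + g x) h = B f h + B g h ;
 formZ : forall a f h, tf f -> tf h -> B (fun x => a * f x) h = a * B f h ;
 formC : forall f g, tf f -> tf g -> B f g = B g f ;
 form_ge0 : forall f, tf f -> 0 <= B f f ;
 form_shift : forall a f g, tf f -> tf g ->
  B (fun x => f (x + a)) (fun x => g (x + a)) = B f g ;
 form_cvg0 : forall (f : nat -> E -> R) C t, (forall k, mfunT (f k)) ->
  (forall k x, `|f k x| <= C) -> (forall k, off_cube t (f k)) ->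
  (forall x, f ^~ x @ \oo --> 0) -> (fun k => B (f k) (f k)) @ \oo --> 0 ;
 form_var : forall J : nat, exists C : R, forall N : nat,
  \sum_(r : @gindex n N J) \sum_(s : @gindex n N J)
   `|B (bx N (grid r)) (bx N (grid s))| <= C }.

Section form_theory.
Variable B : (E -> R) -> (E -> R) -> R.
Hypothesis HB : covariance_form B.

Lemma form0l h : tf h -> B (fun=> 0) h = 0.
move=> th; rewrite (_ : (fun=> 0) = fun x : E => 0 * (fun=> 0 : R) x).
 by rewrite (formZ HB) ?mul0r//; exact: tf0.
by apply/funext => x; rewrite mul0r.
Qed.

Lemma form_suml (I : Type) (r : seq I) (F : I -> E -> R) h : (forall i, tf (F i)) -> tf h ->
 B (fun x => \sum_(i <- r) F i x) h = \sum_(i <- r) B (F i) h.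
move=> tF th; elim: r => [|i r IH].
 by under eq_fun do rewrite big_nil; rewrite form0l// big_nil.
under eq_fun do rewrite big_cons.
by rewrite (formD HB)// ?big_cons ?IH//; exact: tf_sum.
Qed.

Lemma form_sum2 (I : finType) (a b : I -> R) (F : I -> E -> R) : (forall i, tf (F i)) ->
 B (fun x => \sum_i a i * F i x) (fun x => \sum_i b i * F i x) =
 \sum_i \sum_j a i * b j * B (F i) (F j).
move=> tF; have tS (c : I -> R) : tf (fun x => \sum_i c i * F i x).
 by apply: tf_sum => i; exact: tfZ.
rewrite form_suml//; last by move=> i; exact: tfZ.
apply: eq_bigr => i _; rewrite (formZ HB)// (formC HB)// form_suml//; last by move=> j; exact: tfZ.
rewrite mulr_sumr; apply: eq_bigr => j _; rewrite (formZ HB)// mulrA (formC HB)//.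
Qed.

Lemma formDD f g : tf f -> tf g ->
 B (fun x => f x + g x) (fun x => f x + g x) = B f f + 2 * B f g + B g g.
move=> tff tfg; have tfg' := tfD tff tfg.
rewrite (formD HB)// (formC HB tff tfg') (formC HB tfg tfg') !(formD HB)//.
by rewrite (formC HB tfg tff); ring.
Qed.

Lemma formDD_le f g : tf f -> tf g ->
 B (fun x => f x + g x) (fun x => f x + g x) <= 2 * B f f + 2 * B g g.
move=> tff tfg; rewrite formDD//.
have tfg' := tfZ (-1) tfg.
have := form_ge0 HB (tfD tff tfg'); rewrite formDD//.
rewrite (formC HB tff tfg') !(formZ HB)// (formC HB tfg tfg') (formZ HB)// (formC HB tff tfg); lra.
Qed.

Lemma form_ZZ a f : tf f -> B (fun x => a * f x) (fun x => a * f x) = a ^+ 2 * B f f.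
move=> tff; rewrite (formZ HB)//; last exact: tfZ.
by rewrite (formC HB) ?(formZ HB)//; [ring|exact: tfZ].
Qed.
End form_theory.
End covariance_form.

Section dotv_theory.
Context {R : realType} {n : nat}.
Implicit Types x y k : 'rV[R]_n.

Lemma dotvDr k x y : dotv k (x + y) = dotv k x + dotv k y.
Proof. by rewrite -big_split; apply: eq_bigr => i _; rewrite mxE mulrDr. Qed.
Lemma dotvNr k x : dotv k (- x) = - dotv k x.
Proof. by rewrite -sumrN; apply: eq_bigr => i _; rewrite mxE mulrN. Qed.
Lemma dotvBr k x y : dotv k (x - y) = dotv k x - dotv k y.
Proof. by rewrite dotvDr dotvNr. Qed.
Lemma dotvC x y : dotv x y = dotv y x.
Proof. by apply: eq_bigr => i _; rewrite mulrC. Qed.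
Lemma dotvDl x y k : dotv (x + y) k = dotv x k + dotv y k.
Proof. by rewrite ![dotv _ k]dotvC dotvDr. Qed.
Lemma dotvNl x k : dotv (- x) k = - dotv x k.
Proof. by rewrite ![dotv _ k]dotvC dotvNr. Qed.
Lemma dotv0l x : dotv 0 x = 0.
Proof. by rewrite /dotv big1// => i _; rewrite mxE mul0r. Qed.
Lemma dotv_le k x : `|dotv k x| <= n%:R * (`|k| * `|x|).
apply: le_trans (ler_norm_sum _ _ _) _.
via (\sum_(i < n) `|k| * `|x|); last first.
 by rewrite sumr_const card_ord mulr_natl.
by apply: ler_sum => i _; rewrite normrM ler_pM// le_coord_norm.
Qed.
End dotv_theory.

Lemma sum_ltn P K : (\sum_(a < P) (a < K) = minn P K)%N.
elim: P => [|P IH]; first by rewrite big_ord0 min0n.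
by rewrite big_ord_recr/= IH; lia.
Qed.

Lemma sum_geq P m : (\sum_(a < P) (m <= a) = P - m)%N.
elim: P => [|P IH]; first by rewrite big_ord0.
by rewrite big_ord_recr/= IH; lia.
Qed.

(** * Periodograms: approximate spectra on a finite frequency grid *)

Section periodogram.
Context {R : realType} {n : nat}.
Notation E := 'rV[R]_n.
Variable B : (E -> R) -> (E -> R) -> R.
Hypothesis HB : covariance_form B.
Variable N : nat.
Notation h := (mesh N : R).
Notation P := (4 ^ N)%N.
Let P0 : (0 < P)%N. Proof. by rewrite expn_gt0. Qed.
(** The observation window has [4^N] cells of side [2^-N] per coordinate: its side [2^N] grows while
    the mesh shrinks. *)
Definition pos (s : {ffun 'I_n -> 'I_(4 ^ N)}) : E := \row_i ((s i)%:R * mesh N).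
(** There are four times as many frequencies as window positions per coordinate, so that the sum of
    a grid index and a window index never wraps around the period. Centring places them in the band
    of radius [pi / mesh N]. *)
Definition freq (l : {ffun 'I_n -> 'I_(4 * 4 ^ N)}) : E :=
 \row_i (((l i)%:R - (2 * 4 ^ N)%:R) * (2 * pi / (4 * 4 ^ N)%:R) / mesh N).
(** The form evaluated at a complex exponential sampled on the window, as the sum over its real and
    imaginary parts: a periodogram, nonnegative because the form is. *)
Definition window_power l : R :=
 let c x := \sum_s cos (dotv (freq l) (pos s)) * bx N (pos s) x in
 let d x := \sum_s sin (dotv (freq l) (pos s)) * bx N (pos s) x in
 B c c + B d d.
(** The denominator undoes, from right to left, the length of the orthogonality sums, the
    approximate number of window pairs with a given difference, and the squared cell volume
    contained in [dft_power]. *)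
Definition weight l : R :=
 (2 * pi) ^+ n * window_power l / (h ^+ (2 * n) * P%:R ^+ n * (4 * P)%:R ^+ n).
Definition dft_cos J (f : E -> R) (k : E) : R :=
 h ^+ n * \sum_(r : gindex N J) f (grid r) * cos (dotv k (grid r)).
Definition dft_sin J (f : E -> R) (k : E) : R :=
 h ^+ n * \sum_(r : gindex N J) f (grid r) * sin (dotv k (grid r)).
Definition dft_power J f k := dft_cos J f k ^+ 2 + dft_sin J f k ^+ 2.

Lemma window_power_ge0 l : 0 <= window_power l.
have tb (a : {ffun 'I_n -> 'I_P} -> R) : tf (fun x => \sum_s a s * bx N (pos s) x)
 by apply: tf_sum => s; apply: tfZ; exact: tf_bx.
by rewrite addr_ge0//; apply: (form_ge0 HB).
Qed.

Lemma weight_ge0 l : 0 <= weight l.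
rewrite divr_ge0 ?mulr_ge0 ?exprn_ge0 ?window_power_ge0 ?ler0n ?mulr_ge0 ?pi_ge0 ?ler0n//.
by rewrite ltW// mesh_gt0.
Qed.
Let sum_cos_sq (I : finType) (a th : I -> R) :
 (\sum_i a i * cos (th i)) ^+ 2 + (\sum_i a i * sin (th i)) ^+ 2 =
 \sum_(p : I * I) a p.1 * a p.2 * cos (th p.1 - th p.2).
rewrite !expr2 !big_distrlr/= !pair_big/= -big_split/=; apply: eq_bigr => p _.
by rewrite cosB; ring.
Qed.

Lemma dft_powerE J f k : dft_power J f k = h ^+ (2 * n) *
 \sum_(p : gindex N J * gindex N J) f (grid p.1) * f (grid p.2) * cos (dotv k (grid p.1) - dotv k (grid p.2)).
rewrite /dft_power /dft_cos /dft_sin !exprMn -mulrDr sum_cos_sq -exprM mulnC//.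
Qed.
Let corr (v : E) := B (bx N 0) (bx N v).

Lemma form_bx c c' : B (bx N c) (bx N c') = corr (c' - c).
have bxD b v : bx N v = (fun x => bx N (v + b) (x + b)) :> (E -> R).
 apply/funext => x; rewrite /bx; congr ((nat_of_bool _)%:R).
 by apply: eq_forallb => i; rewrite !mxE; apply/idP/idP => /andP[h1 h2]; apply/andP; split; lra.
by rewrite /corr (bxD c 0) (bxD c (c' - c)) add0r subrK (form_shift HB)//; exact: tf_bx.
Qed.

Lemma window_powerE l : window_power l =
 \sum_(q : {ffun 'I_n -> 'I_P} * {ffun 'I_n -> 'I_P})
   B (bx N (pos q.1)) (bx N (pos q.2)) * cos (dotv (freq l) (pos q.1) - dotv (freq l) (pos q.2)).
rewrite /window_power !(form_sum2 HB); [|by move=> s; exact: tf_bx..].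
rewrite !pair_big/= -big_split/=; apply: eq_bigr => p _.
by rewrite cosB; ring.
Qed.

Section count.
Variables (J : nat).
Notation K := (gsize N J).
Hypothesis KP : (K <= P)%N.
(** A pair of grid points and a pair of window points match when they have the same difference; the
    equation is written with sums to avoid subtraction in [nat]. *)
Let D (p : gindex N J * gindex N J) (q : {ffun 'I_n -> 'I_P} * {ffun 'I_n -> 'I_P}) : bool :=
 [forall i, p.1 i + q.2 i == p.2 i + q.1 i]%N.
Let cnt p : R := \sum_q (D p q)%:R.
Let D_corr p q : D p q -> pos q.2 - pos q.1 = grid p.2 - grid p.1.
move=> /forallP pq; apply/rowP => i; rewrite !mxE.
have /eqP := pq i; move=> /(congr1 (fun m : nat => m%:R : R)); rewrite !natrD => e.
have -> : (q.2 i)%:R = (p.2 i)%:R + (q.1 i)%:R - (p.1 i)%:R :> R by lra.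
ring.
Qed.
(** In each coordinate about [P] of the [P^2] pairs of window positions have a prescribed
    difference: every position at distance at least [K] from both ends has exactly one partner, so
    at most [2 * K] of the [P] positions are lost. *)
Let cnt_bound p : P%:R ^+ n * (1 - n%:R * (2 * K%:R / P%:R)) <= cnt p <= P%:R ^+ n.
have P0' : 0 < P%:R :> R by rewrite ltr0n.
pose e i (a : 'I_P) : R := \sum_(b < P) (p.1 i + b == p.2 i + a)%N%:R.
have e01 i a : 0 <= e i a <= 1.
 rewrite sumr_ge0//= /e; have [/existsP[b /eqP ba]|] := boolP [exists b : 'I_P, (p.1 i + b == p.2 i + a)%N].
  rewrite (bigD1 b)//= ba eqxx big1 ?addr0// => b' bb'; case: eqP => // ba'.
  by move: bb'; rewrite -val_eqE -(eqn_add2l (p.1 i)) ba ba' eqxx.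
 rewrite negb_exists => /forallP ne; rewrite big1 ?ler01// => b _.
 by rewrite (negbTE (ne b)).
have e1 i (a : 'I_P) : (K <= a < P - K)%N -> e i a = 1.
 move=> /andP[Ka aK]; have h1 := ltn_ord (p.1 i); have h2 := ltn_ord (p.2 i).
 have bP : (p.2 i + a - p.1 i < P)%N by lia.
 rewrite /e (bigD1 (Ordinal bP))//= subnKC ?eqxx; last by lia.
 rewrite big1 ?addr0// => b bn; apply/eqP; rewrite pnatr_eq0 eqb0.
 by apply: contra bn => /eqP ba; apply/eqP/val_inj => /=; lia.
pose q_ i := \sum_(a < P) e i a.
have qle i : P%:R - 2 * K%:R <= q_ i <= P%:R.
 apply/andP; split; last first.
  rewrite -[X in _ <= X%:R](card_ord P) -sum1_card natr_sum; apply: ler_sum => a _.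
  by have /andP[] := e01 i a.
 rewrite lerBlDr -[X in X%:R <= _](card_ord P) -sum1_card natr_sum.
 via (\sum_(a < P) (e i a + ((a < K)%N + (P - K <= a)%N)%:R)).
  apply: ler_sum => a _; have /andP[e0 _] := e01 i a.
  have [h|] := boolP ((a < K) || (P - K <= a))%N; last first.
   by rewrite negb_or -leqNgt -ltnNge => h; rewrite e1// lerDl.
  have : (1 <= (a < K) + (P - K <= a))%N by move: h; case: (a < K)%N => //=; case: (P - K <= a)%N.
  rewrite -(ler_nat R); lra.
 rewrite big_split/= lerD2l -natr_sum -natrM ler_nat big_split/=.
 rewrite mul2n -addnn leq_add//.
  by rewrite sum_ltn geq_minr.
 by rewrite sum_geq; lia.
(* Matching is a condition on each coordinate separately, so the count factorises. *)
have -> : cnt p = \prod_i q_ i.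
 rewrite /cnt /q_ bigA_distr_bigA/= -(pair_bigA _ (fun s s' => (D p (s, s'))%:R))/=.
 apply: eq_bigr => s _; rewrite /e bigA_distr_bigA/=; apply: eq_bigr => s' _.
 rewrite /D/=; case: forallP => [ps|ps].
  by rewrite big1// => i _; rewrite ps.
 have /existsP[i ni] : [exists i, p.1 i + s' i != p.2 i + s i]%N
  by rewrite -negb_forall; apply/negP => /forallP.
 by rewrite (bigD1 i)//= (negbTE ni) mul0r.
have PnE (x : 'I_n -> R) : \prod_i x i = P%:R ^+ n * \prod_i (x i / P%:R)
 by rewrite big_split/= prodr_const card_ord mulrCA -exprMn mulfV ?gt_eqF// expr1n mulr1.
have x01 i : 0 <= q_ i / P%:R <= 1.
 have /andP[h1 h2] := qle i; rewrite ler_pdivrMr// mul1r h2 andbT.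
 by rewrite divr_ge0// sumr_ge0// => a _; have /andP[] := e01 i a.
apply/andP; split; last first.
 rewrite -[leRHS]mulr1 PnE ler_pM2l ?exprn_gt0//.
 by apply: prodr_ile1 => i _; exact: x01.
rewrite PnE ler_pM2l ?exprn_gt0//; apply: le_trans (prod_ge1B x01).
rewrite lerB//; via (\sum_(i < n) (2 * K%:R / P%:R)); last first.
 by rewrite sumr_const card_ord -[X in X <= _]mulr_natl.
apply: ler_sum => i _.
have /andP[h1 h2] := qle i; rewrite lerBlDr -mulrDl ler_pdivlMr// mul1r; lra.
Qed.

(** Summation over all frequencies kills every pair of differences that do not match. The product of
    two cosines yields a difference and a sum of angles; the sum corresponds to the window pair with
    its points exchanged, and contributes the same total because the form is symmetric. *)
Lemma sum_weight_dft f : \sum_l weight l * dft_power J f (freq l) =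
 (2 * pi) ^+ n * \sum_p f (grid p.1) * f (grid p.2) * B (bx N (grid p.1)) (bx N (grid p.2)) * (cnt p / P%:R ^+ n).
have key p q : \sum_l cos (dotv (freq l) (grid p.1) - dotv (freq l) (grid p.2)) *
  cos (dotv (freq l) (pos q.1) - dotv (freq l) (pos q.2)) =
  (4 * P)%:R ^+ n / 2 * ((D p q)%:R + (D p (q.2, q.1))%:R).
 under eq_bigr do rewrite cosMcos.
 rewrite -mulr_suml big_split/=.
 have hlp (s s' : {ffun 'I_n -> 'I_P}) : \sum_l cos (dotv (freq l) (grid p.1) - dotv (freq l) (grid p.2)
   - (dotv (freq l) (pos s) - dotv (freq l) (pos s'))) = (4 * P)%:R ^+ n * (D p (s, s'))%:R.
  rewrite -(@sum_cos_period R n P (fun i => p.1 i + s' i)%N (fun i => p.2 i + s i)%N)//.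
  - apply: eq_bigr => l _; congr cos; rewrite -!dotvBr; apply: eq_bigr => i _.
   rewrite !mxE [(p.1 i + _)%:R]natrD [(p.2 i + _)%:R]natrD; set c := 2 * pi / _; have h0 : mesh N != 0 :> R := mesh_neq0 N.
   by field.
  - by move=> i; have := ltn_ord (p.1 i); have := ltn_ord (s' i); lia.
  - by move=> i; have := ltn_ord (p.2 i); have := ltn_ord (s i); lia.
 rewrite hlp.
 rewrite (eq_bigr (fun l => cos (dotv (freq l) (grid p.1) - dotv (freq l) (grid p.2)
   - (dotv (freq l) (pos q.2) - dotv (freq l) (pos q.1))))); last by move=> l _; congr cos; ring.
 by rewrite hlp -surjective_pairing; ring.
have h0 : h != 0 by exact: mesh_neq0.
have P0' : P%:R != 0 :> R by rewrite pnatr_eq0 -lt0n.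
have Q0' : (4 * P)%:R != 0 :> R by rewrite pnatr_eq0 -lt0n muln_gt0 P0.
pose c0 : R := (2 * pi) ^+ n / (P%:R ^+ n * (4 * P)%:R ^+ n).
rewrite (eq_bigr (fun l => c0 * ((\sum_(p : gindex N J * gindex N J) f (grid p.1) * f (grid p.2) * cos (dotv (freq l) (grid p.1) - dotv (freq l) (grid p.2)))
  * (\sum_(q : {ffun 'I_n -> 'I_P} * {ffun 'I_n -> 'I_P})
   B (bx N (pos q.1)) (bx N (pos q.2)) * cos (dotv (freq l) (pos q.1) - dotv (freq l) (pos q.2)))))); last first.
 move=> l _; rewrite /weight window_powerE dft_powerE /c0.
 set S1 := \sum_p _; set S2 := \sum_q _; field.
 by rewrite !expf_neq0.
rewrite -mulr_sumr.
under eq_bigr do rewrite big_distrlr/=.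
rewrite exchange_big/=.
rewrite (eq_bigr (fun p => (4 * P)%:R ^+ n * (f (grid p.1) * f (grid p.2) * B (bx N (grid p.1)) (bx N (grid p.2)) * cnt p))); last first.
 move=> p _; rewrite exchange_big/=.
 rewrite (eq_bigr (fun q => (4 * P)%:R ^+ n / 2 * (f (grid p.1) * f (grid p.2)) *
   (B (bx N (pos q.1)) (bx N (pos q.2)) * (D p q)%:R + B (bx N (pos q.1)) (bx N (pos q.2)) * (D p (q.2, q.1))%:R))); last first.
  move=> q _; rewrite -mulrDr.
  rewrite [RHS](_ : _ = f (grid p.1) * f (grid p.2) * B (bx N (pos q.1)) (bx N (pos q.2)) * ((4 * P)%:R ^+ n / 2 * ((D p q)%:R + (D p (q.2, q.1))%:R))); last by ring.
  by rewrite -key mulr_sumr; apply: eq_bigr => l _; ring.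
 rewrite -mulr_sumr big_split/=.
 rewrite [X in _ + X](_ : _ = \sum_(q : {ffun 'I_n -> 'I_P} * {ffun 'I_n -> 'I_P}) B (bx N (pos q.1)) (bx N (pos q.2)) * (D p q)%:R); last first.
  rewrite (reindex_inj (h := fun q => (q.2, q.1))); last by move=> [a b] [c d] [-> ->].
  by apply: eq_bigr => -[a b] _ /=; rewrite (formC HB)//; exact: tf_bx.
 (* On matching pairs, stationarity replaces the value of the form on the window by its value on the
    grid of [f]. *)
 rewrite (eq_bigr (fun q => B (bx N (grid p.1)) (bx N (grid p.2)) * (D p q)%:R)); last first.
  move=> q _; have [Dpq|] := boolP (D p q); last by rewrite !mulr0.
  by rewrite !form_bx (D_corr Dpq).
 by rewrite -mulr_sumr -/(cnt p); field.
rewrite -mulr_sumr /c0 !mulr_sumr; apply: eq_bigr => p _; field.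
by rewrite !expf_neq0.
Qed.

(** Only the relative deficit of the window count remains, of order [K / P], multiplied by the
    variation of the form on the grid. *)
Lemma weight_dft_approx f C V : step N J f -> (forall x, `|f x| <= C) ->
 \sum_(r : gindex N J) \sum_(s : gindex N J) `|B (bx N (grid r)) (bx N (grid s))| <= V ->
 `|\sum_l weight l * dft_power J f (freq l) - (2 * pi) ^+ n * B f f| <=
 (2 * pi) ^+ n * (C ^+ 2 * (n%:R * (2 * K%:R / P%:R)) * V).
move=> sf fC BV; have p0 : 0 <= (2 * pi) ^+ n :> R by rewrite exprn_ge0// mulr_ge0// pi_ge0.
have P0' : 0 < P%:R ^+ n :> R by rewrite exprn_gt0// ltr0n.
have -> : B f f = \sum_(p : gindex N J * gindex N J) f (grid p.1) * f (grid p.2) * B (bx N (grid p.1)) (bx N (grid p.2)).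
 rewrite [X in B X _](funext (step_sum sf)) [X in B _ X](funext (step_sum sf)) (form_sum2 HB).
  by rewrite pair_big.
 by move=> r; exact: tf_bx.
rewrite sum_weight_dft -mulrBr normrM (ger0_norm p0) ler_wpM2l// -sumrB.
apply: le_trans (ler_norm_sum _ _ _) _.
set e := n%:R * _.
have e0 : 0 <= e by rewrite mulr_ge0// divr_ge0.
via (\sum_(p : gindex N J * gindex N J) C ^+ 2 * e * `|B (bx N (grid p.1)) (bx N (grid p.2))|); last first.
 rewrite -mulr_sumr ler_wpM2l//; last by rewrite pair_big in BV.
 by rewrite mulr_ge0// exprn_even_ge0.
apply: ler_sum => p _; rewrite -[X in _ - X]mulr1 -mulrBr !normrM expr2.
have /andP[h1 h2] := cnt_bound p.
have -> : `|cnt p / P%:R ^+ n - 1| = 1 - cnt p / P%:R ^+ n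
 by rewrite ler0_norm ?opprB// subr_le0 ler_pdivrMr// mul1r.
have h3 : 1 - cnt p / P%:R ^+ n <= e by rewrite lerBlDr -lerBlDl ler_pdivlMr// mulrC.
have h4 : 0 <= 1 - cnt p / P%:R ^+ n by rewrite subr_ge0 ler_pdivrMr// mul1r.
rewrite mulrAC ler_wpM2r//; apply: ler_pM => //; exact: ler_pM.
Qed.
End count.
End periodogram.

(** * Lipschitz bounds and the Dirichlet kernel *)

Section trigonometry.
Context {R : realType}.
Implicit Types a b x : R.

Lemma cos_lipschitz a b : `|cos a - cos b| <= `|a - b|.
wlog ab : a b / b <= a => [H|].
 have [|/ltW] := leP b a; first exact: H.
 by rewrite (distrC (cos a)) (distrC a); exact: H.
have [|c _ ->] := @MVT_segment R cos (fun x => - sin x) b a ab.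
 by apply: continuous_subspaceT => x; exact: continuous_cos.
by rewrite normrM normrN ler_piMl// ler_norml sin_geN1 sin_le1.
Qed.

Lemma sin_lipschitz a b : `|sin a - sin b| <= `|a - b|.
wlog ab : a b / b <= a => [H|].
 have [|/ltW] := leP b a; first exact: H.
 by rewrite (distrC (sin a)) (distrC a); exact: H.
have [|c _ ->] := @MVT_segment R sin cos b a ab.
 by apply: continuous_subspaceT => x; exact: continuous_sin.
by rewrite normrM ler_piMl// ler_norml cos_geN1 cos_le1.
Qed.

Lemma cos_ge_half x : `|x| <= 2^-1 -> 2^-1 <= cos x.
move=> xh; have := cos_lipschitz x 0; rewrite cos0 subr0 => h.
have := le_trans h xh; rewrite ler_norml => /andP[h1 _]; lra.
Qed.

(** Near 0 the derivative of the sine is at least [1/2]; beyond [1/2] monotonicity leaves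
    [sin (1/2) >= 1/4], which beats [x / 8] because [x < 2]. *)
Lemma sin_lower x : 0 <= x <= pi / 2 -> x / 8 <= sin x.
move=> /andP[x0 xpi]; have p2 : pi / 2 < 2 :> R by exact: pihalf_lt2.
have small (y : R) : 0 <= y <= 2^-1 -> y / 2 <= sin y.
 move=> /andP[y0 yh].
 have [|c cy] := @MVT_segment R sin cos 0 y y0.
  by apply: continuous_subspaceT => z; exact: continuous_sin.
 rewrite sin0 !subr0 => ->; rewrite mulrC ler_wpM2r//; apply: cos_ge_half.
 by move: cy; rewrite in_itv/= => /andP[c0 cy]; rewrite ger0_norm// (le_trans cy).
have [xh|hx] := leP x 2^-1.
 by apply: le_trans (small x _); [lra|rewrite x0].
have h1 : 2^-1 / 2 <= sin (2^-1 : R) by apply: small; rewrite lexx invr_ge0 ler0n.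
via (sin (2^-1 : R)); first lra.
have p0 := pi_gt0 R; apply/ltW; rewrite ltr_sin// in_itv/=.
 by apply/andP; split; lra.
by apply/andP; split; lra.
Qed.

Lemma sum_cos (M : nat) (t : R) :
 2 * sin (t / 2) * \sum_(j < M) cos (j%:R * t) = sin (M%:R * t - t / 2) + sin (t / 2).
elim: M => [|M IH]; first by rewrite big_ord0 mulr0 mul0r sub0r sinN addNr.
rewrite big_ord_recr/= mulrDr IH.
have -> : M.+1%:R * t - t / 2 = M%:R * t + t / 2 by rewrite -natr1; field.
by rewrite sinB sinD; ring.
Qed.

(** For [t > 0] the closed form bounds the sum by [1 / sin (t / 2)], hence by [16 / t]; the constant
    32 makes this at most half the number of terms. *)
Lemma sum_cos_le (M : nat) (t : R) : 32 <= M%:R * `|t| -> `|t| <= pi ->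
 \sum_(j < M) cos (j%:R * t) <= M%:R / 2.
move=> tM tpi.
wlog t0 : t tM tpi / 0 <= t => [H|].
 have [|/ltW t0] := leP 0 t; first exact: H.
 rewrite (eq_bigr (fun j : 'I_M => cos (j%:R * - t))); last by move=> j _; rewrite mulrN cosN.
 by apply: H; rewrite ?normrN ?oppr_ge0.
rewrite ger0_norm// in tM tpi.
have M0 : 0 < M%:R :> R by rewrite ltr0n lt0n; apply: contraPneq tM => ->; rewrite mul0r lern0.
have s_low : t / 2 / 8 <= sin (t / 2) by apply: sin_lower; apply/andP; split; lra.
have s0 : 0 < sin (t / 2).
 apply: lt_le_trans s_low; rewrite !divr_gt0//.
 by rewrite -(pmulr_rgt0 _ M0); apply: lt_le_trans tM.
have := sum_cos M t; have := sin_le1 (M%:R * t - t / 2); have := sin_le1 (t / 2).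
move=> h1 h2 h3; rewrite -(ler_pM2l (x := 2 * sin (t / 2))) ?mulr_gt0// h3.
via 2; first lra.
nra.
Qed.
End trigonometry.

Lemma integrable_indic_lty d (T : measurableType d) (R : realType)
  (m : meas T R) (A : set T) : measurable A -> (m A < +oo)%E ->
 m.-integrable setT (fun x => (\1_A x)%:E).
move=> mA mAy; apply/integrableP; split; first exact/mEFin.
rewrite (eq_integral (fun x => (\1_A x)%:E)); last first.
 by move=> x _; rewrite gee0_abs// lee_fin.
by rewrite int_indic// setIT.
Qed.

(** * Integrals of test functions against locally finite measures *)

Section test_integrals.
Context {R : realType} {n : nat}.
Notation E := 'rV[R]_n.
Variable m : meas E R.
Hypothesis lf : loc_fin m.
Implicit Types f g u : E -> R.

Lemma tf_integrable f : tf f -> intR m f.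
move=> [mf [C fC] [t ft]].
apply: (@le_integrable _ _ _ m setT mtop (EFin \o f) (fun x => (C * \1_(cube (`|t| + 1)) x)%:E)) => //.
- exact/mEFin.
- move=> x _ /=; rewrite lee_fin indicE.
 have [xc|xc] := boolP (x \in _); first by rewrite mulr1 (le_trans (fC x))// ler_norm.
 rewrite ft ?normr0// leNgt; apply: contra xc => xt; rewrite inE /cube/=.
 by rewrite (lt_trans xt)// (le_lt_trans (ler_norm _))// ltrDl.
- under eq_fun do rewrite EFinM.
 have mc : measurable (cube (`|t| + 1) : set E) by exact: mcub.
 apply: integrableZl => //; apply: integrable_indic_lty => //.
 by apply: lf => //; exact: bounded_cube.
Qed.

Lemma tfM f u : mfunT u -> (exists C, forall x, `|u x| <= C) -> tf f ->
 tf (fun x => f x * u x).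
move=> mu [D uD] [mf [C fC] [t ft]]; split; first exact: mfunM.
 by exists (C * D) => x; rewrite normrM ler_pM.
by exists t => x tx; rewrite ft// mul0r.
Qed.

Lemma tf_norm f : tf f -> tf (fun x => `|f x|).
move=> [mf [C fC] [t ft]]; split; first exact: mcomp.
 by exists C => x; rewrite normr_id.
by exists t => x tx; rewrite ft// normr0.
Qed.

Lemma int_tfD f g : tf f -> tf g ->
 \int[m]_x (f x + g x) = \int[m]_x f x + \int[m]_x g x.
Proof. by move=> tff tfg; rewrite RintegralD//; exact: tf_integrable. Qed.
Lemma int_tfZ a f : tf f -> \int[m]_x (a * f x) = a * \int[m]_x f x.
Proof. by move=> tff; rewrite RintegralZl//; exact: tf_integrable. Qed.
Lemma int_tfB f g : tf f -> tf g ->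
 \int[m]_x (f x - g x) = \int[m]_x f x - \int[m]_x g x.
Proof. by move=> tff tfg; rewrite RintegralB//; exact: tf_integrable. Qed.
Lemma int_tf_sum (I : Type) (r : seq I) (F : I -> E -> R) : (forall i, tf (F i)) ->
 \int[m]_x (\sum_(i <- r) F i x) = \sum_(i <- r) \int[m]_x F i x.
move=> tF; elim: r => [|i r IH].
 under eq_Rint do rewrite big_nil.
 by rewrite big_nil /Rintegral integral0.
under eq_Rint do rewrite big_cons.
by rewrite int_tfD// ?IH ?big_cons//; exact: tf_sum.
Qed.

Lemma le_int_tf f g : tf f -> tf g -> (forall x, f x <= g x) ->
 \int[m]_x f x <= \int[m]_x g x.
Proof. by move=> tff tfg fg; apply: le_Rintegral => //; exact: tf_integrable. Qed.
Lemma int_tf_ge0 f : (forall x, 0 <= f x) -> 0 <= \int[m]_x f x.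
Proof. by move=> f0; apply: Rintegral_ge0. Qed.
Lemma int_tf_norm f : tf f -> `|\int[m]_x f x| <= \int[m]_x `|f x|.
Proof. by move=> tff; apply: le_normr_Rintegral => //; exact: tf_integrable. Qed.
Lemma int_tfM_le f u C : tf f -> mfunT u -> (forall x, f x != 0 -> `|u x| <= C) ->
 (exists D, forall x, `|u x| <= D) ->
 `|\int[m]_x (f x * u x)| <= C * \int[m]_x `|f x|.
move=> tff mu uC uD; apply: le_trans (int_tf_norm _) _; first exact: tfM.
rewrite -int_tfZ; last exact: tf_norm.
apply: le_int_tf => [||x]; [by apply: tf_norm; exact: tfM|by apply: tfZ; exact: tf_norm|].
have [->|fx] := eqVneq (f x) 0; first by rewrite mul0r normr0 mulr0.
by rewrite normrM mulrC ler_wpM2r// uC.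
Qed.
End test_integrals.

(** * Cosine and sine transforms of test functions *)

Section fourier_real.
Context {R : realType} {n : nat}.
Notation E := 'rV[R]_n.
Notation lambda := (@lebesgue_rV R n).
Implicit Types f g : E -> R.
Let lf := @lebesgue_lf R n.
Definition fcos f k : R := \int[lambda]_x (f x * cos (dotv k x)).
Definition fsin f k : R := \int[lambda]_x (f x * sin (dotv k x)).
(** The squared modulus of [fourier f k], by [fourier_Re] and [fourier_Im]; the spectral argument
    runs on these real energies and returns to complex transforms only at the end. *)
Definition fpow f k : R := fcos f k ^+ 2 + fsin f k ^+ 2.

Lemma measurable_cos_dotv (k : E) : mfunT (fun x => cos (dotv k x)).
apply: mcomp; last exact: measurable_dotv.
by apply: cont_mfun => x; exact: continuous_cos.
Qed.

Lemma measurable_sin_dotv (k : E) : mfunT (fun x => sin (dotv k x)).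
apply: mcomp; last exact: measurable_dotv.
by apply: cont_mfun => x; exact: continuous_sin.
Qed.

Lemma cos_bounded (t : R) : `|cos t| <= 1.
Proof. by rewrite ler_norml cos_geN1 cos_le1. Qed.
Lemma sin_bounded (t : R) : `|sin t| <= 1.
Proof. by rewrite ler_norml sin_geN1 sin_le1. Qed.
Lemma tf_cos f k : tf f -> tf (fun x => f x * cos (dotv k x)).
apply: tfM; first exact: measurable_cos_dotv.
by exists 1 => x; exact: cos_bounded.
Qed.

Lemma tf_sin f k : tf f -> tf (fun x => f x * sin (dotv k x)).
apply: tfM; first exact: measurable_sin_dotv.
by exists 1 => x; exact: sin_bounded.
Qed.

Lemma fourier_Re f k : complex.Re (fourier f k) = fcos f k.
rewrite /fourier /=; apply: eq_Rint => x _.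
by rewrite /= cosN mulr0 subr0 mulrC.
Qed.

Lemma fcosN f k : fcos f (- k) = fcos f k.
Proof. by apply: eq_Rint => x _; rewrite dotvNl cosN. Qed.
Lemma fsinN f k : tf f -> fsin f (- k) = - fsin f k.
move=> tff; rewrite -mulN1r -int_tfZ; [|exact: lf|exact: tf_sin].
by apply: eq_Rint => x _; rewrite dotvNl sinN mulN1r mulrN.
Qed.

Lemma fourier_Im f k : tf f -> complex.Im (fourier f k) = - fsin f k.
move=> tff; rewrite -mulN1r -int_tfZ; [|exact: lf|exact: tf_sin].
by apply: eq_Rint => x _; rewrite /= sinN mulr0 add0r mulN1r mulrC mulrN.
Qed.

Lemma fcosD f g k : tf f -> tf g -> fcos (fun x => f x + g x) k = fcos f k + fcos g k.
move=> tff tfg; rewrite -int_tfD; [|exact: lf|exact: tf_cos..].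
by apply: eq_Rint => x _; rewrite mulrDl.
Qed.

Lemma fsinD f g k : tf f -> tf g -> fsin (fun x => f x + g x) k = fsin f k + fsin g k.
move=> tff tfg; rewrite -int_tfD; [|exact: lf|exact: tf_sin..].
by apply: eq_Rint => x _; rewrite mulrDl.
Qed.

Lemma fcosZ a f k : tf f -> fcos (fun x => a * f x) k = a * fcos f k.
move=> tff; rewrite -int_tfZ; [|exact: lf|exact: tf_cos].
by apply: eq_Rint => x _; rewrite mulrA.
Qed.

Lemma fsinZ a f k : tf f -> fsin (fun x => a * f x) k = a * fsin f k.
move=> tff; rewrite -int_tfZ; [|exact: lf|exact: tf_sin].
by apply: eq_Rint => x _; rewrite mulrA.
Qed.

Lemma fpow_ge0 f k : 0 <= fpow f k.
Proof. by rewrite addr_ge0// sqr_ge0. Qed.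
Lemma fcos_le f k : tf f -> `|fcos f k| <= \int[lambda]_x `|f x|.
move=> tff; rewrite -[leRHS]mul1r; apply: int_tfM_le => //; [exact: measurable_cos_dotv|..].
 by move=> x _; exact: cos_bounded.
by exists 1 => x; exact: cos_bounded.
Qed.

Lemma fsin_le f k : tf f -> `|fsin f k| <= \int[lambda]_x `|f x|.
move=> tff; rewrite -[leRHS]mul1r; apply: int_tfM_le => //; [exact: measurable_sin_dotv|..].
 by move=> x _; exact: sin_bounded.
by exists 1 => x; exact: sin_bounded.
Qed.

Lemma lipschitz_continuous (F : E -> R) (C : R) :
 (forall k k', `|F k - F k'| <= C * `|k - k'|) -> continuous F.
move=> FC k; have FF := nbhs_filter k; apply/cvgrPdist_le => e e0; have C0 : 0 < `|C| + 1 by rewrite ltr_wpDl.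
near=> k'; apply: le_trans (FC k k') _.
via ((`|C| + 1) * `|k - k'|).
 by rewrite ler_wpM2r// (le_trans (ler_norm _))// lerDl.
rewrite mulrC -ler_pdivlMr//.
near: k'; apply: cvgr_dist_le => //; by rewrite divr_gt0.
Unshelve. all: by end_near. Qed.

Lemma transform_continuous (c : R -> R) f : tf f -> (forall k : E, tf (fun x : E => f x * c (dotv k x))) ->
 (forall k : E, mfunT (fun x : E => c (dotv k x))) -> (forall a b, `|c a - c b| <= `|a - b|) ->
 (forall a, `|c a| <= 1) -> continuous (fun k : E => \int[lambda]_x (f x * c (dotv k x))).
move=> tff tfc mc lc bc; have [_ _ [t ft]] := tff.
apply: (@lipschitz_continuous _ (n%:R * `|t| * \int[lambda]_x `|f x|)) => k k'.
rewrite -int_tfB; [|exact: lf|exact: tfc..].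
under eq_Rint do rewrite -mulrBr.
rewrite mulrAC; apply: int_tfM_le => //.
- exact: mfunB.
- move=> x fx; apply: le_trans (lc _ _) _.
 rewrite -dotvNl -dotvDl (le_trans (dotv_le _ _))// -mulrA ler_wpM2l// mulrC ler_wpM2r//.
 have [tx|xt] := leP t `|x|; first by rewrite ft// eqxx in fx.
 by rewrite (le_trans (ltW xt))// ler_norm.
- exists 2 => x; apply: le_trans (ler_normB _ _) _.
 by have := bc (dotv k x); have := bc (dotv k' x); lra.
Qed.

Lemma fcos_continuous f : tf f -> continuous (fcos f).
move=> h; apply: transform_continuous => // [k|||]; [exact: tf_cos|exact: measurable_cos_dotv|exact: cos_lipschitz|exact: cos_bounded].
Qed.

Lemma fsin_continuous f : tf f -> continuous (fsin f).
move=> h; apply: transform_continuous => // [k|||]; [exact: tf_sin|exact: measurable_sin_dotv|exact: sin_lipschitz|exact: sin_bounded].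
Qed.

Lemma fpow_continuous f : tf f -> continuous (fpow f).
move=> tff k; have h1 := @fcos_continuous f tff k; have h2 := @fsin_continuous f tff k.
by rewrite /fpow; under eq_fun do rewrite !expr2; exact: (cvgD (cvgM h1 h1) (cvgM h2 h2)).
Qed.
End fourier_real.

(** * Transforms with phases sampled on the dyadic cells *)

Section dyadic_transform.
Context {R : realType} {n : nat}.
Notation E := 'rV[R]_n.
Notation lambda := (@lebesgue_rV R n).
Implicit Types (f : E -> R) (k x : E).
Let lf := @lebesgue_lf R n.

Lemma measurable_cell N : mfunT (@cell R n N).
apply: measurable_fun_rV => i; under eq_fun do rewrite mxE.
apply: mcomp; [exact: measurable_cell1|exact: measurable_coord].
Qed.

Lemma cell_grid N J (r : gindex N J) : cell N (grid r) = grid r :> E.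
Proof. by apply/rowP => i; rewrite mxE gridE cell1_grid. Qed.
Lemma cell_idem N x : cell N (cell N x) = cell N x.
Proof. by rewrite -{2}[N]addn0 cell_refine. Qed.
Lemma cell_dist N x : `|x - cell N x| <= mesh N.
apply: norm_le_coord => [|i]; first exact/ltW/mesh_gt0.
rewrite !mxE; have /andP[h1 h2] := cell1_itv N (x 0 i).
by rewrite ger0_norm ?subr_ge0// lerBlDl ltW.
Qed.

Lemma int_bx N (c : E) : \int[lambda]_x bx N c x = mesh N ^+ n.
rewrite /Rintegral (eq_integral (fun x => (\1_[set x : E | forall i, c 0 i <= x 0 i < c 0 i + mesh N] x)%:E)); last first.
 move=> x _; rewrite /bx indicE; congr ((nat_of_bool _)%:R%:E).
 by apply/forallP/idP; rewrite inE.
have h0 i : c 0 i <= c 0 i + mesh N by rewrite lerDl ltW// mesh_gt0.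
rewrite int_indic//; last first.
 rewrite (_ : [set x | _] = [set x : E | forall i, `[c 0 i, c 0 i + mesh N[%classic (x 0 i)]).
  by apply: (@measurable_rect R n (fun i => `[c 0 i, c 0 i + mesh N[%classic)).
 by apply/seteqP; split=> x /= h i; have := h i; rewrite in_itv.
rewrite setIT (@lebesgue_rV_box R n (fun i => c 0 i) (fun i => c 0 i + mesh N))//=.
rewrite (eq_bigr (fun=> mesh N)) ?prodr_const ?card_ord// => i _.
by rewrite addrAC subrr add0r.
Qed.

Lemma step_integral N J f : step N J f ->
 \int[lambda]_x f x = mesh N ^+ n * \sum_(r : gindex N J) f (grid r).
move=> sf; rewrite [in LHS](funext (step_sum sf)) (int_tf_sum lf); last first.
 by move=> r; apply: tfZ; exact: tf_bx.
rewrite mulr_sumr; apply: eq_bigr => r _; rewrite (int_tfZ lf); last exact: tf_bx.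
by rewrite int_bx mulrC.
Qed.
(** The phase is frozen on each cell. For step functions this is exactly the discrete transform of
    the periodogram, translation by a multiple of the mesh acts by an exact phase factor, and the
    distance to [fcos] is of order [|k| * mesh N]. *)
Definition dcos N f k : R := \int[lambda]_x (f x * cos (dotv k (cell N x))).
Definition dsin N f k : R := \int[lambda]_x (f x * sin (dotv k (cell N x))).
Definition dpow N f k := dcos N f k ^+ 2 + dsin N f k ^+ 2.

Lemma dpow_ge0 N f k : 0 <= dpow N f k.
Proof. by rewrite addr_ge0// sqr_ge0. Qed.
Let mcos k N : mfunT (fun x : E => cos (dotv k (cell N x))).
Proof. exact: (mcomp (measurable_cos_dotv k) (measurable_cell N)). Qed.
Let msin k N : mfunT (fun x : E => sin (dotv k (cell N x))).
Proof. exact: (mcomp (measurable_sin_dotv k) (measurable_cell N)). Qed.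
Lemma tf_dcos f k N : tf f -> tf (fun x => f x * cos (dotv k (cell N x))).
Proof. by apply: tfM => //; exists 1 => x; exact: cos_bounded. Qed.
Lemma tf_dsin f k N : tf f -> tf (fun x => f x * sin (dotv k (cell N x))).
Proof. by apply: tfM => //; exists 1 => x; exact: sin_bounded. Qed.
Lemma dpowE N J f k : step N J f -> dpow N f k = dft_power N J f k.
move=> [s1 s2]; rewrite /dpow /dft_power; congr (_ ^+ 2 + _ ^+ 2).
 rewrite /dcos (@step_integral N J); last first.
  by split=> x; [rewrite cell_idem -s1|move=> /s2 ->; rewrite mul0r].
 by rewrite /dft_cos; congr (_ * _); apply: eq_bigr => r _; rewrite cell_grid.
rewrite /dsin (@step_integral N J); last first.
 by split=> x; [rewrite cell_idem -s1|move=> /s2 ->; rewrite mul0r].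
by rewrite /dft_sin; congr (_ * _); apply: eq_bigr => r _; rewrite cell_grid.
Qed.

Lemma dcos_le N f k : tf f -> `|dcos N f k| <= \int[lambda]_x `|f x|.
move=> tff; rewrite -[leRHS]mul1r; apply: (int_tfM_le lf) => //.
 by move=> x _; exact: cos_bounded.
by exists 1 => x; exact: cos_bounded.
Qed.

Lemma dsin_le N f k : tf f -> `|dsin N f k| <= \int[lambda]_x `|f x|.
move=> tff; rewrite -[leRHS]mul1r; apply: (int_tfM_le lf) => //.
 by move=> x _; exact: sin_bounded.
by exists 1 => x; exact: sin_bounded.
Qed.

Lemma fcos_dcos N f k : tf f ->
 `|fcos f k - dcos N f k| <= n%:R * (`|k| * mesh N) * \int[lambda]_x `|f x|.
move=> tff; rewrite -(int_tfB lf); [|exact: tf_cos|exact: tf_dcos].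
under eq_Rint do rewrite -mulrBr.
apply: (int_tfM_le lf) => //.
- apply: mfunB => //; exact: measurable_cos_dotv.
- move=> x _; apply: le_trans (cos_lipschitz _ _) _.
 rewrite -dotvBr; apply: le_trans (dotv_le _ _) _.
 by rewrite ler_wpM2l// ler_wpM2l// cell_dist.
- exists 2 => x; apply: le_trans (ler_normB _ _) _.
 by have := cos_bounded (dotv k x); have := cos_bounded (dotv k (cell N x)); lra.
Qed.

Lemma fsin_dsin N f k : tf f ->
 `|fsin f k - dsin N f k| <= n%:R * (`|k| * mesh N) * \int[lambda]_x `|f x|.
move=> tff; rewrite -(int_tfB lf); [|exact: tf_sin|exact: tf_dsin].
under eq_Rint do rewrite -mulrBr.
apply: (int_tfM_le lf) => //.
- apply: mfunB => //; exact: measurable_sin_dotv.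
- move=> x _; apply: le_trans (sin_lipschitz _ _) _.
 rewrite -dotvBr; apply: le_trans (dotv_le _ _) _.
 by rewrite ler_wpM2l// ler_wpM2l// cell_dist.
- exists 2 => x; apply: le_trans (ler_normB _ _) _.
 by have := sin_bounded (dotv k x); have := sin_bounded (dotv k (cell N x)); lra.
Qed.

Lemma sqr_dist (a b S D : R) : `|a| <= S -> `|b| <= S -> `|a - b| <= D ->
 `|a ^+ 2 - b ^+ 2| <= 2 * S * D.
move=> aS bS abD; rewrite subr_sqr normrM mulrC ler_pM//.
by rewrite (le_trans (ler_normD _ _))//; lra.
Qed.

Lemma fpow_dpow N f k : tf f -> `|fpow f k - dpow N f k| <=
 4 * (\int[lambda]_x `|f x|) ^+ 2 * n%:R * (`|k| * mesh N).
move=> tff; rewrite (_ : _ - _ = (fcos f k ^+ 2 - dcos N f k ^+ 2) +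
  (fsin f k ^+ 2 - dsin N f k ^+ 2)); last by rewrite /fpow /dpow; ring.
apply: le_trans (ler_normD _ _) _.
have h1 := sqr_dist (fcos_le k tff) (dcos_le N k tff) (fcos_dcos N k tff).
have h2 := sqr_dist (fsin_le k tff) (dsin_le N k tff) (fsin_dsin N k tff).
apply: le_trans (lerD h1 h2) _.
by apply: eq_ler; ring.
Qed.
Definition eshift (i : 'I_n) (t : R) : E := \row_j (t * (j == i)%:R).

Lemma dotv_eshift k i t : dotv k (eshift i t) = k 0 i * t.
rewrite /dotv (bigD1 i)//= mxE eqxx mulr1 big1 ?addr0// => j ji.
by rewrite mxE (negbTE ji) !mulr0.
Qed.

Lemma cell_eshift N i (j : nat) x :
 cell N (x + eshift i (j%:R * mesh N)) = cell N x + eshift i (j%:R * mesh N).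
apply/rowP => l; rewrite !mxE; case: eqP => [_|_]; last by rewrite !mulr0 !addr0.
rewrite !mulr1 /cell1 mulrDr mulrCA meshK mulr1 floorDrz; last by rewrite rpred_nat.
by rewrite intrD mulrDl; congr (_ + _ * _); rewrite floorK// rpred_nat.
Qed.

Lemma dcos_shift N i (j : nat) f k : tf f ->
 let th := k 0 i * (j%:R * mesh N) in
 dcos N (fun x => f (x + eshift i (j%:R * mesh N))) k =
  cos th * dcos N f k + sin th * dsin N f k.
move=> tff th; set a := eshift i _.
have mG : mfunT (fun y => f y * cos (dotv k (cell N y) - th)).
 apply: mfunM; first by case: tff.
 apply: mcomp; first by apply: cont_mfun => x; exact: continuous_cos.
 by apply: mfunB => //; apply: mcomp; [exact: measurable_dotv|exact: measurable_cell].
rewrite /dcos; transitivity (\int[lambda]_x (f (x + a) * cos (dotv k (cell N (x + a)) - th))).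
 by apply: eq_Rint => x _; rewrite cell_eshift dotvDr dotv_eshift addrK.
rewrite (Rintegral_lebesgue_rV_translation a mG) -!(int_tfZ lf); [|exact: tf_dsin|exact: tf_dcos].
rewrite -(int_tfD lf); [|by apply: tfZ; exact: tf_dcos|by apply: tfZ; exact: tf_dsin].
by apply: eq_Rint => x _; rewrite cosB; ring.
Qed.

Lemma dsin_shift N i (j : nat) f k : tf f ->
 let th := k 0 i * (j%:R * mesh N) in
 dsin N (fun x => f (x + eshift i (j%:R * mesh N))) k =
  cos th * dsin N f k - sin th * dcos N f k.
move=> tff th; set a := eshift i _.
have mG : mfunT (fun y => f y * sin (dotv k (cell N y) - th)).
 apply: mfunM; first by case: tff.
 apply: mcomp; first by apply: cont_mfun => x; exact: continuous_sin.
 by apply: mfunB => //; apply: mcomp; [exact: measurable_dotv|exact: measurable_cell].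
rewrite /dsin; transitivity (\int[lambda]_x (f (x + a) * sin (dotv k (cell N (x + a)) - th))).
 by apply: eq_Rint => x _; rewrite cell_eshift dotvDr dotv_eshift addrK.
rewrite (Rintegral_lebesgue_rV_translation a mG) -!(int_tfZ lf); [|exact: tf_dcos|exact: tf_dsin].
rewrite -(int_tfB lf); [|by apply: tfZ; exact: tf_dsin|by apply: tfZ; exact: tf_dcos].
by apply: eq_Rint => x _; rewrite sinB; ring.
Qed.

Section smoothing.
Variables (i : 'I_n) (m q : nat).
Notation h := (mesh (m + q) : R).
(** The average of [f] over [2^q] forward shifts along axis [i], all shorter than [mesh m], is
    subtracted. Low frequencies are damped and high ones kept, so the energy of the result measures
    the high-frequency part of [f]. *)
Definition smooth_diff f x : R :=
 f x - (2 ^+ q)^-1 * \sum_(j < 2 ^ q) f (x + eshift i (j%:R * h)).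

Lemma tf_smooth_avg f : tf f -> tf (fun x => \sum_(j < 2 ^ q) f (x + eshift i (j%:R * h))).
Proof. by move=> tff; apply: tf_sum => j; exact: tf_shift. Qed.
Lemma smooth_shift_le (j : 'I_(2 ^ q)) : j%:R * h < mesh m.
rewrite /mesh exprD invfM mulrCA gtr_pMr ?invr_gt0 ?exprn_gt0//.
by rewrite ltr_pdivrMr ?exprn_gt0// mul1r -natrX ltr_nat.
Qed.

Lemma step_smooth_diff N0 J f : (N0 <= m)%N -> step N0 J f -> step (m + q) J.+1 (smooth_diff f).
move=> Nm sf; have [s1 s2] : step (m + q) J f.
 by rewrite -(subnKC (leq_trans Nm (leq_addr q m))); exact: step_refine.
split=> x.
 rewrite /smooth_diff -s1; congr (_ - _ * _); apply: eq_bigr => j _.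
 by rewrite s1 [RHS]s1 cell_eshift cell_eshift cell_idem.
move=> xJ; rewrite /smooth_diff s2; last by apply: contra xJ; exact: in_box_le.
rewrite big1 ?mulr0 ?subr0// => j _; apply: s2; apply: contra xJ => /forallP xJ.
apply/forallP => l; have := xJ l; rewrite !mxE => /andP[h1 h2].
have j0 : 0 <= j%:R * h by rewrite mulr_ge0// ltW// mesh_gt0.
have j1 : j%:R * h < 1.
 apply: lt_le_trans (smooth_shift_le j) _.
 by rewrite invf_le1 ?exprn_gt0// exprn_ege1// ler1n.
move: h1 h2; rewrite -natr1; case: (l == i); rewrite ?mulr1 ?mulr0 => *; apply/andP; split; lra.
Qed.

Lemma smooth_diff_bounded f C x : (forall x, `|f x| <= C) -> `|smooth_diff f x| <= 2 * C.
move=> fC; apply: le_trans (ler_normB _ _) _.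
suff : `|(2 ^+ q)^-1 * \sum_(j < 2 ^ q) f (x + eshift i (j%:R * h))| <= C.
 by have := fC x; lra.
rewrite normrM ger0_norm ?invr_ge0 ?exprn_ge0// ler_pdivrMl ?exprn_gt0//.
apply: le_trans (ler_norm_sum _ _ _) _.
via (\sum_(j < 2 ^ q) C); first by apply: ler_sum => j _.
by rewrite sumr_const card_ord -[leLHS]mulr_natl natrX.
Qed.

(** The average multiplies the transform by a Dirichlet kernel, whose real part [a] is at most [1/2]
    once [|k_i|] exceeds [32 * 2^m]; so the modulus of the transform is at most halved by the
    subtraction. The upper bound on [|k_i|] keeps the angle within [[-pi, pi]]. *)
Lemma dpow_smooth_diff f k : tf f -> 32 * 2 ^+ m <= `|k 0 i| -> `|k 0 i| * h <= pi ->
 dpow (m + q) f k <= 4 * dpow (m + q) (smooth_diff f) k.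
move=> tff kT kpi.
pose th := k 0 i * h.
pose a := (2 ^+ q)^-1 * \sum_(j < 2 ^ q) cos (j%:R * th).
pose b := (2 ^+ q)^-1 * \sum_(j < 2 ^ q) sin (j%:R * th).
have tsum := tf_smooth_avg tff.
have thE (j : nat) : k 0 i * (j%:R * h) = j%:R * th by rewrite mulrCA.
have cE : dcos (m + q) (smooth_diff f) k = dcos (m + q) f k - (a * dcos (m + q) f k + b * dsin (m + q) f k).
 rewrite /dcos /smooth_diff; under eq_Rint do rewrite mulrBl.
 rewrite (int_tfB lf); [|exact: tf_dcos|by apply: tf_dcos; exact: tfZ]; congr (_ - _).
 under eq_Rint do rewrite -mulrA mulr_suml.
 rewrite (int_tfZ lf); last by apply: tf_sum => j; apply: tf_dcos; exact: tf_shift.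
 rewrite (int_tf_sum lf); last by move=> j; apply: tf_dcos; exact: tf_shift.
 rewrite -mulrA -[X in _ = _ + X]mulrA -mulrDr !mulr_suml -big_split/=; congr (_ * _).
 by apply: eq_bigr => j _; rewrite -/(dcos _ _ _) dcos_shift// thE.
have sE : dsin (m + q) (smooth_diff f) k = dsin (m + q) f k - (a * dsin (m + q) f k - b * dcos (m + q) f k).
 rewrite /dsin /smooth_diff; under eq_Rint do rewrite mulrBl.
 rewrite (int_tfB lf); [|exact: tf_dsin|by apply: tf_dsin; exact: tfZ]; congr (_ - _).
 under eq_Rint do rewrite -mulrA mulr_suml.
 rewrite (int_tfZ lf); last by apply: tf_sum => j; apply: tf_dsin; exact: tf_shift.
 rewrite (int_tf_sum lf); last by move=> j; apply: tf_dsin; exact: tf_shift.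
 rewrite -mulrA -[X in _ = _ - X]mulrA -mulrBr !mulr_suml -sumrB; congr (_ * _).
 by apply: eq_bigr => j _; have := @dsin_shift (m + q) i j f k tff; rewrite /= thE; exact.
have ah : a <= 2^-1.
 rewrite /a ler_pdivrMl ?exprn_gt0// -natrX; apply: sum_cos_le.
  rewrite normrM (ger0_norm (x := h)) ?(ltW (mesh_gt0 _))//.
  rewrite natrX mulrCA (_ : 2 ^+ q * h = mesh m); last first.
   by rewrite /mesh exprD invfM mulrCA divff ?mulr1// expf_neq0.
  by rewrite ler_pdivlMr// exprn_gt0.
 by rewrite normrM (ger0_norm (x := h)) ?(ltW (mesh_gt0 _)).
rewrite /dpow cE sE; set x := dcos _ _ _; set y := dsin _ _ _.
have -> : (x - (a * x + b * y)) ^+ 2 + (y - (a * y - b * x)) ^+ 2 = ((1 - a) ^+ 2 + b ^+ 2) * (x ^+ 2 + y ^+ 2) by ring.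
rewrite mulrA ler_peMl ?addr_ge0 ?sqr_ge0//.
have : 2^-1 ^+ 2 <= (1 - a) ^+ 2 by rewrite lerXn2r ?nnegrE//; lra.
have := sqr_ge0 b; lra.
Qed.
End smoothing.

(* A step function is right-continuous in each coordinate. *)
Lemma smooth_diff_eq0 i N0 J f x : step N0 J f ->
 exists m0, forall m q, (m0 <= m)%N -> smooth_diff i m q f x = 0.
move=> [s1 s2]; have /andP[h1 h2] := cell1_itv N0 (x 0 i).
pose gap := cell1 N0 (x 0 i) + mesh N0 - x 0 i.
have gap0 : 0 < gap by rewrite subr_gt0.
pose m0 := (Num.truncn gap^-1).+1.
have m0gap m : (m0 <= m)%N -> mesh m < gap.
 move=> mm; rewrite -[ltRHS]invrK ltf_pV2 ?posrE ?exprn_gt0 ?invr_gt0//.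
 apply: (lt_le_trans (truncnS_gt _)); rewrite -natrX ler_nat.
 exact: leq_trans mm (ltnW (ltn_expl _ _)).
exists m0 => m q mm.
rewrite /smooth_diff (eq_bigr (fun=> f x)) => [|j _].
 by rewrite sumr_const card_ord -[X in _ * X]mulr_natl natrX mulKf ?expf_neq0// subrr.
rewrite s1 [RHS]s1; congr f; apply/rowP => l; rewrite !mxE.
case: eqP => [->|]; last by rewrite mulr0 addr0.
rewrite mulr1; have j0 : 0 <= j%:R * mesh (m + q) :> R by rewrite mulr_ge0// ltW// mesh_gt0.
have := @smooth_shift_le m q j; have := m0gap m mm; rewrite /gap => g1 g2.
rewrite {1 2}/cell1 in h1 h2; rewrite [RHS]/cell1; apply: cell1_eq.
by rewrite mulrDl mul1r; move: h1 h2 g1; rewrite /cell1 => *; apply/andP; split; lra.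
Qed.
End dyadic_transform.

(** A bounded sequence has a cluster point by compactness, and an ultrafilter converges to its
    cluster points. *)
Lemma bounded_ultra_cvg (R : realType) (U : set_system nat) (a : nat -> R) (C : R) :
 UltraFilter U -> (\forall k \near U, `|a k| <= C) -> cvg (a @ U).
move=> UU aC.
have [p [_ ap]] : `[- C, C]%classic `&` cluster (a @ U) !=set0.
 apply: segment_compact; apply: filterS aC => k /= ak.
 by rewrite in_itv/= -ler_norml.
apply/cvg_ex; exists p => V pV.
have [//|aVC] := in_ultra_setVsetC (a @^-1` V) UU.
by have [x [/= nVx Vx]] := ap (~` V) V aVC pV.
Qed.

(** * A spectral measure for step functions as a limit of periodograms *)

Section approximation.
Context {R : realType} {n : nat}.
Notation E := 'rV[R]_n.
Notation lambda := (@lebesgue_rV R n).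
Variable B : (E -> R) -> (E -> R) -> R.
Hypothesis HB : covariance_form B.
Implicit Types (f g : E -> R).
Let lf := @lebesgue_lf R n.
Let c0 : R := (2 * pi) ^+ n.
Let c0_gt0 : 0 < c0. Proof. by rewrite exprn_gt0// mulr_gt0// pi_gt0. Qed.
(** [G] depends on [N] because the discretised transforms live on the same level as the
    frequencies. *)
Definition freq_sum (G : forall N, {ffun 'I_n -> 'I_(4 * 4 ^ N)} -> R) N : R :=
 \sum_l weight B l * G N l.

Lemma mesh_cvg0 : (mesh : nat -> R) @ \oo --> 0.
rewrite (_ : mesh = GRing.exp (2^-1 : R)); last by apply/funext => k; rewrite /mesh exprVn.
by apply: cvg_expr; rewrite ger0_norm ?invf_lt1 ?ltr1n// invr_ge0.
Qed.

Lemma mesh_small (e : R) : 0 < e -> \forall N \near \oo, mesh N <= e.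
move=> e0; have /cvgrPdist_le /(_ e e0) := mesh_cvg0; apply: filterS => N.
by rewrite sub0r normrN ger0_norm// ltW// mesh_gt0.
Qed.

(** With [gsize N J] cells against a window of [4^N], the ratio [K / P] equals [2 * J / 2^N]: the
    error of the periodogram is of the order of the mesh. *)
Lemma freq_sum_dpow J : exists V, forall N f C, (2 * J <= 2 ^ N)%N -> step N J f ->
 (forall x, `|f x| <= C) ->
 `|freq_sum (fun N l => dpow N f (freq l : E)) N - c0 * B f f| <= C ^+ 2 * V * mesh N.
have [V BV] := form_var HB J.
exists (c0 * (4 * n%:R * J%:R * V)) => N f C JN sf fC.
have KP : (gsize N J <= 4 ^ N)%N by rewrite /gsize (_ : 4 = 2 * 2)%N// expnMn leq_mul2r JN orbT.
have := weight_dft_approx HB KP sf fC (BV N).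
rewrite (eq_bigr (fun l => weight B l * dpow N f (freq l))) => [|l _]; last by rewrite (dpowE _ sf).
move=> /le_trans; apply; rewrite -/c0; apply: eq_ler.
rewrite /gsize /mesh natrM natrM !natrX (_ : 4 = 2 * 2 :> R)// ?exprMn; last by rewrite -natrM.
by field; rewrite expf_neq0.
Qed.

(* The indicator of a small cell has a transform bounded away from 0 on cubes. *)
Lemma freq_mass (t : R) : 0 <= t -> exists C, \forall N \near \oo,
 freq_sum (fun N l => (`|freq l : E| <= t)%R%:R) N <= C.
move=> t0; have [N1 HN1] : exists N1, n%:R * (t * mesh N1) <= 2^-1.
 have e0 : 0 < 2^-1 / (n%:R * t + 1) by rewrite divr_gt0// ltr_wpDl// mulr_ge0.
 have [N1 _ h] := mesh_small e0; exists N1; have := h N1 (leqnn _).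
 rewrite /= ler_pdivlMr ?ltr_wpDl ?mulr_ge0// => h1.
 rewrite mulrA (le_trans _ h1)// mulrC ler_wpM2l ?lerDl//.
 exact/ltW/mesh_gt0.
pose f (x : E) : R := (cell N1 x == 0)%:R.
have sf : step N1 1 f.
 split=> x; first by rewrite /f cell_idem.
 rewrite /f; case: eqP => // x0; rewrite -(in_box_cell N1) x0 => /negP[].
 by apply/forallP => i; rewrite mxE oppr_le0 ler01 ltr01.
have f1 x : `|f x| <= 1 by rewrite /f; case: eqP => _; rewrite ?normr1 ?normr0.
have f0 x : 0 <= f x by rewrite /f.
have tff := tf_step sf.
have intf : \int[lambda]_x f x = mesh N1 ^+ n.
 rewrite -(int_bx N1 (0 : E)); apply: eq_Rint => x _; rewrite /f /bx.
 congr (nat_of_bool _)%:R; apply/eqP/forallP => [x0 i|h].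
  have /rowP/(_ i) := x0; rewrite !mxE add0r => x0i.
  by have := cell1_itv N1 (x 0 i); rewrite x0i add0r.
 apply/rowP => i; rewrite !mxE; have := h i; rewrite mxE add0r => hi.
 have := @cell1_eq R N1 0 (x 0 i); rewrite mul0r add0r mul1r; exact.
have [V HV] := freq_sum_dpow 1.
pose d := (mesh N1 ^+ n / 2) ^+ 2 : R.
have d0 : 0 < d by rewrite exprn_gt0// divr_gt0// exprn_gt0// mesh_gt0.
exists ((c0 * B f f + `|V|) / d); exists (maxn 1 N1) => // N /=; rewrite geq_max => /andP[N0 N1N].
rewrite ler_pdivlMr// mulrC mulr_sumr.
have sfN : step N 1 f by rewrite -(subnKC N1N); exact: step_refine.
have := HV N f 1 _ sfN f1; rewrite muln1 -{1}[2%N]expn1 leq_exp2l// => /(_ N0) h.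
via (freq_sum (fun N l => dpow N f (freq l : E)) N).
 apply: ler_sum => l _; rewrite mulrCA ler_wpM2l ?weight_ge0//.
 case: (leP `|freq l : E| t) => [kt|_]; last by rewrite mulr0 dpow_ge0.
 rewrite mulr1 /dpow -[X in X <= _]addr0 lerD ?sqr_ge0//.
 have m0 : 0 <= mesh N1 ^+ n / 2 :> R by rewrite divr_ge0// exprn_ge0// ltW// mesh_gt0.
 have m1 : mesh N1 ^+ n / 2 <= dcos N f (freq l).
  rewrite -intf mulrC -(int_tfZ lf)//; apply: (le_int_tf lf) => [||x]; [exact: tfZ|exact: tf_dcos|].
  rewrite /f; case: eqP => [x0|_]; last by rewrite mulr0 mul0r.
  rewrite mulr1 mul1r; apply: cos_ge_half; apply: le_trans (dotv_le _ _) _.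
  apply: le_trans HN1; rewrite ler_wpM2l// ler_pM//.
  have := cell_dist N1 (cell N x); rewrite -{2}(subnKC N1N) cell_refine x0 subr0.
  exact.
 by rewrite lerXn2r ?nnegrE ?m0 ?(le_trans m0 m1).
have := le_trans (ler_norm _) h; rewrite expr1n mul1r lerBlDl => /le_trans; apply.
rewrite lerD2l; via (`|V| * mesh N).
 by rewrite ler_wpM2r ?ler_norm// ltW// mesh_gt0.
by rewrite ler_piMr// invf_le1 ?exprn_gt0// exprn_ege1// ler1n.
Qed.

Section limit.
Variable U : set_system nat.
Hypothesis UU : UltraFilter U.
Hypothesis UN : \oo `<=` U.
(** Along an ultrafilter every bounded sequence has a limit, so no subsequence is extracted and
    linearity in [g] is immediate. *)
Definition spectral_functional g : R := lim (freq_sum (fun N l => g (freq l)) @ U).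
Let near_mono (P : nat -> Prop) : (\forall N \near \oo, P N) -> \forall N \near U, P N.
Proof. exact: UN. Qed.
Lemma freq_sum_bounded g : Cc g -> exists C, \forall N \near \oo,
 `|freq_sum (fun N l => g (freq l)) N| <= C.
move=> Cg; have Cg' : Cc (fun x : E => `|g x|).
 case: Cg => cg [t gt]; split; last by exists t => x /gt ->; rewrite normr0.
 by move=> x; apply: continuous_comp; [exact: cg|exact: norm_continuous].
have [M M0 gM] := Cc_bounded Cg'; have [_ [t gt]] := Cg.
have [C HC] := freq_mass (normr_ge0 t); exists (M * C); apply: filterS HC => N HC.
apply: le_trans (ler_norm_sum _ _ _) _.
via (M * freq_sum (fun N l => (`|freq l : E| <= `|t|)%R%:R) N); last first.
 by rewrite ler_wpM2l// ltW.
rewrite mulr_sumr; apply: ler_sum => l _.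
rewrite normrM ger0_norm ?weight_ge0// mulrCA ler_wpM2l ?weight_ge0//.
case: (leP `|freq l : E| `|t|) => [_|tl]; first by rewrite mulr1.
by rewrite gt ?normr0 ?mulr0// (le_trans (ler_norm t))// ltW.
Qed.

Lemma spectral_functional_cvg g : Cc g ->
 freq_sum (fun N l => g (freq l)) @ U --> spectral_functional g.
by move=> /freq_sum_bounded[C gC]; apply: (@bounded_ultra_cvg _ _ _ C UU); exact: near_mono.
Qed.
Let spectral_functionalD f g : Cc f -> Cc g ->
 spectral_functional (fun x => f x + g x) = spectral_functional f + spectral_functional g.
move=> Cf Cg; apply/cvg_lim => //.
rewrite (_ : freq_sum _ = fun N => freq_sum (fun N l => f (freq l)) N + freq_sum (fun N l => g (freq l)) N).
 exact: cvgD (spectral_functional_cvg Cf) (spectral_functional_cvg Cg).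
by apply/funext => N; rewrite /freq_sum -big_split/=; apply: eq_bigr => l _; rewrite mulrDr.
Qed.
Let spectral_functionalZ a f : Cc f ->
 spectral_functional (fun x => a * f x) = a * spectral_functional f.
move=> Cf; apply/cvg_lim => //.
rewrite (_ : freq_sum _ = fun N => a * freq_sum (fun N l => f (freq l)) N).
 exact: cvgMr (spectral_functional_cvg Cf).
by apply/funext => N; rewrite /freq_sum mulr_sumr; apply: eq_bigr => l _; rewrite mulrCA.
Qed.
Let spectral_functional_ge0 f : Cc f -> (forall x, 0 <= f x) -> 0 <= spectral_functional f.
move=> Cf f0; apply: (cvgr_to_ge (F := U) (spectral_functional_cvg Cf)).
by apply: nearW => N; apply: sumr_ge0 => l _; rewrite mulr_ge0// weight_ge0.
Qed.

(** One [m] must serve all [q] at once. If none did, a bad [q] for each [m] would give differences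
    tending to 0 pointwise and boundedly on a common cube but not for the form, against
    [form_cvg0]. *)
Lemma form_smooth_diff_small i N0 J f (e : R) : step N0 J f -> 0 < e ->
 exists2 m, (N0 <= m)%N & forall q, B (smooth_diff i m q f) (smooth_diff i m q f) <= e.
move=> sf e0; have [C fC] : exists C, forall x, `|f x| <= C by case: (tf_step sf).
apply: contrapT => H.
have /choice[q_ hq] (k : nat) : exists q, e < B (smooth_diff i (N0 + k) q f) (smooth_diff i (N0 + k) q f).
 apply: contrapT => Hk; apply: H; exists (N0 + k)%N; first exact: leq_addr.
 by move=> q; rewrite leNgt; apply/negP => Hq; apply: Hk; exists q.
pose u k := smooth_diff i (N0 + k) (q_ k) f.
have su k : step (N0 + k + q_ k) J.+1 (u k) by apply: step_smooth_diff sf; exact: leq_addr.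
have := @form_cvg0 _ _ _ HB u (2 * C) (J.+1%:R + 1).
have H1 k : mfunT (u k) by case: (tf_step (su k)).
have H2 k x : `|u k x| <= 2 * C by exact: smooth_diff_bounded.
have H3 k : off_cube (J.+1%:R + 1) (u k).
 move=> x tx; apply: (su k).2; apply/negP => /in_box_norm xJ.
 by have := le_trans tx xJ; lra.
have H4 x : u ^~ x @ \oo --> 0.
 have [m0 hm] := smooth_diff_eq0 i x sf.
 apply: cvg_near_cst; exists m0 => // k /= mk; apply: hm.
 exact: leq_trans mk (leq_addl _ _).
move=> /(_ H1 H2 H3 H4) /cvgrPdist_lt /(_ e e0)[k _ /(_ k (leqnn _))].
by rewrite /= sub0r normrN => /(le_lt_trans (ler_norm _)) h; have := lt_trans (hq k) h; rewrite ltxx.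
Qed.

Lemma freq_le N (l : {ffun 'I_n -> 'I_(4 * 4 ^ N)}) i : `|freq l 0 i| * mesh N <= pi :> R.
have P0 : 0 < (4 ^ N)%:R :> R by rewrite ltr0n expn_gt0.
have h0 := mesh_gt0 N : 0 < mesh N :> R.
rewrite mxE 2!normrM normfV (ger0_norm (ltW h0)) mulfVK ?gt_eqF//.
have lP : (l i < 4 * 4 ^ N)%N by exact: ltn_ord.
have : `|(l i)%:R - (2 * 4 ^ N)%:R| <= (2 * 4 ^ N)%:R :> R.
 rewrite ler_norml lerBrDl subrr ler0n/= lerBlDr -natrD ler_nat.
 by rewrite (leq_trans (ltnW lP))// -mulnDl.
have p0 := pi_gt0 R.
rewrite (ger0_norm (x := 2 * pi / _)); last by rewrite divr_ge0// mulr_ge0// ltW.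
move=> /(ler_wpM2r (x := 2 * pi / (4 * 4 ^ N)%:R)) => /(_ _)/le_trans; apply.
 by rewrite divr_ge0// mulr_ge0// ltW.
by rewrite !natrM; apply: eq_ler; field; rewrite gt_eqF.
Qed.

(** Tightness: beyond the threshold the energy of [f] is at most four times that of its smoothed
    difference, and the total energy of the latter is close to [c0] times its value under the form,
    hence small. *)
Lemma freq_tail_coord i N0 J f (e : R) : step N0 J f -> 0 < e ->
 exists T : R, \forall N \near \oo,
  freq_sum (fun N l => dpow N f (freq l) * (T <= `|(freq l : E) 0 i|)%R%:R) N <= e.
move=> sf e0; have tff := tf_step sf.
have [C fC] : exists C, forall x, `|f x| <= C by case: tff.
have [V HV] := freq_sum_dpow J.+1.
have e8 : 0 < e / (8 * c0) by rewrite divr_gt0// mulr_gt0.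
have [m N0m hm] := form_smooth_diff_small i sf e8.
exists (32 * 2 ^+ m).
pose W := `|(2 * C) ^+ 2 * V| + 1.
have W0 : 0 < W by rewrite ltr_wpDl.
have eW : 0 < e / (8 * W) by rewrite divr_gt0// mulr_gt0.
have [M1 _ hM1] := mesh_small eW.
exists (maxn (maxn m (2 * J.+1)) M1); first by [].
move=> N /=; rewrite !geq_max -andbA => /and3P[mN JN N1N].
have hN : mesh N <= e / (8 * W).
 exact: hM1.
rewrite -(subnKC mN); set q := (N - m)%N.
have := HV (m + q)%N (smooth_diff i m q f) (2 * C) _ (step_smooth_diff i _ N0m sf) (fun x => smooth_diff_bounded _ _ _ _ fC).
rewrite /q subnKC// => h.
via (4 * freq_sum (fun K l => dpow K (smooth_diff i m (N - m) f) (freq l : E)) N).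
 rewrite mulr_sumr; apply: ler_sum => l _; rewrite [leRHS]mulrCA ler_wpM2l ?weight_ge0//.
 case: (leP (32 * 2 ^+ m) `|(freq l : E) 0 i|) => [kT|_]; last by rewrite mulr0 mulr_ge0// dpow_ge0.
 rewrite mulr1; have := @dpow_smooth_diff R n i m (N - m) f (freq l) tff kT.
 by rewrite subnKC//; apply; exact: freq_le.
rewrite -ler_pdivlMl//.
have hh := ler_norm (freq_sum (fun K l => dpow K (smooth_diff i m (N - m) f) (freq l : E)) N - c0 * B (smooth_diff i m (N - m) f) (smooth_diff i m (N - m) f)).
have {}h := le_trans hh (h (leq_trans JN (ltnW (ltn_expl _ (ltnSn 1))))).
have h2 : c0 * B (smooth_diff i m (N - m) f) (smooth_diff i m (N - m) f) <= e / 8.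
 have := hm (N - m)%N; rewrite invfM mulrA ler_pdivlMr// mulrC; exact.
have h3 : (2 * C) ^+ 2 * V * mesh N <= e / 8.
 via (W * mesh N).
  rewrite ler_wpM2r ?(ltW (mesh_gt0 _))// (le_trans (ler_norm _))// lerDl//.
 by move: hN; rewrite invfM mulrA ler_pdivlMr// mulrC.
lra.
Qed.

Lemma freq_tail N0 J f (e : R) : step N0 J f -> 0 < e ->
 exists T : R, 0 <= T /\ \forall N \near \oo,
  freq_sum (fun N l => dpow N f (freq l) * (T < `|freq l : E|)%R%:R) N <= e.
move=> sf e0.
have e1 : 0 < e / (n%:R + 1) by rewrite divr_gt0// ltr_wpDl.
have /choice[T_ hT] (i : 'I_n) := freq_tail_coord i sf e1.
pose T := \sum_i `|T_ i|; have T0 : 0 <= T by apply: sumr_ge0.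
exists T; split => //.
have /choice[M_ hM] (i : 'I_n) : exists M : nat, forall N, (M <= N)%N ->
  freq_sum (fun N l => dpow N f (freq l) * (T_ i <= `|(freq l : E) 0 i|)%R%:R) N <= e / (n%:R + 1).
 by have [M _ h] := hT i; exists M.
exists (\max_i M_ i) => // N /= MN.
via (\sum_(i < n) freq_sum (fun N l => dpow N f (freq l) * (T_ i <= `|(freq l : E) 0 i|)%R%:R) N).
 rewrite exchange_big/=; apply: ler_sum => l _; rewrite -!mulr_sumr ler_wpM2l ?weight_ge0// ler_wpM2l ?dpow_ge0//.
 case: (ltP T `|freq l : E|) => [Tl|_]; last by apply: sumr_ge0.
 have /existsP[i hi] : [exists i, T_ i <= `|(freq l : E) 0 i|].
  apply: contraTT Tl; rewrite negb_exists => /forallP h; rewrite -leNgt.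
  apply: norm_le_coord => // i; have := h i; rewrite -ltNge => /ltW/le_trans; apply.
  rewrite (le_trans (ler_norm _))// /T (bigD1 i)//= lerDl; exact: sumr_ge0.
 by rewrite (bigD1 i)//= hi lerDl; apply: sumr_ge0.
via (\sum_(i < n) e / (n%:R + 1)).
 apply: ler_sum => i _; apply: hM; apply: leq_trans MN.
 exact: (leq_bigmax i).
rewrite sumr_const card_ord -[leLHS]mulr_natl mulrA ler_pdivrMr ?ltr_wpDl//.
by rewrite mulrC ler_wpM2l ?lerDl// ltW.
Qed.

Lemma spectral_functional_cutoff N0 J f (e : R) : step N0 J f -> 0 < e ->
 exists T : R, forall t, T <= t ->
  `|spectral_functional (fun k => fpow f k * cutoff t k) - c0 * B f f| <= e.
move=> sf e0; have tff := tf_step sf.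
have [C fC] : exists C, forall x, `|f x| <= C by case: tff.
have e4 : 0 < e / 4 by rewrite divr_gt0.
have [T [T0 hT]] := freq_tail sf e4.
exists T => t Tt; have t0 := le_trans T0 Tt.
have Cg : Cc (fun k => fpow f k * cutoff t k) by apply: CcMl; [exact: fpow_continuous|exact: Cc_cutoff].
have [V HV] := freq_sum_dpow J.
have [M HM] := freq_mass (addr_ge0 t0 ler01).
pose S := 4 * (\int[lambda]_x `|f x|) ^+ 2 * n%:R * (t + 1).
have S0 : 0 <= S by apply: mulr_ge0; [apply: mulr_ge0; [apply: mulr_ge0; [|exact: sqr_ge0]|]|exact: addr_ge0].
pose W1 := `|C ^+ 2 * V| + 1; pose W2 := S * `|M| + 1.
have W10 : 0 < W1 by rewrite ltr_wpDl.
have W20 : 0 < W2 by rewrite ltr_wpDl// mulr_ge0.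
have m1 : \forall N \near \oo, mesh N <= e / (4 * W1) by apply: mesh_small; rewrite divr_gt0// mulr_gt0.
have m2 : \forall N \near \oo, mesh N <= e / (4 * W2) by apply: mesh_small; rewrite divr_gt0// mulr_gt0.
have := spectral_functional_cvg Cg; move=> /cvgrPdist_le /(_ _ e4) cvgU.
have big : \forall N \near \oo, (N0 <= N)%N /\ (2 * J <= 2 ^ N)%N.
 exists (maxn N0 (2 * J)) => // N /=; rewrite geq_max => /andP[h1 h2]; split => //.
 exact: leq_trans h2 (ltnW (ltn_expl _ (ltnSn 1))).
have fI P Q : nbhs \oo P -> nbhs \oo Q -> nbhs \oo (P `&` Q) by exact: filterI.
have nU := @UN _ (fI _ _ (fI _ _ m1 m2) (fI _ _ (fI _ _ hT HM) big)).
have [N] := @filter_ex nat U _ _ (@filterI nat U _ _ _ cvgU nU).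
move=> [/= h1 [[h2 h3] [[h4 h5] [N0N JN]]]].
have sfN : step N J f by rewrite -(subnKC N0N); exact: step_refine.
have h6 := HV N f C JN sfN fC.
have h7 : C ^+ 2 * V * mesh N <= e / 4.
 via (W1 * mesh N).
  rewrite ler_wpM2r ?(ltW (mesh_gt0 _))// (le_trans (ler_norm _))// lerDl//.
 by move: h2; rewrite invfM mulrA ler_pdivlMr// mulrC.
have h8 : S * `|M| * mesh N <= e / 4.
 via (W2 * mesh N).
  by rewrite ler_wpM2r ?(ltW (mesh_gt0 _))// lerDl.
 by move: h3; rewrite invfM mulrA ler_pdivlMr// mulrC.
have h9 : `|freq_sum (fun N l => fpow f (freq l) * cutoff t (freq l)) N -
   freq_sum (fun N l => dpow N f (freq l : E)) N| <= S * `|M| * mesh N + e / 4.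
 rewrite /freq_sum -sumrB; apply: le_trans (ler_norm_sum _ _ _) _.
 via (S * mesh N * freq_sum (fun N l => (`|freq l : E| <= t + 1)%R%:R) N +
   freq_sum (fun N l => dpow N f (freq l) * (T < `|freq l : E|)%R%:R) N); last first.
  rewrite lerD// mulrAC ler_wpM2r ?(ltW (mesh_gt0 _))// ler_wpM2l//.
  exact: le_trans h5 (ler_norm _).
 rewrite mulr_sumr -big_split/=; apply: ler_sum => l _.
 rewrite [S * mesh N * _]mulrCA -mulrDr -mulrBr normrM (ger0_norm (weight_ge0 HB l)) ler_wpM2l ?weight_ge0//.
 rewrite (_ : _ - _ = (fpow f (freq l) - dpow N f (freq l)) * cutoff t (freq l) -
   dpow N f (freq l) * (1 - cutoff t (freq l))); last by ring.
 apply: le_trans (ler_normB _ _) _; apply: lerD.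
  rewrite normrM (ger0_norm (cutoff_ge0 _ _)).
  case: (leP `|(freq l : E)| (t + 1)) => [lt1|tl]; last by rewrite (cutoff0 (ltW tl)) !mulr0.
  rewrite mulr1 (le_trans (ler_piMr _ (cutoff_le1 _ _)))//.
  apply: le_trans (fpow_dpow _ _ tff) _; rewrite /S -[leRHS]mulrA.
  apply: ler_wpM2l; first by apply: mulr_ge0 => //; apply: mulr_ge0 => //; exact: sqr_ge0.
  by apply: ler_wpM2r => //; exact/ltW/mesh_gt0.
 have [lt1|tl] := leP `|(freq l : E)| t.
  by rewrite cutoff1// subrr mulr0 normr0 mulr_ge0// dpow_ge0.
 rewrite (le_lt_trans Tt tl) mulr1 normrM (ger0_norm (dpow_ge0 _ _ _)) ler_piMr ?dpow_ge0//.
 rewrite ger0_norm ?subr_ge0 ?cutoff_le1//.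
 by rewrite gerBl cutoff_ge0.
have := ler_normD (spectral_functional (fun k => fpow f k * cutoff t k) - freq_sum (fun N l => fpow f (freq l) * cutoff t (freq l)) N)
 (freq_sum (fun N l => fpow f (freq l) * cutoff t (freq l)) N - c0 * B f f).
rewrite subrKA => /le_trans; apply.
have := ler_normD (freq_sum (fun N l => fpow f (freq l) * cutoff t (freq l)) N - freq_sum (fun N l => dpow N f (freq l : E)) N)
 (freq_sum (fun N l => dpow N f (freq l : E)) N - c0 * B f f).
rewrite subrKA; lra.
Qed.

(** The limit of the integrals with cutoff radius [j] is computed twice: by monotone convergence,
    and by [spectral_functional_cutoff]. *)
Theorem spectral_measure_step_ultra : exists beta : meas E R, loc_fin beta /\
 forall N J f, step N J f -> (\int[beta]_k (fpow f k)%:E = (c0 * B f f)%:E)%E.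
have [beta [lfb hb]] := riesz_representation spectral_functionalD spectral_functionalZ spectral_functional_ge0.
exists beta; split => // N J f sf; have tff := tf_step sf.
pose g (j : nat) k := fpow f k * cutoff j%:R k.
have Cg j : Cc (g j) by apply: CcMl; [exact: fpow_continuous|exact: Cc_cutoff].
have g0 j k : 0 <= g j k by rewrite mulr_ge0 ?fpow_ge0 ?cutoff_ge0.
have Ig j : (\int[beta]_k (g j k)%:E = (spectral_functional (g j))%:E)%E by exact: hb.
have cvg1 : (fun j => \int[beta]_k (g j k)%:E)%E @ \oo --> (\int[beta]_k (fpow f k)%:E)%E.
 rewrite (_ : (\int[beta]_k (fpow f k)%:E)%E = \int[beta]_k limn (fun j => (g j k)%:E))%E; last first.
  apply: eq_integral => k _; apply/esym/cvg_lim => //; apply: cvg_near_cst.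
  exists (Num.truncn `|k|).+1 => // j /= jk; rewrite /g cutoff1 ?mulr1//.
  by apply/ltW/(lt_le_trans (truncnS_gt _)); rewrite ler_nat.
 apply: (@cvg_monotone_convergence _ _ _ beta setT mtop (fun j k => (g j k)%:E)) => //.
 - by move=> j; apply/mEFin; apply: continuous_mfun; exact: (Cg j).1.
 - by move=> j k _; rewrite lee_fin.
 - move=> k _ i j ij; rewrite lee_fin ler_wpM2l ?fpow_ge0//.
  rewrite /cutoff; apply: le_max2 => //; apply: le_min2 => //.
  by rewrite !lerD2r ler_nat.
have cvg2 : (fun j => \int[beta]_k (g j k)%:E)%E @ \oo --> (c0 * B f f)%:E.
 under eq_fun do rewrite Ig.
 apply: cvg_EFin; first by apply: nearW.
 apply/cvgrPdist_le => e e0; have [T hT] := spectral_functional_cutoff sf e0.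
 exists (Num.truncn T).+1 => // j /= jT; rewrite distrC; apply: hT.
 by apply: ltW; apply: (lt_le_trans (truncnS_gt _)); rewrite ler_nat.
exact: cvg_unique cvg1 cvg2.
Qed.
End limit.

Theorem spectral_measure_step : exists beta : meas E R, loc_fin beta /\
 forall N J f, step N J f -> (\int[beta]_k (fpow f k)%:E = (c0 * B f f)%:E)%E.
have [U [UU UN]] := @ultraFilterLemma nat \oo _.
exact: spectral_measure_step_ultra UU UN.
Qed.
End approximation.

Lemma fatou_le d (T : measurableType d) (R : realType) (mu : meas T R)
  (u : nat -> T -> R) (f : T -> R) (M : \bar R) :
 (forall k, mfunT (u k)) -> (forall k x, 0 <= u k x) ->
 (forall x, u ^~ x @ \oo --> f x) -> (forall k, (\int[mu]_x (u k x)%:E <= M)%E) ->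
 (\int[mu]_x (f x)%:E <= M)%E.
move=> mu_ u0 uf uM.
have := @fatou _ _ _ mu setT mtop (fun k x => (u k x)%:E) _ _.
rewrite (_ : (fun x => limn_einf _) = fun x => (f x)%:E); last first.
 apply/funext => x; have h : (fun k => (u k x)%:E) @ \oo --> (f x)%:E by apply: cvg_EFin; [exact: nearW|exact: uf].
 by have [-> _] := cvg_limn_einf_sup h.
move=> h; apply: le_trans (h _ _) _.
- by move=> k; apply/mEFin.
- by move=> k x _; rewrite lee_fin.
rewrite limn_einf_lim; apply: lime_le; first exact: is_cvg_einfs.
apply: nearW => k; apply: le_trans (uM k); apply: ereal_inf_lbound.
by exists k => //=.
Qed.

(** * Bounded Baire functions exhaust the test functions *)

Section baire.
Context {R : realType} {n : nat}.
Notation E := 'rV[R]_n.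
Implicit Types (f g : E -> R).
Variable J : nat.

(** The closure of the step functions under bounded pointwise limits. As an inductive predicate it
    reduces a property stable under such limits to step functions, for all test functions supported
    in the box. *)
Inductive baire : (E -> R) -> Prop :=
| baire_step N f of step N J f : baire f
| baire_lim u C f of (forall k, baire (u k)) & (forall k x, `|u k x| <= C)
  & (forall x, u ^~ x @ \oo --> f x) : baire f.
Let ib (x : E) : R := (in_box J x)%:R.

Lemma baire_bounded f : baire f -> exists C, forall x, `|f x| <= C.
elim=> {f} [N f /tf_step[]//|u C f _ _ uC uf]; exists C => x.
have /cvg_norm := uf x; move=> h; rewrite -(cvg_lim _ h)//; apply: limr_le; first by apply/cvg_ex; exists `|f x|.
exact: nearW.
Qed.

Lemma baireZ a f : baire f -> baire (fun x => a * f x).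
elim=> {f} [N f sf|u C f _ IH uC uf]; first by apply: (@baire_step N); exact: stepZ.
apply: (baire_lim (u := fun k x => a * u k x) (C := `|a| * C)) => // [k x|x].
 by rewrite normrM ler_wpM2l.
exact: cvgMr.
Qed.

Lemma baireD f g : baire f -> baire g -> baire (fun x => f x + g x).
move=> bf bg; elim: bf => {f} [N f sf|u C f _ IH uC uf].
 elim: bg => {g} [M g sg|u C g _ IH uC ug].
  apply: (@baire_step (N + M)); apply: stepD; first exact: step_refine.
  by rewrite addnC; exact: step_refine.
 have [C' fC'] := baire_bounded (baire_step sf).
 apply: (baire_lim (u := fun k x => f x + u k x) (C := C' + C)) => // [k x|x].
  by rewrite (le_trans (ler_normD _ _))// lerD.
 by apply: cvgD => //; exact: cvg_cst.
have [C' gC'] := baire_bounded bg.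
apply: (baire_lim (u := fun k x => u k x + g x) (C := C + C')) => // [k x|x].
 by rewrite (le_trans (ler_normD _ _))// lerD.
by apply: cvgD => //; exact: cvg_cst.
Qed.

Lemma baireB f g : baire f -> baire g -> baire (fun x => f x - g x).
move=> bf bg; rewrite (_ : (fun x => _) = fun x => f x + -1 * g x).
 by apply: baireD => //; exact: baireZ.
by apply/funext => x; rewrite mulN1r.
Qed.

Lemma baireM f g : baire f -> baire g -> baire (fun x => f x * g x).
move=> bf bg; elim: bf => {f} [N f sf|u C f _ IH uC uf].
 elim: bg => {g} [M g sg|u C g _ IH uC ug].
  apply: (@baire_step (N + M)).
  have [f1 f2] := step_refine M sf; have [g1 g2] := step_refine N sg.
  rewrite addnC in g1; split=> x; first by rewrite {1}f1 {1}g1.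
  by move=> /f2 ->; rewrite mul0r.
 have [C' fC'] := baire_bounded (baire_step sf).
 apply: (baire_lim (u := fun k x => f x * u k x) (C := C' * C)) => // [k x|x].
  by rewrite normrM ler_pM.
 by apply: cvgM => //; exact: cvg_cst.
have [C' gC'] := baire_bounded bg.
apply: (baire_lim (u := fun k x => u k x * g x) (C := C * C')) => // [k x|x].
 by rewrite normrM ler_pM.
by apply: cvgM => //; exact: cvg_cst.
Qed.

Lemma baire0 : baire (fun=> 0).
Proof. by apply: (@baire_step 0); split. Qed.
Lemma baire_sum (I : Type) (r : seq I) (F : I -> E -> R) : (forall i, baire (F i)) ->
 baire (fun x => \sum_(i <- r) F i x).
move=> bF; elim: r => [|i r IH].
 by under eq_fun do rewrite big_nil; exact: baire0.
by under eq_fun do rewrite big_cons; exact: baireD.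
Qed.
Let baire_ib : baire ib.
apply: (@baire_step 0); split => x; first by rewrite /ib in_box_cell.
by rewrite /ib => /negPf ->.
Qed.
Let inA (A : set E) (x : E) : R := \1_A x * ib x.
Let ib2 x : ib x * ib x = ib x.
Proof. by rewrite /ib; case: in_box; rewrite ?mulr1// mulr0. Qed.
(** Complements are differences from the indicator of the box, and the complement of a countable
    union is the limit of the products [w k]. *)
Lemma baire_sigma_algebra : sigma_algebra setT [set A | baire (inA A)].
have baireC A : baire (inA A) -> baire (inA (~` A)).
 move=> bA; rewrite (_ : inA _ = fun x => ib x - inA A x); first exact: baireB.
 apply/funext => x; rewrite /inA !indicE in_setC.
 by case: (x \in A); rewrite /= ?mul1r ?mul0r ?subrr ?subr0.
split => /=.
- rewrite (_ : inA _ = fun=> 0); first exact: baire0.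
 by apply/funext => x; rewrite /inA indicE in_set0 mul0r.
- by move=> A bA; rewrite setTD; exact: baireC.
move=> F bF; rewrite -[X in inA X]setCK; apply: baireC.
pose w k x := ib x * \prod_(i < k) (1 - inA (F i) x).
apply: (baire_lim (u := w) (C := 1)).
- elim=> [|k IH]; rewrite /w.
  by under eq_fun do rewrite big_ord0 mulr1.
 rewrite (_ : (fun x => _) = fun x => w k x * (ib x - inA (F k) x)).
  by apply: baireM => //; exact: baireB.
 apply/funext => x; rewrite big_ord_recr/= /w /inA; have := ib2 x.
 move: (ib x) (\1_(F k) x) (\prod_(_ < _) _) => b a q h.
 transitivity (b * q - a * (b * b) * q); first by ring.
 by rewrite -{1}h; ring.
- move=> k x; rewrite normrM; apply: mulr_ile1 => //.
  by rewrite /ib; case: in_box; rewrite ?normr1 ?normr0.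
 rewrite normr_prod; apply: prodr_ile1 => i _; rewrite normr_ge0/=.
 by rewrite /inA indicE /ib; case: (x \in _); case: in_box;
  rewrite /= ?mulr1 ?mulr0 ?subrr ?subr0 ?normr0 ?normr1.
- move=> x; have [[i _ Fix]|nF] := pselect ((\bigcup_i F i) x).
  rewrite [X in _ --> X]/inA indicE in_setC mem_set/= ?mul0r; last by exists i.
  apply: cvg_near_cst; exists i.+1 => // k /= ik.
  rewrite /w (bigD1 (Ordinal ik))//= /inA indicE mem_set// mul1r mulrCA mulrA.
  by rewrite mulrBl mul1r ib2 subrr mul0r.
 rewrite [X in _ --> X]/inA indicE mem_set// mul1r; apply: cvg_near_cst; apply: nearW => k.
 rewrite /w big1 ?mulr1// => i _.
 by rewrite /inA indicE memNset ?mul0r ?subr0// => Fix; apply: nF; exists i.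
Qed.

Lemma baire_coord (i : 'I_n) (a : R) : baire (inA [set x | a < x 0 i]).
apply: (baire_lim (u := fun N x => (a < cell1 N (x 0 i))%R%:R * ib x) (C := 1)).
- move=> N; apply: (@baire_step N); split => x; last by rewrite /ib => /negPf ->; rewrite mulr0.
 have /rowP/(_ i) := cell_idem N x; rewrite !mxE => e.
 by rewrite e /ib in_box_cell.
- move=> N x; rewrite normrM; apply: mulr_ile1 => //; first by case: ltP; rewrite ?normr1 ?normr0.
 by rewrite /ib; case: in_box; rewrite ?normr1 ?normr0.
move=> x; rewrite /inA; apply: cvgM; last exact: cvg_cst.
rewrite indicE; apply: cvg_near_cst; have [ax|xa] := ltP a (x 0 i).
 rewrite mem_set//; have e0 : 0 < (x 0 i - a) / 2 by rewrite divr_gt0// subr_gt0.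
 apply: filterS (mesh_small e0) => N /= hN.
 by have /andP[_] := cell1_itv N (x 0 i) => h; rewrite (_ : _ < _)//; lra.
rewrite memNset/=; last by apply/negP; rewrite -leNgt.
apply: nearW => N; have /andP[h _] := cell1_itv N (x 0 i).
by rewrite ltNge (le_trans h xa).
Qed.

Lemma baire_indic (A : set E) : measurable A -> baire (inA A).
move=> mA; pose G : set (set E) := [set A | baire (inA A)].
have mid : mfunT (id : g_sigma_algebraType G -> E).
 apply: measurable_fun_rV => i.
 apply: (measurability _ (RGenOInfty.measurableE R)) => _ [_ [a ->] <-].
 rewrite setTI; apply: sub_sigma_algebra; rewrite /G/=.
 have := baire_coord i a.
 by congr (baire (inA _)); apply/seteqP; split=> x /=; rewrite in_itv/= andbT.
have := mid mtop A mA; rewrite setTI => h.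
have := @smallest_sub _ (sigma_algebra setT) G G baire_sigma_algebra (fun _ => id) A.
exact.
Qed.

(** Counting the positive integers up to [t] recovers its floor; after division by the number of
    levels this approximates a function uniformly by averages of indicators of superlevel sets. *)
Lemma sum_le_floor (m : nat) (t : R) : 0 <= t ->
 (t <= m%:R -> t - 1 <= \sum_(j < m) (j.+1%:R <= t)%R%:R <= t) /\
 (m%:R <= t -> \sum_(j < m) (j.+1%:R <= t)%R%:R = m%:R :> R).
move=> t0; elim: m => [|m [IH1 IH2]].
 by split => [h|_]; rewrite big_ord0//; apply/andP; lra.
rewrite big_ord_recr/=; split => h.
 have [tm|tm] := leP t m%:R.
  have /negPf -> : ~~ (m.+1%:R <= t) by rewrite -ltNge (le_lt_trans tm) ?ltr_nat.
  by rewrite addr0; exact: IH1.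
 rewrite IH2 ?(ltW tm)//; case: (leP m.+1%:R t) => h'.
  by rewrite /= -natr1 in h h' *; lra.
 by rewrite /= -natr1 in h h' *; lra.
by rewrite h IH2 ?natr1//; apply: le_trans h; rewrite ler_nat.
Qed.

Lemma tf_baire_ge0 f : tf f -> (forall x, ~~ in_box J x -> f x = 0) ->
 (forall x, 0 <= f x) -> baire f.
move=> [mf [C fC] _] f0 fge0; pose m := (Num.truncn `|C|).+1.
have fm x : f x <= m%:R.
 apply: le_trans (ltW (truncnS_gt _)); apply: le_trans (ler_norm _) _.
 exact: le_trans (fC x) (ler_norm _).
pose s k x := \sum_(j < m * 2 ^ k) mesh k * inA [set x | j.+1%:R * mesh k <= f x] x.
have sE k x : in_box J x -> s k x = mesh k * \sum_(j < m * 2 ^ k) (j.+1%:R <= 2 ^+ k * f x)%R%:R.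
 move=> Jx; rewrite mulr_sumr; apply: eq_bigr => j _; rewrite /inA /ib Jx mulr1 indicE.
 have e : (j.+1%:R * mesh k <= f x) = (j.+1%:R <= 2 ^+ k * f x)
  by rewrite /mesh ler_pdivrMr ?exprn_gt0// [f x * _]mulrC.
 by rewrite -e; congr (_ * (nat_of_bool _)%:R); apply/idP/idP; rewrite inE.
have sf k x : `|s k x - f x| <= mesh k.
 have [Jx|Jx] := boolP (in_box J x); last first.
  rewrite f0// subr0 /s big1 ?normr0 ?(ltW (mesh_gt0 _))// => j _.
  by rewrite /inA /ib (negPf Jx) !mulr0.
 rewrite sE//; have t0 : 0 <= 2 ^+ k * f x by rewrite mulr_ge0// exprn_ge0.
 have [h _] := sum_le_floor (m * 2 ^ k) t0.
 have /h : 2 ^+ k * f x <= (m * 2 ^ k)%:R by rewrite natrM natrX mulrC ler_wpM2r// exprn_ge0.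
 set S := \sum_(j < _) _ => /andP[S1 S2].
 have fE : f x = mesh k * (2 ^+ k * f x) by rewrite mulrA [mesh k * _]mulrC meshK mul1r.
 rewrite [X in _ - X]fE -mulrBr normrM (ger0_norm (ltW (mesh_gt0 k))) ler_piMr ?(ltW (mesh_gt0 k))//.
 by rewrite ler_norml; lra.
apply: (baire_lim (u := s) (C := m%:R + 1)).
- move=> k; apply: baire_sum => j; apply: baireZ; apply: baire_indic.
 rewrite -[X in measurable X]setTI.
 exact: measurable_fun_le (mcst _) mf.
- move=> k x; have := sf k x; have := fm x; have := fge0 x.
 have : mesh k <= 1 :> R by rewrite invf_le1 ?exprn_gt0// exprn_ege1// ler1n.
 rewrite !ler_norml; lra.
move=> x; apply/cvgrPdist_le => e e0; apply: filterS (mesh_small e0) => k /= hk.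
by rewrite distrC (le_trans (sf k x)).
Qed.

Lemma tf_baire f : tf f -> (forall x, ~~ in_box J x -> f x = 0) -> baire f.
move=> tff f0.
have tfabs : tf (fun x => `|f x|) by exact: tf_norm.
rewrite (_ : f = fun x => (`|f x| + f x) - `|f x|); last by apply/funext => x; ring.
apply: baireB; apply: tf_baire_ge0 => //.
- exact: tfD.
- by move=> x /f0 ->; rewrite normr0 addr0.
- by move=> x; rewrite -lerBlDr sub0r lerNl; have := ler_norm (- f x); rewrite normrN; lra.
- by move=> x /f0 ->; rewrite normr0.
Qed.
End baire.

(** * Bochner's theorem for covariance forms *)

Section spectral_measure.
Context {R : realType} {n : nat}.
Notation E := 'rV[R]_n.
Notation lambda := (@lebesgue_rV R n).
Implicit Types (f g : E -> R).

Lemma tf_lim (u : nat -> E -> R) f C t : (forall k, mfunT (u k)) ->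
 (forall k x, `|u k x| <= C) -> (forall k, off_cube t (u k)) ->
 (forall x, u ^~ x @ \oo --> f x) ->
 [/\ mfunT f, forall x, `|f x| <= C & off_cube t f].
move=> mu uC ut uf; split.
- by apply: (@measurable_fun_cvg _ _ _ _ u) => // x _; exact: uf.
- move=> x; have /cvg_norm := uf x; move=> h; rewrite -(cvg_lim _ h)//.
 by apply: limr_le; [apply/cvg_ex; exists (`|f x|)|exact: nearW].
move=> x tx; have := uf x; rewrite (_ : u ^~ x = fun=> 0).
 by move=> /cvg_lim <-//; rewrite lim_cst.
by apply/funext => k; exact: ut.
Qed.

Lemma int_tf_cvg (m : meas E R) (u : nat -> E -> R) f C t : loc_fin m ->
 (forall k, mfunT (u k)) ->
 (forall k x, `|u k x| <= C) -> (forall k, off_cube t (u k)) ->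
 (forall x, u ^~ x @ \oo --> f x) -> (fun k => \int[m]_x u k x) @ \oo --> \int[m]_x f x.
move=> lfm mu uC ut uf; have [mf fC ft] := tf_lim mu uC ut uf.
have tfu k : tf (u k) by split; [exact: mu|exists C|exists t].
pose gd (x : E) := C * \1_(cube t) x.
have tfg : tf gd.
 split.
 - by apply: mfunM => //; exact: mindic (mcub t).
 - exists `|C| => x; rewrite normrM ler_piMr// indicE.
  by case: (_ \in _); rewrite ?normr1 ?normr0.
 - exists t => x tx; rewrite /gd indicE memNset ?mulr0//.
  by rewrite /cube/=; apply/negP; rewrite -leNgt.
have C0 : 0 <= C by apply: le_trans (fC 0).
have ug k x : `|u k x| <= gd x.
 rewrite /gd indicE; have [xt|xt] := ltP `|x| t; first by rewrite mem_set// mulr1.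
 by rewrite ut// normr0 mulr_ge0.
have := @dominated_cvg _ _ _ m setT mtop (fun k x => (u k x)%:E) (fun x => (f x)%:E) (fun x => (gd x)%:E).
move=> h; have := h _ _ _ _ _.
move=> h'; apply: fine_cvg; rewrite /Rintegral fineK; last first.
 apply: (integrable_fin_num mtop).
 by apply: (tf_integrable lfm); split; [|exists C|exists t].
apply: h'.
- by move=> k; apply/mEFin.
- by move=> x _; apply: cvg_EFin; [exact: nearW|exact: uf].
- by [].
- exact: (tf_integrable lfm).
- by move=> k x _; rewrite lee_fin.
Qed.
Variable B : (E -> R) -> (E -> R) -> R.
Hypothesis HB : covariance_form B.
Let lf := @lebesgue_lf R n.
Let c0 : R := (2 * pi) ^+ n.
Let c0_gt0 : 0 < c0. Proof. by rewrite exprn_gt0// mulr_gt0// pi_gt0. Qed.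

Lemma form_DD_scaled f g s : tf f -> tf g -> 0 < s ->
 B (fun x => f x + g x) (fun x => f x + g x) <= (1 + s) * B f f + (1 + s^-1) * B g g.
move=> tff tfg s0; have tg := tfZ (-1) tfg; have tsf := tfZ s tff.
have := form_ge0 HB (tfD tsf tg); rewrite !(formDD HB)// !(form_ZZ HB)// (formZ HB)//.
rewrite (formC HB tff tg) (formZ HB)// (formC HB tfg tff) => h.
rewrite -subr_ge0 -(pmulr_rge0 _ s0).
rewrite (_ : s * _ = s ^+ 2 * B f f + s * (2 * (-1 * (B f g))) + (-1) ^+ 2 * B g g); first by lra.
by field; rewrite gt_eqF.
Qed.
(** Two errors are controlled: the first for the form, the second for the pointwise convergence of
    the Fourier transforms. *)
Definition step_approx J f := forall e, 0 < e -> exists N g, [/\ step N J g,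
 B (fun x => f x - g x) (fun x => f x - g x) <= e & \int[lambda]_x `|f x - g x| <= e].

Lemma formB0 f : B (fun x => f x - f x) (fun x => f x - f x) = 0.
have -> : (fun x => f x - f x) = fun=> 0 by apply/funext => x; rewrite subrr.
by rewrite (form0l HB)//; exact: tf0.
Qed.

(** Induction on the Baire class: [form_cvg0] handles the form in a bounded limit and dominated
    convergence the integral, after which a term of the sequence is approximated. *)
Lemma baire_step_approx J f : baire J f ->
 [/\ mfunT f, off_cube (J%:R + 1) f & step_approx J f].
elim=> {f} [N f sf|u C f _ IH uC uf].
 have [mf fC _] := tf_step sf; split => //.
  by move=> x Jx; apply: sf.2; apply/negP => /in_box_norm; lra.
 move=> e e0; exists N, f; split => //; first by rewrite formB0 ltW.
 under eq_Rint do rewrite subrr normr0.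
 by rewrite Rintegral_cst// mul0r ltW.
have mu k : mfunT (u k) by have [] := IH k.
have vu k : off_cube (J%:R + 1) (u k) by have [] := IH k.
have [mf fC vf] := tf_lim mu uC vu uf; split => //.
have tfu k : tf (u k) by split; [|exists C|exists (J%:R + 1)].
have tff : tf f by split; [|exists C|exists (J%:R + 1)].
have mfu k : mfunT (fun x => f x - u k x) by exact: mfunB.
have fuC k x : `|f x - u k x| <= C + C by rewrite (le_trans (ler_normB _ _))// lerD.
have vfu k : off_cube (J%:R + 1) (fun x => f x - u k x) by move=> x tx; rewrite vf// vu// subrr.
have fu0 x : (fun k => f x - u k x) @ \oo --> 0 by rewrite -(subrr (f x)); apply: cvgB => //; exact: cvg_cst.
move=> e e0; have e4 : 0 < e / 4 by rewrite divr_gt0.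
have := form_cvg0 HB mfu fuC vfu fu0 => /cvgrPdist_le /(_ _ e4)[k1 _ hk1].
have : (fun k => \int[lambda]_x `|f x - u k x|) @ \oo --> \int[lambda]_x (0 : R).
 apply: (int_tf_cvg (C := C + C) (t := J%:R + 1) lf).
 - by move=> k; exact: mcomp.
 - by move=> k x; rewrite normr_id.
 - by move=> k x /(vfu k) ->; rewrite normr0.
 - by move=> x; rewrite -(@normr0 _ R); apply: cvg_norm; exact: fu0.
rewrite Rintegral_cst// mul0r => /cvgrPdist_le /(_ _ e4)[k2 _ hk2].
pose k := maxn k1 k2.
have [_ _ /(_ _ e4)[N [g [sg g1 g2]]]] := IH k; have tfg := tf_step sg.
exists N, g; split => //.
 have -> : (fun x => f x - g x) = fun x => (f x - u k x) + (u k x - g x) by apply/funext => x; ring.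
 have := formDD_le HB (tfB tff (tfu k)) (tfB (tfu k) tfg).
 have := hk1 k (leq_maxl _ _); rewrite /= sub0r normrN ger0_norm; last exact: (form_ge0 HB (tfB tff (tfu k))).
 lra.
have := hk2 k (leq_maxr _ _); rewrite /= sub0r normrN ger0_norm; last exact: int_tf_ge0.
move=> h; have t1 := tf_norm (tfB tff (tfu k)); have t2 := tf_norm (tfB (tfu k) tfg).
have := le_int_tf lf (tf_norm (tfB tff tfg)) (tfD t1 t2).
rewrite (int_tfD lf)// => h'; apply: le_trans (h' _) _; last by lra.
by move=> x; rewrite -(subrKA (u k x)) ler_normD.
Qed.

Lemma tf_step_approx f : tf f -> exists J, step_approx J f.
move=> tff; have [_ _ [t ft]] := tff; exists (Num.truncn t).+1.
suff /baire_step_approx[] : baire (Num.truncn t).+1 f by [].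
apply: tf_baire => // x; apply: contraNeq => fx; apply: norm_in_box.
apply: lt_trans (truncnS_gt _); rewrite ltNge; apply/negP => /ft fx0.
by rewrite fx0 eqxx in fx.
Qed.

Lemma fcosB f g k : tf f -> tf g -> fcos (fun x => f x - g x) k = fcos f k - fcos g k.
move=> tff tfg; have tg := tfZ (-1) tfg.
have -> : (fun x => f x - g x) = fun x => f x + -1 * g x by apply/funext => x; rewrite mulN1r.
by rewrite fcosD// fcosZ// mulN1r.
Qed.

Lemma fsinB f g k : tf f -> tf g -> fsin (fun x => f x - g x) k = fsin f k - fsin g k.
move=> tff tfg; have tg := tfZ (-1) tfg.
have -> : (fun x => f x - g x) = fun x => f x + -1 * g x by apply/funext => x; rewrite mulN1r.
by rewrite fsinD// fsinZ// mulN1r.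
Qed.

Lemma fpowDB f g k : tf f -> tf g ->
 fpow (fun x => f x + g x) k + fpow (fun x => f x - g x) k = 2 * fpow f k + 2 * fpow g k.
Proof. by move=> tff tfg; rewrite /fpow fcosB// fsinB// fcosD// fsinD//; ring. Qed.
Lemma fpow_cvg f (u : nat -> E -> R) k : tf f -> (forall j, tf (u j)) ->
 (fun j => \int[lambda]_x `|f x - u j x|) @ \oo --> 0 ->
 (fun j => fpow (u j) k) @ \oo --> fpow f k.
move=> tff tfu h; have hc : (fun j => fcos (u j) k) @ \oo --> fcos f k.
 apply/cvgrPdist_le => e e0; move/cvgrPdist_le : h => /(_ _ e0); apply: filterS => j.
 rewrite sub0r normrN -fcosB// => h; apply: le_trans h.
 by rewrite (le_trans (fcos_le _ (tfB tff (tfu j))))// ler_norm.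
have hs : (fun j => fsin (u j) k) @ \oo --> fsin f k.
 apply/cvgrPdist_le => e e0; move/cvgrPdist_le : h => /(_ _ e0); apply: filterS => j.
 rewrite sub0r normrN -fsinB// => h; apply: le_trans h.
 by rewrite (le_trans (fsin_le _ (tfB tff (tfu j))))// ler_norm.
by rewrite /fpow; apply: cvgD; rewrite -?expr2; under eq_fun do rewrite expr2; rewrite expr2; apply: cvgM.
Qed.

Section beta.
Variable beta : meas E R.
Hypothesis beta_step : forall N J f, step N J f -> (\int[beta]_k (fpow f k)%:E = (c0 * B f f)%:E)%E.
Let mfpow f : tf f -> mfunT (fun k => (fpow f k)%:E).
Proof. by move=> tff; apply/mEFin; apply: continuous_mfun; exact: fpow_continuous. Qed.
(** Fatou's lemma along step approximations gives one inequality. The factor [1 + s] stems from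
    [form_DD_scaled], a Cauchy-Schwarz inequality without square roots, and [e j] is so small that
    the accompanying error [(1 + s^-1) * e j] is at most [s]. *)
Lemma int_fpow_le f : tf f -> (\int[beta]_k (fpow f k)%:E <= (c0 * B f f)%:E)%E.
move=> tff; have [J fJ] := tf_step_approx tff.
suff H s : 0 < s -> (\int[beta]_k (fpow f k)%:E <= (c0 * ((1 + s) * B f f + s))%:E)%E.
 apply/lee_addgt0Pr => e e0; have Bf := form_ge0 HB tff.
 have s0 : 0 < e / (c0 * (B f f + 1)) by rewrite divr_gt0// mulr_gt0// ltr_wpDl.
 apply: le_trans (H _ s0) _; rewrite -EFinD lee_fin.
 apply: eq_ler; field.
 by rewrite !gt_eqF// ltr_wpDl.
move=> s0; pose e j : R := Num.min (s / (1 + s^-1)) j.+1%:R^-1.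
have e0 j : 0 < e j by rewrite lt_min invr_gt0 ltr0Sn divr_gt0// ltr_pwDl ?invr_ge0// ltW.
have /choice[N_ /choice[g hg]] j := fJ _ (e0 j).
have tfg j : tf (g j) by have [/tf_step] := hg j.
apply: (@fatou_le _ _ _ beta (fun j => fpow (g j)) (fpow f)).
- by move=> j; apply/mEFin; exact: mfpow.
- by move=> j k; exact: fpow_ge0.
- move=> k; apply: fpow_cvg => //; apply/cvgrPdist_le => d d0.
 have [m hm] : exists m : nat, m.+1%:R^-1 <= d.
  exists (Num.truncn d^-1); rewrite invf_ple ?posrE ?ltr0Sn//.
  exact/ltW/truncnS_gt.
 exists m => // j /= mj; rewrite sub0r normrN ger0_norm; last exact: int_tf_ge0.
 have [_ _ /le_trans] := hg j; apply; rewrite ge_min; apply/orP; right.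
 by apply: le_trans hm; rewrite lef_pV2 ?posrE ?ltr0Sn// ler_nat ltnS.
move=> j; have [sg Bg _] := hg j; rewrite (beta_step sg) lee_fin ler_pM2l//.
have -> : g j = fun x => f x + -1 * (f x - g j x) by apply/funext => x; ring.
have tfg' := tfB tff (tfg j).
apply: le_trans (form_DD_scaled tff (tfZ (-1) tfg') s0) _.
rewrite (form_ZZ HB)// lerD2l sqrrN expr1n mul1r mulrC -ler_pdivlMr; last first.
 by rewrite ltr_pwDl ?invr_ge0// ltW.
by apply: le_trans Bg _; rewrite ge_min lexx.
Qed.

Lemma int_fpow_fin f : tf f -> (\int[beta]_k (fpow f k)%:E)%E \is a fin_num.
move=> tff; rewrite ge0_fin_numE; first exact: le_lt_trans (int_fpow_le tff) (ltry _).
by apply: int_ge0 => k _; rewrite lee_fin fpow_ge0.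
Qed.

Lemma integrable_fpow f : tf f -> beta.-integrable setT (fun k => (fpow f k)%:E).
move=> tff; apply/integrableP; split; first exact: mfpow.
under eq_integral do rewrite gee0_abs ?lee_fin ?fpow_ge0//.
by rewrite -ge0_fin_numE ?int_fpow_fin//; apply: int_ge0 => k _; rewrite lee_fin fpow_ge0.
Qed.
Let lin (e a b c u v w z : R) : a + b = 2 * w + 2 * c -> b <= v -> z <= e / 2 ->
 0 <= c -> u + v = 2 * w + 2 * z -> u <= a + e.
Proof. lra. Qed.
(** Both quadratic forms obey the parallelogram law. With a step function [g] close to [f],
    [I f = 2 I g + 2 I (f - g) - I (2 g - f)], where [I g] is exact, [I (f - g)] is nonnegative, and
    the last term is bounded by [int_fpow_le]; this gives the reverse inequality. *)
Lemma int_fpow f : tf f -> (\int[beta]_k (fpow f k)%:E = (c0 * B f f)%:E)%E.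
move=> tff; apply/eqP; rewrite eq_le int_fpow_le//=.
have [J fJ] := tf_step_approx tff; pose I f := \int[beta]_k fpow f k.
have IE g : tf g -> (\int[beta]_k (fpow g k)%:E)%E = (I g)%:E by move=> tg; rewrite /I /Rintegral fineK// int_fpow_fin.
have Ile g : tf g -> I g <= c0 * B g g by move=> tg; rewrite -lee_fin -IE// int_fpow_le.
have par g h : tf g -> tf h ->
  I (fun x => g x + h x) + I (fun x => g x - h x) = 2 * I g + 2 * I h.
 move=> tg th; have ig := integrable_fpow tg; have ih := integrable_fpow th.
 rewrite /I -(RintegralD mtop (integrable_fpow (tfD tg th)) (integrable_fpow (tfB tg th))).
 under eq_Rint do rewrite fpowDB//.
 rewrite (RintegralD mtop (integrableZl mtop 2 ig) (integrableZl mtop 2 ih)).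
 by rewrite !RintegralZl.
rewrite IE// lee_fin; apply/ler_addgt0Pr => e e0; have e1 : 0 < e / (2 * c0) by rewrite divr_gt0// mulr_gt0.
have [N [g [sg Bg _]]] := fJ _ e1; have tg := tf_step sg; have th := tfB tff tg.
have Ig : I g = c0 * B g g by apply: EFin_inj; rewrite -IE// (beta_step sg).
have h1 := par g _ tg th; have h2 := Ile _ (tfB tg th).
have fE : (fun x => g x + (f x - g x)) = f by apply/funext => x; ring.
rewrite fE Ig in h1.
have h3 : B f f + B (fun x => g x - (f x - g x)) (fun x => g x - (f x - g x)) =
  2 * B g g + 2 * B (fun x => f x - g x) (fun x => f x - g x).
 rewrite -{1 2}fE (formDD HB tg th).
 have -> : (fun x => g x - (f x - g x)) = fun x => g x + -1 * (f x - g x) by apply/funext => x; ring.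
 have tN := tfZ (-1) th.
 by rewrite (formDD HB tg tN) (form_ZZ HB)// (formC HB tg tN) (formZ HB)// (formC HB th tg); ring.
have h4 : c0 * B (fun x => f x - g x) (fun x => f x - g x) <= e / 2.
 move: Bg; rewrite invfM mulrA ler_pdivlMr// mulrC; exact.
have h5 : 0 <= I (fun x => f x - g x) by apply: Rintegral_ge0 => k _; exact: fpow_ge0.
have h6 : c0 * B f f + c0 * B (fun x => g x - (f x - g x)) (fun x => g x - (f x - g x)) =
  2 * (c0 * B g g) + 2 * (c0 * B (fun x => f x - g x) (fun x => f x - g x)).
 by rewrite -mulrDr h3; ring.
exact: lin h1 h2 h4 h5 h6.
Qed.
End beta.
Definition opp_rV (x : E) : E := - x.
Let measurable_opp_rV : mfunT opp_rV.
Proof. exact: (measurable_funN_rV (@measurable_id _ E setT)). Qed.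

HB.instance Definition _ := isMeasurableFun.Build _ _ _ _ opp_rV measurable_opp_rV.
(** The covariance of real statistics is real, while the imaginary part of the spectral integrand is
    odd in [k]. Averaging with the reflected measure makes its integral vanish and leaves the
    integrals of [fpow] unchanged. *)
Definition symmetrization (m : meas E R) : meas E R :=
 mscale (2^-1)%:nng (measure_add m (image_measure m opp_rV)).

Lemma ge0_integral_symmetrization (m : meas E R) (h : E -> \bar R) :
 mfunT h -> (forall x, 0 <= h x)%E ->
 (\int[symmetrization m]_x h x = (2^-1)%:E * (\int[m]_x h x + \int[m]_x h (- x)%R))%E.
move=> mh h0; rewrite ge0_integral_mscale// ge0_integral_measure_add//.
congr (_ * (_ + _))%E.
by rewrite ge0_integral_pushforward//.
Qed.

Theorem bochner : exists beta : meas E R, loc_fin beta /\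
 forall f g, tf f -> tf g ->
  let F k := (fourier f k * (fourier g k)^*)%C in
  cintegrable beta F /\ (B f g)%:C%C = (((2 * pi) ^- n)%:C * cintegral beta F)%C.
have [b0 [lfb b0step]] := spectral_measure_step HB.
have Ib0 := int_fpow b0step.
pose beta := symmetrization b0.
have lfbeta : loc_fin beta.
 move=> A mA bA; rewrite /beta/= /mscale/= /measure_add/= /msum !big_ord_recl big_ord0/= adde0.
 have mA' : measurable (opp_rV @^-1` A) by rewrite -[X in measurable X]setTI; exact: measurable_opp_rV.
 have bA' : bounded_set (opp_rV @^-1` A).
  have [M [Mr hM]] := bA; exists M; split => // r Mr' x /= Ax.
  by have := hM r Mr' _ Ax; rewrite /= normrN.
 have h1 := lfb _ mA bA; have h2 := lfb _ mA' bA'.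
 by rewrite lte_mul_pinfty ?lee_fin//; exact: lte_add_pinfty.
have sym (h : E -> \bar R) : mfunT h -> (forall x, 0 <= h x)%E ->
  (\int[beta]_x h (- x)%R = \int[beta]_x h x)%E.
 move=> mh h0; rewrite !ge0_integral_symmetrization//.
  by rewrite addeC; congr (_ * (_ + _))%E; apply: eq_integral => x _; rewrite opprK.
 exact: (mcomp mh measurable_opp_rV).
have fpowN f k : tf f -> fpow f (- k) = fpow f k by move=> tff; rewrite /fpow fcosN fsinN// sqrrN.
have mfpow f : tf f -> mfunT (fun k => (fpow f k)%:E)
 by move=> tff; apply/mEFin; apply: continuous_mfun; exact: fpow_continuous.
have Ib f : tf f -> (\int[beta]_k (fpow f k)%:E = (c0 * B f f)%:E)%E.
 move=> tff; rewrite ge0_integral_symmetrization//; last 2 first.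
 - exact: mfpow.
 - by move=> k; rewrite lee_fin fpow_ge0.
 rewrite [X in (_ + X)%E](eq_integral (fun k => (fpow f k)%:E)); last by move=> k _; rewrite fpowN.
 by rewrite Ib0// -EFinD -EFinM; congr _%:E; field.
have intf f : tf f -> intR beta (fpow f).
 move=> tff; apply/integrableP; split; first exact: mfpow.
 under eq_integral do rewrite /= ger0_norm ?fpow_ge0//.
 by rewrite Ib// ltry.
have RI f : tf f -> \int[beta]_k fpow f k = c0 * B f f by move=> tff; rewrite /Rintegral Ib.
exists beta; split => // f g tff tfg F.
(* Polarisation: the real part of the mixed integrand is a combination of three energies. *)
have ReE k : complex.Re (F k) = 2^-1 * (fpow (fun x => f x + g x) k - fpow f k - fpow g k).
 have := fourier_Re f k; have := fourier_Re g k; have := fourier_Im k tff; have := fourier_Im k tfg.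
 rewrite /F /fpow fcosD// fsinD//; case: (fourier f k) (fourier g k) => [a b] [c d]/= -> -> <- <-.
 by field.
have ImE k : complex.Im (F k) = fcos f k * fsin g k - fsin f k * fcos g k.
 have := fourier_Re f k; have := fourier_Re g k; have := fourier_Im k tff; have := fourier_Im k tfg.
 rewrite /F; case: (fourier f k) (fourier g k) => [a b] [c d]/= -> -> <- <-.
 by ring.
have tfs := tfD tff tfg.
have cRe : beta.-integrable setT (fun k => (complex.Re (F k))%:E).
 rewrite (_ : (fun k => _) = (fun k => (2^-1)%:E * ((fpow (fun x => f x + g x) k)%:E - (fpow f k)%:E - (fpow g k)%:E))%E).
  by apply: integrableZl => //; apply: integrableB => //; [apply: integrableB => //|]; exact: intf.
 by apply/funext => k; rewrite ReE.
have mIm : mfunT (fun k => complex.Im (F k)).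
 under eq_fun do rewrite ImE.
 have mc h : tf h -> mfunT (fcos h) by move=> th; exact: continuous_mfun (fcos_continuous th).
 have ms h : tf h -> mfunT (fsin h) by move=> th; exact: continuous_mfun (fsin_continuous th).
 by apply: mfunB; apply: mfunM; [exact: mc|exact: ms|exact: ms|exact: mc].
have cIm : beta.-integrable setT (fun k => (complex.Im (F k))%:E).
 apply: (@le_integrable _ _ _ beta setT mtop _ (fun k => (fpow f k)%:E + (fpow g k)%:E)%E).
 - exact/mEFin.
 - move=> k _; rewrite ImE -EFinD /= lee_fin [leRHS]ger0_norm; last by apply: addr_ge0; exact: fpow_ge0.
  rewrite /fpow; move: (fcos f k) (fsin f k) (fcos g k) (fsin g k) => a b c d.
  rewrite ler_norml; apply/andP; split.
   by have := sqr_ge0 (a + d); have := sqr_ge0 (b - c); have := sqr_ge0 a; have := sqr_ge0 b; have := sqr_ge0 c; have := sqr_ge0 d; nra.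
  by have := sqr_ge0 (a - d); have := sqr_ge0 (b + c); have := sqr_ge0 a; have := sqr_ge0 b; have := sqr_ge0 c; have := sqr_ge0 d; nra.
 - by apply: integrableD => //; exact: intf.
split => //.
have Im0 : \int[beta]_k complex.Im (F k) = 0.
 rewrite /Rintegral integralE.
 have -> : (\int[beta]_x (fun k => (complex.Im (F k))%:E)^\- x =
       \int[beta]_x (fun k => (complex.Im (F k))%:E)^\+ x)%E.
  rewrite -[RHS]sym//; last first.
   by apply: measurable_funepos; exact/mEFin.
  apply: eq_integral => k _; rewrite funenegE funeposE !ImE fcosN fsinN// fcosN fsinN//.
  by rewrite -EFinN; congr (maxe _%:E _); ring.
 rewrite subee// fin_num_abs gee0_abs; last by apply: int_ge0.
 have := integrable_funepos mtop cIm => /integrableP[_].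
 by under eq_integral do rewrite gee0_abs//.
rewrite /cintegral Im0; under eq_Rint do rewrite ReE.
rewrite RintegralZl//; last first.
 exact: (integrableB mtop (integrableB mtop (intf _ tfs) (intf _ tff)) (intf _ tfg)).
rewrite (RintegralB mtop (integrableB mtop (intf _ tfs) (intf _ tff)) (intf _ tfg)).
rewrite (RintegralB mtop (intf _ tfs) (intf _ tff)) !RI// (formDD HB)//.
apply/eqP; rewrite eq_complex/= !mulr0 !mul0r subr0 addr0 eqxx andbT; apply/eqP.
by rewrite /c0; field; rewrite expf_neq0// gt_eqF// mulr_gt0// pi_gt0.
Qed.
End spectral_measure.

Lemma sqr_sum_le (R : realFieldType) (I : finType) (a : I -> R) :
 (\sum_i a i) ^+ 2 <= #|I|%:R * \sum_i a i ^+ 2.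
rewrite expr2 mulr_suml.
via (\sum_i \sum_j (a i ^+ 2 + a j ^+ 2) / 2).
 apply: ler_sum => i _; rewrite mulr_sumr; apply: ler_sum => j _.
 by have := sqr_ge0 (a i - a j); rewrite sqrrB; lra.
under eq_bigr do rewrite -mulr_suml big_split/= sumr_const.
by rewrite -mulr_suml big_split/= sumr_const sumrMnl mulr_natl mulrDl -splitr; exact: lexx.
Qed.

Lemma sqrt_lt1 (R : rcfType) (a : R) : (Num.sqrt a < 1) = (a < 1).
Proof. by rewrite -{1}(sqrtr1 R) ltr_sqrt. Qed.
Lemma Rintegral_sum d (Om : measurableType d) (R : realType) (P : meas Om R) (I : Type) (r : seq I) (F : I -> Om -> R) :
 (forall i, intR P (F i)) ->
 \int[P]_w (\sum_(i <- r) F i w) = \sum_(i <- r) \int[P]_w F i w /\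
 intR P (fun w => \sum_(i <- r) F i w).
move=> iF.
have iS r' : intR P (fun w => \sum_(i <- r') F i w).
 rewrite (_ : EFin \o _ = fun w => (\sum_(j <- r') (F j w)%:E)%E); first exact: (@integrable_sum _ _ _ P setT mtop I r' xpredT (fun j w => (F j w)%:E) (fun i _ => iF i)).
 by apply/funext => w; rewrite /= sumEFin.
split => //; elim: r => [|i r IH].
 by under eq_Rint do rewrite big_nil; rewrite Rintegral_cst// mul0r big_nil.
under eq_Rint do rewrite big_cons.
by rewrite big_cons -IH (RintegralD mtop (iF i) (iS r)).
Qed.

(** * Square-integrable random variables *)

Section square_integrable.
Context d (Om : measurableType d) (R : realType).
Variable P : probability Om R.
Implicit Types X Y : Om -> R.
Definition sqint X := mfunT X /\ (\int[P]_w (X w ^+ 2)%:E < +oo)%E.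

Lemma sqint_integrable X : sqint X -> intR P (fun w => X w ^+ 2).
move=> [mX X2]; apply/integrableP; split.
 by apply/mEFin; exact: mfunX.
by under eq_integral do rewrite /= ger0_norm ?sqr_ge0//.
Qed.

Lemma sqint_le X Y C : mfunT X -> sqint Y -> (forall w, `|X w| <= C * `|Y w|) -> sqint X.
move=> mX [mY Y2] XY; split => //.
have mY2 : mfunT (fun w => (Y w ^+ 2)%:E) by apply/mEFin; exact: mfunX.
apply: (@le_lt_trans _ _ (\int[P]_w ((C ^+ 2)%:E * (Y w ^+ 2)%:E))%E).
 apply: ge0_le_integral => //.
 - by move=> w _; rewrite lee_fin sqr_ge0.
 - by apply/mEFin; exact: mfunX.
 - exact: measurable_funeM.
 - move=> w _; rewrite -EFinM lee_fin -exprMn -[leLHS]real_normK ?num_real//.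
  rewrite -[leRHS]real_normK ?num_real// lerXn2r ?nnegrE//.
  by rewrite normrM; apply: le_trans (XY w) _; rewrite ler_wpM2r// ler_norm.
rewrite ge0_integralZl//; last 2 first.
- by move=> w _; rewrite lee_fin sqr_ge0.
- by rewrite lee_fin sqr_ge0.
by rewrite lte_mul_pinfty// lee_fin sqr_ge0.
Qed.

Lemma sqintM X Y : sqint X -> sqint Y -> intR P (fun w => X w * Y w).
move=> sX sY; have [mX _] := sX; have [mY _] := sY.
apply: (@le_integrable _ _ _ P setT mtop _ (fun w => (X w ^+ 2)%:E + (Y w ^+ 2)%:E)%E).
- by apply/mEFin; exact: mfunM.
- move=> w _; rewrite -EFinD /= lee_fin [leRHS]ger0_norm; last by apply: addr_ge0; exact: sqr_ge0.
 rewrite ler_norml; have := sqr_ge0 (X w); have := sqr_ge0 (Y w).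
 by have := sqr_ge0 (X w - Y w); have := sqr_ge0 (X w + Y w); rewrite sqrrB sqrrD; lra.
- by apply: integrableD => //; exact: sqint_integrable.
Qed.

Lemma sqint_cst (c : R) : sqint (fun=> c).
split => //; rewrite integral_cst//= probability_setT mule1; exact: ltry.
Qed.

Lemma sqint1 X : sqint X -> intR P X.
move=> sX; have := sqintM sX (sqint_cst 1).
by under eq_fun do rewrite mulr1.
Qed.
End square_integrable.

(** * Linear statistics of a stationary random measure *)

Section stationary.
Context d (Om : measurableType d) (R : realType) (n : nat).
Variables (P : probability Om R) (theta : measurable_flow Om R n).
Hypothesis htheta : preserves theta P.
Notation E := 'rV[R]_n.
Notation lambda := (@lebesgue_rV R n).

Lemma measurable_flow_at x : mfunT (theta x).
Proof. exact: (mcomp (flow_measurable theta) (measurable_pair2 x)). Qed.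
Lemma ge0_integral_flow x (h : Om -> \bar R) : mfunT h -> (forall w, 0 <= h w)%E ->
 (\int[P]_w h (theta x w) = \int[P]_w h w)%E.
move=> mh h0; have mt := measurable_flow_at x.
have := @ge0_integral_pushforward _ _ _ _ R _ mt P setT h mtop mh (fun w _ => h0 w).
rewrite preimage_setT => <-.
by apply: eq_measure_integral => A mA _; exact: htheta.
Qed.

Lemma integral_flow x (h : Om -> R) : intR P h ->
 \int[P]_w h (theta x w) = \int[P]_w h w.
move=> ih; have mt := measurable_flow_at x; have /integrableP[mh h1] := ih.
have ih' : intR P (fun w => h (theta x w)).
 apply/integrableP; split; first exact: (mcomp mh mt).
 rewrite (ge0_integral_flow x (h := fun w => `|(h w)%:E|%E))//.
 exact: mcomp.
have := @integral_pushforward _ _ _ _ R _ mt P setT (EFin \o h) mh.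
rewrite preimage_setT => /(_ ih' mtop) e.
rewrite /Rintegral; congr fine; rewrite -e.
by apply: eq_measure_integral => A mA _; exact: htheta.
Qed.
Variable nu : random_measure Om R n.
Hypothesis hnu : invariant_measure theta nu.
Hypothesis hnu2 : locally_square_integrable P nu.
Let lfnu w := random_measure_locally_finite nu w.

Lemma ge0_integral_nu_flow x w (f : E -> \bar R) : mfunT f -> (forall y, 0 <= f y)%E ->
 (\int[nu (theta x w)]_y f y = \int[nu w]_y f (y - x)%R)%E.
move=> mf f0.
have mt : mfunT (fun y : E => y - x) by exact: measurable_funB_rV.
have := @ge0_integral_pushforward _ _ _ _ R _ mt (nu w) setT f mtop mf (fun w _ => f0 w).
rewrite preimage_setT => <-.
apply: eq_measure_integral => A mA _; rewrite hnu// /pushforward; congr (nu w _).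
apply/seteqP; split => [y [b Ab <-]|y Ay]; first by rewrite /= addrK.
by exists (y - x) => //; rewrite subrK.
Qed.

Notation X := (lstat nu).
Let integrable_nu w f : tf f -> intR (nu w) f.
Proof. exact: tf_integrable. Qed.
Lemma statD f g w : tf f -> tf g -> X (fun x => f x + g x) w = X f w + X g w.
Proof. by move=> tff tfg; rewrite /lstat (int_tfD (lfnu w)). Qed.
Lemma statZ a f w : tf f -> X (fun x => a * f x) w = a * X f w.
Proof. by move=> tff; rewrite /lstat (int_tfZ (lfnu w)). Qed.
Lemma le_stat f g w : tf f -> tf g -> (forall x, f x <= g x) -> X f w <= X g w.
Proof. exact: le_int_tf. Qed.
Lemma stat_norm_le f g w : tf f -> tf g -> (forall x, `|f x| <= g x) -> `|X f w| <= X g w.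
move=> tff tfg fg; apply: le_trans (int_tf_norm (lfnu w) tff) _.
by apply: le_int_tf => //; exact: tf_norm.
Qed.

Lemma stat_shift f a w : tf f -> X (fun x => f (x + a)) w = X f (theta (- a) w).
move=> tff; rewrite /lstat /Rintegral; congr fine.
have mf : mfunT (EFin \o f) by apply/mEFin; case: tff.
rewrite [RHS]integralE [LHS]integralE.
rewrite !ge0_integral_nu_flow//; try exact: measurable_funepos; try exact: measurable_funeneg.
by congr (_ - _)%E; apply: eq_integral => x _; rewrite ?funeposE ?funenegE /= opprK.
Qed.

Lemma measurable_stat f : tf f -> mfunT (X f).
move=> [mf _ _]; rewrite /lstat /Rintegral.
apply: mcomp => //.
under eq_fun do rewrite integralE.
have mf' : mfunT (EFin \o f) by exact/mEFin.
by apply: emeasurable_funB; apply: measurable_fun_integral_kernel => //;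
 [exact: measurable_kernel|exact: measurable_funepos|exact: measurable_kernel|exact: measurable_funeneg].
Qed.
(** Square integrability is assumed on the Euclidean unit ball; the dyadic cell at the origin fits
    into it once its side is at most [1 / (n + 1)]. *)
Let small_box : exists N0, sqint P (X (bx N0 0)).
have e0 : 0 < (n%:R + 1)^-1 :> R by rewrite invr_gt0 ltr_wpDl.
have [N0 _ hN] := mesh_small e0; exists N0; have {hN} hN := hN N0 (leqnn _).
split; first exact: measurable_stat (tf_bx _ _).
apply: le_lt_trans hnu2.
have mb2 : measurable (@ball2 R n 1).
 rewrite (_ : ball2 1 = (fun x => dotv x x) @^-1` `]-oo, 1[%classic); last first.
  by apply/seteqP; split => x; rewrite /ball2/= in_itv/= /norm2 sqrt_lt1.
 rewrite -[X in measurable X]setTI.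
 have mdot : mfunT (fun x : E => dotv x x).
  apply: measurable_sum => i; apply: mfunM; exact: measurable_coord.
 by apply: mdot => //; exact: measurable_itv.
have mbx : measurable [set x : E | bx N0 0 x = 1 :> R].
 have [m _ _] := @tf_bx R n N0 0.
 by have := m mtop [set (1:R)] (measurable_set1 _); rewrite setTI.
apply: ge0_le_integral => //.
- by move=> w _; rewrite lee_fin sqr_ge0.
- by apply/mEFin; apply: mfunX; exact: measurable_stat (tf_bx _ _).
- by under eq_fun do rewrite expe2; apply: emfunM; exact: measurable_kernel.
move=> w _.
have -> : X (bx N0 0) w = fine (nu w [set x | bx N0 0 x = 1 :> R]).
 rewrite /lstat /Rintegral; congr fine.
 have := int_indic (nu w) mtop mbx; rewrite setIT => <-.
 apply: eq_integral => x _; rewrite indicE /bx; congr (_%:E).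
 case: (boolP [forall i, _]) => h; first by rewrite mem_set//= h.
 by rewrite memNset//= (negPf h) => /eqP; rewrite eq_sym oner_eq0.
have le1 : (nu w [set x | bx N0 0 x = 1%R :> R] <= nu w (ball2 1))%E.
 apply: le_measure; rewrite ?inE// => x /=; rewrite /bx.
 case: (boolP [forall i, _]) => [/forallP h _|_ /eqP]; last by rewrite eq_sym oner_eq0.
 rewrite /ball2/= /norm2 sqrt_lt1.
 apply: (@le_lt_trans _ _ (\sum_(i < n) (n%:R + 1)^-1)).
  apply: ler_sum => i _; have := h i; rewrite mxE add0r => /andP[x0 xh].
  via (x 0 i); last exact: le_trans (ltW xh) hN.
  rewrite ler_piMr// (le_trans (ltW xh))// (le_trans hN)// invf_le1 ?lerDr//.
 by rewrite sumr_const card_ord -[ltLHS]mulr_natl ltr_pdivrMr ?ltr_wpDl// mul1r ltrDl.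
have f1 : nu w [set x | bx N0 0 x = 1 :> R] \is a fin_num.
 rewrite ge0_fin_numE//; apply: lfnu => //.
 have [_ _ [t ht]] := @tf_bx R n N0 0.
 exists t; split; first exact: num_real.
 move=> M tM x /= hx; rewrite leNgt; apply/negP => Mx.
 by have := ht x (ltW (lt_trans tM Mx)); rewrite hx => /eqP; rewrite oner_eq0.
by rewrite EFin_expe fineK// !expe2 lee_pmul.
Qed.

Lemma tf_cube t : tf (\1_(cube t) : E -> R).
split; first exact: mindic (mcub t).
 by exists 1 => x; rewrite indicE; case: (_ \in _); rewrite ?normr1 ?normr0.
exists t => x tx; rewrite indicE memNset//.
by rewrite /cube/=; apply/negP; rewrite -leNgt.
Qed.

Lemma cube_indicE t (x : E) : \1_(cube t) x = (`|x| < t)%R%:R :> R.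
rewrite indicE; case: (ltP `|x| t) => h; first by rewrite mem_set.
by rewrite memNset// /cube/=; apply/negP; rewrite -leNgt.
Qed.

Lemma bx_shift N (c x : E) : bx N c x = bx N 0 (x - c) :> R.
rewrite /bx; congr (nat_of_bool _)%:R; apply: eq_forallb => i; rewrite !mxE add0r.
by rewrite subr_ge0 ltrBlDl.
Qed.

Lemma sum_bx_grid N J (x : E) : \sum_(r : @gindex n N J) bx N (grid r) x = (in_box J x)%:R :> R.
under eq_bigr do rewrite bx_grid.
have [Jx|Jx] := boolP (in_box J x); last first.
 rewrite big1// => r _; case: eqP => // e; have := @in_box_grid R n N J r.
 by rewrite -e in_box_cell (negPf Jx).
have [r rx] := grid_cell N Jx; rewrite (bigD1 r)//= rx eqxx big1 ?addr0// => s sr.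
by case: eqP => // e; move: sr; rewrite (@grid_inj R n N J s r) ?eqxx// rx.
Qed.

Lemma stat_ge0 f w : (forall x, 0 <= f x) -> 0 <= X f w.
Proof. by move=> f0; exact: Rintegral_ge0. Qed.
(** A cube of half-width [t] is covered by at most [(4 * 2^N0 * t)^n] translates of the small cell,
    which share one second moment by stationarity; the Cauchy-Schwarz inequality for sums squares
    their number. *)
Lemma growth : exists2 C : R, 0 <= C & forall t, 1 <= t ->
 (\int[P]_w ((X \1_(cube t) w) ^+ 2)%:E <= (C * t ^+ (2 * n))%:E)%E.
have [N0 [mX0 X02]] := small_box.
pose A := fine (\int[P]_w (X (bx N0 0) w ^+ 2)%:E).
have AE : (\int[P]_w (X (bx N0 0) w ^+ 2)%:E = A%:E)%E
 by rewrite fineK// ge0_fin_numE//; apply: int_ge0 => w _; rewrite lee_fin sqr_ge0.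
have A0 : 0 <= A by rewrite -lee_fin -AE; apply: int_ge0 => w _; rewrite lee_fin sqr_ge0.
have XN w (c : E) : X (bx N0 c) w = X (bx N0 0) (theta c w).
 rewrite (_ : bx N0 c = fun x => bx N0 0 (x + - c)); last by apply/funext => x; rewrite bx_shift.
 by rewrite stat_shift ?opprK//; exact: tf_bx.
have IXN c : (\int[P]_w (X (bx N0 c) w ^+ 2)%:E = A%:E)%E.
 under eq_integral do rewrite XN.
 rewrite (ge0_integral_flow c (h := fun w => (X (bx N0 0) w ^+ 2)%:E))//.
  by apply/mEFin; exact: mfunX.
 by move=> w; rewrite lee_fin sqr_ge0.
exists (((4 * 2 ^+ N0) ^+ n) ^+ 2 * A); first by rewrite mulr_ge0// exprn_ge0.
move=> t t1; pose K := (Num.truncn t).+1.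
have tK : t < K%:R by exact: truncnS_gt.
have Kt : K%:R <= 2 * t.
 have : (Num.truncn t)%:R <= t by rewrite truncn_le// (le_trans ler01 t1).
 by rewrite /K -natr1; lra.
pose I := @gindex n N0 K.
have le1 w : X \1_(cube t) w <= \sum_(s : I) X (bx N0 (grid s)) w.
 have tfb (s : I) : tf (@bx R n N0 (grid s)) by exact: tf_bx.
 rewrite /lstat -(int_tf_sum (lfnu w))//; apply: le_int_tf => //; first exact: tf_cube.
  exact: tf_sum.
 move=> x; rewrite sum_bx_grid cube_indicE ler_nat; case: ltP => // xt.
 by rewrite norm_in_box// (lt_trans xt).
have mb c : mfunT (fun w => (X (bx N0 c) w ^+ 2)%:E) by apply/mEFin; apply: mfunX; exact/measurable_stat/tf_bx.
via (\int[P]_w (#|I|%:R%:E * \sum_(s : I) (X (bx N0 (grid s)) w ^+ 2)%:E))%E.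
 apply: ge0_le_integral => //.
 - by move=> w _; rewrite lee_fin sqr_ge0.
 - by apply/mEFin; apply: mfunX; exact/measurable_stat/tf_cube.
 - by apply: measurable_funeM; apply: emeasurable_sum => s; exact: mb.
 - move=> w _; rewrite sumEFin -EFinM lee_fin; apply: le_trans (sqr_sum_le _).
  rewrite lerXn2r ?nnegrE//.
   by apply: stat_ge0 => x; rewrite indicE.
  by apply: sumr_ge0 => s _; apply: stat_ge0 => x; rewrite /bx.
rewrite ge0_integralZl//; last 2 first.
- by apply: emeasurable_sum => s; exact: mb.
- by move=> w _; apply: sume_ge0 => s _; rewrite lee_fin sqr_ge0.
rewrite ge0_integral_sum//; last by move=> s w _; rewrite lee_fin sqr_ge0.
under eq_bigr do rewrite IXN.
have cI : #|I|%:R <= (4 * 2 ^+ N0) ^+ n * t ^+ n :> R.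
 rewrite card_ffun !card_ord natrX -exprMn lerXn2r ?nnegrE//.
  by rewrite mulr_ge0 ?mulr_ge0 ?exprn_ge0//; lra.
 rewrite /gsize !natrM natrX [leRHS]mulrAC ler_wpM2r ?exprn_ge0//; lra.
rewrite sumEFin sumr_const -EFinM lee_fin.
via (#|I|%:R ^+ 2 * A); first by rewrite -[A *+ _]mulr_natl expr2 mulrA; exact: lexx.
rewrite [leRHS]mulrAC ler_wpM2r// mulnC exprM -exprMn lerXn2r ?nnegrE ?mulr_ge0 ?exprn_ge0//.
exact: le_trans t1.
Qed.

Lemma sqint_cube t : sqint P (X \1_(cube t)).
have [C C0 hC] := growth; split; first exact/measurable_stat/tf_cube.
apply: (@le_lt_trans _ _ (\int[P]_w (X \1_(cube (Num.max t 1)) w ^+ 2)%:E)%E).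
 apply: ge0_le_integral => //.
 - by move=> w _; rewrite lee_fin sqr_ge0.
 - by apply/mEFin; apply: mfunX; exact/measurable_stat/tf_cube.
 - by apply/mEFin; apply: mfunX; exact/measurable_stat/tf_cube.
 - move=> w _; rewrite lee_fin lerXn2r ?nnegrE//.
  + by apply: stat_ge0 => x; rewrite indicE.
  + by apply: stat_ge0 => x; rewrite indicE.
  + apply: le_stat; [exact: tf_cube|exact: tf_cube|move=> x].
   rewrite !cube_indicE ler_nat; case: ltP => // xt.
   by rewrite lt_max xt.
by apply: le_lt_trans (hC _ _) (ltry _); rewrite le_max lexx orbT.
Qed.

Lemma stat_le_cube f C t w : tf f -> (forall x, `|f x| <= C) -> off_cube t f ->
 `|X f w| <= C * X \1_(cube t) w.
move=> tff fC ft; rewrite -statZ; last exact: tf_cube.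
apply: stat_norm_le => //; first by apply: tfZ; exact: tf_cube.
move=> x; rewrite cube_indicE; case: ltP => h; first by rewrite mulr1.
by rewrite ft// normr0 mulr0.
Qed.

Lemma sqint_stat f : tf f -> sqint P (X f).
move=> tff; have [_ [C fC] [t ft]] := tff.
apply: (sqint_le (C := C) (measurable_stat tff) (sqint_cube t)) => w.
rewrite [X in _ * X]ger0_norm; last by apply: stat_ge0 => x; rewrite indicE.
exact: stat_le_cube.
Qed.
Definition second_moment f g : R := \int[P]_w (X f w * X g w).
Definition cov_stat f g : R :=
 second_moment f g - (\int[P]_w X f w) * (\int[P]_w X g w).

Lemma covariance_statE f g : tf f -> tf g ->
 covariance P (X f) (X g) = (cov_stat f g)%:E.
move=> tff tfg; have sf := sqint_stat tff; have sg := sqint_stat tfg.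
have fin h : intR P h -> (\int[P]_w (h w)%:E = (\int[P]_w h w)%:E)%E
 by move=> ih; rewrite /Rintegral fineK//; exact: integrable_fin_num.
have EE (h : Om -> R) : expectation P h = (\int[P]_w (h w)%:E)%E by rewrite unlock.
rewrite covarianceE.
- rewrite !EE (fin _ (sqint1 sf)) (fin _ (sqint1 sg)).
 by have -> : (\int[P]_w ((X f * X g) w)%:E)%E = _ := fin _ (sqintM sf sg).
- by apply/Lfun1_integrable; exact: sqint1.
- by apply/Lfun1_integrable; exact: sqint1.
- by apply/Lfun1_integrable; exact: sqintM.
Qed.

Lemma second_momentD f g h : tf f -> tf g -> tf h ->
 second_moment (fun x => f x + g x) h = second_moment f h + second_moment g h.
move=> tff tfg tfh; rewrite /second_moment.
rewrite -(RintegralD mtop (sqintM (sqint_stat tff) (sqint_stat tfh)) (sqintM (sqint_stat tfg) (sqint_stat tfh))).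
by apply: eq_Rint => w _; rewrite statD// mulrDl.
Qed.

Lemma second_momentZ a f h : tf f -> tf h ->
 second_moment (fun x => a * f x) h = a * second_moment f h.
move=> tff tfh; rewrite /second_moment -RintegralZl//; last exact: (sqintM (sqint_stat tff) (sqint_stat tfh)).
by apply: eq_Rint => w _; rewrite statZ// mulrA.
Qed.

Lemma second_moment_shift a f g : tf f -> tf g ->
 second_moment (fun x => f (x + a)) (fun x => g (x + a)) = second_moment f g.
move=> tff tfg; rewrite /second_moment.
under eq_Rint do rewrite !stat_shift//.
exact: (integral_flow (h := fun w => X f w * X g w) _ (sqintM (sqint_stat tff) (sqint_stat tfg))).
Qed.

Lemma mean_shift a f : tf f -> \int[P]_w X (fun x => f (x + a)) w = \int[P]_w X f w.
move=> tff; under eq_Rint do rewrite stat_shift//.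
exact: (integral_flow (h := X f) _ (sqint1 (sqint_stat tff))).
Qed.

Lemma meanD f g : tf f -> tf g ->
 \int[P]_w X (fun x => f x + g x) w = \int[P]_w X f w + \int[P]_w X g w.
move=> tff tfg; rewrite -(RintegralD mtop (sqint1 (sqint_stat tff)) (sqint1 (sqint_stat tfg))).
by apply: eq_Rint => w _; rewrite statD.
Qed.

Lemma meanZ a f : tf f -> \int[P]_w X (fun x => a * f x) w = a * \int[P]_w X f w.
move=> tff; rewrite -(RintegralZl _ mtop (sqint1 (sqint_stat tff))).
by apply: eq_Rint => w _; rewrite statZ.
Qed.

Lemma second_moment_ge0 f : 0 <= second_moment f f.
Proof. by apply: Rintegral_ge0 => w _; rewrite -expr2 sqr_ge0. Qed.
Lemma covariance_stat_ge0 f : tf f -> 0 <= cov_stat f f.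
move=> tff; have sf := sqint_stat tff; pose m := \int[P]_w X f w.
have : 0 <= \int[P]_w ((X f w - m) ^+ 2) by apply: Rintegral_ge0 => w _; exact: sqr_ge0.
have e w : (X f w - m) ^+ 2 = X f w * X f w + (- (2 * m) * X f w + m ^+ 2) by ring.
under eq_Rint do rewrite e.
have i1 := sqintM sf sf; have i2 := integrableZl mtop (- (2 * m)) (sqint1 sf).
have i3 := sqint1 (sqint_cst P (m ^+ 2)).
rewrite (RintegralD mtop i1 (integrableD mtop i2 i3)).
rewrite (RintegralD mtop i2 i3) (RintegralZl _ mtop (sqint1 sf)).
have -> : \int[P]_w (m ^+ 2) = m ^+ 2 by rewrite /Rintegral integral_cst//= probability_setT mule1.
rewrite -/m /cov_stat -/(second_moment f f) -/m.
by move=> h; apply: le_trans h _; apply: eq_ler; ring.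
Qed.

Lemma second_moment_cvg0 (f : nat -> E -> R) C t : (forall k, mfunT (f k)) ->
  (forall k x, `|f k x| <= C) -> (forall k, off_cube t (f k)) ->
  (forall x, f ^~ x @ \oo --> 0) -> (fun k => second_moment (f k) (f k)) @ \oo --> 0.
move=> mf fC ft f0; have tff k : tf (f k) by split; [exact: mf|exists C|exists t].
have sc := sqint_cube t.
have := @dominated_cvg _ _ _ P setT mtop (fun k w => (X (f k) w * X (f k) w)%:E) (fun w => 0%:E)
 (fun w => (C ^+ 2)%:E * (X \1_(cube t) w * X \1_(cube t) w)%:E)%E.
move=> h; have {}h := h _ _ _ _ _.
rewrite -[0]/(fine 0) -(@integral0 _ _ _ P setT); apply: fine_cvg; rewrite fineK; last by rewrite integral0.
apply: h.
- by move=> k; apply/mEFin; apply: mfunM; exact: measurable_stat.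
- move=> w _; apply: cvg_EFin; first exact: nearW.
 have Xw : (fun k => X (f k) w) @ \oo --> 0.
  have := int_tf_cvg (lfnu w) mf fC ft f0; rewrite /Rintegral integral0; exact.
 by rewrite -(mulr0 0); exact: cvgM.
- by [].
- by apply: integrableZl => //; exact: sqintM.
- move=> k w _; rewrite -EFinM /= lee_fin normrM expr2 mulrACA.
 by apply: ler_pM => //; exact: stat_le_cube.
Qed.

Lemma covariance_stat_le f : cov_stat f f <= second_moment f f.
Proof. by rewrite gerBl -expr2 sqr_ge0. Qed.
(** The cell masses add up to at most the mass of a slightly larger cube. Summed over all cells,
    mixed moments and means are thus bounded independently of [N], which is the source of [form_var]
    for both forms. *)
Lemma stat_grid N J : let S := \1_(cube (J%:R + 1)) : E -> R in
 \sum_(r : @gindex n N J) \sum_(s : @gindex n N J) second_moment (bx N (grid r)) (bx N (grid s))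
  <= second_moment S S /\
 \sum_(r : @gindex n N J) \int[P]_w X (bx N (grid r)) w <= \int[P]_w X S w.
move=> S; have tfb (s : @gindex n N J) : tf (@bx R n N (grid s)) by exact: tf_bx.
have sb s := sqint_stat (tfb s); have sc := sqint_cube (J%:R + 1).
have tS : tf (fun x : E => \sum_(s : @gindex n N J) bx N (grid s : E) x) by apply: (@tf_sum R n _ _ (fun s : @gindex n N J => bx N (grid s))).
pose Y w := \sum_(s : @gindex n N J) X (bx N (grid s)) w.
have X0 s w : 0 <= X (bx N (@grid R n N J s)) w by apply: stat_ge0 => x; rewrite /bx.
have YE w : Y w = X (fun x => \sum_(s : @gindex n N J) bx N (grid s) x) w
 by rewrite /Y /lstat -(int_tf_sum (lfnu w)).
have Yle w : Y w <= X S w.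
 rewrite YE; apply: le_stat => //; first exact: tf_cube.
 move=> x; rewrite sum_bx_grid /S cube_indicE ler_nat; case: (boolP (in_box J x)) => // /in_box_norm h.
 by rewrite (le_lt_trans h)// ltrDl.
have Y0 w : 0 <= Y w by exact: sumr_ge0.
split.
 rewrite (eq_bigr (fun r => \int[P]_w (X (bx N (grid r)) w * Y w))); last first.
  move=> r _; have [<- _] := @Rintegral_sum _ _ R P _ (index_enum (@gindex n N J)) (fun s w => X (bx N (grid r)) w * X (bx N (grid s)) w) (fun s => sqintM (sb r) (sb s)).
  by apply: eq_Rint => w _; rewrite mulr_sumr.
 have sY : sqint P Y by rewrite (_ : Y = X (fun x => \sum_(s : @gindex n N J) bx N (grid s) x)); [exact: sqint_stat|exact/funext].
 have [<- _] := @Rintegral_sum _ _ R P _ (index_enum (@gindex n N J)) (fun r w => X (bx N (grid r)) w * Y w) (fun r => sqintM (sb r) sY).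
 under eq_Rint do rewrite -mulr_suml.
 apply: (le_Rintegral mtop (sqintM sY sY) (sqintM sc sc)) => w _.
 by apply: ler_pM => //; exact: Yle.
have [<- iY] := @Rintegral_sum _ _ R P _ (index_enum (@gindex n N J)) (fun s w => X (bx N (grid s)) w) (fun s => sqint1 (sb s)).
by apply: (le_Rintegral mtop iY (sqint1 sc)) => w _; exact: Yle.
Qed.

(** The uncentred form is positive and stationary as well. Its spectrum may have an atom at 0 due to
    the mean, which is harmless for kernels of integral zero. *)
Lemma second_moment_form : covariance_form second_moment.
split.
- exact: second_momentD.
- exact: second_momentZ.
- by move=> f g _ _; apply: eq_Rint => w _; rewrite mulrC.
- by move=> f _; exact: second_moment_ge0.
- exact: second_moment_shift.
- exact: second_moment_cvg0.
move=> J; exists (second_moment \1_(cube (J%:R + 1)) \1_(cube (J%:R + 1))) => N.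
have [h _] := stat_grid N J; apply: le_trans h.
apply: ler_sum => r _; apply: ler_sum => s _; rewrite ger0_norm//.
by apply: Rintegral_ge0 => w _; rewrite mulr_ge0//; apply: stat_ge0 => x; rewrite /bx.
Qed.

Lemma covariance_stat_form : covariance_form cov_stat.
split.
- move=> f g h tff tfg tfh; rewrite /cov_stat (second_momentD tff tfg tfh) (meanD tff tfg).
 by rewrite mulrDl opprD addrACA.
- move=> a f h tff tfh; rewrite /cov_stat (second_momentZ a tff tfh) (meanZ a tff).
 by rewrite -mulrA -mulrBr.
- move=> f g tff tfg; rewrite /cov_stat (formC second_moment_form tff tfg).
 by rewrite [X in _ - X]mulrC.
- exact: covariance_stat_ge0.
- by move=> a f g tff tfg; rewrite /cov_stat (second_moment_shift a tff tfg) (mean_shift a tff) (mean_shift a tfg).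
- move=> f C t mf fC ft f0; apply: (squeeze_cvgr _ _ (second_moment_cvg0 mf fC ft f0)); last exact: cvg_cst.
 apply: nearW => k; rewrite covariance_stat_le covariance_stat_ge0//.
 by split; [exact: mf|exists C|exists t].
move=> J; set S := \1_(cube (J%:R + 1)) : E -> R.
exists (second_moment S S + (\int[P]_w X S w) ^+ 2) => N.
have [h1 h2] := stat_grid N J; rewrite -/S in h1 h2.
have m0 (r : @gindex n N J) : 0 <= \int[P]_w X (@bx R n N (grid r)) w
 by apply: Rintegral_ge0 => w _; apply: stat_ge0 => x; rewrite /bx.
have e2 : (\sum_(r : @gindex n N J) \int[P]_w X (bx N (grid r)) w) ^+ 2 <= (\int[P]_w X S w) ^+ 2.
 have s0 : 0 <= \sum_(r : @gindex n N J) \int[P]_w X (@bx R n N (grid r)) w by exact: sumr_ge0.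
 by rewrite lerXn2r ?nnegrE ?s0 ?(le_trans s0 h2).
apply: le_trans (lerD h1 e2); rewrite expr2 mulr_suml -big_split/=.
apply: ler_sum => r _; rewrite mulr_sumr -big_split/=; apply: ler_sum => s _.
have s0 : 0 <= second_moment (bx N (grid r)) (bx N (grid s))
 by apply: Rintegral_ge0 => w _; rewrite mulr_ge0//; apply: stat_ge0 => x; rewrite /bx.
rewrite /cov_stat; apply: le_trans (ler_normB _ _) _.
by rewrite (ger0_norm s0) (ger0_norm (mulr_ge0 (m0 r) (m0 s))) lexx.
Qed.
End stationary.

(** * Comparison of the Euclidean norm with the sup norm *)

Section norm2_theory.
Context {R : realType} {n : nat}.
Notation E := 'rV[R]_n.

Lemma measurable_norm2 : mfunT (@norm2 R n).
apply: mcomp; first exact: cont_mfun (@sqrt_continuous R).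
by apply: measurable_sum => i; apply: mfunM; exact: measurable_coord.
Qed.

Lemma norm2_ge0 (x : E) : 0 <= norm2 x. Proof. exact: sqrtr_ge0. Qed.

Lemma norm_le_norm2 (x : E) : `|x| <= norm2 x.
apply: norm_le_coord => [|i]; first exact: norm2_ge0.
rewrite -sqrtr_sqr; apply: ler_wsqrtr; rewrite /dotv (bigD1 i)//= expr2 lerDl.
by apply: sumr_ge0 => j _; rewrite -expr2 sqr_ge0.
Qed.

Lemma norm2_le (x : E) : norm2 x <= n%:R * `|x|.
rewrite -[leRHS]ger0_norm ?mulr_ge0// -sqrtr_sqr; apply: ler_wsqrtr.
case: n x => [|n' x]; first by move=> x; rewrite /dotv big_ord0 sqr_ge0.
rewrite exprMn; via (n'.+1%:R * `|x| ^+ 2).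
 rewrite /dotv; via (\sum_(i < n'.+1) `|x| ^+ 2).
  apply: ler_sum => i _; rewrite -expr2 -real_normK ?num_real//.
  exact: (lerXn2r 2 (normr_ge0 _) (normr_ge0 x) (le_coord_norm x i)).
 by rewrite sumr_const card_ord mulr_natl.
by rewrite ler_wpM2r ?sqr_ge0// expr2 -natrM ler_nat leq_pmulr.
Qed.
End norm2_theory.

(** * Measures with a density *)

Section density.
Context {R : realType} {n : nat}.
Notation E := 'rV[R]_n.
Variables (m : meas E R) (h : E -> R).
Hypotheses (mh : mfunT h) (h0 : forall x, 0 <= h x).
Definition density (A : set E) : \bar R := (\int[m]_x (h x * \1_A x)%:E)%E.
Let density0 : density set0 = 0%E.
Proof. by rewrite /density integral0_eq// => x _; rewrite indic0 mulr0. Qed.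
Let density_ge0 A : (0 <= density A)%E.
Proof. by apply: int_ge0 => x _; rewrite lee_fin mulr_ge0. Qed.
Let density_sigma_additive : semi_sigma_additive density.
apply: (@integral_semi_sigma_additive _ _ _ _ _ m setT (fun x A => (h x * \1_A x)%:E)) => //.
- move=> x F mF tF mUF.
 rewrite [X in X @ _ --> _](_ : _ = fun k =>
  ((h x)%:E * \sum_(0 <= i < k) (@dirac _ _ x R (F i)))%E); last first.
  by apply/funext => k; rewrite ge0_sume_distrr.
 by rewrite EFinM; apply: cvgeZl => //; exact: (@measure_semi_sigma_additive _ _ R (dirac x)).
- by move=> x A; rewrite lee_fin mulr_ge0.
- by move=> A mA; apply/mEFin; apply: mfunM => //; exact: mindic.
Qed.
Definition density_measure : meas E R :=
 HB.pack density (isMeasure.Build _ _ _ density density0 density_ge0 density_sigma_additive).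

Import HBNNSimple.
Let integral_density_nnsfun (g : {nnsfun E >-> R}) :
 (\int[density_measure]_x (g x)%:E = \int[m]_x (h x * g x)%:E)%E.
rewrite integralT_nnsfun sintegralE.
rewrite (eq_integral (fun x => \sum_(y \in range g) (y * (h x * \1_(g @^-1` [set y]) x))%:E)%E); last first.
 move=> x _; rewrite {1}(fimfunE g) mulr_fsumr -fsumEFin//.
 by apply: eq_fsbigr => y _; rewrite mulrCA.
rewrite ge0_integral_fsum//.
- apply: eq_fsbigr => y; rewrite inE => -[x _ <-].
 under [RHS]eq_integral do rewrite EFinM.
 rewrite ge0_integralZl//.
 + by apply/mEFin; apply: mfunM => //; exact: mindic.
 + by move=> z _; rewrite lee_fin mulr_ge0.
 + by rewrite lee_fin.
- move=> y; apply/mEFin; apply: mfunM => //; exact: mfunM.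
- move=> y x _; rewrite lee_fin.
 case: (ltP y 0) => y0; last by rewrite !mulr_ge0.
 by rewrite preimage_nnfun0// indic0 !mulr0.
Qed.

Lemma ge0_integral_density (f : E -> R) : mfunT f -> (forall x, 0 <= f x) ->
 (\int[density_measure]_x (f x)%:E = \int[m]_x (h x * f x)%:E)%E.
move=> mf f0; have mf' : mfunT (EFin \o f) by exact/mEFin.
pose f_ := nnsfun_approx mtop mf'.
have fcvg x : (fun k => (f_ k x)%:E) @ \oo --> (f x)%:E
 by apply: (cvg_nnsfun_approx mtop mf') => // y _; rewrite lee_fin.
transitivity (limn (fun k => \int[density_measure]_x (f_ k x)%:E)%E).
 rewrite -monotone_convergence//.
 - by apply: eq_integral => y _; apply/esym/cvg_lim.
 - by move=> k; exact/mEFin/mfunP.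
 - by move=> k y _; rewrite lee_fin.
 - by move=> y _ k l kl; rewrite lee_fin; exact/lefP/nd_nnsfun_approx.
under eq_fun do rewrite integral_density_nnsfun.
rewrite -monotone_convergence//.
- apply: eq_integral => y _; apply/cvg_lim => //.
 by under eq_fun do rewrite EFinM; rewrite EFinM; apply: cvgeZl.
- by move=> k; apply/mEFin; apply: mfunM.
- by move=> k y _; rewrite lee_fin mulr_ge0.
- by move=> y _ k l kl; rewrite lee_fin ler_wpM2l//; exact/lefP/nd_nnsfun_approx.
Qed.

Lemma Rintegral_density (f : E -> R) : tf f -> loc_fin density_measure ->
 \int[density_measure]_x f x = \int[m]_x (h x * f x).
move=> tff lfd; rewrite /Rintegral; congr fine; rewrite [LHS]integralE [RHS]integralE.
have [mf _ _] := tff.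
have e1 : (fun x => (f x)%:E)^\+%E = fun x => (Num.max (f x) 0)%:E by apply/funext => x; rewrite funeposE EFin_max.
have e2 : (fun x => (f x)%:E)^\-%E = fun x => (Num.max (- f x) 0)%:E by apply/funext => x; rewrite funenegE EFin_max.
have e3 : (fun x => (h x * f x)%:E)^\+%E = fun x => (h x * Num.max (f x) 0)%:E
 by apply/funext => x; rewrite funeposE maxr_pMr// mulr0 EFin_max.
have e4 : (fun x => (h x * f x)%:E)^\-%E = fun x => (h x * Num.max (- f x) 0)%:E
 by apply/funext => x; rewrite funenegE maxr_pMr// mulr0 mulrN EFin_max.
rewrite e1 e2 e3 e4 !ge0_integral_density//.
- by apply: measurable_maxr => //; exact: mcomp.
- by move=> x; rewrite le_max lexx orbT.
- by apply: measurable_maxr.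
- by move=> x; rewrite le_max lexx orbT.
Qed.
End density.

Lemma measurable_linear_statistic d (Om : measurableType d) (R : realType) n
  (m : Om -> (meas 'rV[R]_n R)) (f : 'rV[R]_n -> R) :
 (forall A, measurable A -> mfunT (fun w => m w A)) -> mfunT f ->
 mfunT (lstat m f).
move=> mm mf; rewrite /lstat /Rintegral; apply: mcomp => //.
under eq_fun do rewrite integralE.
have mf' : mfunT (EFin \o f) by exact/mEFin.
by apply: emeasurable_funB; apply: measurable_fun_integral_kernel => //;
 [exact: measurable_funepos|exact: measurable_funeneg].
Qed.

Lemma measurable_ball2 (R : realType) n (r : R) : measurable (@ball2 R n r).
rewrite (_ : ball2 r = (fun x => norm2 x) @^-1` `]-oo, r[%classic); last first.
 by apply/seteqP; split => x; rewrite /ball2/= in_itv.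
by rewrite -[X in measurable X]setTI; exact: measurable_norm2.
Qed.

(** * Regular versions of random measures *)

Section regularization.
Context d (Om : measurableType d) (R : realType) (n : nat).
Variables (P : probability Om R) (theta : measurable_flow Om R n).
Notation E := 'rV[R]_n.
Variable m : Om -> (meas E R).
Hypothesis mm : forall A, measurable A -> mfunT (fun w => m w A).
(** Where local finiteness fails the measure is set to 0. This keeps measurability in [w] and
    produces a [random_measure], to which the stationary theory applies. *)
Definition regularize (w : Om) : meas E R :=
 if `[< loc_fin (m w) >] then m w else mzero.

Lemma regularizeE w : loc_fin (m w) -> regularize w = m w.
Proof. by move=> lf; rewrite /regularize; case: asboolP. Qed.
Lemma regularize_lf w : loc_fin (regularize w).
Proof. by rewrite /regularize; case: asboolP => // _ A _ _; rewrite /mzero/= ltry. Qed.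
Lemma locally_finiteP (mu : meas E R) :
 loc_fin mu <-> forall k : nat, (mu (cube k%:R) < +oo)%E.
split=> [lf k|h A mA [M [Mr hM]]]; first by apply: lf; [exact: mcub|exact: bounded_cube].
apply: le_lt_trans (h (Num.truncn (M + 1)).+1); apply: le_measure; rewrite ?inE//.
 exact: mcub.
move=> x Ax; rewrite /cube/=; apply: le_lt_trans (truncnS_gt _).
by apply: (hM (M + 1)) => //; rewrite ltrDl.
Qed.
Let lfset := [set w | loc_fin (m w)].
Let lfsetE : lfset = \bigcap_k [set w | (m w (cube k%:R) < +oo)%E].
apply/seteqP; split => w; first by move=> /locally_finiteP h k _; exact: h.
by move=> h; apply/locally_finiteP => k; exact: h k I.
Qed.
Let measurable_lfset : measurable lfset.
rewrite lfsetE; apply: bigcapT_measurable => k.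
rewrite -[X in measurable X]setTI.
by apply: emeasurable_fun_infty_o => //; exact: mm (mcub _).
Qed.
Let measurable_regularize A : measurable A -> mfunT (fun w => regularize w A).
move=> mA; rewrite (_ : (fun w => _) = fun w => if w \in lfset then m w A else 0%E); last first.
 apply/funext => w; rewrite /regularize; case: asboolP => h; first by rewrite mem_set.
 by rewrite memNset.
apply: measurable_fun_ifT => //; last exact: mm.
apply: (measurable_fun_bool true); rewrite setTI.
have -> : (fun w => w \in lfset) @^-1` [set true] = lfset
 by apply/seteqP; split => w /= h; [exact: set_mem|exact: mem_set].
exact: measurable_lfset.
Qed.
Definition regular_kernel : R.-ker Om ~> E :=
 HB.pack regularize (isKernel.Build _ _ _ _ _ regularize measurable_regularize).
Definition regular_measure : random_measure Om R n :=
 @RandomMeasure _ _ _ _ regular_kernel regularize_lf.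

Lemma cube_shift_sub (x : E) k : exists k' : nat,
 [set b + x | b in cube k%:R] `<=` cube k'%:R /\ measurable [set b + x | b in cube k%:R].
exists (Num.truncn (k%:R + `|x|)).+1; split.
 move=> _ [b bk <-]; rewrite /cube/=; apply: lt_trans (truncnS_gt _).
 by apply: le_lt_trans (ler_normD _ _) _; rewrite ltrD2r.
rewrite (_ : [set _ | _ in _] = (fun y : E => y - x) @^-1` cube k%:R).
 rewrite -[X in measurable X]setTI; apply: measurable_funB_rV => //; exact: mcub.
apply/seteqP; split => [_ [b bk <-]|y yk]; first by rewrite /= addrK.
by exists (y - x) => //; rewrite subrK.
Qed.

(** Local finiteness of [m w] is itself invariant under the flow, so [m w] and its translates are
    replaced by 0 simultaneously. *)
Lemma regular_invariant : (forall w x A, measurable A -> m (theta x w) A = m w [set b + x | b in A]) ->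
 invariant_measure theta regular_measure.
move=> hm w x A mA.
have lf1 u y : loc_fin (m u) -> loc_fin (m (theta y u)).
 move=> /locally_finiteP lf; apply/locally_finiteP => k.
 have [k' [kk' mk]] := cube_shift_sub y k.
 rewrite hm; last exact: mcub.
 apply: le_lt_trans (lf k'); apply: le_measure; rewrite ?inE//; exact: mcub.
have lf2 : loc_fin (m (theta x w)) -> loc_fin (m w)
 by move=> /(lf1 _ (- x)); rewrite -[theta (- x) _]/((theta (- x) \o theta x) w) -flowD addNr flow0.
rewrite /= /regularize; case: asboolP => h; case: asboolP => h' //.
- exact: hm.
- by case: h'; exact: lf2.
- by case: h; exact: lf1.
Qed.
Hypothesis m2 : forall k : nat, (\int[P]_w (m w (cube k%:R) ^+ 2) < +oo)%E.

Lemma ae_locally_finite : {ae P, forall w, loc_fin (m w)}.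
have mE k : mfunT (fun w => (m w (cube k%:R) ^+ 2)%E)
 by under eq_fun do rewrite expe2; apply: emfunM; exact: mm (mcub _).
have e0 k w : (0 <= m w (cube k%:R) ^+ 2)%E by rewrite expe2 mule_ge0.
have h (k : nat) : {ae P, forall w, (m w (cube k%:R) ^+ 2)%E \is a fin_num}.
 have := @integrable_ae _ _ _ P setT mtop (fun w => (m w (cube k%:R) ^+ 2)%E).
 move=> /(_ _); have i : P.-integrable setT (fun w => (m w (cube k%:R) ^+ 2)%E).
  apply/integrableP; split; first exact: mE.
  by under eq_integral do rewrite gee0_abs//.
 by move=> /(_ i); apply: filterS => w; apply.
have := ae_foralln h; apply: filterS => w hw; apply/locally_finiteP => k.
rewrite ltey; apply/eqP => e; have := hw k.
by rewrite e expe2 mulyy.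
Qed.

Lemma ae_eq_regular f : {ae P, forall w, lstat m f w = lstat regular_measure f w}.
by have := ae_locally_finite; apply: filterS => w lf; rewrite /lstat /= regularizeE.
Qed.

Lemma square_integrable_of_cube : locally_square_integrable P m.
have mb : measurable (@ball2 R n 1) := @measurable_ball2 R n 1.
apply: le_lt_trans (m2 1); apply: ge0_le_integral => //.
- by move=> w _; rewrite expe2 mule_ge0.
- by under eq_fun do rewrite expe2; apply: emfunM; exact: mm.
- by under eq_fun do rewrite expe2; apply: emfunM; exact: mm (mcub _).
move=> w _; rewrite !expe2; have le1 : (m w (ball2 1) <= m w (cube 1%:R))%E.
 apply: le_measure; rewrite ?inE//; first exact: mcub.
 by move=> x; apply: le_lt_trans; exact: norm_le_norm2.
exact: lee_pmul.
Qed.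

Lemma regular_square_integrable : locally_square_integrable P regular_measure.
have mb : measurable (@ball2 R n 1) := @measurable_ball2 R n 1.
apply: le_lt_trans square_integrable_of_cube; apply: ge0_le_integral => //.
- by move=> w _; rewrite expe2 mule_ge0.
- by under eq_fun do rewrite expe2; apply: emfunM; exact: measurable_kernel.
- by under eq_fun do rewrite expe2; apply: emfunM; exact: mm.
move=> w _; rewrite /= /regularize; case: asboolP => _ //.
by rewrite /mzero mul0e mule_ge0.
Qed.

Lemma covariance_regular f g : mfunT f -> mfunT g ->
 covariance P (lstat m f) (lstat m g) =
 covariance P (lstat regular_measure f) (lstat regular_measure g).
move=> mf mg.
have EE (h : Om -> R) : expectation P h = (\int[P]_w (h w)%:E)%E by rewrite unlock.
have mX h : mfunT h -> mfunT (lstat m h) := measurable_linear_statistic mm.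
have mY h : mfunT h -> mfunT (lstat regular_measure h)
 by move=> mh; apply: measurable_linear_statistic => // A mA; exact: measurable_kernel.
have aeE (u v : Om -> R) : mfunT u -> mfunT v ->
  {ae P, forall w, u w = v w} -> (\int[P]_w (u w)%:E = \int[P]_w (v w)%:E)%E.
 move=> mu mv uv; apply: ae_eq_integral => //; try exact/mEFin.
 by apply: filterS uv => w -> _.
have mf1 := aeE _ _ (mX f mf) (mY f mf) (ae_eq_regular f).
have mg1 := aeE _ _ (mX g mg) (mY g mg) (ae_eq_regular g).
rewrite covariance.unlock !EE mf1 mg1.
apply: aeE.
- by apply: mfunM; apply: mfunB => //; [exact: mX|exact: mX].
- by apply: mfunM; apply: mfunB => //; [exact: mY|exact: mY].
apply: filterS2 (ae_eq_regular f) (ae_eq_regular g) => w e1 e2.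
set c1 := fine _; set c2 := fine _.
by rewrite -[LHS]/((lstat m f w - c1) * (lstat m g w - c2)) e1 e2.
Qed.
End regularization.

(** * Derivative chains, Taylor remainders and the one-dimensional bump *)

Section chains.
Context {R : realType}.
Implicit Types (t a : R) (u : nat -> R -> R).
(** The successive derivatives are carried along as an explicit family, so that iterated derivatives
    need not be formed. *)
Definition chain K u := forall i, (i < K)%N -> forall t, is_derive t 1 (u i) (u i.+1 t).

Lemma mean_value_le (g g' : R -> R) (M s t : R) : (forall x : R, is_derive x 1 g (g' x)) ->
 (forall x, Num.min s t <= x <= Num.max s t -> `|g' x| <= M) -> `|g s - g t| <= M * `|s - t|.
move=> dg; wlog ts : s t / t <= s => [H gM|].
 have [|/ltW st] := leP t s; first by move=> ts; apply: H.
 by rewrite (distrC (g s)) (distrC s); apply: H => // x; rewrite minC maxC; exact: gM.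
rewrite min_r// max_l// => gM.
have [|c ct ->] := @MVT_segment R g g' t s ts.
 by apply: continuous_subspaceT => x; apply: differentiable_continuous; apply/derivable1_diffP; have [] := dg x.
by rewrite normrM ler_wpM2r// gM//; move: ct; rewrite in_itv.
Qed.

Lemma chain_shift K u : chain K.+1 u -> chain K (fun i => u i.+1).
Proof. by move=> cu i iK t; exact: cu. Qed.
(** Encoded as a polynomial in [z], so that its derivative in [z] is formal. *)
Definition taylor m u x z : R := (\poly_(a < m) (u a x / a`!%:R)).[z].

Lemma taylorE m u x z : taylor m u x z = \sum_(a < m) u a x / a`!%:R * z ^+ a.
Proof. by rewrite /taylor horner_poly. Qed.
(** Induction on the order: the derivative in [z] of the remainder is the remainder of one order
    less for the derivative, and the mean value theorem adds a factor [|z|]. This crude form carries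
    no factorial. *)
Lemma taylor_remainder m u M x z : chain m u -> (forall t, `|u m t| <= M) ->
 `|u 0%N (x + z) - taylor m u x z| <= M * `|z| ^+ m.
elim: m u z => [|m IH] u z cu uM.
 by rewrite taylorE big_ord0 subr0 expr0 mulr1.
have M0 : 0 <= M by apply: le_trans (uM 0).
pose p := \poly_(a < m.+1) (u a x / a`!%:R).
pose g y := u 0%N (x + y) - p.[y].
have dg (y : R) : is_derive y 1 g (u 1%N (x + y) - taylor m (fun i => u i.+1) x y).
 have d1 : is_derive y 1 (fun y => u 0%N (x + y)) (u 1%N (x + y)).
  have h := cu 0%N (ltn0Sn _) (x + y).
  have := @is_derive1_comp _ (u 0%N) (fun y => x + y) y _ 1 h.
  rewrite mulr1; apply.
  by have := is_deriveD (is_derive_cst x y 1) (is_derive_id y 1); rewrite add0r.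
 have -> : taylor m (fun i => u i.+1) x y = (p^`()).[y].
  rewrite /taylor; congr (_.[_]); apply/polyP => i; rewrite coef_deriv !coef_poly ltnS.
  case: ltnP => im; last by rewrite mul0rn.
  rewrite factS natrM -mulr_natr; field.
  by rewrite !pnatr_eq0 -lt0n fact_gt0/=.
 exact: is_deriveB.
have g0 : g 0 = 0.
 rewrite /g addr0 horner_coef0 coef_poly/= fact0 divr1 subrr//.
have := @mean_value_le g _ (M * `|z| ^+ m) z 0 dg.
rewrite g0 !subr0 exprSr mulrA; apply => y yz.
apply: le_trans (IH _ _ (chain_shift cu) uM) _.
rewrite ler_wpM2l// lerXn2r ?nnegrE//.
move: yz; case: (leP z 0) => z0; case/andP => y1 y2.
 by rewrite !ler0_norm// lerN2.
by rewrite !ger0_norm// ltW.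
Qed.
Definition delta a (g : R -> R) t := g t - g (t - a).

(** Each difference uses up one derivative and gains a factor [|a|] by the mean value theorem. *)
Lemma delta_iter_le K u M a t : chain K u -> (forall t, `|u K t| <= M) ->
 `|iter K (delta a) (u 0%N) t| <= `|a| ^+ K * M.
elim: K u M => [|K IH] u M cu uM; first by rewrite expr0 mul1r; exact: uM.
rewrite iterSr exprSr -mulrA; apply: (IH (fun i => delta a (u i)) (`|a| * M)).
 move=> i iK s; apply: is_deriveB; first by apply: cu; exact: ltnW.
 have h := cu i (ltnW iK) (s - a).
 have := @is_derive1_comp _ (u i) (fun y => y - a) s _ 1 h.
 rewrite mulr1; apply.
 by have := is_deriveB (is_derive_id s 1) (is_derive_cst a s 1); rewrite subr0.
move=> s; rewrite /delta; have := @mean_value_le (u K) (u K.+1) M s (s - a) (cu K (ltnSn _)).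
have -> : s - (s - a) = a by ring.
 by rewrite mulrC; apply => x _; exact: uM.
Qed.
Definition phi M (s : R) := Num.max 0 s ^+ M.

Lemma phi_ge0 M s : 0 <= phi M s. Proof. by rewrite exprn_ge0// le_max lexx. Qed.

Lemma phi_neg M s : s <= 0 -> phi M.+1 s = 0.
Proof. by move=> s0; rewrite /phi (max_idPl _) ?expr0n. Qed.
Lemma phi_pos M s : 0 <= s -> phi M s = s ^+ M.
Proof. by move=> s0; rewrite /phi (max_idPr _). Qed.
Lemma is_derive_phi M (s : R) : is_derive s 1 (phi M.+2) (M.+2%:R * phi M.+1 s).
have [s0|s0|<-] := ltgtP 0 s.
- rewrite phi_pos ?ltW//; apply: (@near_eq_is_derive _ _ _ (fun x : R => x ^+ M.+2)).
  by near=> x; rewrite phi_pos// ltW//; near: x; exact: lt_nbhsr.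
 rewrite (_ : (fun x => x ^+ M.+2) = horner ('X^(M.+2))); last by apply/funext => x; rewrite hornerXn.
 by apply: is_derive_eq; rewrite derivXn hornerMn hornerXn mulr_natl.
- rewrite phi_neg ?ltW// mulr0; apply: (@near_eq_is_derive _ _ _ (cst 0)).
  by near=> x; rewrite phi_neg// ltW//; near: x; exact: lt_nbhsl.
(* At the junction point 0 the difference quotient is [phi M.+1], continuous and zero there, so
   Caratheodory's criterion applies. *)
rewrite phi_neg// mulr0; apply/is_derive1_caratheodory; exists (phi M.+1); split.
- move=> z; rewrite (phi_neg _ (lexx 0)) !subr0 /phi [LHS]exprSr.
 by case: (leP 0 z) => z0//; rewrite exprS !mul0r.
- apply: (@continuous_comp _ _ _ (fun t : R => Num.max 0 t) (fun t => t ^+ M.+1)); last exact: exprn_continuous.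
 by apply: continuous_max; [exact: cst_continuous|exact: id].
- exact: phi_neg.
Unshelve. all: by end_near.
Qed.
Variable N : nat.

(** The polynomial factors in the derivatives of [(1 - t^2)^N]: differentiating
    [p * (1 - t^2)^(N-j)] leaves [(1 - t^2)^(N-j-1)] times the next polynomial. *)
Fixpoint bump_poly (j : nat) : {poly R} :=
 if j is j'.+1 then
  (bump_poly j')^`() * (1 - 'X ^+ 2) - (2 * (N - j')%:R) *: ('X * bump_poly j')
 else 1.
(** The [a]-th derivative of the truncated power [max(0, 1 - t^2)^N], for [a < N]. Finitely many
    derivatives suffice, and everything stays explicit. *)
Definition bump (a : nat) t : R := (bump_poly a).[t] * phi (N - a) (1 - t ^+ 2).

Lemma bump_chain K : (K < N)%N -> chain K bump.
move=> KN i iK t; rewrite /bump /=.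
have [M e] : exists M, (N - i)%N = M.+2 by exists (N - i).-2; lia.
have e1 : (N - i.+1)%N = M.+1 by lia.
rewrite e e1.
have d1 : is_derive t 1 (fun t : R => 1 - t ^+ 2) (- (2 * t)).
 rewrite (_ : (fun t => 1 - t ^+ 2) = horner (1 - 'X^2)); last by apply/funext => x; rewrite !hornerE.
 by apply: is_derive_eq; rewrite derivB derivC sub0r derivXn hornerN hornerMn hornerX mulr_natl.
have d2 := @is_derive1_comp _ (phi M.+2) (fun t => 1 - t ^+ 2) t _ _ (is_derive_phi M (1 - t ^+ 2)) d1.
have e3 : (fun t0 => (bump_poly i).[t0] * phi M.+2 (1 - t0 ^+ 2)) =
 horner (bump_poly i) * (phi M.+2 \o (fun t => 1 - t ^+ 2)) by [].
rewrite e3; apply: (is_derive_eq (is_deriveM (is_derive_poly (bump_poly i) t) d2)); rewrite /GRing.scale/= !hornerE/=.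
have -> : phi M.+2 (1 - t ^+ 2) = (1 - t ^+ 2) * phi M.+1 (1 - t ^+ 2).
 rewrite /= /phi exprS; case: (leP 0 (1 - t ^+ 2)) => h//.
 by rewrite !exprS !mul0r mulr0.
by ring.
Qed.

Lemma bump_support (a : nat) t : (a < N)%N -> 1 <= `|t| -> bump a t = 0.
move=> aN t1; rewrite /bump; have [M ->] : exists M, (N - a)%N = M.+1 by exists (N - a).-1; lia.
rewrite phi_neg ?mulr0// subr_le0 -real_normK ?num_real// exprn_ege1//.
Qed.

Lemma bump_bounded (a : nat) : exists2 M, 0 <= M & forall t, (a < N)%N -> `|bump a t| <= M.
exists (\sum_(i < size (bump_poly a)) `|(bump_poly a)`_i|); first exact: sumr_ge0.
move=> t aN; have [t1|t1] := leP 1 `|t|; first by rewrite bump_support// normr0 sumr_ge0.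
rewrite /bump normrM (ger0_norm (phi_ge0 _ _)).
apply: (@le_trans _ _ `|(bump_poly a).[t]|).
 rewrite ler_piMr// /phi exprn_ile1// ?le_max ?lexx// ge_max ler01/= gerBl sqr_ge0//.
rewrite horner_coef; apply: le_trans (ler_norm_sum _ _ _) _; apply: ler_sum => i _.
by rewrite normrM ler_piMr// normrX exprn_ile1// ltW.
Qed.

Lemma bump0_ge0 t : 0 <= bump 0 t.
Proof. by rewrite /bump hornerE mul1r phi_ge0. Qed.
Lemma bump0_le1 t : bump 0 t <= 1.
Proof. by rewrite /bump hornerE mul1r exprn_ile1// ?le_max ?lexx// ge_max ler01/= gerBl sqr_ge0. Qed.
Lemma bump0_gt t : `|t| <= 2^-1 -> 2^-1 ^+ N <= bump 0 t.
move=> th; have t2 : t ^+ 2 <= 2^-1.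
 rewrite -real_normK ?num_real// expr2 (le_trans (ler_pM _ _ th th))//; lra.
by rewrite /bump hornerE mul1r subn0 phi_pos ?lerXn2r ?nnegrE//; lra.
Qed.

Lemma bump_continuous (a : nat) : (a < N)%N -> continuous (bump a).
move=> aN t; rewrite /bump; apply: continuousM; first exact: continuous_horner.
apply: (@continuous_comp _ _ _ (fun t => Num.max 0 (1 - t ^+ 2)) (fun t => t ^+ (N - a))).
 apply: continuous_max; first exact: cst_continuous.
 by apply: continuousB; [exact: cst_continuous|exact: exprn_continuous].
exact: exprn_continuous.
Qed.
End chains.

(** * Multi-indices and the Taylor expansion of the product bump *)

Section mindex.
Context {R : realType} {n : nat}.
Notation E := 'rV[R]_n.
Implicit Types (x z : E).
Variables (m K : nat).
(** Up to [m] derivatives serve the Taylor expansion and [K] more the decay of the transforms of its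
    coefficients; the additional 1 keeps the last derivative continuous. *)
Let N := (m + K).+1.
(** Each exponent is below [m], which loses nothing in total degree below [m]. *)
Definition mindex := {ffun 'I_n -> 'I_m}.
Definition mdeg (j : mindex) : nat := (\sum_i j i)%N.
Definition monomial (j : mindex) z : R := \prod_i z 0 i ^+ j i.
(** The [a]-th derivative of the [b]-th one-dimensional Taylor coefficient. *)
Definition bump_factor (b a : nat) (t : R) : R := bump N (b + a) t / b`!%:R.
Definition bump_coef (j : mindex) x : R := \prod_i bump_factor (j i) 0 (x 0 i).
Definition bumps x : R := \prod_i bump N 0 (x 0 i).

Lemma bump_factor_chain b : (b <= m)%N -> chain K (bump_factor b).
move=> bm i iK t; rewrite /bump_factor.
have h := @bump_chain R N (m + K) (ltnSn _) (b + i)%N.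
have {}h : is_derive t 1 (bump N (b + i)) (bump N (b + i).+1 t) by apply: h; lia.
have e : (fun t0 : R => bump N (b + i) t0 / b`!%:R) = (b`!%:R)^-1 *: bump N (b + i)
 by apply/funext => s; rewrite fctE mulrC.
rewrite e addnS; apply: (is_derive_eq (is_deriveZ _ h)).
by rewrite /GRing.scale/= mulrC.
Qed.

Lemma bump_factor_support b a t : (b <= m)%N -> (a <= K)%N -> 1 <= `|t| -> bump_factor b a t = 0.
Proof. by move=> bm aK t1; rewrite /bump_factor bump_support ?mul0r// /N; lia. Qed.
Lemma bump_factor_bounded : exists2 M : R, 1 <= M & forall b a t, (b <= m)%N -> (a <= K)%N -> `|bump_factor b a t| <= M.
have hM0 (c : nat) : exists M : R, 0 <= M /\ forall t, (c < N)%N -> `|bump N c t| <= M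
 by have [M M0 h] := @bump_bounded R N c; exists M.
have /choice[M_ hM] := hM0; pose M := 1 + \sum_(c < N) M_ c.
have M0 c : 0 <= M_ c by have [] := hM c.
exists M; first by rewrite lerDl; apply: sumr_ge0.
move=> b a t bm aK; rewrite normrM normfV normr_nat.
have cN : (b + a < N)%N by rewrite /N; lia.
apply: (@le_trans _ _ `|bump N (b + a) t|).
 rewrite ler_piMr// invf_le1 ?ltr0n ?fact_gt0// ler1n fact_gt0//.
have [_ /(_ t cN) h] := hM (b + a)%N; apply: le_trans h _.
rewrite /M (bigD1 (Ordinal cN))//= addrCA lerDl addr_ge0//; exact: sumr_ge0.
Qed.

Lemma prod_le_pow (I : Type) (r : seq I) (F : I -> R) M : 1 <= M -> (forall i, `|F i| <= M) ->
 `|\prod_(i <- r) F i| <= M ^+ size r.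
move=> M1 FM; elim: r => [|i r IH]; first by rewrite big_nil normr1 expr0.
by rewrite big_cons normrM exprS ler_pM.
Qed.

Lemma prod_dist_le (I : Type) (r : seq I) (F G : I -> R) M D : 1 <= M ->
 (forall i, `|F i| <= M) -> (forall i, `|G i| <= M) -> (forall i, `|F i - G i| <= D) ->
 `|\prod_(i <- r) F i - \prod_(i <- r) G i| <= (size r)%:R * M ^+ size r * D.
move=> M1 FM GM FG; elim: r => [|i r IH]; first by rewrite !big_nil subrr normr0 !mul0r.
have D0 : 0 <= D by apply: le_trans (FG i).
have M0 : 0 <= M by apply: le_trans M1.
rewrite !big_cons; set p := \prod_(_ <- _) _; set q := \prod_(_ <- _) _.
have -> : F i * p - G i * q = (F i - G i) * p + G i * (p - q) by ring.
apply: le_trans (ler_normD _ _) _; rewrite !normrM.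
have h1 : `|F i - G i| * `|p| <= D * M ^+ (size r).+1.
 apply: ler_pM => //; apply: le_trans (prod_le_pow r M1 FM) _.
 by rewrite exprS ler_peMl// exprn_ge0.
have h2 : `|G i| * `|p - q| <= M * ((size r)%:R * M ^+ size r * D) by apply: ler_pM.
apply: le_trans (lerD h1 h2) _.
rewrite [size _]/= -natr1 !exprS; apply: eq_ler; ring.
Qed.

Lemma monomial_le (j : mindex) z : `|monomial j z| <= `|z| ^+ mdeg j.
rewrite /monomial normr_prod /mdeg -prodrXr; apply: ler_prod => i _.
by rewrite normr_ge0/= normrX lerXn2r ?nnegrE// le_coord_norm.
Qed.

Lemma bump_coef_support (j : mindex) x : 1 <= `|x| -> bump_coef j x = 0.
move=> /(norm_ge_coord ltr01)[i xi].
rewrite /bump_coef (bigD1 i)//= bump_factor_support ?mul0r//.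
by rewrite ltnW.
Qed.

Lemma bumps_support x : 1 <= `|x| -> bumps x = 0.
move=> /(norm_ge_coord ltr01)[i xi].
by rewrite /bumps (bigD1 i)//= bump_support ?mul0r// /N; lia.
Qed.

Lemma bumps_ge0 x : 0 <= bumps x.
Proof. by apply: prodr_ge0 => i _; exact: bump0_ge0. Qed.
Lemma bumps_le1 x : bumps x <= 1.
Proof. by apply: prodr_ile1 => i _; rewrite bump0_ge0 bump0_le1. Qed.
Definition bump_rem x z : R :=
 bumps (x + z) - \sum_(j : mindex | (mdeg j < m)%N) bump_coef j x * monomial j z.

Lemma bump_coef_le : exists2 M : R, 1 <= M & forall j x, `|bump_coef j x| <= M.
have [M M1 hM] := bump_factor_bounded; exists (M ^+ size (index_enum 'I_n)); first exact: exprn_ege1.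
by move=> j x; apply: prod_le_pow => // i; apply: hM => //; exact: ltnW.
Qed.

Lemma bump_expand x z : \prod_i taylor m (bump N) (x 0 i) (z 0 i) =
 \sum_(j : mindex) bump_coef j x * monomial j z.
under eq_bigr do rewrite taylorE.
rewrite bigA_distr_bigA/=; apply: eq_bigr => j _.
rewrite /bump_coef /monomial -big_split/=; apply: eq_bigr => i _.
by rewrite /bump_factor addn0.
Qed.

Lemma bump_rem_le : (0 < m)%N -> exists2 C : R, 0 < C & forall x z,
 (`|z| <= 1 -> `|bump_rem x z| <= C * `|z| ^+ m) /\
 (1 <= `|z| -> `|bump_rem x z| <= C * `|z| ^+ m.-1).
move=> m0; have [M M1 hM] := bump_factor_bounded; have [M' M'1 hM'] := bump_coef_le.
have M0 : 0 <= M by exact: le_trans M1.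
have M'0 : 0 <= M' by exact: le_trans M'1.
have [L L0 hL] := @bump_bounded R N m.
pose M2 := 1 + m%:R * M; have M21 : 1 <= M2 by rewrite lerDl mulr_ge0.
pose S := size (index_enum 'I_n).
pose C1 := S%:R * M2 ^+ S * L; pose C2 := #|{: mindex}|%:R * M'.
have C10 : 0 <= C1 by rewrite !mulr_ge0// exprn_ge0// (le_trans ler01 M21).
have C20 : 0 <= C2 by rewrite mulr_ge0.
have mN : (m < N)%N by rewrite /N; lia.
exists (C1 + C2 + 1); first by rewrite ltr_wpDl// addr_ge0.
have sumle (P : pred mindex) z x e : 0 <= e -> (forall j, P j -> `|z| ^+ mdeg j <= e) ->
  `|\sum_(j | P j) bump_coef j x * monomial j z| <= C2 * e.
 move=> e0 h; apply: le_trans (ler_norm_sum _ _ _) _.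
 via (\sum_(j | P j) M' * e).
  apply: ler_sum => j Pj; rewrite normrM ler_pM//.
  by apply: le_trans (monomial_le _ _) _; exact: h.
 rewrite sumr_const -[leLHS]mulr_natl -/C2 /C2 -mulrA ler_wpM2r ?mulr_ge0//.
 by rewrite ler_nat max_card.
move=> x z; split => [z1|z1].
 have h1 : `|bumps (x + z) - \prod_i taylor m (bump N) (x 0 i) (z 0 i)| <= C1 * `|z| ^+ m.
  rewrite /C1 -mulrA; apply: prod_dist_le => //.
  - move=> i; apply: (@le_trans _ _ 1) => //.
   by rewrite ger0_norm ?bump0_le1// bump0_ge0.
  - move=> i; rewrite taylorE; apply: le_trans (ler_norm_sum _ _ _) _.
   via (\sum_(a < m) M); last first.
    by rewrite sumr_const card_ord -[leLHS]mulr_natl lerDr.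
   apply: ler_sum => a _; rewrite normrM -[leRHS]mulr1; apply: ler_pM => //.
    have := hM a 0%N (x 0 i) (ltnW (ltn_ord a)) (leq0n _).
    by rewrite /bump_factor addn0.
   by rewrite normrX exprn_ile1// (le_trans (le_coord_norm _ _)).
  - move=> i; rewrite mxE.
   have := @taylor_remainder R m (bump N) L (x 0 i) (z 0 i) (@bump_chain R N m mN) (fun t => hL t mN).
   by move=> /le_trans; apply; rewrite ler_wpM2l// lerXn2r ?nnegrE// le_coord_norm.
 have h2 : `|\sum_(j : mindex | ~~ (mdeg j < m)%N) bump_coef j x * monomial j z| <= C2 * `|z| ^+ m
  by apply: sumle => [|j]; [exact: exprn_ge0|]; rewrite -leqNgt => mj; exact: ler_wiXn2l.
 rewrite /bump_rem.
 have -> : \sum_(j : mindex | (mdeg j < m)%N) bump_coef j x * monomial j z =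
   \prod_i taylor m (bump N) (x 0 i) (z 0 i) -
   \sum_(j : mindex | ~~ (mdeg j < m)%N) bump_coef j x * monomial j z.
  by rewrite bump_expand [X in _ = X - _](bigID (fun j => (mdeg j < m)%N))/= addrK.
 rewrite opprB addrCA; apply: le_trans (ler_normD _ _) _.
 apply: le_trans (lerD h2 h1) _.
 by rewrite -mulrDl ler_wpM2r ?exprn_ge0//; lra.
have h2 : `|\sum_(j : mindex | (mdeg j < m)%N) bump_coef j x * monomial j z| <= C2 * `|z| ^+ m.-1
 by apply: sumle => [|j mj]; [exact: exprn_ge0|]; apply: ler_weXn2l => //; rewrite -ltnS prednK.
rewrite /bump_rem; apply: le_trans (ler_normB _ _) _.
have h1 : `|bumps (x + z)| <= 1 * `|z| ^+ m.-1
 by rewrite ger0_norm ?bumps_ge0// mul1r (le_trans (bumps_le1 _))// exprn_ege1.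
apply: le_trans (lerD h1 h2) _.
rewrite -mulrDl ler_wpM2r ?exprn_ge0//; lra.
Qed.

Lemma tf_bump_coef j : tf (bump_coef j).
split.
- apply: (measurable_prod (h := fun i (x : E) => bump_factor (j i) 0 (x 0 i))) => i _.
 apply: mfunM => //.
 apply: (mcomp _ (measurable_coord i)); apply: cont_mfun.
 apply: bump_continuous; rewrite /N addn0; have := ltn_ord (j i); lia.
- by have [M _ h] := bump_coef_le; exists M.
- by exists 1 => x; exact: bump_coef_support.
Qed.

Lemma tf_bumps : tf bumps.
split.
- apply: (measurable_prod (h := fun i (x : E) => bump N 0 (x 0 i))) => i _.
 apply: (mcomp _ (measurable_coord i)); apply: cont_mfun.
 exact: bump_continuous.
- by exists 1 => x; rewrite ger0_norm ?bumps_le1 ?bumps_ge0.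
- by exists 1 => x; exact: bumps_support.
Qed.
End mindex.

(** * Decay of Fourier transforms by iterated differences *)

Section decay.
Context {R : realType} {n : nat}.
Notation E := 'rV[R]_n.
Notation lambda := (@lebesgue_rV R n).
Let lf := @lebesgue_lf R n.

Lemma fcos_shift_pi (g : E -> R) i (k : E) : tf g -> k 0 i != 0 ->
 fcos (fun x => g (x + eshift i (- (pi / k 0 i)))) k = - fcos g k.
move=> tg ki; set e := eshift _ _.
have mG : mfunT (fun y => g y * cos (dotv k y + pi)).
 apply: mfunM; first by case: tg.
 apply: mcomp; first by apply: cont_mfun => x; exact: continuous_cos.
 by apply: mfunD => //; exact: measurable_dotv.
have ke : dotv k e = - pi by rewrite dotv_eshift; field.
rewrite /fcos; transitivity (\int[lambda]_x (g (x + e) * cos (dotv k (x + e) + pi))).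
 by apply: eq_Rint => x _; rewrite dotvDr ke subrK.
rewrite (Rintegral_lebesgue_rV_translation e mG) -[RHS]mulN1r -(int_tfZ lf); last exact: tf_cos.
by apply: eq_Rint => x _; rewrite cosDpi; ring.
Qed.

Lemma fsin_shift_pi (g : E -> R) i (k : E) : tf g -> k 0 i != 0 ->
 fsin (fun x => g (x + eshift i (- (pi / k 0 i)))) k = - fsin g k.
move=> tg ki; set e := eshift _ _.
have mG : mfunT (fun y => g y * sin (dotv k y + pi)).
 apply: mfunM; first by case: tg.
 apply: mcomp; first by apply: cont_mfun => x; exact: continuous_sin.
 by apply: mfunD => //; exact: measurable_dotv.
have ke : dotv k e = - pi by rewrite dotv_eshift; field.
rewrite /fsin; transitivity (\int[lambda]_x (g (x + e) * sin (dotv k (x + e) + pi))).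
 by apply: eq_Rint => x _; rewrite dotvDr ke subrK.
rewrite (Rintegral_lebesgue_rV_translation e mG) -[RHS]mulN1r -(int_tfZ lf); last exact: tf_sin.
by apply: eq_Rint => x _; rewrite sinDpi; ring.
Qed.

(* Half a period in one coordinate reverses the sign of the transform, so that differences double it. *)
Lemma fpow_diff (g : E -> R) i (k : E) : tf g -> k 0 i != 0 ->
 fpow (fun x => g x - g (x + eshift i (- (pi / k 0 i)))) k = 4 * fpow g k.
move=> tg ki; have ts := tf_shift (eshift i (- (pi / k 0 i))) tg.
by rewrite /fpow fcosB// fsinB// fcos_shift_pi// fsin_shift_pi//; ring.
Qed.

Lemma fpow_le (g : E -> R) k : tf g -> fpow g k <= 2 * (\int[lambda]_x `|g x|) ^+ 2.
move=> tg; have i0 : 0 <= \int[lambda]_x `|g x| by apply: int_tf_ge0.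
have h1 : fcos g k ^+ 2 <= (\int[lambda]_x `|g x|) ^+ 2
 by have h := fcos_le k tg; rewrite -[leLHS]real_normK ?num_real//; exact: (lerXn2r 2 (normr_ge0 _) i0 h).
have h2 : fsin g k ^+ 2 <= (\int[lambda]_x `|g x|) ^+ 2
 by have h := fsin_le k tg; rewrite -[leLHS]real_normK ?num_real//; exact: (lerXn2r 2 (normr_ge0 _) i0 h).
by rewrite /fpow; lra.
Qed.

Lemma int_norm_le (g : E -> R) M t : tf g -> 0 < t -> (forall x, `|g x| <= M) ->
 off_cube t g -> \int[lambda]_x `|g x| <= M * (2 * t) ^+ n.
move=> tg t0 gM gt; have M0 : 0 <= M by apply: le_trans (gM 0).
via (\int[lambda]_x (M * \1_(cube t) x)).
 apply: (le_int_tf lf); [exact: tf_norm|apply: tfZ; exact: tf_cube|move=> x].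
 rewrite cube_indicE; case: ltP => h; first by rewrite mulr1.
 by rewrite gt// normr0 mulr0.
rewrite (int_tfZ lf); last exact: tf_cube.
rewrite ler_wpM2l// /Rintegral int_indic//; last exact: mcub.
have h := @lebesgue_rV_cube_le R n 0 t t0.
have e : cube t `&` setT = [set x : E | `|x + 0| < t] by rewrite setIT; apply/seteqP; split => x /=; rewrite addr0.
rewrite e -lee_fin fineK//; rewrite ge0_fin_numE//; exact: le_lt_trans h (ltry _).
Qed.
Definition put (i : 'I_n) (rest : E -> R) (h : R -> R) (x : E) : R := h (x 0 i) * rest x.

Lemma delta_support (h : R -> R) a s : (forall t, s <= `|t| -> h t = 0) ->
 forall t, s + `|a| <= `|t| -> delta a h t = 0.
move=> hs t st; rewrite /delta !hs ?subrr//.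
 by have := lerB_dist t a; lra.
by apply: le_trans st; rewrite lerDl.
Qed.

Lemma iter_delta_support (h : R -> R) a s q : (forall t, s <= `|t| -> h t = 0) ->
 forall t, s + q%:R * `|a| <= `|t| -> iter q (delta a) h t = 0.
move=> hs; elim: q => [|q IH] t; first by rewrite mul0r addr0; exact: hs.
by rewrite -natr1 mulrDl mul1r addrA => h1; exact: delta_support IH _ h1.
Qed.

Lemma measurable_delta (h : R -> R) a q : mfunT h ->
 mfunT (iter q (delta a) h).
move=> mh; elim: q => [//|q IH]; rewrite /= /delta.
apply: mfunB => //; apply: (mcomp IH).
exact: mfunB.
Qed.

(** In the coordinate where [|k|] is attained, differences with step [pi / k_i] do not decrease the
    energy at [k], while [K] of them reduce the function to the size [(pi / |k|)^K] times its [K]-th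
    derivative. This replaces integration by parts. *)
Lemma fourier_decay (K : nat) : exists2 C : R, 0 < C &
 forall (r M : R) (u : 'I_n -> nat -> R -> R), 0 < r -> 1 <= M ->
 (forall i, chain K (u i)) -> (forall i t, `|u i 0%N t| <= M) ->
 (forall i t, `|u i K t| <= M * r^-1 ^+ K) ->
 (forall i t, r <= `|t| -> u i 0%N t = 0) -> (forall i, mfunT (u i 0%N)) ->
 forall k : E, 1 <= r * `|k| ->
 fpow (fun x => \prod_i u i 0%N (x 0 i)) k <= C * (M ^+ n) ^+ 2 * r ^+ (2 * n) * (r * `|k|)^-1 ^+ (2 * K).
pose p : R := pi; have p0 : 0 < p := pi_gt0 R.
(* Each of the [K] shifts has length [pi / |k| <= pi * r], so the support keeps a half-width of at
   most [r * (1 + K * pi)]; [L] is twice this factor. *)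
pose L := 2 * (1 + K%:R * p).
have L0 : 0 < L by rewrite mulr_gt0// ltr_pwDl// mulr_ge0// ltW.
exists (2 * (p ^+ K * L ^+ n) ^+ 2); first by rewrite mulr_gt0// exprn_gt0// mulr_gt0// exprn_gt0.
move=> r M u r0 M1 cu u0 uK us mu k rk.
have M0 : 0 <= M by apply: le_trans M1.
have k0 : 0 < `|k| by rewrite -(pmulr_rgt0 _ r0) (lt_le_trans ltr01).
have [i ik] : exists i, `|k| <= `|k 0 i|.
 apply/existsP; rewrite -[X in is_true X]negbK negb_exists; apply/negP => /forallP h.
 have : `|k| < `|k| by rewrite norm_lt_coord//; apply/forallP => i; rewrite ltNge; exact: h.
 by rewrite ltxx.
have {ik} ik : `|k 0 i| = `|k| by apply/eqP; rewrite eq_le ik le_coord_norm.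
have ki0 : k 0 i != 0 by rewrite -normr_gt0 ik.
pose a := p / k 0 i.
have an : `|a| = p / `|k| by rewrite /a normrM normfV ik ger0_norm// ltW.
pose rest (x : E) := \prod_(j < n | j != i) u j 0%N (x 0 j).
pose G q := put i rest (iter q (delta a) (u i 0%N)).
have rest_le x : `|rest x| <= M ^+ n.-1.
 have h (j : 'I_n) : 0 <= `|u j 0%N (x 0 j)| <= M by rewrite normr_ge0/= u0.
 rewrite /rest normr_prod; via (\prod_(j < n | j != i) M).
  by apply: ler_prod => j _; exact: h.
 rewrite prodr_const; rewrite (_ : #|_| = n.-1)//.
 have := cardC1 i; rewrite card_ord => <-.
 by apply: eq_card => j; rewrite !inE.
have rs x : G 0%N x = \prod_j u j 0%N (x 0 j) by rewrite /G /put /rest [RHS](bigD1 i).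
have mrest : mfunT rest.
 rewrite /rest; under eq_fun do rewrite -big_filter.
 by apply: measurable_prod => j _; apply: (mcomp (mu j) (measurable_coord j)).
pose t q := r + q%:R * `|a|.
have t0 q : 0 < t q by rewrite ltr_pwDl// mulr_ge0.
have hb q : exists C, forall s, `|iter q (delta a) (u i 0%N) s| <= C.
 elim: q => [|q [C hC]]; first by exists M => s; exact: u0.
 by exists (C + C) => s; rewrite /= /delta (le_trans (ler_normB _ _))// lerD.
have vG q : off_cube (t q) (G q).
 move=> x tx; rewrite /G /put.
 have [h|h] := leP (t q) `|x 0 i|; first by rewrite (iter_delta_support (s := r)) ?mul0r//; exact: us.
 have [j /andP[ji hj]] : exists j, (j != i) && (r <= `|x 0 j|).
  apply/existsP; rewrite -[X in is_true X]negbK negb_exists; apply/negP => /forallP H.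
  have : `|x| < t q.
   rewrite norm_lt_coord//; apply/forallP => j; have [->//|ji] := eqVneq j i.
   have := H j; rewrite ji/= -ltNge => /lt_le_trans; apply.
   by rewrite /t lerDl mulr_ge0.
  by rewrite ltNge tx.
 by rewrite /rest (bigD1 j)//= us// mul0r mulr0.
have tG q : tf (G q).
 split; last by exists (t q); exact: vG.
  apply: mfunM => //; apply: (mcomp (measurable_delta a q (mu i)) (measurable_coord i)).
 have [C hC] := hb q; exists (C * M ^+ n.-1) => x; rewrite normrM ler_pM//.
have step q : fpow (G q.+1) k = 4 * fpow (G q) k.
 rewrite -(fpow_diff (tG q) ki0); congr (fpow _ k); apply/funext => x.
 rewrite /G /put /= /delta mulrBl !mxE eqxx mulr1; congr (_ - _ * _).
 by apply: eq_bigr => j ji; rewrite !mxE (negPf ji) mulr0 addr0.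
have e4 q : fpow (G q) k = 4 ^+ q * fpow (G 0%N) k
 by elim: q => [|q IH]; [rewrite mul1r|rewrite step IH exprS mulrA].
have -> : (fun x : E => \prod_j u j 0%N (x 0 j)) = G 0%N by apply/funext => x; rewrite rs.
(* The factor [4 ^+ K] only helps and is dropped. *)
have le1 : fpow (G 0%N) k <= fpow (G K) k by rewrite (e4 K) ler_peMl ?fpow_ge0// exprn_ege1// ler1n.
apply: le_trans le1 _; apply: le_trans (fpow_le k (tG K)) _.
have GK x : `|G K x| <= (`|a| ^+ K * (M * r^-1 ^+ K)) * M ^+ n.-1
 by rewrite normrM; apply: ler_pM => //; apply: delta_iter_le.
have := int_norm_le (tG K) (t0 K) GK (vG K).
have n0 : (0 < n)%N by apply: leq_ltn_trans (leq0n i) (ltn_ord i).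
have tL : 2 * t K <= r * L.
 have : K%:R * `|a| <= K%:R * (p * r).
  rewrite ler_wpM2l// an ler_pdivrMr// -mulrA ler_peMr// ltW//.
 by rewrite /t /L; lra.
have I0 : 0 <= \int[lambda]_x `|G K x| by apply: int_tf_ge0.
move=> h.
have {h} h : \int[lambda]_x `|G K x| <= p ^+ K * L ^+ n * (M ^+ n * r ^+ n * (r * `|k|)^-1 ^+ K).
 apply: le_trans h _.
 via (`|a| ^+ K * (M * r^-1 ^+ K) * M ^+ n.-1 * (r * L) ^+ n).
  rewrite ler_wpM2l ?mulr_ge0 ?exprn_ge0 ?invr_ge0 ?(ltW r0)//.
  have h1 : 0 <= 2 * t K by rewrite mulr_ge0// ltW.
  exact: (lerXn2r n h1 (le_trans h1 tL) tL).
 have eM : M ^+ n = M * M ^+ n.-1 by rewrite -exprS prednK.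
 rewrite an eM exprMn invfM !exprMn.
 by apply: eq_ler; ring.
have := lerXn2r 2 I0 (le_trans I0 h) h => h2.
via (2 * (p ^+ K * L ^+ n * (M ^+ n * r ^+ n * (r * `|k|)^-1 ^+ K)) ^+ 2).
 by rewrite ler_wpM2l.
rewrite ![(_ * _) ^+ 2]exprMn -!exprM ![(_ * 2)%N]mulnC.
by apply: eq_ler; ring.
Qed.
End decay.

Lemma geometric_le (R : realFieldType) (a : R) (m : nat) : 0 <= a -> a < 1 ->
 \sum_(i < m) a ^+ i <= (1 - a)^-1.
move=> a0 a1; have a2 : 0 < 1 - a by rewrite subr_gt0.
rewrite -[leRHS]div1r ler_pdivlMr// mulrC.
have -> : (1 - a) * \sum_(i < m) a ^+ i = 1 - a ^+ m by have := subrX1 a m; lra.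
by rewrite gerBl exprn_ge0.
Qed.

(** * Integration over dyadic annuli *)

Section dyadic.
Context {R : realType} {n : nat}.
Notation E := 'rV[R]_n.

Lemma dyadic_scale (rho t : R) : 0 < rho -> rho <= t -> exists i, 2 ^+ i * rho <= t < 2 ^+ i.+1 * rho.
move=> r0 rt; pose P i := t < 2 ^+ i * rho.
have exP : exists i, P i.
 exists (Num.truncn (t / rho)).+1; rewrite /P -ltr_pdivrMr//.
 apply: lt_le_trans (truncnS_gt _) _; rewrite -natrX ler_nat ltnW//; exact: ltn_expl.
case: (ex_minnP exP) => -[|i] Pi mini.
 by move: Pi; rewrite /P expr0 mul1r ltNge rt.
have Pi' : t < 2 ^+ i.+1 * rho := Pi.
by exists i; rewrite Pi' andbT leNgt; apply/negP => /mini; rewrite ltnn.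
Qed.

(** On the annulus at scale [2^i * rho] the integrand is at most [c * k^i] and the mass at most
    [D * th^(i+1)]; [k * th < 1] sums the series, and the central cube contributes [c * D]. *)
Lemma integral_geometric_le (m : meas E R) (h : E -> \bar R) (rho c k th D : R) :
 0 < rho -> 0 <= c -> 0 <= k -> 0 <= th -> 0 <= D -> k * th < 1 ->
 mfunT h -> (forall x, 0 <= h x)%E ->
 (forall x, h x <= c%:E)%E ->
 (forall i x, 2 ^+ i * rho <= `|x| -> (h x <= (c * k ^+ i)%:E)%E) ->
 (forall i, (m (cube (2 ^+ i * rho)) <= (D * th ^+ i)%:E)%E) ->
 (\int[m]_x h x <= ((1 - k * th)^-1 * c * D * th)%:E + (c * D)%:E)%E.
move=> r0 c0 k0 th0 D0 kth mh h0 hc hi mi.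
pose W i (x : E) : \bar R := ((c * k ^+ i) * \1_(cube (2 ^+ i.+1 * rho)) x)%:E.
have W0 i x : (0 <= W i x)%E by rewrite lee_fin !mulr_ge0 ?exprn_ge0.
have mW i : mfunT (W i) by apply/mEFin; apply: mfunM => //; exact: mindic (mcub _).
have hW x : (h x <= (c * \1_(cube rho) x)%:E + \sum_(i <oo) W i x)%E.
 have [xr|xr] := ltP `|x| rho.
  rewrite cube_indicE xr mulr1; apply: le_trans (hc x) _.
  by rewrite leeDl//; apply: nneseries_ge0.
 have [i /andP[h1 h2]] := dyadic_scale r0 xr.
 rewrite cube_indicE ltNge xr mulr0 add0e.
 via (W i x).
  by rewrite /W cube_indicE h2 mulr1; exact: hi.
 have := @nneseries_lim_ge R (fun i => W i x) xpredT 0 i.+1 (fun j _ _ => W0 j x).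
 apply: le_trans; rewrite big_nat_recr//= leeDr//.
 by apply: sume_ge0 => j _.
apply: (@le_trans _ _ (\int[m]_x ((c * \1_(cube rho) x)%:E + \sum_(i <oo) W i x)))%E.
 apply: ge0_le_integral => //.
 apply: emeasurable_funD.
  by apply/mEFin; apply: mfunM => //; exact: mindic (mcub _).
 exact: ge0_emeasurable_sum.
rewrite ge0_integralD//; last 4 first.
- by move=> x _; rewrite lee_fin mulr_ge0.
- by apply/mEFin; apply: mfunM => //; exact: mindic (mcub _).
- by move=> x _; apply: nneseries_ge0.
- exact: ge0_emeasurable_sum.
rewrite addeC; apply: leeD.
 rewrite integral_nneseries//; apply: lime_le.
  by apply: is_cvg_nneseries => i _ _; apply: int_ge0.
 apply: nearW => q; via (\sum_(0 <= i < q) (c * D * th * (k * th) ^+ i)%:E)%E.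
  apply: lee_sum => i _; rewrite /W; under eq_integral do rewrite EFinM.
  rewrite int_Zl ?mulr_ge0 ?exprn_ge0//; last first.
   by apply/mEFin; exact: mindic (mcub _).
  rewrite int_indic//; last exact: mcub.
  rewrite setIT; via ((c * k ^+ i)%:E * (D * th ^+ i.+1)%:E)%E.
   by rewrite lee_wpmul2l// lee_fin mulr_ge0// exprn_ge0.
  rewrite -EFinM lee_fin.
  rewrite exprS exprMn.
  have -> // : c * k ^+ i * (D * (th * th ^+ i)) = c * D * th * (k ^+ i * th ^+ i) by ring.
 rewrite sumEFin lee_fin -mulr_sumr big_mkord.
 have -> : (1 - k * th)^-1 * c * D * th = c * D * th * (1 - k * th)^-1 by ring.
 by apply: (ler_wpM2l (mulr_ge0 (mulr_ge0 c0 D0) th0)); apply: geometric_le; rewrite ?mulr_ge0.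
under eq_integral do rewrite EFinM.
rewrite int_Zl//; last first.
 by apply/mEFin; exact: mindic (mcub _).
rewrite int_indic//; last exact: mcub.
have := mi 0%N; rewrite !expr0 mul1r mulr1 setIT EFinM => h1.
by rewrite lee_wpmul2l// lee_fin.
Qed.

Lemma integral_dyadic_le (m : meas E R) (h : E -> \bar R) (rho c k th D : R) :
 0 < rho -> 0 <= c -> 0 <= k -> 0 <= th -> 0 <= D -> k * th <= 2^-1 ->
 mfunT h -> (forall x, 0 <= h x)%E ->
 (forall x, h x <= c%:E)%E ->
 (forall i x, 2 ^+ i * rho <= `|x| -> (h x <= (c * k ^+ i)%:E)%E) ->
 (forall i, (m (cube (2 ^+ i * rho)) <= (D * th ^+ i)%:E)%E) ->
 (\int[m]_x h x <= (2 * c * D * th)%:E + (c * D)%:E)%E.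
move=> r0 c0 k0 th0 D0 kth mh h0 hc hi mi.
apply: le_trans (integral_geometric_le r0 c0 k0 th0 D0 _ mh h0 hc hi mi) _; first by lra.
apply: leeD2r; rewrite lee_fin -!mulrA ler_wpM2r ?mulr_ge0//.
rewrite -[leRHS]invrK lef_pV2 ?posrE; lra.
Qed.
End dyadic.

(** * Spectral mass and variances of scaled bumps *)

Section spectral_estimates.
Context {R : realType} {n : nat}.
Notation E := 'rV[R]_n.
Notation lambda := (@lebesgue_rV R n).
Variables (beta : meas E R) (V : (E -> R) -> R).
Let c0 : R := (2 * pi) ^+ n.
Hypothesis betaV : forall f, tf f -> (\int[beta]_k (fpow f k)%:E = (c0 * V f)%:E)%E.
Let lf := @lebesgue_lf R n.
Let c0_gt0 : 0 < c0. Proof. by rewrite exprn_gt0// mulr_gt0// pi_gt0. Qed.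

Lemma scale_norm (r : R) (x : E) : 0 < r -> `|r^-1 *: x| = `|x| / r.
Proof. by move=> r0; rewrite normrZ normfV gtr0_norm// mulrC. Qed.
Lemma measurable_scale (r : R) : mfunT (fun x : E => r *: x).
apply: measurable_fun_rV => i; under eq_fun do rewrite mxE.
by apply: mfunM => //; exact: measurable_coord.
Qed.

Lemma tf_scale (r : R) f : 0 < r -> tf f -> tf (fun x : E => f (r^-1 *: x)).
move=> r0 [mf [C fC] [t ft]]; split.
- exact: (mcomp mf (measurable_scale _)).
- by exists C.
- by exists (t * r) => x tx; apply: ft; rewrite scale_norm// ler_pdivlMr.
Qed.
Variables (m K : nat).
Definition bumpr (r : R) (x : E) : R := bumps m K (r^-1 *: x).

Lemma tf_bumpr r : 0 < r -> tf (bumpr r).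
Proof. by move=> r0; apply: tf_scale => //; exact: tf_bumps. Qed.
(** For [|x| < r] and [|k| < 1 / ((2n+1) r)] the phase stays below [1/2] and its cosine above [1/2].
    The transform of the bump is thus at least half its integral, and the integral is bounded below
    on a box of side [r / 2], where the bump is at least [q]. *)
Lemma spectral_mass_le : exists2 C : R, 0 < C & forall r, 0 < r ->
 (beta (cube ((2 * n%:R + 1)^-1 / r)) <= (C * r^-1 ^+ (2 * n) * V (bumpr r))%:E)%E.
pose q : R := (2^-1 ^+ (m + K).+1) ^+ n.
have q0 : 0 < q by rewrite !exprn_gt0.
pose D r : R := (q * (r / 2) ^+ n) / 2.
exists (c0 * (2 * 2 ^+ n / q) ^+ 2); first by rewrite mulr_gt0// exprn_gt0// divr_gt0// mulr_gt0// exprn_gt0.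
move=> r r0; have tfr := tf_bumpr r0.
have D0 : 0 < D r by rewrite divr_gt0// mulr_gt0// exprn_gt0// divr_gt0.
have I0 : q * (r / 2) ^+ n <= \int[lambda]_x bumpr r x.
 pose bxr : set E := [set x : E | forall i, 0 <= x 0 i < r / 2].
 have mb : measurable bxr.
  rewrite (_ : bxr = [set x : E | forall i, `[0, r / 2[%classic (x 0 i)]).
   by apply: (@measurable_rect R n (fun i => `[0, r / 2[%classic)) => i; exact: measurable_itv.
  by apply/seteqP; split => x h i; have := h i; rewrite /= in_itv.
 have lb : lambda bxr = ((r / 2) ^+ n)%:E.
  rewrite (@lebesgue_rV_box R n (fun=> 0) (fun=> r / 2)).
   by under eq_bigr do rewrite subr0; rewrite prodr_const card_ord.
  by move=> i; rewrite divr_ge0// ltW.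
 have r2 : 0 <= r / 2 by rewrite divr_ge0// ltW.
 have tb : tf (\1_bxr : E -> R).
  split; first exact: mindic.
   by exists 1 => x; rewrite indicE; case: (_ \in _); rewrite ?normr1 ?normr0.
  exists r => x rx; rewrite indicE memNset// => h; move: rx; apply/negP; rewrite -ltNge.
  rewrite norm_lt_coord//; apply/forallP => i; have /andP[h1 h2] := h i.
  by rewrite ger0_norm//; lra.
 via (\int[lambda]_x (q * \1_bxr x)).
  rewrite (int_tfZ lf)// ler_wpM2l ?(ltW q0)//.
  by rewrite /Rintegral int_indic// setIT lb.
 apply: (le_int_tf lf) => //; first exact: tfZ.
 move=> x; rewrite indicE; case: (boolP (x \in bxr)) => xb; last by rewrite mulr0 bumps_ge0.
 have -> : q = \prod_(i < n) 2^-1 ^+ (m + K).+1 by rewrite prodr_const card_ord.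
 rewrite mulr1 /bumpr /bumps; apply: ler_prod => i _.
 rewrite exprn_ge0//=; apply: bump0_gt; rewrite mxE.
 have := set_mem xb => /(_ i) /andP[h1 h2].
 by rewrite ger0_norm ?mulr_ge0 ?invr_ge0 ?(ltW r0)// mulrC ler_pdivrMr// mulrC ltW.
have fc k : `|k| < (2 * n%:R + 1)^-1 / r -> D r ^+ 2 <= fpow (bumpr r) k.
 move=> kr; rewrite /fpow -[leLHS]addr0 lerD ?sqr_ge0//.
 have h : D r <= fcos (bumpr r) k.
  via (\int[lambda]_x (2^-1 * bumpr r x)).
   by rewrite (int_tfZ lf)// /D mulrC ler_wpM2l.
  apply: (le_int_tf lf); [exact: tfZ|exact: tf_cos|move=> x].
  have [xr|xr] := ltP `|x| r; last first.
   by rewrite /bumpr bumps_support ?mulr0 ?mul0r// scale_norm// ler_pdivlMr// mul1r.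
  rewrite mulrC ler_wpM2l ?bumps_ge0//; apply: cos_ge_half.
  apply: le_trans (dotv_le _ _) _.
  have h1 : `|k| * `|x| <= (2 * n%:R + 1)^-1 / r * r by apply: ler_pM => //; exact: ltW.
  rewrite divfK ?gt_eqF// in h1.
  apply: le_trans (ler_wpM2l _ h1) _ => //.
  by rewrite ler_pdivrMr ?ltr_wpDl ?mulr_ge0//; lra.
 exact: (lerXn2r 2 (ltW D0) (le_trans (ltW D0) h) h).
have mc := @mcub R n ((2 * n%:R + 1)^-1 / r).
have : ((D r ^+ 2)%:E * beta (cube ((2 * n%:R + 1)^-1 / r)) <= (c0 * V (bumpr r))%:E)%E.
 rewrite -betaV// -[cube _]setIT -int_indic//.
 rewrite -int_Zl ?sqr_ge0//; last by apply/mEFin; exact: mindic.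
 apply: ge0_le_integral => //.
 - by move=> x _; rewrite -EFinM lee_fin mulr_ge0// sqr_ge0.
 - by apply/mEFin; apply: mfunM => //; exact: mindic.
 - by apply/mEFin; apply: continuous_mfun; exact: fpow_continuous.
 - move=> x _; rewrite -EFinM lee_fin cube_indicE; case: ltP => h; first by rewrite mulr1; exact: fc.
  by rewrite mulr0 fpow_ge0.
rewrite -lee_pdivlMl ?exprn_gt0// -EFinM => /le_trans; apply.
rewrite lee_fin; apply: eq_ler.
rewrite /D [(2 * n)%N]mulnC exprM !exprMn !exprVn.
set rn := r ^+ n; set tn : R := 2 ^+ n.
have rn0 : rn != 0 by rewrite expf_neq0 ?gt_eqF.
have tn0 : tn != 0 by rewrite expf_neq0 ?gt_eqF.
by field; rewrite rn0 tn0 gt_eqF.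
Qed.

(** The energy of a scaled coefficient at [k] is bounded by [r^(2n)] and decays like [(r|k|)^(-2K)].
    Dyadic integration against a mass growing like [t^u] and [t^v] converges because both exponents
    are at most [2K - 1]: per scale, the gain [2^(-2K)] times the loss [2^(2K-1)] is [1/2]. *)
Lemma var_decay : (0 < K)%N -> exists2 C : R, 0 < C & forall (A B u v : R), 0 <= A -> 0 <= B ->
 0 <= u <= (2 * K).-1%:R -> 0 <= v <= (2 * K).-1%:R ->
 (forall t : R, 0 < t -> (beta (cube t) <= (A * t `^ u + B * t `^ v)%:E)%E) ->
 forall j r, 0 < r ->
 V (fun x => @bump_coef R n m K j (r^-1 *: x)) <= C * r ^+ (2 * n) * (A * (r `^ u)^-1 + B * (r `^ v)^-1).
move=> K0; have [C1 C10 hC1] := @fourier_decay R n K.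
have [M M1 hM] := @bump_factor_bounded R m K.
have [M' M'1 hM'] := @bump_coef_le R n m K.
have M0 : 0 <= M by exact: le_trans M1.
have M'0 : 0 <= M' by exact: le_trans M'1.
pose C2 := C1 * (M ^+ n) ^+ 2 + 2 * (M' * 2 ^+ n) ^+ 2.
have C20 : 0 <= C2 by rewrite addr_ge0 ?mulr_ge0 ?(ltW C10)// ?exprn_ge0// ?mulr_ge0// exprn_ge0.
pose th : R := 2 ^+ (2 * K).-1.
have th0 : 0 <= th by rewrite exprn_ge0.
exists ((2 * C2 * th + C2 + 1) / c0); first by rewrite divr_gt0// ltr_wpDl// addr_ge0// !mulr_ge0.
move=> A B u v A0 B0 /andP[u0 uK] /andP[v0 vK] hb j r r0.
set g := fun x => _; have tg : tf g by apply: tf_scale => //; exact: tf_bump_coef.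
pose D := A * (r `^ u)^-1 + B * (r `^ v)^-1.
have D0 : 0 <= D by rewrite addr_ge0// mulr_ge0// invr_ge0 powR_ge0.
have rn0 : 0 <= r ^+ (2 * n) by rewrite exprn_ge0// ltW.
suff : ((c0 * V g)%:E <= ((2 * (C2 * r ^+ (2 * n)) * D * th) + C2 * r ^+ (2 * n) * D)%:E)%E.
 rewrite lee_fin -ler_pdivlMl// => /le_trans; apply.
 rewrite -/D; via (c0^-1 * ((2 * C2 * th + C2) * (r ^+ (2 * n) * D))).
  by apply: eq_ler; ring.
 rewrite [_ / c0]mulrC -!mulrA ler_wpM2l ?invr_ge0 ?(ltW c0_gt0)//.
 by rewrite ler_wpM2r ?mulr_ge0// lerDl.
rewrite -betaV// EFinD.
have pw (w : R) i : 0 <= w <= (2 * K).-1%:R -> (2 ^+ i * r^-1) `^ w <= th ^+ i * (r `^ w)^-1.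
 move=> /andP[w0 wK]; rewrite powRM ?exprn_ge0 ?invr_ge0 ?(ltW r0)//.
 have -> : r^-1 `^ w = (r `^ w)^-1 by rewrite -[r^-1]powR_inv1 ?(ltW r0)// -powRrM mulN1r powRN.
 rewrite ler_wpM2r ?invr_ge0 ?powR_ge0//.
 via ((2 ^+ i) `^ (2 * K).-1%:R).
  by apply: (ler_powR _ wK); apply: exprn_ege1; rewrite ler1n.
 by rewrite powR_mulrn ?exprn_ge0// /th -!exprM mulnC.
apply: (@integral_dyadic_le R n beta _ r^-1 (C2 * r ^+ (2 * n)) (2^-1 ^+ (2 * K)) th D) => //.
- by rewrite invr_gt0.
- by rewrite mulr_ge0.
- rewrite /th -{1}(prednK (n := 2 * K)) ?muln_gt0// exprS -mulrA -exprMn mulVf// expr1n mulr1//.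
- by apply/mEFin; apply: continuous_mfun; exact: fpow_continuous.
- by move=> k; rewrite lee_fin fpow_ge0.
- move=> k; rewrite lee_fin; apply: le_trans (fpow_le k tg) _.
 have := @int_norm_le R n g M' r tg r0 (fun x => hM' _ _).
 have vg : off_cube r g by move=> x xr; rewrite /g bump_coef_support// scale_norm// ler_pdivlMr// mul1r.
 move=> /(_ vg) h; have i0 : 0 <= \int[lambda]_x `|g x| by apply: int_tf_ge0.
 via (2 * (M' * (2 * r) ^+ n) ^+ 2).
  by rewrite ler_wpM2l//; exact: (lerXn2r 2 i0 (le_trans i0 h) h).
 have -> : 2 * (M' * (2 * r) ^+ n) ^+ 2 = 2 * (M' * 2 ^+ n) ^+ 2 * r ^+ (2 * n)
  by rewrite [(2 * n)%N]mulnC exprM !exprMn; ring.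
 by apply: (ler_wpM2r rn0); rewrite /C2 lerDr mulr_ge0 ?(ltW C10)// exprn_ge0// exprn_ge0.
- move=> i k ik; have k0 : 0 < `|k|.
  by apply: lt_le_trans ik; rewrite mulr_gt0 ?exprn_gt0// invr_gt0.
 rewrite lee_fin.
 (* The factor [r^-1 ^+ a] comes from the chain rule, so that [U i'] is a derivative chain of the
    rescaled factor. *)
 pose U (i' : 'I_n) (a : nat) (t : R) := r^-1 ^+ a * bump_factor m K (j i') a (r^-1 * t).
 have rk : 2 ^+ i <= r * `|k| by move: ik; rewrite ler_pdivrMr// mulrC.
 have rk1 : 1 <= r * `|k| by apply: le_trans rk; apply: exprn_ege1; rewrite ler1n.
 have := hC1 r M U r0 M1 _ _ _ _ _ k rk1.
 have -> : (fun x : E => \prod_i0 U i0 0%N (x 0 i0)) = g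
  by apply/funext => x; apply: eq_bigr => i' _; rewrite /U expr0 mul1r mxE.
 have jm i' : (j i' <= m)%N by exact/ltnW/ltn_ord.
 move=> h; apply: le_trans (h _ _ _ _ _) _.
 + move=> i' a aK t; rewrite /U.
  have h1 := @bump_factor_chain R m K (j i') (jm i') a aK (r^-1 * t).
  have d1 : is_derive t (1:R) (fun t : R => r^-1 * t) r^-1.
   rewrite (_ : (fun t : R => r^-1 * t) = r^-1 *: id); last by apply/funext => s.
   by have := is_deriveZ r^-1 (is_derive_id t (1:R)); rewrite /GRing.scale/= mulr1.
  have h2 := @is_derive1_comp _ (bump_factor m K (j i') a) (fun t => r^-1 * t) t _ _ h1 d1.
  have := is_deriveZ (r^-1 ^+ a) h2; rewrite /GRing.scale/= exprSr => h3.
  by apply: (is_derive_eq h3); rewrite /GRing.scale/=; ring.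
 + by move=> i' t; rewrite /U expr0 mul1r; apply: hM.
 + move=> i' t; rewrite /U normrM mulrC.
  have rK : 0 <= r^-1 ^+ K by rewrite exprn_ge0// invr_ge0 ltW.
  by rewrite [`|r^-1 ^+ K|]ger0_norm//; apply: (ler_wpM2r rK); apply: hM.
 + move=> i' t rt; rewrite /U bump_factor_support ?mulr0//.
  by rewrite normrM gtr0_norm ?invr_gt0// mulrC ler_pdivlMr// mul1r.
 + move=> i'; rewrite /U; apply: mfunM => //; apply: mfunM => //.
  apply: (@mcomp _ _ _ _ _ _ (bump (m + K).+1 (j i' + 0)) _ (fun t : R => r^-1 * t)); last exact: mfunM.
  have jN : (j i' + 0 < (m + K).+1)%N by rewrite addn0 ltnS (leq_trans (jm i')) ?leq_addr.
  exact: (cont_mfun (@bump_continuous R (m + K).+1 _ jN)).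
 via (C1 * (M ^+ n) ^+ 2 * r ^+ (2 * n) * (2^-1 ^+ (2 * K)) ^+ i).
  have P0 : 0 <= C1 * M ^+ n ^+ 2 * r ^+ (2 * n) by rewrite mulr_ge0// mulr_ge0 ?(ltW C10)// exprn_ge0// exprn_ge0.
  apply: (ler_wpM2l P0); have -> : (2^-1 : R) ^+ (2 * K) ^+ i = (2 ^+ i)^-1 ^+ (2 * K).
   by rewrite !exprVn -!exprM mulnC.
  have h0 : 0 <= (r * `|k|)^-1 by rewrite invr_ge0 (le_trans ler01 rk1).
  have h1 : (r * `|k|)^-1 <= (2 ^+ i)^-1 by rewrite lef_pV2 ?posrE ?exprn_gt0// (lt_le_trans ltr01 rk1).
  exact: (lerXn2r (2 * K) h0 (le_trans h0 h1) h1).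
 have P0 : 0 <= 2^-1 ^+ (2 * K) ^+ i :> R by rewrite exprn_ge0// exprn_ge0.
 apply: (ler_wpM2r P0); apply: (ler_wpM2r rn0); rewrite /C2 lerDl.
 by rewrite mulr_ge0// exprn_ge0// mulr_ge0// exprn_ge0.
- move=> i; apply: le_trans (hb _ _) _; first by rewrite mulr_gt0 ?exprn_gt0// invr_gt0.
 rewrite lee_fin /D mulrDl; apply: lerD.
  by rewrite -mulrA [_ * th ^+ i]mulrC ler_wpM2l// pw// u0.
 by rewrite -mulrA [_ * th ^+ i]mulrC ler_wpM2l// pw// v0.
Qed.
End spectral_estimates.

(** * Measurability of integrals against kernels and random measures *)

Section kernel_pullback.
Context d0 d1 d2 (W : measurableType d0) (Y : measurableType d1) (T : measurableType d2) (R : realType).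
Variable g : W -> Y.
Hypothesis mg : mfunT g.

Section kernel.
Variable k : R.-ker Y ~> T.
Definition pullback (w : W) : meas T R := k (g w).
Let measurable_pullback U : measurable U -> mfunT (pullback ^~ U).
Proof. by move=> mU; exact: (mcomp (measurable_kernel k U mU) mg). Qed.
Definition pullback_kernel : R.-ker W ~> T :=
 HB.pack pullback (isKernel.Build _ _ _ _ _ pullback measurable_pullback).
End kernel.

Section pkernel.
Variable k : R.-pker Y ~> T.
Definition ppullback (w : W) : meas T R := k (g w).
Let measurable_ppullback U : measurable U -> mfunT (ppullback ^~ U).
Proof. by move=> mU; exact: (mcomp (measurable_kernel k U mU) mg). Qed.

HB.instance Definition _ := isKernel.Build _ _ _ _ _ ppullback measurable_ppullback.
Let ppullback_prob w : ppullback w setT = 1%E. Proof. exact: prob_kernel. Qed.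

HB.instance Definition _ := Kernel_isProbability.Build _ _ _ _ _ ppullback ppullback_prob.

Lemma measurable_integral_ppullback (f : W * T -> \bar R) : (forall t, 0 <= f t)%E ->
 mfunT f -> mfunT (fun w => \int[k (g w)]_t f (w, t))%E.
move=> f0 mf.
exact: (@measurable_fun_integral_sfinite_kernel _ _ W T R f ppullback f0 mf).
Qed.
End pkernel.
End kernel_pullback.

Section random_measure_integrals.
Context d (Om : measurableType d) (R : realType) (n : nat).
Variable nu : random_measure Om R n.
Notation E := 'rV[R]_n.
Local Open Scope ereal_scope.
Let lfnu w := random_measure_locally_finite nu w.

Lemma measurable_int_nu (F : Om * E -> \bar R) : (forall t, 0 <= F t) -> mfunT F ->
 mfunT (fun w => \int[nu w]_x F (w, x)).
Proof. by move=> F0 mF; exact: (measurable_integral_locally_finite lfnu mtop F0 mF). Qed.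
Lemma measurable_int_nu_fst (F : (Om * E) * E -> \bar R) : (forall t, 0 <= F t) -> mfunT F ->
 mfunT (fun q : Om * E => \int[nu q.1]_y F (q, y)).
move=> F0 mF.
exact: (@measurable_integral_locally_finite _ _ _ _
 (pullback_kernel (@mfst _ _ Om E) nu) (fun q => lfnu q.1) _ _ mtop F0 mF).
Qed.

Lemma measurable_int_nu2 (F : (Om * E) * E -> \bar R) : (forall t, 0 <= F t) -> mfunT F ->
 mfunT (fun w => \int[nu w]_x \int[nu w]_y F (w, x, y)).
move=> F0 mF.
apply: (measurable_int_nu (F := fun q => \int[nu q.1]_y F (q, y))).
 by move=> q; exact: int_ge0.
exact: measurable_int_nu_fst.
Qed.

Lemma int_nu_swap w (F : E * E -> \bar R) : (forall t, 0 <= F t) -> mfunT F ->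
 \int[nu w]_x \int[nu w]_y F (x, y) = \int[nu w]_x \int[nu w]_y F (y, x).
move=> F0 mF.
exact: (@fubini_tonelli _ _ E E R (sf_of (lfnu w)) (sf_of (lfnu w)) F mF F0).
Qed.

Lemma int_nu_prod w (f g : E -> \bar R) : (forall t, 0 <= f t) -> mfunT f ->
 (forall t, 0 <= g t) -> mfunT g ->
 \int[nu w]_x f x * \int[nu w]_y g y = \int[nu w]_x \int[nu w]_y (f x * g y).
move=> f0 mf g0 mg.
under [RHS]eq_integral => x _ do rewrite ge0_integralZl//.
rewrite ge0_integralZr//; exact: int_ge0.
Qed.
End random_measure_integrals.

Arguments measurable_integral_ppullback {d0 d1 d2 W Y T R g} mg k {f} _ _.
Arguments measurable_int_nu {d Om R n} nu {F} _ _.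
Arguments measurable_int_nu_fst {d Om R n} nu {F} _ _.
Arguments measurable_int_nu2 {d Om R n} nu {F} _ _.
Arguments int_nu_swap {d Om R n} nu w {F} _ _.
Arguments int_nu_prod {d Om R n} nu w {f g} _ _ _ _.

Section unit_mass.
Context d (T : measurableType d) (R : realType).
(** As with [sf_of]: a copy of [m] on which a probability structure is declared. *)
Definition prob_of (m : meas T R) (m1 : m setT = 1%E) : set T -> \bar R := m.

HB.instance Definition _ (m : meas T R) (m1 : m setT = 1%E) := Measure.on (prob_of m1).
HB.instance Definition _ (m : meas T R) (m1 : m setT = 1%E) := Measure_isProbability.Build _ _ _ (prob_of m1) m1.
End unit_mass.

Lemma measurable_nonneg_lty d (T : measurableType d) (R : realType) (m : meas T R)
  (f : T -> \bar R) : mfunT f -> (forall x, 0 <= f x)%E -> (\int[m]_x f x < +oo)%E ->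
 {ae m, forall x, (f x < +oo)%E}.
move=> mf f0 fin; have i : m.-integrable setT f.
 by apply/integrableP; split => //; under eq_integral do rewrite gee0_abs//.
apply: filterS (integrable_ae mtop i) => x /(_ I).
by rewrite ge0_fin_numE.
Qed.

(* Unlike [ge0_le_integral], no measurability is needed: [kappa] need not be measurable. *)
Lemma le_intT d (T : measurableType d) (R : realType) (m : meas T R)
  (f g : T -> \bar R) : (forall x, 0 <= f x)%E -> (forall x, f x <= g x)%E ->
 (\int[m]_x f x <= \int[m]_x g x)%E.
move=> f0 fg; have g0 x : (0 <= g x)%E by exact: le_trans (fg x).
rewrite !ge0_integralTE//; apply: le_ereal_sup => _ [h hf <-].
by exists h => // x; exact: le_trans (hf x) (fg x).
Qed.

Lemma mbool_natr d (T : measurableType d) (R : realType) (b : T -> bool) :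
 mfunT b -> mfunT (fun t => (b t)%:R : R).
move=> mb; rewrite (_ : (fun t => _) = fun t => if b t then 1 else 0).
 exact: measurable_fun_ifT.
by apply/funext => t; case: (b t).
Qed.

Lemma ltr_powR (R : realType) (a x y : R) : 1 < a -> x < y -> a `^ x < a `^ y.
move=> a1 xy; have a0 : 0 < a by exact: lt_trans a1.
rewrite -[y](subrK x) powRD; last by rewrite (gt_eqF a0) implybT.
rewrite ltr_pMl ?powR_gt0//.
have -> : 1 = 1 `^ (y - x) :> R by rewrite powR1.
by apply: gt0_ltr_powR => //; rewrite ?nnegrE ?subr_gt0// ltW.
Qed.

Lemma powR_ge1 (R : realType) (a x : R) : 1 <= a -> 0 <= x -> 1 <= a `^ x.
Proof. by move=> a1 x0; rewrite -(powRr0 a); exact: ler_powR. Qed.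
Lemma sqr1D_le (R : realFieldType) (a : R) : (1 + a) ^+ 2 <= 2 + 2 * a ^+ 2.
Proof. by have := sqr_ge0 (a - 1); rewrite !expr2; lra. Qed.
Lemma addee_mul2 (R : realDomainType) (a : \bar R) : (0 <= a)%E -> (a + a = 2%:E * a)%E.
Proof. by move=> a0; rewrite -[in LHS](mul1e a) -ge0_muleDl// -EFinD. Qed.
Lemma lee_of_abse_sub (R : realDomainType) (a b : \bar R) : (0 <= a)%E -> (0 <= b)%E ->
 (a <= `|a - b| + b)%E.
case: a b => [a||] [b||]//= a0 b0; rewrite ?leey//.
by rewrite -EFinD lee_fin -lerBlDr ler_norm.
Qed.

(** The positive part of a product by the signs of its factors. With [maxrN_mulN] it brings signed
    pair products within reach of the Palm formula, which is stated for nonnegative functions. *)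
Lemma maxrN_mul (R : realDomainType) (s t : R) :
 Num.max s 0 * Num.max t 0 + Num.max (- s) 0 * Num.max (- t) 0 = Num.max (s * t) 0.
case: (leP s 0) => hs; case: (leP t 0) => ht.
- by rewrite mul0r add0r !max_l ?oppr_ge0// ?mulrNN// mulr_le0.
- rewrite mul0r add0r (max_r (x := - t)) ?oppr_le0 ?(ltW ht)// mulr0.
 by rewrite max_r// mulr_le0_ge0// ltW.
- rewrite mulr0 add0r (max_r (x := - s)) ?oppr_le0 ?(ltW hs)// mul0r.
 by rewrite max_r// mulr_ge0_le0// ltW.
- rewrite (max_r (x := - s)) ?oppr_le0 ?(ltW hs)// mul0r addr0 max_l//.
 by rewrite mulr_ge0// ltW.
Qed.

Lemma maxrN_mulN (R : realDomainType) (s t : R) :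
 Num.max s 0 * Num.max (- t) 0 + Num.max (- s) 0 * Num.max t 0 = Num.max (- (s * t)) 0.
Proof. by rewrite -mulrN -maxrN_mul opprK. Qed.
Lemma abse_subC (R : realDomainType) (a b : \bar R) : (0 <= a)%E -> (0 <= b)%E ->
 (`|a - b| = `|b - a|)%E.
Proof. by case: a b => [a||] [b||]//= _ _; rewrite distrC. Qed.

Section abs_integral.
Context d (T : measurableType d) (R : realType) (m : meas T R).
Local Open Scope ereal_scope.
Let pos (v : T -> R) := \int[m]_x (Num.max (v x) 0%R)%:E.
Let neg (v : T -> R) := \int[m]_x (Num.max (- v x)%R 0%R)%:E.

Lemma integral_posneg (v : T -> R) : \int[m]_x (v x)%:E = pos v - neg v.
Proof. by rewrite integralE; congr (_ - _); apply: eq_integral => x _; rewrite ?funeposE ?funenegE EFin_max. Qed.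
(** The integrals of the two parts differ by at most the absolute value of the integral; in additive
    form this remains true when both are infinite. *)
Lemma integral_pos_le (v : T -> R) a : mfunT v ->
 \int[m]_x (Num.max (a * v x) 0)%R%:E <=
 `|a|%:E * `|\int[m]_x (v x)%:E| + \int[m]_x (Num.max (- (a * v x)) 0)%R%:E.
move=> mv.
have p0 : 0 <= pos v by apply: int_ge0 => x _; rewrite lee_fin le_max lexx orbT.
have n0 : 0 <= neg v by apply: int_ge0 => x _; rewrite lee_fin le_max lexx orbT.
have Z (b : R) (u : T -> R) : (0 <= b)%R -> mfunT u ->
  \int[m]_x (b * Num.max (u x) 0)%R%:E = b%:E * \int[m]_x (Num.max (u x) 0)%R%:E.
 move=> b0 mu; under eq_integral do rewrite EFinM.
 rewrite int_Zl//; last by apply/mEFin; exact: measurable_maxr.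
 by move=> x _; rewrite lee_fin le_max lexx orbT.
have mnv : mfunT (fun x => - v x)%R by exact: measurable_funN.
have [a0|a0] := leP 0%R a.
 under eq_integral do rewrite -[X in Num.max _ X](mulr0 a) -maxr_pMr//.
 under [X in _ <= _ + X]eq_integral do rewrite -mulrN -[X in Num.max _ X](mulr0 a) -maxr_pMr//.
 rewrite (Z _ _ a0 mv) (Z _ _ a0 mnv) ger0_norm// -ge0_muleDr// integral_posneg.
 by apply: lee_wpmul2l; [rewrite lee_fin|exact: lee_of_abse_sub].
have a1 : (0 <= - a)%R by rewrite oppr_ge0 ltW.
under eq_integral do rewrite -mulrNN -[X in Num.max _ X](mulr0 (- a)%R) -maxr_pMr//.
under [X in _ <= _ + X]eq_integral do rewrite -mulNr -[X in Num.max _ X](mulr0 (- a)%R) -maxr_pMr//.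
rewrite (Z _ _ a1 mv) (Z _ _ a1 mnv) ltr0_norm// -ge0_muleDr// integral_posneg.
apply: lee_wpmul2l; first by rewrite lee_fin.
have -> : `|pos v - neg v| = `|neg v - pos v|.
 exact: abse_subC.
exact: lee_of_abse_sub.
Qed.
End abs_integral.

Lemma powR_add_le (R : realType) (a b G : R) : 0 <= a -> 0 <= b -> 0 <= G ->
 (a + b) `^ G <= 2 `^ G * (a `^ G + b `^ G).
move=> a0 b0 G0.
have h (x y : R) : 0 <= x -> 0 <= y -> x <= y -> (x + y) `^ G <= 2 `^ G * (x `^ G + y `^ G).
 move=> x0 y0 xy; via ((2 * y) `^ G).
  by apply: ge0_ler_powR => //; rewrite ?nnegrE ?addr_ge0 ?mulr_ge0//; lra.
 by rewrite powRM// ler_wpM2l ?powR_ge0// lerDr powR_ge0.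
case: (leP a b) => ab; first exact: h.
by rewrite addrC [X in _ * X]addrC; apply: h => //; exact: ltW.
Qed.

Lemma ereal_null (R : realFieldType) (x : \bar R) (a b : R) : (0 <= x)%E -> (x < +oo)%E -> b < a ->
 (a%:E * x <= b%:E * x)%E -> x = 0%E.
case: x => [x||]//; rewrite lee_fin => x0 _ ba; rewrite -!EFinM lee_fin -subr_le0 -mulrBl.
rewrite pmulr_rle0 ?subr_gt0// => x1.
by congr EFin; apply/eqP; rewrite eq_le x0 x1.
Qed.

Lemma measure_int_indic d (T : measurableType d) (R : realType) (m : meas T R) B :
 measurable B -> m B = (\int[m]_y (\1_B y)%:E)%E.
Proof. by move=> mB; rewrite int_indic// setIT. Qed.
Lemma norm_sub_mul_le1 (R : realDomainType) (x a b : R) : 0 <= x <= 1 -> 0 <= a <= 1 -> 0 <= b <= 1 ->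
 `|x - a * b| <= 1.
move=> /andP[x0 x1] /andP[a0 a1] /andP[b0 b1].
have ab0 : 0 <= a * b by exact: mulr_ge0.
have ab1 : a * b <= 1 by rewrite mulr_ile1.
by rewrite ler_norml; apply/andP; split; lra.
Qed.

Lemma powR_le_1D (R : realType) (t a b : R) : 0 <= t -> 0 <= a -> a <= b -> t `^ a <= 1 + t `^ b.
move=> t0 a0 ab; case: (leP t 1) => t1; last first.
 by apply: (le_trans (ler_powR (ltW t1) ab)); rewrite lerDr.
via 1; last by rewrite lerDl powR_ge0.
move: t0; rewrite le_eqVlt => /orP[/eqP <-|t0].
 by have [->|an] := eqVneq a 0; [rewrite powRr0|rewrite powR0].
by rewrite -(powRr0 t); apply: ger_powR; rewrite ?t0.
Qed.

Lemma mule_ltyW (R : realFieldType) (a : R) (x : \bar R) : 0 < a -> (0 <= x)%E ->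
 (a%:E * x < +oo)%E -> (x < +oo)%E.
Proof. by case: x => [x||]// a0; rewrite ?ltry// gt0_muley ?lte_fin. Qed.
Lemma sqe_addC_le (R : realType) (C : R) (a b : \bar R) : 0 < C -> (0 <= a)%E -> (0 <= b)%E ->
 ((C%:E * a + b) * (C%:E * a + b) <= (2 * C ^+ 2)%:E * (a * a) + 2%:E * (b * b))%E.
move=> C0; case: a => [a||]; case: b => [b||] //; rewrite ?lee_fin.
- move=> a0 b0; have := sqr_ge0 (C * a - b); rewrite !expr2; nra.
- by move=> a0 _; rewrite !mulyy mulry gtr0_sg// mul1e addey -?EFinM ?leey.
- by move=> _ b0; rewrite !mulyy [X in (_ <= X + _)%E]mulry gtr0_sg ?mul1e ?addye ?leey// mulr_gt0// exprn_gt0.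
- move=> _ _; have C2 : (0 < (2 * C ^+ 2)%:E)%E by rewrite lte_fin mulr_gt0// exprn_gt0.
 by rewrite !mulyy (gt0_muley C2) addye ?leey// gt0_muley// lte_fin.
Qed.

Lemma powR_tail (R : realType) (a t T G : R) : 0 < T -> T <= t -> a <= G ->
 t `^ a <= t `^ G * T `^ (a - G).
move=> T0 Tt aG; have t0 : 0 < t by exact: lt_le_trans Tt.
have -> : t `^ a = t `^ G * t `^ (a - G) by rewrite -powRD ?(gt_eqF t0) ?implybT// [G + _]addrC subrK.
rewrite ler_wpM2l ?powR_ge0//.
have -> : a - G = - (G - a) by rewrite opprB.
rewrite !powRN lef_pV2 ?posrE ?powR_gt0//.
by apply: ge0_ler_powR => //; rewrite ?nnegrE ?subr_ge0// ltW.
Qed.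
Definition clip (R : realDomainType) (t a : R) := Num.max (- t) (Num.min t a).

Section clip.
Context {R : realDomainType}.
Implicit Types t a : R.

Lemma clip_le t a : 0 < t -> `|clip t a| <= t.
Proof. by move=> t0; rewrite ler_norml /clip le_max lexx/= ge_max ge_min lexx/= andbT; lra. Qed.
Lemma clip_norm_le t a : 0 < t -> `|clip t a| <= `|a|.
move=> t0; rewrite /clip; case: (leP t a) => h1.
 by rewrite max_r ?(ger0_norm (ltW t0)); [exact: le_trans h1 (ler_norm _)|lra].
case: (leP (- t) a) => // h2; rewrite normrN (ger0_norm (ltW t0)).
by rewrite ler0_norm; lra.
Qed.

Lemma clip_id t a : `|a| <= t -> clip t a = a.
Proof. by rewrite ler_norml /clip => /andP[h1 h2]; rewrite min_r// max_r. Qed.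
Lemma clip_dist t a : 0 < t -> `|a - clip t a| <= `|a|.
move=> t0; rewrite /clip; case: (leP t a) => h1.
 by rewrite max_r; [rewrite !ger0_norm; lra|lra].
case: (leP (- t) a) => h2; first by rewrite subrr normr0.
by rewrite !ler0_norm; lra.
Qed.

(** On the left is the correlation of [f = 2 t u - t] in terms of moments of [u], with [v] the
    reference mean of [u]. The discrepancies enter with weights [4 + 2 + 2] times [t^2], and the
    main part is the squared mean of [f]. *)
Lemma clip_combination (t k a b c v : R) : `|a - v * v| <= k -> `|b - v| <= k -> `|c - v| <= k ->
 `|4 * t ^+ 2 * a - 2 * t ^+ 2 * b - 2 * t ^+ 2 * c + t ^+ 2| <= 8 * t ^+ 2 * k + (2 * t * v - t) ^+ 2.
rewrite !ler_norml => /andP[a1 a2] /andP[b1 b2] /andP[c1 c2].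
have T0' : 0 <= t ^+ 2 by exact: sqr_ge0.
have sq := sqr_ge0 (2 * t * v - t).
have p1 := ler_wpM2l T0' a1; have p2 := ler_wpM2l T0' a2; have p3 := ler_wpM2l T0' b1.
have p4 := ler_wpM2l T0' b2; have p5 := ler_wpM2l T0' c1; have p6 := ler_wpM2l T0' c2.
by apply/andP; split; move: p1 p2 p3 p4 p5 p6 sq; lra.
Qed.
End clip.

Section unit_mass_integrals.
Context d (T : measurableType d) (R : realType) (m : meas T R).
Hypothesis m1 : m setT = 1%E.

Lemma bnd_integrable (f : T -> R) C : mfunT f -> (forall x, `|f x| <= C) ->
 intR m f.
move=> mf fC; apply/integrableP; split; first exact/mEFin.
apply: (@le_lt_trans _ _ (\int[m]_x C%:E)%E).
 by apply: le_intT => x //=; rewrite lee_fin.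
by rewrite integral_cst// m1 mule1 ltry.
Qed.

Lemma Rintegral_unit_cst (c : R) : \int[m]_x c = c.
Proof. by rewrite /Rintegral integral_cst// m1 mule1. Qed.
Lemma le_Rintegral_unit (f g : T -> R) : intR m f -> intR m g ->
 (forall x, f x <= g x) -> \int[m]_x f x <= \int[m]_x g x.
Proof. by move=> i1 i2 fg; apply: le_Rintegral => // x _; exact: fg. Qed.
End unit_mass_integrals.

(** * From discrepancies of events to correlations of unbounded functions *)

Section discrepancy.
Context d0 d1 d2 (Y : measurableType d0) (T : measurableType d1) (T0 : measurableType d2) (R : realType).
Variables (m : meas T R) (m0 : meas T0 R).
Hypotheses (m1 : m setT = 1%E) (m01 : m0 setT = 1%E).
Variables (U V : T -> Y) (W : T0 -> Y).
Hypotheses (mU : mfunT U) (mV : mfunT V) (mW : mfunT W).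
Variable k : R.
Hypothesis k0 : 0 <= k.
Hypothesis hk : forall A1 A2, measurable A1 -> measurable A2 ->
 `|fine (m [set w | A1 (U w) /\ A2 (V w)]) - fine (m0 [set w | A1 (W w)]) * fine (m0 [set w | A2 (W w)])| <= k.
(** For [f] with values in [[0, 1]], this rounds down to multiples of [1 / (L + 1)], written as an
    average of indicators of superlevel sets, to which [hk] applies term by term. *)
Let levels L (f : Y -> R) y : R := L.+1%:R^-1 * \sum_(j < L.+1) (j.+1%:R <= L.+1%:R * f y)%R%:R.
Let levels_near L f y : 0 <= f y <= 1 -> f y - L.+1%:R^-1 <= levels L f y <= f y.
move=> /andP[f0 f1]; have L0 : 0 < L.+1%:R :> R by [].
have t0 : 0 <= L.+1%:R * f y by rewrite mulr_ge0.
have [h _] := sum_le_floor L.+1 t0.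
have /h : L.+1%:R * f y <= L.+1%:R by rewrite ler_piMr.
rewrite /levels; set S := \sum_(j < _) _ => /andP[S1 S2].
have e : f y = L.+1%:R^-1 * (L.+1%:R * f y) by rewrite mulrA mulVf ?mul1r// gt_eqF.
apply/andP; split; rewrite {1}e; last by rewrite ler_wpM2l.
by rewrite -{2}[L.+1%:R^-1]mulr1 -mulrBr ler_wpM2l.
Qed.
Let measurable_level L (f : Y -> R) j : mfunT f ->
 measurable [set y | j%:R <= L%:R * f y].
move=> mf; rewrite -[X in measurable X]setTI.
apply: (@measurable_fun_le _ _ _ setT (fun=> j%:R) (fun y => L%:R * f y)) => //.
exact: mfunM.
Qed.
Let mlevels L f : mfunT f -> mfunT (levels L f).
move=> mf; apply: mfunM => //; apply: measurable_sum => j.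
apply: mbool_natr; apply: measurable_fun_ler => //; exact: mfunM.
Qed.
Let fine_le1 dT (X : measurableType dT) (p : meas X R) : p setT = 1%E -> forall A, measurable A ->
 p A \is a fin_num.
move=> p1 A mA; rewrite ge0_fin_numE//; apply: (@le_lt_trans _ _ 1%E); last exact: ltry.
by rewrite -p1; apply: le_measure; rewrite ?inE.
Qed.
Let int_natr dT (X : measurableType dT) (p : meas X R) (b : X -> bool) : mfunT b ->
 \int[p]_x (b x)%:R = fine (p [set x | b x]).
move=> mb; have mB : measurable [set x | b x].
 rewrite -[X in measurable X]setTI; exact: (mb mtop [set true]).
rewrite /Rintegral -[X in _ = fine (p X)]setIT -int_indic//; congr fine.
by apply: eq_integral => x _; rewrite indicE mem_setE.
Qed.

(** For rounded functions the discrepancy is an average, over pairs of level sets, of quantities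
    bounded by [k]. Rounding costs at most [2 / (L + 1)], which is sent to 0. *)
Lemma discrepancy_unit (f g : Y -> R) : mfunT f -> mfunT g ->
 (forall y, 0 <= f y <= 1) -> (forall y, 0 <= g y <= 1) ->
 `|\int[m]_w (f (U w) * g (V w)) - \int[m0]_w f (W w) * \int[m0]_w g (W w)| <= k.
move=> mf mg f01 g01.
have lev01 L u y : (forall y, 0 <= u y <= 1) -> 0 <= levels L u y <= 1.
 move=> u01; have /andP[h1 h2] := levels_near L (u01 y); have /andP[u0 u1] := u01 y.
 rewrite (le_trans h2 u1) andbT /levels mulr_ge0//; apply: sumr_ge0 => j _; exact: ler0n.
have b01 (x : R) : 0 <= x <= 1 -> `|x| <= 1 by move=> /andP[h1 h2]; rewrite ger0_norm.
have int0 (u : Y -> R) : mfunT u -> (forall y, 0 <= u y <= 1) ->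
  intR m0 (fun w => u (W w)).
 by move=> mu u01; apply: (bnd_integrable m01 (C := 1)) => [|w]; [exact: mcomp|exact: b01].
have int2 (u v : Y -> R) : mfunT u -> mfunT v ->
  (forall y, 0 <= u y <= 1) -> (forall y, 0 <= v y <= 1) ->
  intR m (fun w => u (U w) * v (V w)).
 move=> mu mv u01 v01; apply: (bnd_integrable m1 (C := 1)) => [|w].
  by apply: mfunM; exact: mcomp.
 by rewrite normrM mulr_ile1// b01.
have I01 (u : Y -> R) : mfunT u -> (forall y, 0 <= u y <= 1) -> 0 <= \int[m0]_w u (W w) <= 1.
 move=> mu u01; apply/andP; split.
  by apply: Rintegral_ge0 => w _; have /andP[] := u01 (W w).
 rewrite -[leRHS](Rintegral_unit_cst m01); apply: le_Rintegral_unit; first exact: int0.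
  by apply: (bnd_integrable m01 (C := 1)) => // x; rewrite normr1.
 by move=> w; have /andP[] := u01 (W w).
have close L (u : Y -> R) : mfunT u -> (forall y, 0 <= u y <= 1) ->
  \int[m0]_w u (W w) - L.+1%:R^-1 <= \int[m0]_w levels L u (W w) <= \int[m0]_w u (W w).
 move=> mu u01; have il := int0 _ (mlevels L mu) (fun y => lev01 L u y u01).
 apply/andP; split; last first.
  by apply: le_Rintegral_unit => //; [exact: int0|move=> w; have /andP[] := levels_near L (u01 (W w))].
 have ic : intR m0 (fun=> L.+1%:R^-1 : R) by apply: (bnd_integrable m01 (C := `|L.+1%:R^-1|)) => // x.
 rewrite -[X in _ - X](Rintegral_unit_cst m01) -(RintegralB mtop (int0 _ mu u01) ic).
 apply: le_Rintegral_unit => //; last by move=> w; have /andP[] := levels_near L (u01 (W w)).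
 exact: (integrableB mtop (int0 _ mu u01) ic).
have close2 L : \int[m]_w (f (U w) * g (V w)) - 2 * L.+1%:R^-1 <=
  \int[m]_w (levels L f (U w) * levels L g (V w)) <= \int[m]_w (f (U w) * g (V w)).
 have il := int2 _ _ (mlevels L mf) (mlevels L mg) (fun y => lev01 L f y f01) (fun y => lev01 L g y g01).
 have ic : intR m (fun=> 2 * L.+1%:R^-1 : R) by apply: (bnd_integrable m1 (C := `|2 * L.+1%:R^-1|)) => // x.
 have ifg := int2 _ _ mf mg f01 g01.
 have pw w : f (U w) * g (V w) - 2 * L.+1%:R^-1 <= levels L f (U w) * levels L g (V w) <= f (U w) * g (V w).
  have /andP[a1 a2] := levels_near L (f01 (U w)); have /andP[b1 b2] := levels_near L (g01 (V w)).
  have /andP[c1 c2] := lev01 L f (U w) f01; have /andP[d1' d2'] := lev01 L g (V w) g01.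
  have /andP[e1 e2] := f01 (U w); have /andP[h1 h2] := g01 (V w).
  move: a1 a2 b1 b2 c1 c2 d1' d2' e1 e2 h1 h2; set a := levels L f _; set b := levels L g _.
  set a' := f _; set b' := g _; set e : R := L.+1%:R^-1 => a1 a2 b1 b2 c1 c2 d1' d2' e1 e2 h1 h2.
  apply/andP; split; last exact: ler_pM.
  have h3 : a * (b' - b) <= b' - b by rewrite ler_piMl// subr_ge0.
  have h4 : b' * (a' - a) <= a' - a by rewrite ler_piMl// subr_ge0.
  have -> : a' * b' - 2 * e = a * b + a * (b' - b) + b' * (a' - a) - 2 * e by ring.
  lra.
 apply/andP; split; last first.
  by apply: le_Rintegral_unit => // w; have /andP[] := pw w.
 rewrite -[X in _ - X](Rintegral_unit_cst m1) -(RintegralB mtop ifg ic).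
 apply: le_Rintegral_unit => //; last by move=> w; have /andP[] := pw w.
 exact: (integrableB mtop ifg ic).
have lev L : `|\int[m]_w (levels L f (U w) * levels L g (V w)) -
  \int[m0]_w levels L f (W w) * \int[m0]_w levels L g (W w)| <= k.
 pose a (j : 'I_L.+1) y : bool := j.+1%:R <= L.+1%:R * f y.
 pose b (j : 'I_L.+1) y : bool := j.+1%:R <= L.+1%:R * g y.
 have ma j : mfunT (a j) by apply: measurable_fun_ler => //; exact: mfunM.
 have mb j : mfunT (b j) by apply: measurable_fun_ler => //; exact: mfunM.
 have nat01 (c : bool) : `|c%:R| <= 1 :> R by case: c; rewrite ?normr1 ?normr0.
 have sumE0 (c : 'I_L.+1 -> Y -> bool) : (forall j, mfunT (c j)) ->
   \int[m0]_w (L.+1%:R^-1 * \sum_j (c j (W w))%:R) = L.+1%:R^-1 * \sum_j fine (m0 [set w | c j (W w)]).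
  move=> mc; have mcW j : mfunT (fun w => c j (W w)) by exact: mcomp.
  have ij j : intR m0 (fun w => (c j (W w))%:R : R)
   by apply: (bnd_integrable m01 (C := 1)) => //; exact: mbool_natr.
  have [e i] := @Rintegral_sum _ _ R m0 _ (index_enum _) (fun j w => (c j (W w))%:R) ij.
  rewrite (RintegralZl _ mtop i) e; congr (_ * _); apply: eq_bigr => j _.
  exact: int_natr.
 have sumE2 : \int[m]_w (levels L f (U w) * levels L g (V w)) =
   L.+1%:R^-1 ^+ 2 * \sum_i \sum_j fine (m [set w | a i (U w) /\ b j (V w)]).
  have mab i j : mfunT (fun w => a i (U w) && b j (V w)) by apply: measurable_and; exact: mcomp.
  have iab i j : intR m (fun w => (a i (U w) && b j (V w))%:R : R)
   by apply: (bnd_integrable m1 (C := 1)) => //; exact: mbool_natr.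
  have e2 i := @Rintegral_sum _ _ R m _ (index_enum _) (fun j w => (a i (U w) && b j (V w))%:R) (iab i).
  have [e i] := @Rintegral_sum _ _ R m _ (index_enum _)
   (fun i w => \sum_j (a i (U w) && b j (V w))%:R) (fun i => (e2 i).2).
  transitivity (\int[m]_w (L.+1%:R^-1 ^+ 2 * \sum_i \sum_j (a i (U w) && b j (V w))%:R)).
   apply: eq_Rint => w _; rewrite /levels -/(a _ _) mulrACA -expr2; congr (_ * _).
   rewrite mulr_suml; apply: eq_bigr => i' _; rewrite mulr_sumr; apply: eq_bigr => j _.
   by rewrite /a /b; case: (_ <= _); case: (_ <= _); rewrite ?mulr1 ?mulr0 ?mul0r.
  rewrite (RintegralZl _ mtop i) e; congr (_ * _); apply: eq_bigr => i' _.
  rewrite (e2 i').1; apply: eq_bigr => j _; rewrite int_natr//; congr (fine (m _)).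
  by apply/seteqP; split => w /=; [move=> /andP|move=> [-> ->]].
 rewrite sumE2 /levels (sumE0 a ma) (sumE0 b mb) mulrACA -expr2 -mulrBr.
 rewrite mulr_suml; under [X in _ - X]eq_bigr do rewrite mulr_sumr.
 rewrite -sumrB; under eq_bigr do rewrite -sumrB.
 have L2 : 0 <= L.+1%:R^-1 ^+ 2 :> R by rewrite exprn_ge0// invr_ge0.
 rewrite normrM ger0_norm//.
 via (L.+1%:R^-1 ^+ 2 * (L.+1%:R * (L.+1%:R * k))); last first.
  by apply: eq_ler; field; rewrite addrC natr1.
 apply: (ler_wpM2l L2); apply: le_trans (ler_norm_sum _ _ _) _.
 have cst (x : R) : L.+1%:R * x = \sum_(i < L.+1) x by rewrite sumr_const card_ord mulr_natl.
 rewrite [leRHS]cst; apply: ler_sum => i _; apply: le_trans (ler_norm_sum _ _ _) _.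
 rewrite [leRHS]cst; apply: ler_sum => j _.
 exact: (hk (measurable_level L.+1 i.+1 mf) (measurable_level L.+1 j.+1 mg)).
have fin L : `|\int[m]_w (f (U w) * g (V w)) - \int[m0]_w f (W w) * \int[m0]_w g (W w)| <= k + 2 * L.+1%:R^-1.
 have := lev L; have /andP[] := close2 L; have /andP[] := close L f mf f01; have /andP[] := close L g mg g01.
 have /andP[] := I01 _ mf f01; have /andP[] := I01 _ mg g01.
 have /andP[] := I01 _ (mlevels L mf) (fun y => lev01 L f y f01).
 have /andP[] := I01 _ (mlevels L mg) (fun y => lev01 L g y g01).
 set x := \int[m]_w (f (U w) * g (V w)); set x' := \int[m]_w (levels L f (U w) * levels L g (V w)).
 set y := \int[m0]_w f (W w); set y' := \int[m0]_w levels L f (W w).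
 set z := \int[m0]_w g (W w); set z' := \int[m0]_w levels L g (W w).
 set e : R := L.+1%:R^-1.
 move: x x' y y' z z' e => x x' y y' z z' e z'0 z'1 y'0 y'1 z0 z1 y0 y1 zz1 zz2 yy1 yy2 xx1 xx2.
 rewrite !ler_norml => /andP[k1 k2].
 have h3 : y' * (z - z') <= z - z' by rewrite ler_piMl// subr_ge0.
 have h4 : z * (y - y') <= y - y' by rewrite ler_piMl// subr_ge0.
 have h5 : 0 <= y' * (z - z') by rewrite mulr_ge0// subr_ge0.
 have h6 : 0 <= z * (y - y') by rewrite mulr_ge0// subr_ge0.
 have -> : y * z = y' * z' + y' * (z - z') + z * (y - y') by ring.
 by apply/andP; split; lra.
apply/ler_addgt0Pr => e e0; pose L := Num.truncn (2 / e).
apply: le_trans (fin L) _; rewrite lerD2l.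
rewrite ler_pdivrMr// mulrC -ler_pdivrMr//; exact: ltW (truncnS_gt _).
Qed.

(** An affine map brings [f] into [[0, 1]]. The constant function 1 as one of the two arguments
    compares the marginals of [m] with [m0]. *)
Lemma discrepancy_clip (f : Y -> R) t : 0 < t -> mfunT f -> (forall y, `|f y| <= t) ->
 `|\int[m]_w (f (U w) * f (V w))| <= 8 * t ^+ 2 * k + (\int[m0]_w f (W w)) ^+ 2.
move=> t0 mf ft; pose u y := (f y + t) / (2 * t).
have t20 : 0 < 2 * t by rewrite mulr_gt0.
have mu : mfunT u by apply: mfunM => //; exact: mfunD.
have u01 y : 0 <= u y <= 1.
 have := ft y; rewrite ler_norml => /andP[h1 h2]; rewrite /u.
 by apply/andP; split; [rewrite divr_ge0 ?(ltW t20)//; lra|rewrite ler_pdivrMr//; lra].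
have fE y : f y = 2 * t * u y - t by rewrite /u mulrC divfK ?gt_eqF//; ring.
have one (y : Y) : (0 : R) <= 1 <= (1 : R) by rewrite ler01 lexx.
have m1c : mfunT (fun _ : Y => 1 : R) by [].
have d11 := discrepancy_unit mu mu u01 u01.
have d10 := discrepancy_unit mu m1c u01 one.
have d01 := discrepancy_unit m1c mu one u01.
have i0 : intR m0 (fun w => u (W w)).
 apply: (bnd_integrable m01 (C := 1)) => [|w]; first exact: mcomp.
 by have /andP[h1 h2] := u01 (W w); rewrite ger0_norm.
have iM (g h : Y -> R) : mfunT g -> mfunT h -> (forall y, 0 <= g y <= 1) -> (forall y, 0 <= h y <= 1) ->
  intR m (fun w => g (U w) * h (V w)).
 move=> mg mh g01 h01; apply: (bnd_integrable m1 (C := 1)) => [|w].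
  by apply: mfunM; exact: mcomp.
 have /andP[a1 a2] := g01 (U w); have /andP[b1 b2] := h01 (V w).
 by rewrite normrM mulr_ile1// ger0_norm.
have i11 := iM _ _ mu mu u01 u01; have i10 := iM _ _ mu m1c u01 one; have i01 := iM _ _ m1c mu one u01.
have ic (x : R) : intR m (fun=> x : R) by apply: (bnd_integrable m1 (C := `|x|)).
have ic0 (x : R) : intR m0 (fun=> x : R) by apply: (bnd_integrable m01 (C := `|x|)).
have E0 : \int[m0]_w f (W w) = 2 * t * \int[m0]_w u (W w) - t.
 under eq_Rint do rewrite fE.
 rewrite (RintegralB mtop (integrableZl mtop (2 * t) i0) (ic0 t)) (RintegralZl _ mtop i0).
 by rewrite Rintegral_unit_cst.
have E2 : \int[m]_w (f (U w) * f (V w)) = 4 * t ^+ 2 * \int[m]_w (u (U w) * u (V w)) -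
  2 * t ^+ 2 * \int[m]_w (u (U w) * 1) - 2 * t ^+ 2 * \int[m]_w (1 * u (V w)) + t ^+ 2.
 have e w : f (U w) * f (V w) = 4 * t ^+ 2 * (u (U w) * u (V w)) + (- (2 * t ^+ 2) * (u (U w) * 1)
   + (- (2 * t ^+ 2) * (1 * u (V w)) + t ^+ 2)) by rewrite !fE; ring.
 under eq_Rint do rewrite e.
 have j1 := integrableZl mtop (4 * t ^+ 2) i11.
 have j2 := integrableZl mtop (- (2 * t ^+ 2)) i10.
 have j3 := integrableZl mtop (- (2 * t ^+ 2)) i01.
 have j4 := integrableD mtop j3 (ic (t ^+ 2)).
 have j5 := integrableD mtop j2 j4.
 rewrite (RintegralD mtop j1 j5) (RintegralD mtop j2 j4) (RintegralD mtop j3 (ic (t ^+ 2))).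
 rewrite (RintegralZl _ mtop i11) (RintegralZl _ mtop i10) (RintegralZl _ mtop i01).
 by rewrite Rintegral_unit_cst//; ring.
move: d11 d10 d01; rewrite (Rintegral_unit_cst m01) E0 E2 mulr1 mul1r => d11 d10 d01.
exact: clip_combination.
Qed.
Variable g : Y -> R.
Hypothesis mg : mfunT g.
Variables (G C0 C2 : R).
Hypothesis G2 : 2 < G.
Hypothesis gU : (\int[m]_w (`|g (U w)| `^ G)%:E <= C2%:E)%E.
Hypothesis gV : (\int[m]_w (`|g (V w)| `^ G)%:E <= C2%:E)%E.
Hypothesis gW : (\int[m0]_w (`|g (W w)| `^ G)%:E <= C0%:E)%E.
Hypothesis g0 : \int[m0]_w g (W w) = 0.
Let moment_integrable dT (X : measurableType dT) (p : meas X R) (h : X -> Y) C :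
 mfunT h -> (\int[p]_w (`|g (h w)| `^ G)%:E <= C%:E)%E ->
 intR p (fun w => `|g (h w)| `^ G) /\ \int[p]_w (`|g (h w)| `^ G) <= C.
move=> mh hC.
have mgh : mfunT (fun w => `|g (h w)| `^ G).
 apply: (mcomp (measurable_powR G)); apply: mcomp => //; exact: mcomp.
have i : intR p (fun w => `|g (h w)| `^ G).
 apply/integrableP; split; first exact/mEFin.
 apply: le_lt_trans (ltry C); apply: le_trans hC; apply: le_intT => x //=.
 by rewrite lee_fin ger0_norm// powR_ge0.
split => //; rewrite -lee_fin /Rintegral fineK//; exact: integrable_fin_num.
Qed.

(** Where the larger factor exceeds 1, the product is at most its square and hence its power
    [G > 2]; elsewhere the product is at most 1. *)
Lemma correlation_integrable : intR m (fun w => g (U w) * g (V w)).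
have [iU _] := moment_integrable mU gU; have [iV _] := moment_integrable mV gV.
have ic : intR m (fun=> 1 : R) by apply: (bnd_integrable m1 (C := 1)) => // x; rewrite normr1.
apply: (le_integrable mtop _ _ (integrableD mtop ic (integrableD mtop iU iV))).
 by apply/mEFin; apply: mfunM; exact: mcomp.
move=> w _; rewrite /= lee_fin normrM.
have pU := powR_ge0 `|g (U w)| G; have pV := powR_ge0 `|g (V w)| G.
rewrite [leRHS]ger0_norm ?addr_ge0//.
have sq (a b : R) : 1 < a -> 0 <= b -> b <= a -> a * b <= a `^ G.
 move=> a1 b0 ba; have a0 : 0 <= a by exact: le_trans (ltW a1).
 via (a ^+ 2); first by rewrite expr2 ler_wpM2l.
 by rewrite -powR_mulrn//; apply: ler_powR; [exact: ltW|exact: ltW].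
case: (leP `|g (U w)| `|g (V w)|) => h.
 case: (leP `|g (V w)| 1) => h1.
  via 1; last by rewrite lerDl addr_ge0.
  by rewrite mulr_ile1// (le_trans h).
 rewrite mulrC; apply: le_trans (sq _ _ h1 (normr_ge0 _) h) _.
 by rewrite addrA lerDr addr_ge0.
case: (leP `|g (U w)| 1) => h1.
 via 1; last by rewrite lerDl addr_ge0.
 by rewrite mulr_ile1// (le_trans (ltW h)).
apply: le_trans (sq _ _ h1 (normr_ge0 _) (ltW h)) _.
by rewrite addrCA lerDl addr_ge0.
Qed.

(** Truncation at [t]: the truncated product is controlled by the discrepancy, and what is lost is
    at most [t^(2-G)] times moments of order [G]. As [g] has mean zero under [m0], the mean of the
    truncation is minus that of the excess, of order [t^(1-G)]. *)
Lemma correlation_le_clip t : 1 <= t ->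
 `|\int[m]_w (g (U w) * g (V w))| <= 8 * t ^+ 2 * k + (C0 ^+ 2 + 4 * C2) * t `^ (2 - G).
move=> t1; have t0 : 0 < t by exact: lt_le_trans t1.
pose f y := clip t (g y).
have mf : mfunT f by apply: measurable_maxr => //; exact: measurable_minr.
have ft y : `|f y| <= t by exact: clip_le.
have fg y : `|f y| <= `|g y| by exact: clip_norm_le.
have fe y : `|g y| <= t -> f y = g y by exact: clip_id.
have G1 : 1 <= G by apply: le_trans (ltW G2); rewrite ler1n.
have [iU hU] := moment_integrable mU gU; have [iV hV] := moment_integrable mV gV.
have [iW hW] := moment_integrable mW gW.
have tG0 : 0 <= t `^ (2 - G) by exact: powR_ge0.

have mean : (\int[m0]_w f (W w)) ^+ 2 <= C0 ^+ 2 * t `^ (2 - G).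
 have b w : `|g (W w) - f (W w)| <= t `^ (1 - G) * `|g (W w)| `^ G.
  have [h|h] := leP `|g (W w)| t.
   by rewrite fe// subrr normr0 mulr_ge0 ?powR_ge0.
  apply: (@le_trans _ _ `|g (W w)|); first exact: clip_dist.
  by rewrite mulrC -[leLHS]powRr1//; exact: (powR_tail t0 (ltW h) G1).
 have ifW : intR m0 (fun w => f (W w)) by apply: (bnd_integrable m01 (C := t)) => //; exact: mcomp.
 have ib := integrableZl mtop (t `^ (1 - G)) iW.
 have idif : intR m0 (fun w => g (W w) - f (W w)).
  apply: (le_integrable mtop _ _ ib).
   apply/mEFin; apply: mfunB; exact: mcomp.
  move=> w _; rewrite /= lee_fin; apply: le_trans (b w) (ler_norm _).
 have igW : intR m0 (fun w => g (W w)).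
  rewrite (_ : (fun w => _) = fun w => (g (W w) - f (W w)) + f (W w)); last by apply/funext => w; rewrite subrK.
  exact: (integrableD mtop idif ifW).
 have e : \int[m0]_w f (W w) = - \int[m0]_w (g (W w) - f (W w))
  by rewrite (RintegralB mtop igW ifW) g0 sub0r opprK.
 have hle : `|\int[m0]_w f (W w)| <= t `^ (1 - G) * C0.
  rewrite e normrN; apply: le_trans (le_normr_Rintegral mtop idif) _.
  via (\int[m0]_w (t `^ (1 - G) * `|g (W w)| `^ G)).
   apply: le_Rintegral => //.
   by apply: (integrable_norm idif).
  by rewrite (RintegralZl _ mtop iW) ler_wpM2l// powR_ge0.
 rewrite -real_normK ?num_real//.
 via ((t `^ (1 - G) * C0) ^+ 2).
  exact: (lerXn2r 2 (normr_ge0 _) (le_trans (normr_ge0 _) hle) hle).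
 rewrite exprMn mulrC ler_wpM2l ?sqr_ge0// -powR_mulrn ?powR_ge0// -powRrM.
 by apply: ler_powR => //; lra.
have iff : intR m (fun w => f (U w) * f (V w)).
 apply: (bnd_integrable m1 (C := t * t)) => [|w].
  by apply: mfunM; exact: mcomp.
 by rewrite normrM ler_pM.
pose bb w := 2 * t `^ (2 - G) * (`|g (U w)| `^ G + `|g (V w)| `^ G).
have ibb : intR m bb.
 exact: (integrableZl mtop (2 * t `^ (2 - G)) (integrableD mtop iU iV)).
have bdif w : `|g (U w) * g (V w) - f (U w) * f (V w)| <= bb w.
 have bb0 : 0 <= bb w by rewrite !mulr_ge0// addr_ge0// powR_ge0.
 have sq (x y : Y) : t <= `|g x| -> `|g y| <= `|g x| -> `|g x| * `|g y| <= t `^ (2 - G) * (`|g x| `^ G).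
  move=> h1 h2; via (`|g x| ^+ 2); first by rewrite expr2 ler_wpM2l.
  by rewrite mulrC -[X in _ ^+ X]/2%N -powR_mulrn//; exact: (powR_tail t0 h1 (ltW G2)).
 have big : `|g (U w)| * `|g (V w)| <= t `^ (2 - G) * (`|g (U w)| `^ G + `|g (V w)| `^ G) ->
   `|g (U w) * g (V w) - f (U w) * f (V w)| <= bb w.
  move=> h; apply: le_trans (ler_normB _ _) _; rewrite !normrM.
  have h2 : `|f (U w)| * `|f (V w)| <= `|g (U w)| * `|g (V w)| by rewrite ler_pM.
  by rewrite /bb -mulrA; lra.
 have pU : 0 <= t `^ (2 - G) * `|g (U w)| `^ G by rewrite mulr_ge0// powR_ge0.
 have pV : 0 <= t `^ (2 - G) * `|g (V w)| `^ G by rewrite mulr_ge0// powR_ge0.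
 case: (leP `|g (U w)| `|g (V w)|) => h; last first.
  case: (leP `|g (U w)| t) => h1.
   by rewrite (fe (U w))// (fe (V w)) ?subrr ?normr0// (le_trans (ltW h)).
  by apply: big; rewrite mulrDr; apply: le_trans (sq (U w) (V w) (ltW h1) (ltW h)) _; rewrite lerDl.
 case: (leP `|g (V w)| t) => h1.
  by rewrite (fe (U w)) ?(fe (V w)) ?subrr ?normr0// (le_trans h).
 by apply: big; rewrite mulrDr [`|g (U w)| * _]mulrC; apply: le_trans (sq (V w) (U w) (ltW h1) h) _; rewrite lerDr.
have idif : intR m (fun w => g (U w) * g (V w) - f (U w) * f (V w)).
 apply: (le_integrable mtop _ _ ibb).
  by apply/mEFin; apply: mfunB; apply: mfunM; exact: mcomp.
 by move=> w _; rewrite /= lee_fin; apply: le_trans (bdif w) (ler_norm _).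
have -> : \int[m]_w (g (U w) * g (V w)) = \int[m]_w (g (U w) * g (V w) - f (U w) * f (V w)) + \int[m]_w (f (U w) * f (V w)).
 rewrite -(RintegralD mtop idif iff).
 by apply: eq_Rint => w _; rewrite subrK.
apply: le_trans (ler_normD _ _) _.
have d1' : `|\int[m]_w (g (U w) * g (V w) - f (U w) * f (V w))| <= 4 * C2 * t `^ (2 - G).
 apply: le_trans (le_normr_Rintegral mtop idif) _.
 via (\int[m]_w bb w).
  by apply: le_Rintegral => //; apply: (integrable_norm idif).
 rewrite /bb (RintegralZl _ mtop (integrableD mtop iU iV)) (RintegralD mtop iU iV).
 via (2 * t `^ (2 - G) * (C2 + C2)).
  by apply: (ler_wpM2l (mulr_ge0 _ tG0)) => //; exact: lerD hU hV.
 by apply: eq_ler; ring.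
have := discrepancy_clip t0 mf ft; rewrite mulrDl; lra.
Qed.

(** The level [t = k^(-1/G)] balances [t^2 * k] with [t^(2-G)]; both become [k^(1-2/G)]. For [k = 0]
    the level is sent to infinity instead. *)
Lemma correlation_le : k <= 1 ->
 `|\int[m]_w (g (U w) * g (V w))| <= (8 + (C0 ^+ 2 + 4 * C2)) * k `^ (1 - 2 / G).
move=> k1; have G0 : 0 < G by exact: lt_trans G2.
have G12 : 0 < 1 - 2 / G by rewrite subr_gt0 ltr_pdivrMr// mul1r.
move: (k0); rewrite le_eqVlt => /orP[/eqP ek|kp].
 rewrite -ek powR0 ?gt_eqF// mulr0.
 set a := `|_|; set D := C0 ^+ 2 + 4 * C2.
 have h (t : R) : 1 <= t -> a <= D * t `^ (2 - G)
  by move=> t1; have := correlation_le_clip t1; rewrite -ek mulr0 add0r.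
 have D0 : 0 <= D by have := h 1 (lexx _); rewrite powR1 mulr1; apply: le_trans; exact: normr_ge0.
 apply/ler_addgt0Pr => e e0; rewrite add0r.
 pose t := Num.max 1 (((D + 1) / e) `^ (G - 2)^-1).
 have t1 : 1 <= t by rewrite le_max lexx.
 have t0 : 0 < t by exact: lt_le_trans t1.
 apply: le_trans (h t t1) _.
 have G20 : 0 < G - 2 by rewrite subr_gt0.
 have -> : 2 - G = - (G - 2) by rewrite opprB.
 rewrite powRN ler_pdivrMr ?powR_gt0//.
 have De0 : 0 <= (D + 1) / e by rewrite divr_ge0 ?(ltW e0)// addr_ge0.
 have h1 : (D + 1) / e <= t `^ (G - 2).
  have -> : (D + 1) / e = (((D + 1) / e) `^ (G - 2)^-1) `^ (G - 2) by rewrite -powRrM mulVf ?gt_eqF// powRr1.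
  apply: ge0_ler_powR; rewrite ?nnegrE ?powR_ge0 ?(ltW G20) ?(ltW t0)//.
  by rewrite le_max lexx orbT.
 have : e * ((D + 1) / e) <= e * t `^ (G - 2) by rewrite ler_wpM2l// ltW.
 by rewrite mulrC divfK ?gt_eqF//; lra.
pose t := k `^ (- G^-1).
have t1 : 1 <= t.
 rewrite /t powRN -[leLHS]invr1 lef_pV2 ?posrE ?powR_gt0//.
 have -> : 1 = 1 `^ G^-1 :> R by rewrite powR1.
 by apply: ge0_ler_powR; rewrite ?nnegrE ?invr_ge0 ?(ltW G0).
have := correlation_le_clip t1.
have -> : 8 * t ^+ 2 * k = 8 * k `^ (1 - 2 / G).
 rewrite -mulrA; congr (8 * _).
 rewrite -[t ^+ 2]powR_mulrn ?powR_ge0// /t -powRrM.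
 have {2}-> : k = k `^ 1 by rewrite powRr1.
 by rewrite -powRD ?(gt_eqF kp) ?implybT//; congr (_ `^ _); rewrite mulNr addrC mulrC.
have -> : t `^ (2 - G) = k `^ (1 - 2 / G) by rewrite /t -powRrM; congr (_ `^ _); field; rewrite gt_eqF.
by rewrite -mulrDl.
Qed.
End discrepancy.

(** * Calculus of growth rates *)

Section rate.
Context {R : realType}.
Implicit Types (F G : R -> \bar R) (a b : R).

(* [F r = o(r^a)] if [strong], [F r = O(r^a)] otherwise, as [r] tends to infinity. *)
Definition rate (strong : bool) a F : Prop :=
 if strong then forall e, 0 < e -> exists2 r0, 1 <= r0 & forall r, r0 <= r -> (F r <= (e * r `^ a)%:E)%E
 else exists2 e, 0 < e & exists2 r0, 1 <= r0 & forall r, r0 <= r -> (F r <= (e * r `^ a)%:E)%E.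

Lemma rate_le s a F G : (forall r, 1 <= r -> (F r <= G r)%E) -> rate s a G -> rate s a F.
move=> FG; have H e r0 : 1 <= r0 -> (forall r, r0 <= r -> (G r <= (e * r `^ a)%:E)%E) ->
  forall r, r0 <= r -> (F r <= (e * r `^ a)%:E)%E.
 by move=> r01 h r rr; apply: le_trans (h r rr); apply: FG; exact: le_trans rr.
case: s => /=; first by move=> h e /h[r0 r01 h']; exists r0 => //; exact: H.
by move=> [e e0 [r0 r01 h]]; exists e => //; exists r0 => //; exact: H.
Qed.

Lemma rate_add s a F G : rate s a F -> rate s a G -> rate s a (fun r => F r + G r)%E.
have H e e' r0 r0' : (forall r, r0 <= r -> (F r <= (e * r `^ a)%:E)%E) ->
  (forall r, r0' <= r -> (G r <= (e' * r `^ a)%:E)%E) ->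
  forall r, Num.max r0 r0' <= r -> (F r + G r <= ((e + e') * r `^ a)%:E)%E.
 by move=> h h' r; rewrite ge_max => /andP[h1 h2]; rewrite mulrDl EFinD; apply: leeD; [exact: h|exact: h'].
case: s => /= hF hG.
 move=> e e0; have e20 : 0 < e / 2 by rewrite divr_gt0.
 have [r0 r01 h] := hF _ e20; have [r0' r01' h'] := hG _ e20.
 exists (Num.max r0 r0'); first by rewrite le_max r01.
 by have := H _ _ _ _ h h'; rewrite -splitr.
have [e e0 [r0 r01 h]] := hF; have [e' e'0 [r0' r01' h']] := hG.
exists (e + e'); first exact: addr_gt0.
by exists (Num.max r0 r0'); [rewrite le_max r01|exact: H h h'].
Qed.

Lemma rate_scale s a F C : 0 <= C -> rate s a F -> rate s a (fun r => C%:E * F r)%E.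
move=> C0; have H e r0 : 0 < e -> (forall r, r0 <= r -> (F r <= (e * r `^ a)%:E)%E) ->
  forall r, r0 <= r -> (C%:E * F r <= (((C + 1) * e) * r `^ a)%:E)%E.
 move=> e0 h r rr; via (C%:E * (e * r `^ a)%:E)%E.
  by rewrite lee_wpmul2l ?lee_fin// h.
 rewrite -EFinM lee_fin -mulrA ler_wpM2r ?lerDl//.
 by rewrite mulr_ge0 ?(ltW e0)// powR_ge0.
have C1 : 0 < C + 1 by rewrite ltr_wpDl.
case: s => /= hF.
 move=> e e0; have [r0 r01 h] := hF _ (divr_gt0 e0 C1); exists r0 => //.
 by have := H _ _ (divr_gt0 e0 C1) h; rewrite [(C + 1) * _]mulrC divfK ?gt_eqF.
have [e e0 [r0 r01 h]] := hF; exists ((C + 1) * e); first exact: mulr_gt0.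
by exists r0 => //; exact: H.
Qed.

Lemma rate_sum s a (I : Type) (l : seq I) (Q : pred I) (F : I -> R -> \bar R) : (forall i, Q i -> rate s a (F i)) ->
 rate s a (fun r => \sum_(i <- l | Q i) F i r)%E.
move=> hF; elim: l => [|i l IH].
 have h e r : 0 < e -> (\sum_(i <- [::] | Q i) F i r <= (e * r `^ a)%:E)%E
  by move=> e0; rewrite big_nil lee_fin mulr_ge0 ?powR_ge0// ltW.
 by case: (s) => /=; [move=> e e0; exists 1 => // r _; exact: h|exists 1 => //; exists 1 => // r _; exact: h].
have [Qi|nQi] := boolP (Q i); last by apply: rate_le IH => r _; rewrite big_cons (negbTE nQi).
by apply: rate_le (rate_add (hF i Qi) IH) => r _; rewrite big_cons Qi.
Qed.

(** A strictly smaller exponent beats any constant for large [r]; this gives the strong rate and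
    with it the weak one. *)
Lemma rate_pow s a b F C : b < a -> (forall r, 1 <= r -> (F r <= (C * r `^ b)%:E)%E) -> rate s a F.
move=> ba hF; have strong : rate true a F.
 move=> e e0; pose r0 := Num.max 1 (((`|C| + 1) / e) `^ (a - b)^-1).
 have ab0 : 0 < a - b by rewrite subr_gt0.
 exists r0; first by rewrite le_max lexx.
 move=> r; rewrite ge_max => /andP[r1 rr]; have r0' : 0 < r by exact: lt_le_trans r1.
 apply: le_trans (hF r r1) _; rewrite lee_fin.
 have -> : r `^ a = r `^ (a - b) * r `^ b by rewrite -powRD ?(gt_eqF r0') ?implybT// subrK.
 rewrite mulrA ler_wpM2r ?powR_ge0//.
 have h : (`|C| + 1) / e <= r `^ (a - b).
  have -> : (`|C| + 1) / e = (((`|C| + 1) / e) `^ (a - b)^-1) `^ (a - b)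
   by rewrite -powRrM mulVf ?gt_eqF// powRr1// divr_ge0 ?(ltW e0)// addr_ge0.
  by apply: ge0_ler_powR; rewrite ?nnegrE ?powR_ge0 ?(ltW ab0) ?(ltW r0').
 rewrite mulrC; move: h; rewrite ler_pdivrMr//; apply: le_trans.
 by apply: le_trans (ler_norm C) _; rewrite lerDl.
case: s => //; have [r0 r01 h] := strong 1 ltr01.
by exists 1 => //; exists r0.
Qed.

Lemma rate_shift s a b F : rate s a F -> rate s (a + b) (fun r => (r `^ b)%:E * F r)%E.
have H e r0 : 1 <= r0 -> (forall r, r0 <= r -> (F r <= (e * r `^ a)%:E)%E) ->
  forall r, r0 <= r -> ((r `^ b)%:E * F r <= (e * r `^ (a + b))%:E)%E.
 move=> r01 h r rr; have r0' : 0 < r by apply: lt_le_trans rr; exact: lt_le_trans r01.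
 via ((r `^ b)%:E * (e * r `^ a)%:E)%E.
  by rewrite lee_wpmul2l ?lee_fin ?powR_ge0// h.
 rewrite -EFinM lee_fin powRD ?(gt_eqF r0') ?implybT//.
 by apply: eq_ler; ring.
case: s => /= hF; first by move=> e /hF[r0 r01 h]; exists r0 => //; exact: H.
by have [e e0 [r0 r01 h]] := hF; exists e => //; exists r0 => //; exact: H.
Qed.
End rate.

(** * Growth of integrals with a finite weighted mass *)

Section weighted_growth.
Context {R : realType} {n : nat}.
Notation E := 'rV[R]_n.
Variables (m : meas E R) (rho : E -> \bar R) (s : R).
Hypothesis mrho : mfunT rho.
Hypothesis rho0 : forall y, (0 <= rho y)%E.
Hypothesis s0 : 0 <= s.
Definition weight_at (y : E) : R := (1 + norm2 y `^ s)^-1.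

Lemma weight_at_gt0 y : 0 < weight_at y.
Proof. by rewrite invr_gt0 ltr_pwDl// powR_ge0. Qed.
Lemma measurable_weight_at : mfunT weight_at.
have mp := mcomp (measurable_powR s) (@measurable_norm2 R n).
have mp1 := mfunD (f := fun=> 1) (mcst _) mp.
rewrite (_ : weight_at = fun y => (1 + norm2 y `^ s) `^ (-1)).
 exact: (mcomp (measurable_powR (-1)) mp1).
by apply/funext => y; rewrite powR_inv1// addr_ge0// powR_ge0.
Qed.
Hypothesis fin : (\int[m]_y (rho y * (weight_at y)%:E) < +oo)%E.
Let Q y : \bar R := (rho y * (weight_at y)%:E)%E.
Let Q0 y : (0 <= Q y)%E. Proof. by rewrite mule_ge0// lee_fin ltW// weight_at_gt0. Qed.
Let mQ : mfunT Q.
Proof. by apply: emfunM => //; apply/mEFin; exact: measurable_weight_at. Qed.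
Let rho_le t y : 0 <= t -> `|y| <= t -> (rho y <= (1 + (n%:R * t) `^ s)%:E * Q y)%E.
move=> t0 yt; have w0 := weight_at_gt0 y.
have -> : (rho y = (weight_at y)^-1%:E * Q y)%E by rewrite /Q muleCA -EFinM mulVf ?mule1// gt_eqF.
rewrite lee_wpmul2r// lee_fin /weight_at invrK lerD2l.
apply: ge0_ler_powR => //; rewrite ?nnegrE ?norm2_ge0 ?mulr_ge0//.
by apply: le_trans (norm2_le y) _; rewrite ler_wpM2l.
Qed.

(** On the cube of radius [2 * r] the inverse weight is at most a constant times [r^s], which gives
    the weak rate. For the strong one the integral is split at a fixed cube: outside it the weighted
    mass is small by dominated convergence, inside it the integral is bounded while [r^s] tends to
    infinity. *)
Lemma weighted_growth (strong : bool) : (strong -> 0 < s) ->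
 rate strong s (fun r => \int[m]_y (rho y * (\1_(cube (2 * r)) y)%:E))%E.
move=> ss; pose I := fine (\int[m]_y Q y)%E.
have IE : (\int[m]_y Q y = I%:E)%E by rewrite fineK// ge0_fin_numE//; apply: int_ge0.
have I0 : 0 <= I by rewrite fine_ge0//; apply: int_ge0.
pose A : R := 1 + (n%:R * 2) `^ s.
have A0 : 0 < A by rewrite ltr_pwDl// powR_ge0.
have As r : 1 <= r -> 1 + (n%:R * (2 * r)) `^ s <= A * r `^ s.
 move=> r1; have r0 : 0 <= r by exact: le_trans r1.
 rewrite mulrA powRM ?mulr_ge0// /A mulrDl mul1r lerD2r; exact: powR_ge1.
have mc t : mfunT (fun y : E => (\1_(cube t) y)%:E : \bar R) by apply/mEFin; exact: mindic (mcub _).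
case: strong ss => ss /=; last first.
 exists (A * I + 1); first by rewrite ltr_wpDl// mulr_ge0// ltW.
 exists 1 => // r r1; via (\int[m]_y ((A * r `^ s)%:E * Q y))%E.
  apply: le_intT => y; first by rewrite mule_ge0// lee_fin.
  rewrite cube_indicE; case: ltP => yr; last first.
   by rewrite mule0 mule_ge0// lee_fin mulr_ge0 ?(ltW A0)// powR_ge0.
  rewrite mule1; apply: le_trans (rho_le _ (ltW yr)) _; first by rewrite mulr_ge0// (le_trans _ r1).
  by rewrite lee_wpmul2r// lee_fin As.
 rewrite int_Zl// ?mulr_ge0 ?(ltW A0) ?powR_ge0// IE -EFinM lee_fin.
 by rewrite [leRHS]mulrDl mul1r [A * I * _]mulrAC lerDl powR_ge0.
have {}ss : 0 < s by exact: ss.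
move=> e e0; pose v (k : nat) y : \bar R := (Q y * (\1_(~` cube k%:R) y)%:E)%E.
have v0 k y : (0 <= v k y)%E by rewrite mule_ge0// lee_fin.
have mv k : mfunT (v k).
 apply: emfunM => //; apply/mEFin; apply: mindic.
 by apply: measurableC; exact: mcub.
have vQ k y : (v k y <= Q y)%E by rewrite -[leRHS]mule1 lee_wpmul2l// lee_fin indicE; case: (_ \in _).
have iQ : m.-integrable setT Q by apply/integrableP; split => //; under eq_integral do rewrite gee0_abs//.
have [] := @dominated_convergence _ _ _ m setT mtop v (fun=> 0%E) Q mv (mcst _) _ iQ _.
- apply: aeW => y _; apply: cvg_near_cst.
 have [k yk] : exists k : nat, `|y| < k%:R by exists (Num.truncn `|y|).+1; exact: truncnS_gt.
 exists k => // k' /= kk'; apply/eqP; rewrite /v indicE memNset ?mule0//=.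
 by apply; rewrite /cube/= (lt_le_trans yk)// ler_nat.
- by apply: aeW => y k _; rewrite gee0_abs.
move=> _ _; rewrite integral0 => cv.
have eA : 0 < e / 2 / A by rewrite !divr_gt0.
have [k hk] : exists k, (\int[m]_y v k y <= (e / 2 / A)%:E)%E.
 have /fine_cvgP[fn /cvgrPdist_le/(_ _ eA) h] := cv.
 have [k [h1 h2]] : exists k, (\int[m]_y v k y)%E \is a fin_num /\ `|0 - fine (\int[m]_y v k y)%E| <= e / 2 / A
  by have [k _ hk] := filterI fn h; exists k; split; have [] := hk k (leqnn k).
 exists k; rewrite -(fineK h1) lee_fin; apply: le_trans h2; rewrite sub0r normrN; exact: ler_norm.
pose B := (1 + (n%:R * k%:R) `^ s) * I.
have B0 : 0 <= B by rewrite mulr_ge0// addr_ge0// powR_ge0.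
pose r0 := Num.max 1 ((2 * B / e) `^ s^-1).
exists r0; first by rewrite le_max lexx.
move=> r; rewrite ge_max => /andP[r1 rr]; have r0' : 0 < r by exact: lt_le_trans r1.
have rs : 2 * B / e <= r `^ s.
 have h0 : 0 <= 2 * B / e by rewrite !mulr_ge0// invr_ge0 ltW.
 have -> : 2 * B / e = ((2 * B / e) `^ s^-1) `^ s by rewrite -powRrM mulVf ?gt_eqF// powRr1.
 by apply: ge0_ler_powR; rewrite ?nnegrE ?powR_ge0 ?(ltW r0').
have c10 : 0 <= 1 + (n%:R * k%:R) `^ s by rewrite addr_ge0// powR_ge0.
have c20 : 0 <= A * r `^ s by rewrite mulr_ge0 ?powR_ge0// ltW.
via (\int[m]_y ((1 + (n%:R * k%:R) `^ s)%:E * Q y + (A * r `^ s)%:E * v k y))%E.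
 apply: le_intT => y; first by rewrite mule_ge0// lee_fin.
 rewrite cube_indicE; case: ltP => yr; last by rewrite mule0 adde_ge0// mule_ge0.
 rewrite mule1 /v indicE; case: (ltP `|y| k%:R) => yk.
  by apply: le_trans (rho_le _ (ltW yk)) _ => //; rewrite leeDl// mule_ge0// mule_ge0.
 rewrite mem_set/=; last by rewrite /cube/= ltNge yk.
 rewrite mule1; apply: le_trans (rho_le _ (ltW yr)) _; first by rewrite mulr_ge0// ltW.
 via ((A * r `^ s)%:E * Q y)%E; first by rewrite lee_wpmul2r// lee_fin As.
 by rewrite leeDr// mule_ge0.
rewrite ge0_integralD//; last 4 first.
- by move=> y _; rewrite mule_ge0.
- exact: measurable_funeM.
- by move=> y _; rewrite mule_ge0.
- exact: measurable_funeM.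
rewrite int_Zl// IE int_Zl//.
via (((1 + (n%:R * k%:R) `^ s)%:E * I%:E) + ((A * r `^ s)%:E * (e / 2 / A)%:E))%E.
 by apply: leeD2l; rewrite lee_wpmul2l.
rewrite -!EFinM -EFinD lee_fin -/B.
have -> : A * r `^ s * (e / 2 / A) = e / 2 * r `^ s by field; rewrite gt_eqF.
have h1 : B <= e / 2 * r `^ s.
 have : e / 2 * (2 * B / e) <= e / 2 * r `^ s by rewrite ler_wpM2l// divr_ge0// ltW.
 by have -> // : e / 2 * (2 * B / e) = B by field; rewrite gt_eqF.
by apply: le_trans (lerD h1 (lexx _)) _; rewrite -mulrDl -splitr.
Qed.
End weighted_growth.

(** * Integrals of partial derivatives *)

Section partial_derivative.
Context {R : realType} {n : nat}.
Notation E := 'rV[R]_n.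
Notation lambda := (@lebesgue_rV R n).
Let lf := @lebesgue_lf R n.

(* Difference quotients integrate to zero by translation invariance, and converge boundedly. *)
Lemma int_partial_derivative i (h h' : R -> R) (rest : E -> R) M M' s :
 (forall t : R, is_derive t (1:R) h (h' t)) -> (forall t, `|h' t| <= M) ->
 (forall (x : E) (a : R), rest (x + eshift i a) = rest x) -> (forall x, `|rest x| <= M') -> mfunT rest ->
 (forall x : E, s <= `|x| -> h (x 0 i) * rest x = 0) ->
 \int[lambda]_x (h' (x 0 i) * rest x) = 0.
move=> dh hM shiftr restM mrest supp.
have M0 : 0 <= M by exact: le_trans (hM 0).
have ch : continuous h
 by move=> t; apply: differentiable_continuous; apply/derivable1_diffP; exact: (@ex_derive _ _ _ _ _ _ _ (dh t)).
have mh : mfunT h by exact: cont_mfun.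
pose F (x : E) := h (x 0 i) * rest x.
have mF : mfunT F by apply: mfunM => //; exact: (mcomp mh (measurable_coord i)).
have s1 : 0 <= Num.max s 0 by rewrite le_max lexx orbT.
pose a (k : nat) : R := k.+1%:R^-1.
have a0 k : 0 < a k by rewrite invr_gt0.
have a1 k : a k <= 1 by rewrite invf_le1// ler1n.
pose u k (x : E) := (a k)^-1 * (F (x + eshift i (a k)) - F x).
have coordE x (b : R) : (x + eshift i b) 0 i = x 0 i + b :> R by rewrite !mxE eqxx mulr1.
have uE k x : u k x = (a k)^-1 * (h (x 0 i + a k) - h (x 0 i)) * rest x
 by rewrite /u /F shiftr coordE mulrBr mulrBr mulrBl !mulrA.
have mu k : mfunT (u k).
 apply: mfunM => //; apply: mfunB => //.
 by apply: (mcomp mF); exact: mfunD_rV.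
have uC k x : `|u k x| <= M * M'.
 rewrite uE normrM; apply: ler_pM => //.
 have := @mean_value_le R h h' M (x 0 i + a k) (x 0 i) dh (fun t _ => hM t).
 rewrite addrAC subrr add0r => hle.
 rewrite normrM normfV [`|a k|]gtr0_norm// mulrC ler_pdivrMr//.
 by apply: le_trans hle _; rewrite gtr0_norm.
have normshift k x : `|x| <= `|x + eshift i (a k)| + 1.
 have : `|eshift i (a k)| <= 1 :> R.
  apply: norm_le_coord => // j; rewrite !mxE normrM; have := a1 k; have := a0 k.
  by case: (j == i); rewrite ?mulr1n ?mulr0n ?normr1 ?normr0 ?mulr0// mulr1 => h1; rewrite gtr0_norm.
 by have := ler_normB (x + eshift i (a k)) (eshift i (a k)); rewrite addrK; lra.
have supu k : off_cube (Num.max s 0 + 1) (u k).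
 move=> x sx; have sm : s <= Num.max s 0 by rewrite le_max lexx.
 have h1 : s <= `|x| by lra.
 have h2 : s <= `|x + eshift i (a k)| by have := normshift k x; lra.
 by rewrite /u /F (supp _ h1) (supp _ h2) subrr mulr0.
have cvu x : u ^~ x @ \oo --> h' (x 0 i) * rest x.
 under eq_fun do rewrite uE.
 apply: cvgM; last exact: cvg_cst.
 have /cvg_ex[l hl] : derivable h (x 0 i) 1 by exact: (@ex_derive _ _ _ _ _ _ _ (dh (x 0 i))).
 have el : h' (x 0 i) = l by rewrite -(@derive_val _ _ _ _ _ _ _ (dh (x 0 i))); exact: (cvg_lim _ hl).
 rewrite el; move: hl => /cvgrPdist_le hl; apply/cvgrPdist_le => e e0.
 have [b /= b0 hb] := hl e e0.
 have := @cvg_harmonic R => /cvgrPdist_lt/(_ _ b0); apply: filterS => k /=.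
 rewrite -/(a k) => kb; have := hb (a k) kb (negbT (gt_eqF (a0 k))).
 by rewrite /= /GRing.scale/= mulr1 [a k + _]addrC.
have tfu k : tf (u k) by split => //; [exists (M * M')|exists (Num.max s 0 + 1)].
have cv := int_tf_cvg lf mu uC supu cvu.
have u0 k : \int[lambda]_x u k x = 0.
 have tF : tf F.
  split => //; last by exists s.
  exists ((`|h 0| + M * `|s|) * M') => x; rewrite /F; case: (leP s `|x|) => xs.
   by rewrite supp// normr0 mulr_ge0 ?addr_ge0 ?mulr_ge0// (le_trans _ (restM 0)).
  rewrite normrM ler_pM//; have := @mean_value_le R h h' M (x 0 i) 0 dh (fun t _ => hM t).
  rewrite subr0 => h1; have h2 : M * `|x 0 i| <= M * `|s|.
   by rewrite ler_wpM2l// (le_trans (le_coord_norm x i))// (le_trans (ltW xs))// ler_norm.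
  by have := ler_normD (h (x 0 i) - h 0) (h 0); rewrite subrK; lra.
 have tFs : tf (fun x => F (x + eshift i (a k))) by exact: tf_shift.
 rewrite /u (int_tfZ lf); last exact: tfB.
 by rewrite (int_tfB lf)// Rintegral_lebesgue_rV_translation// subrr mulr0.
move: cv; under eq_fun do rewrite u0; move=> cv.
by apply: (cvg_unique (@norm_hausdorff _ _) cv); exact: cvg_cst.
Qed.
End partial_derivative.

(** * Growth rates of the variances of the Taylor coefficients *)

Section coefficient_rate.
Context {R : realType} {n : nat}.
Notation E := 'rV[R]_n.
Notation lambda := (@lebesgue_rV R n).
Variables (m K : nat).
Hypothesis nK : (2 * n < (2 * K).-1)%N.
Let c0 : R := (2 * pi) ^+ n.
Let c0_gt0 : 0 < c0. Proof. by rewrite exprn_gt0// mulr_gt0// pi_gt0. Qed.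
Let lf := @lebesgue_lf R n.
Let v : R := (2 * K).-1%:R.
Let K0 : (0 < K)%N. Proof. by move: nK; case: (K). Qed.
Definition mass_growth (beta : meas E R) :=
 exists2 D : R, 0 <= D & forall t, 1 <= t -> (beta (cube t) <= (D * t ^+ (2 * n))%:E)%E.
(** For [u = 0] the strong version says that the mass of shrinking cubes tends to 0, that is, that
    there is no atom at the origin. *)
Definition small_mass (strong : bool) (u : R) (beta : meas E R) :=
 if strong then forall A, 0 < A -> exists2 e, 0 < e & forall t, 0 < t -> t <= e -> (beta (cube t) <= (A * t `^ u)%:E)%E
 else exists2 A, 0 < A & exists2 e, 0 < e & forall t, 0 < t -> t <= e -> (beta (cube t) <= (A * t `^ u)%:E)%E.

Section interpolation.
Variable beta : meas E R.
Hypothesis lfb : loc_fin beta.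
Hypothesis growth : mass_growth beta.

(** A power bound near 0 and growth at infinity merge into one bound for all [t]: [v] exceeds the
    growth exponent [2 * n], and on the intermediate range from [e] to 1 the constant [b / e^v]
    makes up for the small power. *)
Lemma mass_interp (A e u : R) : 0 <= A -> 0 < e ->
 (forall t, 0 < t -> t <= e -> (beta (cube t) <= (A * t `^ u)%:E)%E) ->
 exists2 B, 0 <= B & forall t, 0 < t -> (beta (cube t) <= (A * t `^ u + B * t `^ v)%:E)%E.
move=> A0 e0 he; have [D D0 hD] := growth.
pose b := fine (beta (cube 1)).
have bE : (beta (cube 1) = b%:E)%E.
 rewrite fineK// ge0_fin_numE//; apply: lfb; [exact: mcub|exact: bounded_cube].
have b0 : 0 <= b by rewrite fine_ge0.
have ev : 0 < e `^ v by rewrite powR_gt0.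
have B0 : 0 <= D + b / e `^ v by rewrite addr_ge0// divr_ge0// ltW.
exists (D + b / e `^ v) => // t t0.
have P1 : 0 <= A * t `^ u by rewrite mulr_ge0// powR_ge0.
have tv0 : 0 <= t `^ v by exact: powR_ge0.
case: (leP t e) => te.
 by apply: le_trans (he _ t0 te) _; rewrite lee_fin lerDl mulr_ge0.
case: (leP 1 t) => t1.
 apply: le_trans (hD _ t1) _; rewrite lee_fin.
 via (D * t `^ v).
  rewrite ler_wpM2l// -powR_mulrn ?(ltW t0)//; apply: ler_powR => //.
  by rewrite ler_nat ltnW.
 rewrite -[leLHS]add0r; apply: lerD => //.
 by rewrite ler_wpM2r// lerDl divr_ge0// ltW.
via (beta (cube 1)).
 apply: le_measure; rewrite ?inE; [exact: mcub|exact: mcub|].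
 by apply: le_cube; exact: ltW.
rewrite bE lee_fin; via (b / e `^ v * t `^ v).
 rewrite mulrAC ler_pdivlMr// ler_wpM2l//.
 by apply: ge0_ler_powR; rewrite ?nnegrE ?(ltW e0) ?(ltW t0) ?ler0n// ltW.
rewrite -[leLHS]add0r; apply: lerD => //.
by rewrite ler_wpM2r// lerDr.
Qed.
Variable V : (E -> R) -> R.
Hypothesis betaV : forall f, tf f -> (\int[beta]_k (fpow f k)%:E = (c0 * V f)%:E)%E.

(** The term with exponent [2n - v] is negligible against [2n - u]. The leading constant is
    proportional to the mass constant [A], so small [o] is transferred as well as large [O]. *)
Lemma coef_rate strong (u : R) (j : @mindex n m) : 0 <= u -> u < v -> small_mass strong u beta ->
 rate strong ((2 * n)%:R - u) (fun r => (V (fun x => bump_coef K j (r^-1 *: x)))%:E).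
move=> u0 uv; have [C C0 hC] := var_decay betaV m K0.
have v0 : 0 <= v by exact: ler0n.
have H A e : 0 < A -> 0 < e -> (forall t, 0 < t -> t <= e -> (beta (cube t) <= (A * t `^ u)%:E)%E) ->
  exists2 r0, 1 <= r0 & forall r, r0 <= r ->
  ((V (fun x => bump_coef K j (r^-1 *: x)))%:E <= (2 * C * A * r `^ ((2 * n)%:R - u))%:E)%E.
 move=> A0 e0 he; have [B B0 hB] := mass_interp (ltW A0) e0 he.
 have uv' : (2 * n)%:R - v < (2 * n)%:R - u by rewrite ltrD2l ltrN2.
 have [r0 r01 hr] := @rate_pow R true _ _ (fun r => (B * r `^ ((2 * n)%:R - v))%:E) B uv' (fun r _ => lexx _) A A0.
 exists r0 => // r rr; have r1 : 1 <= r by exact: le_trans rr.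
 have rp : 0 < r by exact: lt_le_trans r1.
 rewrite lee_fin; apply: le_trans (hC A B u v (ltW A0) B0 _ _ hB j r rp) _.
 - by rewrite u0 ltW.
 - by rewrite v0 lexx.
 have := hr r rr; rewrite lee_fin => h2.
 have pw w : r ^+ (2 * n) * (r `^ w)^-1 = r `^ ((2 * n)%:R - w)
  by rewrite -powR_mulrn ?(ltW rp)// -powRN -powRD ?(gt_eqF rp) ?implybT.
 have -> : C * r ^+ (2 * n) * (A / r `^ u + B / r `^ v) =
   C * (A * (r ^+ (2 * n) * (r `^ u)^-1) + B * (r ^+ (2 * n) * (r `^ v)^-1)) by ring.
 rewrite !pw [2 * C]mulrC -!mulrA ler_wpM2l ?(ltW C0)//.
 by rewrite mulr_natl mulr2n lerD2l.
have C20 : 0 < 2 * C by rewrite mulr_gt0.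
case: strong => /=.
 move=> h e e0; have [e' e'0 he] := h _ (divr_gt0 e0 C20).
 have [r0 r01 hr] := H _ _ (divr_gt0 e0 C20) e'0 he; exists r0 => // r rr.
 by have := hr r rr; rewrite [2 * C * _]mulrC divfK ?gt_eqF.
move=> [A A0 [e e0 he]]; have [r0 r01 hr] := H _ _ A0 e0 he.
by exists (2 * C * A); [rewrite mulr_gt0|exists r0].
Qed.

(** [spectral_mass_le] read at the small scale [r = dl / t]: large cubes of frequencies are tested
    by narrow bumps, on which [V] stays bounded. *)
Lemma mass_growth_of_bounded V0 : (forall r, 0 < r -> r <= 1 -> V (bumpr m K r) <= V0) -> mass_growth beta.
move=> hV; have [C C0 hC] := spectral_mass_le betaV m K.
pose dl : R := (2 * n%:R + 1)^-1.
have dl0 : 0 < dl by rewrite invr_gt0 ltr_wpDl// mulr_ge0.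
have dl1 : dl <= 1 by rewrite invf_le1 ?ltr_wpDl ?mulr_ge0// lerDr mulr_ge0.
have V00 : 0 <= `|V0| by [].
exists (C * dl^-1 ^+ (2 * n) * `|V0|).
 by rewrite !mulr_ge0 ?(ltW C0)// exprn_ge0// invr_ge0 ltW.
move=> t t1; have t0 : 0 < t by exact: lt_le_trans t1.
have r0 : 0 < dl / t by rewrite divr_gt0.
have r1 : dl / t <= 1 by rewrite ler_pdivrMr// mul1r (le_trans dl1).
have := hC _ r0; rewrite -/dl.
have -> : dl / (dl / t) = t by rewrite invf_div mulrCA divff ?mulr1// gt_eqF.
move=> /le_trans; apply; rewrite lee_fin.
have -> : (dl / t)^-1 ^+ (2 * n) = dl^-1 ^+ (2 * n) * t ^+ (2 * n) by rewrite invf_div mulrC exprMn.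
have c1 : 0 <= C * (dl^-1 ^+ (2 * n) * t ^+ (2 * n)) by rewrite !mulr_ge0 ?(ltW C0)// exprn_ge0 ?invr_ge0// ltW.
via (C * (dl^-1 ^+ (2 * n) * t ^+ (2 * n)) * `|V0|).
 by apply: (ler_wpM2l c1); apply: le_trans (hV _ r0 r1) (ler_norm _).
by apply: eq_ler; ring.
Qed.
End interpolation.

(** In a coordinate with positive exponent the factor is the derivative of a compactly supported
    function, the bump derivative of one order less, so that the integral in this coordinate already
    vanishes. *)
Lemma int_bump_coef0 (j : @mindex n m) (r : R) : (0 < mdeg j)%N -> 0 < r ->
 \int[lambda]_x @bump_coef R n m K j (r^-1 *: x) = 0.
move=> j0 r0; have [i ji] : exists i, (0 < j i)%N.
 apply/existsP; move: j0; apply: contraTT; rewrite negb_exists => /forallP h.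
 by rewrite -leqNgt leqn0 /mdeg sum_nat_eq0; apply/forallP => i /=; have := h i; rewrite lt0n negbK.
have jm i' : (j i' <= m)%N by exact/ltnW/ltn_ord.
have [M M1 hM] := @bump_factor_bounded R m K.
have M0 : 0 <= M by exact: le_trans M1.
have ji0 : (j i)`!%:R != 0 :> R by rewrite pnatr_eq0 -lt0n fact_gt0.
pose h (t : R) : R := (r / (j i)`!%:R) * bump (m + K).+1 (j i).-1 (r^-1 * t).
pose h' (t : R) : R := bump_factor m K (j i) 0 (r^-1 * t).
pose fac i' (x : E) : R := bump_factor m K (j i') 0 (r^-1 * x 0 i').
pose rest (x : E) : R := \prod_(i' < n) (if i' != i then fac i' x else 1).
have mlin : mfunT (fun t : R => r^-1 * t) by exact: mfunM.
have mrest : mfunT rest.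
 rewrite /rest; apply: measurable_prod => i' _; case: (i' != i); last exact: mcst.
 rewrite /fac /bump_factor; apply: mfunM => //.
 have jN : (j i' + 0 < (m + K).+1)%N by rewrite addn0 ltnS (leq_trans (jm i')) ?leq_addr.
 have mb := cont_mfun (@bump_continuous R (m + K).+1 _ jN).
 exact: (mcomp (mcomp mb mlin) (measurable_coord i')).
have dh t : is_derive (t : R) (1:R) h (h' t).
 have jK : ((j i).-1 < m + K)%N by have := ltn_ord (j i); lia.
 have := @bump_chain R (m + K).+1 (m + K) (ltnSn _) (j i).-1 jK (r^-1 * t); rewrite prednK// => d1.
 have d0 : is_derive (t : R) (1:R) (fun t : R => r^-1 * t) r^-1.
  rewrite (_ : (fun t : R => r^-1 * t) = r^-1 *: id); last by apply/funext => s.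
  by have := is_deriveZ r^-1 (is_derive_id t (1:R)); rewrite /GRing.scale/= mulr1.
 have d2 := @is_derive1_comp _ (bump (m + K).+1 (j i).-1) (fun t => r^-1 * t) t _ _ d1 d0.
 have := is_deriveZ (r / (j i)`!%:R) d2; rewrite /GRing.scale/= => d3.
 apply: (is_derive_eq d3); rewrite /h' /bump_factor addn0 /GRing.scale/=.
 by set b := bump _ _ _; field; rewrite ji0 gt_eqF.
have restM x : `|rest x| <= M ^+ size (index_enum 'I_n).
 apply: prod_le_pow => // i'; case: ifP => _; [exact: hM|by rewrite normr1].
have -> : \int[lambda]_x @bump_coef R n m K j (r^-1 *: x) = \int[lambda]_x (h' (x 0 i) * rest x).
 apply: eq_Rint => x _; rewrite /bump_coef (bigD1 i)//= mxE; congr (_ * _).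
 by rewrite /rest big_mkcond; apply: eq_bigr => i' _; rewrite /fac mxE.
apply: (@int_partial_derivative R n i h h' rest M (M ^+ size (index_enum 'I_n)) r dh) => //.
- by move=> t; exact: hM.
- move=> x a; apply: eq_bigr => i' _; case: ifP => // ne.
 by rewrite /fac !mxE (negPf ne) mulr0 addr0.
- move=> x x1; have [i' xi] := norm_ge_coord r0 x1.
 have xi' : 1 <= `|r^-1 * x 0 i'| by rewrite normrM gtr0_norm ?invr_gt0// mulrC ler_pdivlMr// mul1r.
 have [ei|ne] := eqVneq i' i.
  rewrite /h bump_support ?mulr0 ?mul0r -?ei//; have := ltn_ord (j i'); lia.
 by rewrite /rest (bigD1 i')//= ne /fac bump_factor_support ?mul0r ?mulr0.
Qed.

Section mean_zero.
Variable beta : meas E R.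
Hypothesis lfb : loc_fin beta.
Hypothesis growth : mass_growth beta.
Variable V : (E -> R) -> R.
Hypothesis betaV : forall f, tf f -> (\int[beta]_k (fpow f k)%:E = (c0 * V f)%:E)%E.
Let punct : set E := [set x | 0 < `|x|].
Let mpunct : measurable punct.
have := @measurable_norm_rV R n mtop `]0, +oo[%classic (measurable_itv _).
by rewrite setTI; congr measurable; apply/seteqP; split => x; rewrite /punct /= in_itv/= andbT.
Qed.
Let mh : mfunT (\1_punct : E -> R). Proof. exact: mindic. Qed.
Let h0 (x : E) : 0 <= \1_punct x :> R. Proof. by rewrite indicE. Qed.
Let beta' : meas E R := density_measure beta mh h0.
Let beta'E A : measurable A -> beta' A = beta (punct `&` A).
move=> mA; rewrite /beta'/= /density -[X in beta X]setIT.
rewrite -int_indic//; last exact: measurableI.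
by apply: eq_integral => x _; rewrite indicI.
Qed.
Let beta'_le A : measurable A -> (beta' A <= beta A)%E.
move=> mA; by rewrite beta'E//; apply: le_measure; rewrite ?inE//; exact: measurableI.
Qed.
Let lfb' : loc_fin beta'.
Proof. by move=> A mA bA; apply: le_lt_trans (beta'_le mA) (lfb mA bA). Qed.
Let growth' : mass_growth beta'.
have [D D0 hD] := growth; exists D => // t t1.
by apply: le_trans (beta'_le (mcub _)) (hD t t1).
Qed.
Let V' f : R := fine (\int[beta']_k (fpow f k)%:E) / c0.
Let mfpow (f : E -> R) : tf f -> mfunT (fpow f).
Proof. by move=> tff; apply: continuous_mfun; exact: fpow_continuous. Qed.
Let int_beta' f : tf f -> (\int[beta']_k (fpow f k)%:E = \int[beta]_k (\1_punct k * fpow f k)%:E)%E.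
Proof. by move=> tff; apply: ge0_integral_density; [exact: mfpow|exact: fpow_ge0]. Qed.
Let betaV' f : tf f -> (\int[beta']_k (fpow f k)%:E = (c0 * V' f)%:E)%E.
move=> tff; rewrite /V' mulrC divfK ?gt_eqF// fineK// ge0_fin_numE; last first.
 by apply: int_ge0 => k _; rewrite lee_fin fpow_ge0.
apply: (@le_lt_trans _ _ (\int[beta]_k (fpow f k)%:E)%E); last by rewrite betaV// ltry.
rewrite int_beta'//; apply: le_intT => k; rewrite lee_fin ?mulr_ge0 ?fpow_ge0//.
by rewrite indicE; case: (_ \in _); rewrite ?mul1r ?mul0r ?fpow_ge0.
Qed.
(** Continuity from above: the cubes shrink to the origin, which has been removed. *)
Let small' : small_mass true 0 beta'.
move=> A A0; pose F k : set E := cube k.+1%:R^-1.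
have mF k : measurable (F k) by exact: mcub.
have e0 : punct `&` \bigcap_k F k = set0.
 apply/seteqP; split => x //= [x0 hx]; have := truncnS_gt `|x|^-1.
 have := hx (Num.truncn `|x|^-1) I; rewrite /F /cube/= => h1 h2.
 by move: h1; rewrite ltNge => /negP; apply; rewrite invf_ple ?posrE// ltW.
have mI : measurable (\bigcap_k F k) by exact: bigcap_measurable.
have fin : (beta' (F 0%N) < +oo)%E by apply: lfb' => //; exact: bounded_cube.
have dec : {homo F : k l / (k <= l)%N >-> (l <= k)%O}.
 move=> k l kl; apply/subsetPset; apply: le_cube.
 by rewrite lef_pV2 ?posrE// ler_nat.
have := @nonincreasing_cvg_mu _ _ _ beta' F fin mF mI dec.
have -> : beta' (\bigcap_k F k) = 0%E by rewrite beta'E// e0 measure0.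
move=> /fine_cvgP[fn /cvgrPdist_le/(_ _ A0) h].
have [k [h1 h2]] : exists k, beta' (F k) \is a fin_num /\ `|0 - fine (beta' (F k))| <= A
 by have [k _ hk] := filterI fn h; exists k; split; have [] := hk k (leqnn k).
exists k.+1%:R^-1; first by rewrite invr_gt0.
move=> t t0 tk; rewrite powRr0 mulr1; via (beta' (F k)).
 by apply: le_measure; rewrite ?inE//; [exact: mcub|exact: le_cube].
rewrite -(fineK h1) lee_fin; apply: le_trans h2; rewrite sub0r normrN; exact: ler_norm.
Qed.

(** A mean ergodic statement. An atom of the spectrum at 0 is the only obstacle to the order
    [o(r^(2n))], and it is weighted by the squared integral of the coefficient, which is 0; so
    [beta] may be replaced by its restriction to the complement of the origin. *)
Lemma mean_zero_rate (j : @mindex n m) : (0 < mdeg j)%N ->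
 rate true (2 * n)%:R (fun r => (V (fun x => bump_coef K j (r^-1 *: x)))%:E).
move=> j0; have v0 : 0 < v by rewrite ltr0n; exact: leq_ltn_trans nK.
have := coef_rate lfb' growth' betaV' j (lexx 0) v0 small'; rewrite subr0.
apply: rate_le => r r1; have r0 : 0 < r by exact: lt_le_trans r1.
set f := fun x => _; have tff : tf f by apply: tf_scale => //; exact: tf_bump_coef.
rewrite lee_fin -(ler_pM2l c0_gt0) -lee_fin -betaV// -betaV'// int_beta'//.
apply: le_intT => k; first by rewrite lee_fin fpow_ge0.
rewrite lee_fin indicE; case: (boolP (k \in punct)) => [|kp]; first by rewrite mul1r.
have k0 : k = 0.
 apply/eqP; rewrite -normr_eq0; apply/eqP/le_anti; rewrite normr_ge0 andbT leNgt.
 by apply/negP => kp'; move/negP: kp; apply; exact: mem_set.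
have I0 : \int[lambda]_x f x = 0.
 exact: int_bump_coef0.
rewrite mul0r k0 /fpow.
have -> : fcos f 0 = 0 by rewrite /fcos -[RHS]I0; apply: eq_Rint => x _; rewrite dotv0l cos0 mulr1.
have -> : fsin f 0 = 0.
 rewrite /fsin; under eq_Rint do rewrite dotv0l sin0 mulr0.
 by rewrite Rintegral_cst// mul0r.
by rewrite expr2 mul0r addr0.
Qed.
End mean_zero.
End coefficient_rate.

(** * Spectral measures and energies of test functions *)

Section spectral.
Context {R : realType} {n : nat}.
Notation E := 'rV[R]_n.

Lemma tf_test_function (f : E -> R) : tf f -> test_function f.
move=> [mf [C fC] [t ft]]; split => //.
 exists C; split; first exact: num_real.
 by move=> M CM x _; exact: le_trans (fC x) (ltW CM).
apply: bounded_closed_compact; last exact: closed_closure.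
have cb : closed [set x : E | `|x| <= `|t|].
 have := @closed_comp E R (fun x : E => `|x|) [set s | s <= `|t|].
 by move=> /(_ (fun x _ => @norm_continuous _ _ x) (@closed_le _ _)).
have sub : closure [set x | f x != 0] `<=` [set x : E | `|x| <= `|t|].
 have /closure_id cE := cb; rewrite [X in _ `<=` X]cE; apply: closure_subset => x /=.
 by apply: contraR; rewrite -ltNge => tx; rewrite ft// (le_trans (ler_norm t))// ltW.
exists `|t|; split; first exact: num_real.
by move=> M tM x /sub xt; exact: le_trans xt (ltW tM).
Qed.

Lemma test_function_tf (f : E -> R) : test_function f -> tf f.
move=> [mf [M [Mr hM]] cf]; split => //.
 by exists (M + 1) => x; apply: (hM (M + 1)) => //; rewrite ltrDl.
have [N [Nr hN]] := compact_bounded cf; exists (N + 2) => x xN; apply/eqP; apply: contraTT xN => fx.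
rewrite -ltNge; have h : `|x| <= N + 1.
 by apply: (hN (N + 1)); [rewrite ltrDl|exact: subset_closure].
lra.
Qed.

Lemma cintegral_fpow (beta : meas E R) (f : E -> R) (v : R) : tf f ->
 let F := fun k => (fourier f k * (fourier f k)^*)%C in
 cintegrable beta F -> (v%:C = ((2 * pi) ^- n)%:C * cintegral beta F)%C ->
 (\int[beta]_k (fpow f k)%:E = ((2 * pi) ^+ n * v)%:E)%E.
move=> tff F [iF _] hv.
have FE k : complex.Re (F k) = fpow f k.
 have := fourier_Re f k; have := fourier_Im k tff.
 rewrite /F /fpow; case: (fourier f k) => [a b]/= -> <-; ring.
have c0 : (2 * pi) ^+ n != 0 :> R by rewrite expf_neq0// mulf_neq0// gt_eqF// pi_gt0.
have -> : v = (2 * pi) ^- n * \int[beta]_k fpow f k.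
 have Re_scale (a : R) (z : R[i]) : complex.Re (a%:C%C * z) = a * complex.Re z by case: z => x y /=; rewrite mul0r subr0.
 have := congr1 (@complex.Re R) hv; rewrite Re_scale => hv'; apply: (etrans hv'); congr (_ * _).
 rewrite -[LHS]/(\int[beta]_k complex.Re (F k)); apply: eq_Rint => k _; exact: FE.
rewrite mulrA divff// mul1r /Rintegral fineK//; apply: integrable_fin_num => //.
by apply: eq_integrable iF => // k _; rewrite FE.
Qed.
End spectral.

(** * Rates for stationary random measures *)

Section stationary_rates.
Context d (Om : measurableType d) (R : realType) (n : nat).
Variables (P : probability Om R) (theta : measurable_flow Om R n).
Hypothesis htheta : preserves theta P.
Variables (m K : nat).
Hypothesis nK : (2 * n < (2 * K).-1)%N.
Notation E := 'rV[R]_n.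
Variable nu : random_measure Om R n.
Hypothesis hnu : invariant_measure theta nu.
Hypothesis hnu2 : locally_square_integrable P nu.

Lemma second_moment_scaled_bumps r : 0 < r -> r <= 1 ->
 second_moment P nu (bumpr m K r) (bumpr m K r) <= second_moment P nu \1_(cube 1) \1_(cube 1).
move=> r0 r1; have tfb := tf_bumpr m K r0 : tf (_ : E -> R); have tfc := @tf_cube R n 1.
have s1 := sqint_stat htheta hnu hnu2 tfb; have s2 := sqint_stat htheta hnu hnu2 tfc.
apply: le_Rintegral => //; [exact: sqintM|exact: sqintM|move=> w _].
have b0 : 0 <= lstat nu (bumpr m K r) w by apply: stat_ge0 => x; exact: bumps_ge0.
suff h : lstat nu (bumpr m K r) w <= lstat nu \1_(cube 1) w by exact: ler_pM.
apply: le_stat => // x; rewrite cube_indicE /bumpr; case: ltP => x1; first exact: bumps_le1.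
by rewrite bumps_support// scale_norm// ler_pdivlMr// mul1r (le_trans r1).
Qed.

Lemma second_moment_rate (j : @mindex n m) : (0 < mdeg j)%N ->
 rate true (2 * n)%:R (fun r => (second_moment P nu (fun x => bump_coef K j (r^-1 *: x)) (fun x => bump_coef K j (r^-1 *: x)))%:E).
move=> j0; have [beta [lfb hb]] := bochner (second_moment_form htheta hnu hnu2).
have betaV f : tf f -> (\int[beta]_k (fpow f k)%:E = ((2 * pi) ^+ n * second_moment P nu f f)%:E)%E
 by move=> tff; have [h1 h2] := hb f f tff tff; exact: cintegral_fpow.
have growth := mass_growth_of_bounded betaV second_moment_scaled_bumps.
exact: (mean_zero_rate nK lfb growth betaV j0).
Qed.

Lemma covariance_rate beta (strong : bool) (u : R) (j : @mindex n m) : loc_fin beta ->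
 (forall f, tf f -> (\int[beta]_k (fpow f k)%:E = ((2 * pi) ^+ n * cov_stat P nu f f)%:E)%E) ->
 0 <= u -> u < (2 * K).-1%:R -> small_mass strong u beta ->
 rate strong ((2 * n)%:R - u)
  (fun r => (cov_stat P nu (fun x => bump_coef K j (r^-1 *: x)) (fun x => bump_coef K j (r^-1 *: x)))%:E).
move=> lfb betaV u0 uv sm.
have growth : mass_growth beta.
 apply: (mass_growth_of_bounded (m := m) (K := K) betaV) => r r0 r1.
 exact: le_trans (covariance_stat_le _ _ _) (second_moment_scaled_bumps r0 r1).
exact: (coef_rate nK lfb growth betaV j u0 uv sm).
Qed.
End stationary_rates.

Lemma sqr_sum_cond_le (R : realFieldType) (I : finType) (Q : pred I) (a : I -> R) :
 (\sum_(i | Q i) a i) ^+ 2 <= #|I|%:R * \sum_(i | Q i) a i ^+ 2.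
rewrite big_mkcond [X in _ * X]big_mkcond/=; apply: le_trans (sqr_sum_le _) _.
by rewrite ler_wpM2l//; apply: ler_sum => i _; case: ifP => // _; rewrite expr0n.
Qed.

Lemma sqr3_le (R : realFieldType) (N y u v U V : R) : v ^+ 2 <= N * U -> u ^+ 2 <= N * V ->
 (y + (u + v)) ^+ 2 <= 3 * N * (V + U) + 3 * y ^+ 2.
have := sqr_ge0 (y - u); have := sqr_ge0 (y - v); have := sqr_ge0 (u - v).
rewrite !expr2; nra.
Qed.

Lemma rate_weaken (R : realType) (a : R) (F : R -> \bar R) (strong : bool) : rate true a F -> rate strong a F.
Proof. by case: strong => // h; have [r0 r01 hr] := h 1 ltr01; exists 1 => //; exists r0. Qed.
Lemma monomial_scale (R : realType) n m (j : @mindex n m) (a : R) (z : 'rV[R]_n) :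
 monomial j (a *: z) = a ^+ mdeg j * monomial j z.
rewrite /monomial /mdeg -prodrXr -big_split/=; apply: eq_bigr => i _.
by rewrite mxE exprMn.
Qed.

Lemma centered_sqr d (Om : measurableType d) (R : realType) (P : probability Om R) (X : Om -> R) (a : R) :
 sqint P X -> (\int[P]_w ((X w - a) ^+ 2)%:E =
  (\int[P]_w (X w * X w) - (\int[P]_w X w) * (\int[P]_w X w) + (\int[P]_w X w - a) ^+ 2)%:E)%E.
move=> sX; have i1 := sqint1 sX; have i2 := sqintM sX sX.
have iA := integrableZl mtop (- (2 * a)) i1.
have iC := sqint1 (sqint_cst P (a ^+ 2)).
have i12 := integrableD mtop i2 iA.
have i3 := integrableD mtop i12 iC.
transitivity (\int[P]_w (X w * X w + - (2 * a) * X w + a ^+ 2))%:E; last first.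
 rewrite (RintegralD mtop i12 iC) (RintegralD mtop i2 iA) (RintegralZl _ mtop i1).
 rewrite (Rintegral_unit_cst (probability_setT P)); congr (_%:E).
 set u := Rintegral _ _ _; set v := Rintegral _ _ _; ring.
rewrite /Rintegral fineK; last exact: integrable_fin_num i3.
by apply: eq_integral => w _; congr (_%:E); ring.
Qed.

(** * Palm calculus for a displaced stationary measure *)

Section displaced_measure.
Context d (Om : measurableType d) (R : realType) (n : nat).
Variables (P : probability Om R) (theta : measurable_flow Om R n).
Hypothesis htheta : preserves theta P.
Variable Phi : random_measure Om R n.
Hypothesis hPhi : invariant_measure theta Phi.
Hypothesis hPhi2 : locally_square_integrable P Phi.
Variable Z : random_field Om R n.
Hypothesis hZ : invariant_field theta Z.
Variable P2 : R.-pker 'rV[R]_n ~> Om.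
Hypothesis hP2 : is_palm2 P theta Phi P2.
Notation E := 'rV[R]_n.
Notation lambda := (@lebesgue_rV R n).
Notation alpha := (reduced_moment P Phi).
Notation palm1 := (palm P theta Phi).
Notation kap := (kappa P theta Phi P2 Z).
Notation X := (lstat Phi).
Let mZt : mfunT (fun t : Om * E => Z (t.1, t.2)).
Proof. by under eq_fun do rewrite -surjective_pairing; exact: mfunP. Qed.
Let mZw w : mfunT (fun x => Z (w, x)).
Proof. exact: (mcomp (mfunP Z) (measurable_pair1 w)). Qed.
Let mZs : mfunT (fun t : E * Om => Z (t.2, t.1)).
apply: (mcomp (mfunP Z) (g := fun t : E * Om => (t.2, t.1))).
by apply: mpair; [exact: msnd|exact: mfst].
Qed.
Let lfPhi w := random_measure_locally_finite Phi w.
Let mdiff A : measurable A -> mfunT (fun q : Om * E => \int[Phi q.1]_y (\1_A (q.2 - y)%R)%:E)%E.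
move=> mA; apply: (measurable_int_nu_fst Phi (F := fun q => (\1_A (q.1.2 - q.2)%R)%:E)).
 by move=> q; rewrite lee_fin indicE.
apply/mEFin; apply: mcomp; first exact: mindic.
apply: measurable_funB_rV; last exact: msnd.
exact: (mcomp msnd mfst).
Qed.

Lemma mnorm dT (T : measurableType dT) (f : T -> E) : mfunT f ->
 mfunT (fun t => `|f t|).
Proof. by move=> mf; exact: (mcomp (@measurable_norm_rV R n) mf). Qed.
Let mweight s r w : mfunT (fun x => ((1 + `|Z (w, x)| `^ s) * \1_(cube r) x)%:E).
apply/mEFin; apply: mfunM; last exact: mindic (mcub _).
have mp := mcomp (measurable_powR s) (mnorm (mZw w)).
exact: (mfunD (f := fun=> 1) (mcst _) mp).
Qed.

Lemma random_measure_cube w t : Phi w (cube t) = (X \1_(cube t) w)%:E.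
rewrite /lstat /Rintegral int_indic// ?setIT; last exact: mcub.
rewrite fineK// ge0_fin_numE//; apply: lfPhi; [exact: mcub|exact: bounded_cube].
Qed.

(** The weights [t^n] and [t^-n] in the arithmetic-geometric inequality balance the second moments
    of the masses of a fixed cube and of a cube of size [t], of orders 1 and [t^(2n)]; the result
    has the order [t^n] of a volume. *)
Lemma reduced_moment_growth : exists2 D : R, 0 <= D & forall t, 1 <= t ->
 (alpha (cube t) <= (D * t ^+ n)%:E)%E.
have [C C0 hC] := growth htheta hPhi hPhi2.
exists (C * 4 ^+ n); first by rewrite mulr_ge0// exprn_ge0.
move=> t t1; have t0 : 0 < t by exact: lt_le_trans t1.
have tn0 : 0 < t ^+ n by rewrite exprn_gt0.
pose a w := X \1_(cube 2) w; pose b w := X \1_(cube (2 * t)) w.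
have a0 w : 0 <= a w by apply: int_tf_ge0 => x; rewrite indicE.
have b0 w : 0 <= b w by apply: int_tf_ge0 => x; rewrite indicE.
have ma : mfunT a by apply: measurable_stat; exact: tf_cube.
have mb : mfunT b by apply: measurable_stat; exact: tf_cube.
via (\int[P]_w (2^-1 * (t ^+ n * a w ^+ 2) + 2^-1 * (t ^- n * b w ^+ 2))%:E)%E.
 have tw w : (\int[Phi w]_(x in unit_cube) \int[Phi w]_y (\1_(cube t) (x - y)%R)%:E <= (a w * b w)%:E)%E.
  via (\int[Phi w]_(x in unit_cube) (b w)%:E)%E.
   apply: ge0_le_integral => //.
   - exact: measurable_unit_cube.
   - by move=> x _; exact: int_ge0.
   - by apply: measurable_funTS; exact: (mcomp (mdiff (mcub t)) (measurable_pair1 w)).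
   - move=> x ux; rewrite -random_measure_cube.
    rewrite [leLHS](_ : _ = \int[Phi w]_y (\1_[set y | `|x - y| < t] y)%:E)%E; last first.
     by apply: eq_integral => y _; rewrite !indicE.
    have msub : measurable [set y : E | `|x - y| < t].
     have := measurable_funB_rV (@mcst _ _ E E setT x) (@measurable_id _ E setT).
     by move=> /(_ mtop _ (mcub t)); rewrite setTI.
    rewrite int_indic//.
    rewrite setIT; apply: le_measure; rewrite ?inE//.
    + exact: mcub.
    + move=> y /= xy; rewrite /cube/=.
     have x1 : `|x| <= 1
      by apply: norm_le_coord => // i; have /andP[h1 h2] := ux i; rewrite ger0_norm// ltW.
     have -> : y = x - (x - y) by rewrite opprB addrC subrK.
     by apply: le_lt_trans (ler_normB _ _) _; lra.
  rewrite integral_cst ?measurable_unit_cube//; last exact: measurable_unit_cube.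
  rewrite mulrC EFinM lee_wpmul2l ?lee_fin//.
  rewrite -random_measure_cube; apply: le_measure; rewrite ?inE//.
  - exact: measurable_unit_cube.
  - exact: mcub.
  - move=> x ux; rewrite /cube/=; apply: (@le_lt_trans _ _ 1); last by rewrite ltr1n.
   by apply: norm_le_coord => // i; have /andP[h1 h2] := ux i; rewrite ger0_norm// ltW.
 apply: ge0_le_integral => //.
 - by move=> w _; apply: int_ge0 => x _; exact: int_ge0.
 - apply: (measurable_integral_locally_finite lfPhi (f := fun p => \int[Phi p.1]_y (\1_(cube t) (p.2 - y)%R)%:E)%E).
  + exact: measurable_unit_cube.
  + by move=> p; exact: int_ge0.
  + exact: mdiff (mcub t).
 - apply/mEFin; apply: mfunD; apply: mfunM => //; apply: mfunM => //; exact: mfunX.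
 - move=> w _; apply: le_trans (tw w) _; rewrite lee_fin.
  have := sqr_ge0 (t ^+ n * a w - b w); rewrite -(pmulr_rge0 _ (x := t ^- n)) ?invr_gt0//.
  have -> : t ^- n * (t ^+ n * a w - b w) ^+ 2 = t ^+ n * a w ^+ 2 + t ^- n * b w ^+ 2 - 2 * (a w * b w)
   by field; rewrite gt_eqF.
  lra.
rewrite (_ : (fun w => _) = (fun w => ((2^-1 * t ^+ n) * a w ^+ 2)%:E + ((2^-1 * t ^- n) * b w ^+ 2)%:E)%E); last first.
 by apply/funext => w; rewrite -EFinD !mulrA.
rewrite ge0_integralD//; last 4 first.
- by move=> w _; rewrite lee_fin !mulr_ge0 ?sqr_ge0 ?(ltW tn0).
- by apply/mEFin; apply: mfunM => //; exact: mfunX.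
- by move=> w _; rewrite lee_fin !mulr_ge0 ?sqr_ge0 ?invr_ge0 ?(ltW tn0).
- by apply/mEFin; apply: mfunM => //; exact: mfunX.
under eq_integral do rewrite EFinM.
under [X in (_ + X)%E]eq_integral do rewrite EFinM.
rewrite !int_Zl//; last 6 first.
- by move=> w _; rewrite lee_fin sqr_ge0.
- by apply/mEFin; exact: mfunX.
- by rewrite mulr_ge0 ?invr_ge0 ?(ltW tn0).
- by move=> w _; rewrite lee_fin sqr_ge0.
- by apply/mEFin; exact: mfunX.
- by rewrite mulr_ge0 ?(ltW tn0).
via ((2^-1 * t ^+ n)%:E * (C * 2 ^+ (2 * n))%:E + (2^-1 * t ^- n)%:E * (C * (2 * t) ^+ (2 * n))%:E)%E.
 apply: leeD; apply: lee_wpmul2l; rewrite ?lee_fin ?mulr_ge0 ?invr_ge0 ?(ltW tn0)//; apply: hC; rewrite ?ler1n//.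
 by rewrite -[leLHS]mul1r ler_pM// ler1n.
rewrite -!EFinM -EFinD lee_fin; apply: eq_ler.
have h4 : 2 ^+ (2 * n) = 4 ^+ n :> R by rewrite exprM; congr (_ ^+ _); ring.
have -> : (2 * t) ^+ (2 * n) = 4 ^+ n * (t ^+ n * t ^+ n) by rewrite exprMn h4 -exprD mul2n addnn.
by rewrite h4; field; rewrite gt_eqF.
Qed.

Lemma reduced_moment_locally_finite : loc_fin alpha.
have [D _ hD] := reduced_moment_growth; apply/locally_finiteP => k.
apply: le_lt_trans (ltry (D * k.+1%:R ^+ n)); apply: le_trans (hD _ _); last by rewrite ler1n.
apply: le_measure; rewrite ?inE; [exact: mcub|exact: mcub|].
by apply: le_cube; rewrite ler_nat.
Qed.
Let mE1 : mfunT (fun t : (Om * E) * E => t.1.2).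
Proof. exact: (mcomp msnd mfst). Qed.
Let mZ1 : mfunT (fun t : (Om * E) * E => Z (t.1.1, t.1.2)).
apply: (mcomp (mfunP Z) (g := fun t : (Om * E) * E => (t.1.1, t.1.2))).
apply: mpair => //.
exact: (mcomp mfst mfst).
Qed.
Let mZ2 : mfunT (fun t : (Om * E) * E => Z (t.1.1, t.2)).
apply: (mcomp (mfunP Z) (g := fun t : (Om * E) * E => (t.1.1, t.2))).
apply: mpair; last exact: msnd.
exact: (mcomp mfst mfst).
Qed.
Let mark (t : (Om * E) * E) : (E * E) * (E * E) :=
 ((t.1.2, t.2), (Z (t.1.1, t.1.2), Z (t.1.1, t.2))).
Let measurable_mark : mfunT mark.
apply: mpair; apply: mpair => //; exact: msnd.
Qed.

Lemma measurable_pair_field (H : (E * E) * (E * E) -> \bar R) : mfunT H ->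
 mfunT (fun t : (Om * E) * E => H ((t.1.2, t.2), (Z (t.1.1, t.1.2), Z (t.1.1, t.2)))).
Proof. by move=> mH; exact: (mcomp mH measurable_mark). Qed.
(** Invariance of [Z] turns the marks at [x] and [x + y] into those at 0 and [y], so that the Palm
    integrand depends on the position [x] only through [H]. *)
Lemma pair_palm (H : (E * E) * (E * E) -> \bar R) : (forall t, 0 <= H t)%E -> mfunT H ->
 (\int[P]_w \int[Phi w]_x \int[Phi w]_y H ((x, y), (Z (w, x), Z (w, y))) =
  \int[lambda]_x \int[alpha]_y \int[P2 y]_w H ((x, (x + y)%R), (Z (w, 0%R), Z (w, y))))%E.
move=> H0 mH; have := hP2 (f := H \o mark) (fun t => H0 _) (mcomp mH measurable_mark).
rewrite /mark/= => ->; apply: eq_integral => x _; apply: eq_integral => y _; apply: eq_integral => w _ /=.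
by rewrite !hZ subrr [x + y]addrC addrK.
Qed.

Lemma measurable_palm2_mark (H : (E * E) * (E * E) -> \bar R) : (forall t, 0 <= H t)%E -> mfunT H ->
 mfunT (fun q : E * E => \int[P2 q.2]_w H ((q.1, (q.1 + q.2)%R), (Z (w, 0%R), Z (w, q.2))))%E.
move=> H0 mH.
pose f (t : (E * E) * Om) := H ((t.1.1, (t.1.1 + t.1.2)%R), (Z (t.2, 0%R), Z (t.2, t.1.2))).
have m11 : mfunT (fun t : (E * E) * Om => t.1.1) by exact: (mcomp mfst mfst).
have m12 : mfunT (fun t : (E * E) * Om => t.1.2) by exact: (mcomp msnd mfst).
apply: (measurable_integral_ppullback (@msnd _ _ E E) P2 (f := f) (fun t => H0 _)).
apply: (mcomp mH); apply: mpair; apply: mpair => //.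
- exact: mfunD_rV.
- apply: (mcomp (mfunP Z) (g := fun t : (E * E) * Om => (t.2, 0 : E))).
 by apply: mpair => //; exact: msnd.
- apply: (mcomp (mfunP Z) (g := fun t : (E * E) * Om => (t.2, t.1.2))).
 by apply: mpair => //; exact: msnd.
Qed.

Lemma pair_swap (H : (E * E) * (E * E) -> \bar R) : (forall t, 0 <= H t)%E -> mfunT H ->
 (\int[P]_w \int[Phi w]_x \int[Phi w]_y H ((x, y), (Z (w, x), Z (w, y))) =
  \int[P]_w \int[Phi w]_x \int[Phi w]_y H ((y, x), (Z (w, y), Z (w, x))))%E.
move=> H0 mH; apply: eq_integral => w _.
apply: (int_nu_swap Phi w (F := fun q => H ((q.1, q.2), (Z (w, q.1), Z (w, q.2)))) (fun t => H0 _)).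
have mw (g : E * E -> E) : mfunT g -> mfunT (fun q => Z (w, g q)).
 move=> mg; apply: (mcomp (mfunP Z) (g := fun q => (w, g q))).
 exact: mpair.
apply: (mcomp mH); apply: mpair; apply: mpair => //.
- exact: mw mfst.
- exact: mw msnd.
Qed.

(** When only the mark at 0 enters, the integral over positions can be done first, for a fixed
    mark. *)
Lemma palm_tonelli (H : E * (E * E) -> \bar R) : (forall t, 0 <= H t)%E -> mfunT H ->
 (\int[lambda]_x \int[alpha]_y \int[P2 y]_w H (x, (y, Z (w, 0%R))) =
  \int[alpha]_y \int[P2 y]_w \int[lambda]_x H (x, (y, Z (w, 0%R))))%E.
move=> H0 mH.
have mZ0 : mfunT (fun w => Z (w, 0)).
 apply: (mcomp (mfunP Z) (g := fun w : Om => (w, 0 : E))).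
 exact: mpair.
have mf : mfunT (fun t : (E * E) * Om => H (t.1.1, (t.1.2, Z (t.2, 0)))).
 apply: (mcomp mH); apply: mpair.
  exact: (mcomp mfst mfst).
 apply: mpair; first exact: (mcomp msnd mfst).
 exact: (mcomp mZ0 msnd).
have mg := measurable_integral_ppullback (@msnd _ _ E E) P2
 (f := fun t => H (t.1.1, (t.1.2, Z (t.2, 0)))) (fun t => H0 _) mf.
transitivity (\int[alpha]_y \int[lambda]_x \int[P2 y]_w H (x, (y, Z (w, 0%R))))%E.
 exact: (@fubini_tonelli _ _ E E R (sf_of (@lebesgue_lf R n)) (sf_of reduced_moment_locally_finite)
  (fun q => \int[P2 q.2]_w H (q.1, (q.2, Z (w, 0%R))))%E mg (fun q => int_ge0 _ (fun _ _ => H0 _))).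
apply: eq_integral => y _.
have mH' : mfunT (fun q : E * Om => H (q.1, (y, Z (q.2, 0)))).
 apply: (mcomp mH); apply: mpair; first exact: mfst.
 apply: mpair => //; exact: (mcomp mZ0 msnd).
have p1 : P2 y setT = 1%E by exact: prob_kernel.
exact: (@fubini_tonelli _ _ E Om R (sf_of (@lebesgue_lf R n)) (prob_of p1) _ mH' (fun q => H0 _)).
Qed.

(** * Moment bounds for near and far points *)

Variables (gamma c : R).
Hypothesis c0 : 0 <= c.
Hypothesis gamma0 : 0 < gamma.
Hypothesis moment2 : forall y, (\int[P2 y]_w (`|Z (w, 0)%R| `^ gamma)%:E <= c%:E)%E.
Hypothesis ngamma : n%:R < gamma.
Let mproj1 : mfunT (fun t : (E * E) * (E * E) => t.1.1).
Proof. exact: (mcomp mfst mfst). Qed.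
Let mproj2 : mfunT (fun t : (E * E) * (E * E) => t.1.2).
Proof. exact: (mcomp msnd mfst). Qed.
Let mproj3 : mfunT (fun t : (E * E) * (E * E) => t.2.1).
Proof. exact: (mcomp mfst msnd). Qed.
Let mproj4 : mfunT (fun t : (E * E) * (E * E) => t.2.2).
Proof. exact: (mcomp msnd msnd). Qed.
Let measurable_Z y : mfunT (fun w => Z (w, y)).
apply: (mcomp (mfunP Z) (g := fun w : Om => (w, y))).
exact: mpair.
Qed.
Let swap (t : (E * E) * (E * E)) := ((t.1.2, t.1.1), (t.2.2, t.2.1)).
Let measurable_swap : mfunT swap.
Proof. by apply: mpair; apply: mpair. Qed.
Let fieldw w : mfunT (fun q : E * E => ((q.1, q.2), (Z (w, q.1), Z (w, q.2)))).
have mw (g : E * E -> E) : mfunT g -> mfunT (fun q => Z (w, g q)).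
 move=> mg; apply: (mcomp (mfunP Z) (g := fun q => (w, g q))).
 exact: mpair.
by apply: mpair; apply: mpair => //; apply: mw.
Qed.
Let mfield (H : (E * E) * (E * E) -> \bar R) : mfunT H ->
 mfunT (fun q : (Om * E) * E => H ((q.1.2, q.2), (Z (q.1.1, q.1.2), Z (q.1.1, q.2)))).
Proof. exact: measurable_pair_field. Qed.
Lemma int_nu_pairD w (G H : (E * E) * (E * E) -> \bar R) : (forall t, 0 <= G t)%E -> (forall t, 0 <= H t)%E ->
 mfunT G -> mfunT H ->
 (\int[Phi w]_x \int[Phi w]_y (G ((x, y), (Z (w, x), Z (w, y))) + H ((x, y), (Z (w, x), Z (w, y)))) =
  \int[Phi w]_x \int[Phi w]_y G ((x, y), (Z (w, x), Z (w, y))) +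
  \int[Phi w]_x \int[Phi w]_y H ((x, y), (Z (w, x), Z (w, y))))%E.
move=> G0 H0 mG mH.
have m1 (K : (E * E) * (E * E) -> \bar R) : mfunT K -> forall x,
  mfunT (fun y => K ((x, y), (Z (w, x), Z (w, y)))).
 by move=> mK x; exact: (mcomp (mcomp mK (fieldw w)) (measurable_pair1 x)).
have m2 (K : (E * E) * (E * E) -> \bar R) : (forall t, 0 <= K t)%E -> mfunT K ->
  mfunT (fun x => \int[Phi w]_y K ((x, y), (Z (w, x), Z (w, y))))%E.
 move=> K0 mK; apply: (mcomp _ (measurable_pair1 w)
  (f := fun q : Om * E => \int[Phi q.1]_y K ((q.2, y), (Z (q.1, q.2), Z (q.1, y))))%E).
 exact: (measurable_int_nu_fst Phi (fun t => K0 _) (mfield mK)).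
under eq_integral => x _ do rewrite (ge0_integralD _ mtop (fun _ _ => G0 _) (m1 _ mG x) (fun _ _ => H0 _) (m1 _ mH x)).
by rewrite (ge0_integralD _ mtop (fun _ _ => int_ge0 _ (fun _ _ => G0 _)) (m2 _ G0 mG) (fun _ _ => int_ge0 _ (fun _ _ => H0 _)) (m2 _ H0 mH)).
Qed.

(** Under [P2 y] a moment is at hand for the mark at 0 only. A product over two points is therefore
    dominated by [G] plus its exchange, where in the applications [G] involves just the first mark;
    the symmetry of the double integral over [Phi] identifies the two contributions. *)
Lemma pair_sym_le (G : (E * E) * (E * E) -> \bar R) (H : Om -> E -> \bar R) : (forall t, 0 <= G t)%E -> mfunT G ->
 (forall w x, 0 <= H w x)%E -> (forall w, mfunT (H w)) ->
 (forall w x y, H w x * H w y <= G ((x, y), (Z (w, x), Z (w, y))) + G ((y, x), (Z (w, y), Z (w, x))))%E ->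
 (\int[P]_w (\int[Phi w]_x H w x * \int[Phi w]_x H w x) <=
  2%:E * \int[lambda]_x \int[alpha]_y \int[P2 y]_w G ((x, (x + y)%R), (Z (w, 0%R), Z (w, y))))%E.
move=> G0 mG H0 mH HG.
have mGs : mfunT (G \o swap) by exact: mcomp.
rewrite -(pair_palm G0 mG).
have e : (\int[P]_w \int[Phi w]_x \int[Phi w]_y (G ((x, y), (Z (w, x), Z (w, y))) + (G \o swap) ((x, y), (Z (w, x), Z (w, y)))) =
  2%:E * \int[P]_w \int[Phi w]_x \int[Phi w]_y G ((x, y), (Z (w, x), Z (w, y))))%E.
 under eq_integral => w _ do rewrite (int_nu_pairD (H := G \o swap) w G0 (fun t => G0 _) mG mGs).
 have mm K : (forall t, 0 <= K t)%E -> mfunT K ->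
   mfunT (fun w => \int[Phi w]_x \int[Phi w]_y K ((x, y), (Z (w, x), Z (w, y))))%E.
  by move=> K0 mK; exact: (measurable_int_nu2 Phi (fun t => K0 _) (mfield mK)).
 have pos K : (forall t, 0 <= K t)%E -> forall w, setT w -> (0 <= \int[Phi w]_x \int[Phi w]_y K ((x, y), (Z (w, x), Z (w, y))))%E
  by move=> K0 w _; apply: int_ge0 => x _; apply: int_ge0.
 rewrite (ge0_integralD _ mtop (pos _ G0) (mm _ G0 mG) (pos _ (fun t => G0 _)) (mm _ (fun t => G0 _) mGs)).
 rewrite (pair_swap (H := G \o swap) (fun t => G0 _) mGs).
 have I0 : (0 <= \int[P]_w \int[Phi w]_x \int[Phi w]_y G ((x, y), (Z (w, x), Z (w, y))))%E
  by apply: int_ge0 => w _; exact: pos.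
 by rewrite -(addee_mul2 I0).
rewrite -e; apply: le_intT => w; first by rewrite mule_ge0//; apply: int_ge0.
rewrite (int_nu_prod Phi w (H0 w) (mH w) (H0 w) (mH w)).
apply: le_intT => x; first by apply: int_ge0 => y _; rewrite mule_ge0.
by apply: le_intT => y; [rewrite mule_ge0|exact: HG].
Qed.

Lemma moment_sqr_le y : (\int[P2 y]_w ((1 + `|Z (w, 0)%R| `^ (gamma / 2)) ^+ 2)%:E <= (2 + 2 * c)%:E)%E.
via (\int[P2 y]_w (2 + 2 * `|Z (w, 0)%R| `^ gamma)%:E)%E.
 apply: le_intT => w; first by rewrite lee_fin sqr_ge0.
 rewrite lee_fin; have -> : `|Z (w, 0)| `^ gamma = (`|Z (w, 0)| `^ (gamma / 2)) ^+ 2.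
  by rewrite -powR_mulrn ?powR_ge0// -powRrM divfK.
 exact: sqr1D_le.
have mzg : mfunT (fun w => `|Z (w, 0)| `^ gamma) by apply: (mcomp (measurable_powR gamma)); exact: mnorm.
under eq_integral do rewrite EFinD EFinM.
rewrite ge0_integralD//; last by apply: measurable_funeM; exact/mEFin.
rewrite [X in (X + _)%E](_ : _ = 2%:E); last first.
 by have := integral_cst (P2 y) mtop (2%:E : \bar R); rewrite prob_kernel mule1.
rewrite [X in (_ <= X)%E]EFinD; apply: leeD2l.
rewrite int_Zl//; last exact/mEFin.
by rewrite EFinM lee_wpmul2l.
Qed.
(** The power [gamma / 2] is the largest one whose square is controlled by moments of order
    [gamma]. *)
Definition near_sum r w : \bar R :=
 (\int[Phi w]_x ((1 + `|Z (w, x)| `^ (gamma / 2)) * \1_(cube r) x)%:E)%E.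

(** Bounding [a * b] by [a^2 + b^2] charges each pair to a single mark; the volume of the positions
    and the mass of [alpha] give a factor [r^n] each. *)
Lemma near_bound : exists2 C : R, 0 <= C & forall r, 1 <= r ->
 (\int[P]_w (near_sum r w * near_sum r w) <= (C * r ^+ (2 * n))%:E)%E.
have [D D0 hD] := reduced_moment_growth.
exists (2 * (2 ^+ n * (D * 2 ^+ n * (2 + 2 * c)))).
 by rewrite !mulr_ge0 ?exprn_ge0// addr_ge0 ?mulr_ge0.
move=> r r1; have r0 : 0 < r by exact: lt_le_trans r1.
pose u (z : E) : R := 1 + `|z| `^ (gamma / 2).
have u0 z : 0 <= u z by rewrite addr_ge0// powR_ge0.
have mu : mfunT u.
 have mp := mcomp (measurable_powR (gamma / 2)) (@measurable_norm_rV R n).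
 exact: (mfunD (f := fun=> 1) (mcst _) mp).
have mc : mfunT (\1_(cube r) : E -> R) by exact: mindic (mcub _).
pose G (t : (E * E) * (E * E)) : \bar R := (\1_(cube r) t.1.1 * \1_(cube r) t.1.2 * u t.2.1 ^+ 2)%:E.
have G0 t : (0 <= G t)%E by rewrite lee_fin mulr_ge0 ?sqr_ge0// mulr_ge0.
have mG : mfunT G.
 apply/mEFin; apply: mfunM.
  by apply: mfunM; [exact: (mcomp mc mproj1)|exact: (mcomp mc mproj2)].
 by apply: mfunX; exact: (mcomp mu mproj3).
pose H w x : \bar R := (u (Z (w, x)) * \1_(cube r) x)%:E.
have H0 w x : (0 <= H w x)%E by rewrite lee_fin mulr_ge0.
have mH w : mfunT (H w).
 apply/mEFin; apply: mfunM => //.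
 by apply: (mcomp mu); exact: (mZw w).
apply: le_trans (pair_sym_le G0 mG H0 mH _) _.
 move=> w x y; rewrite /H /G/= -EFinM -EFinD lee_fin.
 set a := u (Z (w, x)); set b := u (Z (w, y)); set i : R := \1_(cube r) x; set j : R := \1_(cube r) y.
 have -> : i * j * a ^+ 2 + j * i * b ^+ 2 = (i * j) * (a ^+ 2 + b ^+ 2) by ring.
 have -> : a * i * (b * j) = (i * j) * (a * b) by ring.
 apply: ler_wpM2l; first exact: mulr_ge0.
 by have := sqr_ge0 (a - b); have := sqr_ge0 a; have := sqr_ge0 b; rewrite sqrrB -mulr_natr; lra.
rewrite -mulrA EFinM lee_wpmul2l//.
pose M := D * 2 ^+ n * (2 + 2 * c).
have M0 : 0 <= M by rewrite !mulr_ge0 ?exprn_ge0// addr_ge0 ?mulr_ge0.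
via (\int[lambda]_x ((M * r ^+ n) * \1_(cube r) x)%:E)%E.
 apply: le_intT => x; first by apply: int_ge0 => y _; apply: int_ge0.
 have [xr|xr] := ltP `|x| r; last first.
  rewrite cube_indicE ltNge xr mulr0 integral0_eq// => y _; rewrite integral0_eq// => w _.
  by rewrite /G/= cube_indicE ltNge xr !mul0r.
 rewrite cube_indicE xr mulr1.
 via (\int[alpha]_y ((2 + 2 * c) * \1_(cube (2 * r)) y)%:E)%E.
  apply: le_intT => y; first by apply: int_ge0.
  have [yr|yr] := ltP `|y| (2 * r).
   rewrite [X in (_ <= (_ * X)%:E)%E]cube_indicE yr mulr1; apply: le_trans (moment_sqr_le y).
   apply: le_intT => w; first exact: G0.
   rewrite /G/= lee_fin ler_piMl ?sqr_ge0// mulr_ile1// indicE; by case: (_ \in _).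
  rewrite [X in (_ <= (_ * X)%:E)%E]cube_indicE ltNge yr mulr0 integral0_eq// => w _.
  rewrite /G/= [\1_(cube r) (x + y)]cube_indicE; case: ltP; rewrite ?mulr0 ?mul0r// => h; exfalso.
  have : `|y| <= `|x + y| + `|x| by have := ler_normB (x + y) x; rewrite [x + y]addrC addrK.
  lra.
 under eq_integral do rewrite EFinM.
 rewrite int_Zl//; last 2 first.
 - by apply/mEFin; exact: mindic (mcub _).
 - by rewrite addr_ge0 ?mulr_ge0.
 rewrite int_indic//; last exact: mcub.
 rewrite setIT; via ((2 + 2 * c)%:E * (D * (2 * r) ^+ n)%:E)%E.
  rewrite lee_wpmul2l ?lee_fin ?addr_ge0 ?mulr_ge0//; apply: hD; lra.
 by rewrite -EFinM lee_fin /M exprMn; apply: eq_ler; ring.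
under eq_integral do rewrite EFinM.
have Mr0 : 0 <= M * r ^+ n by rewrite mulr_ge0// exprn_ge0// ltW.
rewrite int_Zl//; last by apply/mEFin.
rewrite int_indic//; last exact: mcub.
rewrite setIT; via ((M * r ^+ n)%:E * ((2 * r) ^+ n)%:E)%E.
 rewrite lee_wpmul2l ?lee_fin//; have := lebesgue_rV_cube_le (0 : E) r0.
 by under [X in lambda X]eq_set do rewrite addr0.
rewrite -EFinM lee_fin -/M exprMn mul2n -addnn exprD; apply: eq_ler; ring.
Qed.

Lemma tail_moment y b : 0 < b ->
 (\int[P2 y]_w ((b <= `|Z (w, 0)%R|)%R%:R)%:E <= (c * (b `^ gamma)^-1)%:E)%E.
move=> b0; have bg : 0 < b `^ gamma by rewrite powR_gt0.
via (\int[P2 y]_w ((b `^ gamma)^-1%:E * (`|Z (w, 0)%R| `^ gamma)%:E))%E.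
 apply: le_intT => w; first by rewrite lee_fin.
 rewrite -EFinM lee_fin; case: (leP b `|Z (w, 0)|) => h /=; last by rewrite mulr_ge0 ?invr_ge0 ?powR_ge0.
 by rewrite ler_pdivlMl// mulr1 ge0_ler_powR ?nnegrE ?(ltW gamma0) ?(ltW b0).
rewrite int_Zl ?invr_ge0 ?powR_ge0//; last first.
 apply/mEFin; apply: (mcomp (measurable_powR gamma)); exact: mnorm.
by rewrite mulrC EFinM lee_wpmul2l// lee_fin invr_ge0 powR_ge0.
Qed.
(** Points that start outside radius [2 * r] but land within radius [r]; each has been displaced by
    more than [r]. *)
Definition far_sum r w : \bar R :=
 (\int[Phi w]_x ((2 * r <= `|x|) && (`|x + Z (w, x)| < r))%R%:R%:E)%E.

(** Two such points land within [2 * r] of each other, so if [z] is the larger mark and [y] the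
    difference of the starting points, then [|z| >= r] and [|y| <= 4 * |z|]. The moment bounds the
    probability of this by a multiple of [max(r, |y|)^(-gamma)], integrable against [alpha] because
    [gamma > n]; integrating out the landing position gives the factor [(2 * r)^n]. *)
Lemma far_bound : exists2 C : R, 0 <= C & forall r, 1 <= r ->
 (\int[P]_w (far_sum r w * far_sum r w) <= (C * r ^+ (2 * n) * (r `^ gamma)^-1)%:E)%E.
have [D D0 hD] := reduced_moment_growth.
pose th : R := 2 ^+ n; pose k : R := (2 `^ gamma)^-1.
have k0 : 0 <= k by rewrite invr_ge0 powR_ge0.
have th0 : 0 <= th by rewrite exprn_ge0.
have kth : k * th < 1.
 rewrite /k /th mulrC ltr_pdivrMr ?powR_gt0// mul1r -powR_mulrn//.
 by apply: ltr_powR => //; rewrite ltr1n.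
pose q : R := (1 - k * th)^-1 * th + 1.
have q0 : 0 <= q by rewrite addr_ge0// mulr_ge0// invr_ge0 subr_ge0 ltW.
have c40 : 0 <= c * 4 `^ gamma by rewrite mulr_ge0// powR_ge0.
exists (2 * (2 ^+ n * (c * 4 `^ gamma * D * q))); first by rewrite !mulr_ge0 ?exprn_ge0 ?powR_ge0.
move=> r r1; have r0 : 0 < r by exact: lt_le_trans r1.
have rg0 : 0 < r `^ gamma by rewrite powR_gt0.
pose b (y z : E) : bool := (r <= `|z|) && (`|y| <= 4 * `|z|).
pose H (t : E * (E * E)) : \bar R := ((`|t.1 + t.2.2| < r) && b t.2.1 t.2.2)%R%:R%:E.
have H0 t : (0 <= H t)%E by rewrite lee_fin.
have mb dT (T : measurableType dT) (f g : T -> E) : mfunT f -> mfunT g ->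
  mfunT (fun t => b (f t) (g t)).
 move=> mf mg; have mg' := mnorm mg; have mf' := mnorm mf.
 by apply: measurable_and; apply: measurable_fun_ler => //; exact: mfunM.
have mH : mfunT H.
 apply/mEFin; apply: mbool_natr.
 have m1 : mfunT (fun t : E * (E * E) => t.2.1) by exact: (mcomp mfst msnd).
 have m2 : mfunT (fun t : E * (E * E) => t.2.2) by exact: (mcomp msnd msnd).
 apply: measurable_and; last exact: mb.
 by apply: measurable_fun_ltr => //; apply: mnorm; apply: mfunD_rV.
pose G (t : (E * E) * (E * E)) : \bar R := H (t.1.1, (t.1.2 - t.1.1, t.2.1)).
have mG : mfunT G.
 apply: (mcomp mH); apply: mpair => //; apply: mpair => //.
 exact: measurable_funB_rV.
pose A w x : \bar R := ((2 * r <= `|x|) && (`|x + Z (w, x)| < r))%R%:R%:E.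
have A0 w x : (0 <= A w x)%E by rewrite lee_fin.
have mA w : mfunT (A w).
 apply/mEFin; apply: mbool_natr; apply: measurable_and.
  by apply: measurable_fun_ler => //; exact: measurable_norm_rV.
 by apply: measurable_fun_ltr => //; apply: mnorm; apply: mfunD_rV.
apply: le_trans (pair_sym_le (fun t => H0 _) mG A0 mA _) _.
 move=> w x y; rewrite /A /G /H/= -EFinM -EFinD lee_fin.
 set zx := Z (w, x); set zy := Z (w, y).
 have [/andP[xr xz]|_] := boolP ((2 * r <= `|x|) && (`|x + zx| < r)); last by rewrite mul0r addr_ge0.
 have [/andP[yr yz]|_] := boolP ((2 * r <= `|y|) && (`|y + zy| < r)); last by rewrite mulr0 addr_ge0.
 rewrite xz yz /b/= mul1r.
 have low (u v : E) : 2 * r <= `|u| -> `|u + v| < r -> r <= `|v|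
  by move=> h1 h2; have := ler_normB (u + v) v; rewrite addrK; lra.
 have dist (u v s t : E) : 2 * r <= `|u| -> `|u + s| < r -> `|v + t| < r -> `|t| <= `|s| -> `|v - u| <= 4 * `|s|.
  move=> h1 h2 h3 h4; have -> : v - u = ((v + t) - (u + s)) + (s - t).
   by apply/rowP => i; rewrite !mxE; ring.
  have := ler_normD ((v + t) - (u + s)) (s - t); have := ler_normB (v + t) (u + s); have := ler_normB s t.
  by have := low _ _ h1 h2; lra.
 have zx1 := low _ _ xr xz; have zy1 := low _ _ yr yz.
 case: (leP `|zy| `|zx|) => h.
  by rewrite zx1 (dist _ _ _ _ xr xz yz h)/= lerDl.
 by rewrite zy1 (dist _ _ _ _ yr yz xz (ltW h))/= lerDr.
rewrite -!mulrA EFinM lee_wpmul2l//.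
have -> : (\int[lambda]_x \int[alpha]_y \int[P2 y]_w G ((x, (x + y)%R), (Z (w, 0%R), Z (w, y))) =
  \int[lambda]_x \int[alpha]_y \int[P2 y]_w H (x, (y, Z (w, 0%R))))%E.
 apply: eq_integral => x _; apply: eq_integral => y _; apply: eq_integral => w _.
 by rewrite /G/= [x + y]addrC addrK.
rewrite (palm_tonelli H0 mH).
pose h y : \bar R := (\int[P2 y]_w (b y (Z (w, 0%R)))%:R%:E)%E.
have h0 y : (0 <= h y)%E by apply: int_ge0 => w _; rewrite lee_fin.
have mh : mfunT h.
 apply: (@measurable_fun_integral_sfinite_kernel _ _ E Om R (fun t => (b t.1 (Z (t.2, 0)))%:R%:E) P2) => //.
  apply/mEFin; apply: mbool_natr; apply: mb => //.
  exact: (mcomp (measurable_Z 0) msnd).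
via (\int[alpha]_y (((2 * r) ^+ n)%:E * h y))%E.
 apply: le_intT => y.
  by apply: int_ge0 => w _; apply: int_ge0.
 rewrite /h -int_Zl ?exprn_ge0 ?mulr_ge0 ?(ltW r0)//; last first.
  apply/mEFin; apply: mbool_natr; exact: mb.
 apply: le_intT => w; first by apply: int_ge0.
 rewrite /H/=; case: (b y (Z (w, 0))); last by rewrite mule0 integral0_eq// => x _; rewrite andbF.
 rewrite mule1; apply: le_trans (lebesgue_rV_cube_le (Z (w, 0)) r0).
 under eq_integral do rewrite andbT.
 rewrite -[X in (_ <= lambda X)%E]setIT -int_indic//.
  by apply: le_intT => x; rewrite lee_fin// indicE mem_setE.
 have mD : mfunT (fun x : E => `|x + Z (w, 0)|) by apply: mnorm; apply: mfunD_rV.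
 rewrite -[X in measurable X]setTI (_ : [set x | _] = (fun x : E => `|x + Z (w, 0)|) @^-1` `]-oo, r[%classic).
  by apply: mD => //; exact: measurable_itv.
 by apply/seteqP; split => x; rewrite /= in_itv.
rewrite int_Zl ?exprn_ge0 ?mulr_ge0 ?(ltW r0)//.
have hh : (\int[alpha]_y h y <= (c * 4 `^ gamma * D * q * r ^+ n * (r `^ gamma)^-1)%:E)%E.
 have cr0 : 0 <= c * 4 `^ gamma * (r `^ gamma)^-1 by rewrite mulr_ge0// invr_ge0 ltW.
 have Dr0 : 0 <= D * r ^+ n by rewrite mulr_ge0// exprn_ge0// ltW.
 apply: le_trans (integral_geometric_le r0 cr0 k0 th0 Dr0 kth mh h0 _ _ _) _.
 - move=> y; via (\int[P2 y]_w ((r <= `|Z (w, 0)%R|)%R%:R)%:E)%E.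
   apply: le_intT => w; rewrite lee_fin// ler_nat /b.
   by case: (r <= _); case: (_ <= _).
  apply: le_trans (tail_moment y r0) _; rewrite lee_fin -mulrA ler_wpM2l//.
  by rewrite ler_peMl ?invr_ge0 ?(ltW rg0)//; apply: powR_ge1; rewrite ?(ltW gamma0)// ler1n.
 - move=> i y yr; have t0 : 0 < 2 ^+ i * r / 4 by rewrite divr_gt0// mulr_gt0// exprn_gt0.
  via (\int[P2 y]_w ((2 ^+ i * r / 4 <= `|Z (w, 0)%R|)%R%:R)%:E)%E.
   apply: le_intT => w; rewrite lee_fin// ler_nat /b.
   case: (r <= _) => //=; case: (leP `|y|) => //= hy.
   have -> : 2 ^+ i * r / 4 <= `|Z (w, 0)| by rewrite ler_pdivrMr// mulrC [_ * 4]mulrC (le_trans _ hy)// mulrC.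
   by [].
  apply: le_trans (tail_moment y t0) _; rewrite lee_fin.
  have -> : (2 ^+ i * r / 4) `^ gamma = (2 `^ gamma) ^+ i * r `^ gamma * (4 `^ gamma)^-1.
   rewrite !powRM ?mulr_ge0 ?exprn_ge0 ?invr_ge0 ?(ltW r0)//; congr (_ * _ * _).
    by rewrite -powR_mulrn// -powRrM mulrC powRrM powR_mulrn ?powR_ge0.
   by rewrite -[4^-1]powR_inv1// -powRrM mulN1r powRN.
  rewrite !invfM invrK /k exprVn; apply: eq_ler; ring.
 - move=> i; apply: le_trans (hD _ _) _.
   by rewrite -[leLHS]mul1r ler_pM// exprn_ege1// ler1n.
  rewrite lee_fin exprMn /th -!exprM mulnC; apply: eq_ler; ring.
 - rewrite -EFinD lee_fin /q; apply: eq_ler; ring.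
via (((2 * r) ^+ n)%:E * (c * 4 `^ gamma * D * q * r ^+ n * (r `^ gamma)^-1)%:E)%E.
 by rewrite lee_wpmul2l// lee_fin exprn_ge0// mulr_ge0// ltW.
rewrite -EFinM lee_fin exprMn mul2n -addnn exprD; apply: eq_ler; ring.
Qed.

(** * Signed statistics of the marks *)

Section signed.
Variable g : E -> R.
Hypothesis mg : mfunT g.
Definition palm_corr y : \bar R := `|\int[P2 y]_w (g (Z (w, 0)) * g (Z (w, y)))%:E|%E.

Lemma measurable_palm_product : mfunT (fun t : E * Om => g (Z (t.2, 0)) * g (Z (t.2, t.1))).
have m0 : mfunT (fun t : E * Om => Z (t.2, 0)).
 apply: (mcomp (mfunP Z) (g := fun t : E * Om => (t.2, 0 : E))).
 by apply: mpair => //; exact: msnd.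
by apply: mfunM; [exact: (mcomp mg m0)|exact: (mcomp mg mZs)].
Qed.

Lemma measurable_palm_corr : mfunT palm_corr.
have mp := measurable_palm_product.
have mK (k : E * Om -> R) : mfunT k ->
  mfunT (fun y => \int[P2 y]_w (Num.max (k (y, w)) 0)%:E)%E.
 move=> mk; apply: (@measurable_fun_integral_sfinite_kernel _ _ E Om R (fun t => (Num.max (k t) 0)%:E) P2).
  by move=> t; rewrite lee_fin le_max lexx orbT.
 by apply/mEFin; exact: measurable_maxr.
rewrite /palm_corr; apply: mcomp => //.
under eq_fun do rewrite integral_posneg.
by apply: emeasurable_funB; [exact: mK mp|exact: mK (measurable_funN mp)].
Qed.
Variables (h : E -> R) (M M' r : R).
Hypothesis mh : mfunT h.
Hypothesis hM : forall x, `|h x| <= M.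
Hypothesis hr : off_cube r h.
Hypothesis gM : forall z, `|g z| <= M' * (1 + `|z| `^ (gamma / 2)).
Hypothesis M'0 : 0 <= M'.
Hypothesis r1 : 1 <= r.
Let M0 : 0 <= M. Proof. exact: le_trans (hM 0). Qed.
Let gp (x z : E) : R := Num.max (h x * g z) 0.
Let gm (x z : E) : R := Num.max (- (h x * g z)) 0.
Let gp0 x z : 0 <= gp x z. Proof. by rewrite le_max lexx orbT. Qed.
Let gm0 x z : 0 <= gm x z. Proof. by rewrite le_max lexx orbT. Qed.
Let A w : \bar R := (\int[Phi w]_x (gp x (Z (w, x)))%:E)%E.
Let B w : \bar R := (\int[Phi w]_x (gm x (Z (w, x)))%:E)%E.
Let A0 w : (0 <= A w)%E. Proof. by apply: int_ge0 => x _; rewrite lee_fin. Qed.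
Let B0 w : (0 <= B w)%E. Proof. by apply: int_ge0 => x _; rewrite lee_fin. Qed.
Let mgp dT (T : measurableType dT) (u v : T -> E) : mfunT u -> mfunT v ->
 mfunT (fun t => gp (u t) (v t)).
move=> mu mv; apply: measurable_maxr => //; apply: mfunM.
 exact: mcomp.
exact: mcomp.
Qed.
Let mgm dT (T : measurableType dT) (u v : T -> E) : mfunT u -> mfunT v ->
 mfunT (fun t => gm (u t) (v t)).
move=> mu mv; apply: measurable_maxr => //; apply: measurable_funN; apply: mfunM.
 exact: mcomp.
exact: mcomp.
Qed.
Let mA : mfunT A.
apply: (measurable_int_nu Phi (F := fun t => (gp t.2 (Z (t.1, t.2)))%:E)); first by move=> t; rewrite lee_fin.
apply/mEFin; apply: mgp; first exact: msnd.
by under eq_fun do rewrite -surjective_pairing; exact: mfunP.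
Qed.
Let mB : mfunT B.
apply: (measurable_int_nu Phi (F := fun t => (gm t.2 (Z (t.1, t.2)))%:E)); first by move=> t; rewrite lee_fin.
apply/mEFin; apply: mgm; first exact: msnd.
by under eq_fun do rewrite -surjective_pairing; exact: mfunP.
Qed.
Let stat_le x w : `|h x * g (Z (w, x))| <= M * M' * ((1 + `|Z (w, x)| `^ (gamma / 2)) * \1_(cube r) x).
rewrite cube_indicE; case: ltP => xr; last by rewrite hr// mul0r normr0 !mulr0.
by rewrite mulr1 normrM -mulrA ler_pM.
Qed.
Let near w := near_sum r w.
Let near0 w : (0 <= near w)%E.
Proof. by apply: int_ge0 => x _; rewrite lee_fin mulr_ge0// addr_ge0// powR_ge0. Qed.
Let near_le (k : E -> R) w : (forall x, 0 <= k x) ->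
 (forall x, k x <= `|h x * g (Z (w, x))|) -> (\int[Phi w]_x (k x)%:E <= (M * M')%:E * near w)%E.
move=> k0 kle; rewrite /near /near_sum -int_Zl ?mulr_ge0//.
apply: le_intT => x; first by rewrite lee_fin.
by rewrite -EFinM lee_fin; exact: le_trans (kle x) (stat_le x w).
Qed.
Let A_le w : (A w <= (M * M')%:E * near w)%E.
Proof. by apply: near_le => // x; rewrite /gp ge_max normr_ge0 ler_norm. Qed.
Let B_le w : (B w <= (M * M')%:E * near w)%E.
Proof. by apply: near_le => // x; rewrite /gm ge_max normr_ge0 andbT -normrN ler_norm. Qed.
Lemma measurable_near_sum : mfunT near.
apply: (measurable_int_nu Phi (F := fun t => ((1 + `|Z (t.1, t.2)| `^ (gamma / 2)) * \1_(cube r) t.2)%:E)).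
 by move=> t; rewrite lee_fin mulr_ge0// addr_ge0// powR_ge0.
apply/mEFin; apply: mfunM; last first.
 by apply: (mcomp _ msnd); exact: mindic (mcub _).
have mp := mcomp (measurable_powR (gamma / 2)) (mnorm mZt).
exact: (mfunD (f := fun=> 1) (mcst _) mp).
Qed.

Lemma ae_near_sum_lty : {ae P, forall w, (near w < +oo)%E}.
have [C C0' hC] := near_bound.
have mn := measurable_near_sum.
have f : (\int[P]_w (near w * near w) < +oo)%E by apply: le_lt_trans (ltry (C * r ^+ (2 * n))); exact: hC.
have := measurable_nonneg_lty (emfunM mn mn) (fun w => mule_ge0 (near0 w) (near0 w)) f.
apply: filterS => w; have := near0 w; by case: (near w) => [a||]//=; rewrite ?ltry// mulyy.
Qed.
Definition marked_stat w : R := \int[Phi w]_x (h x * g (Z (w, x))).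

Lemma marked_statE w : marked_stat w = fine (A w - B w)%E.
Proof. by rewrite /marked_stat /Rintegral integral_posneg. Qed.
Lemma measurable_marked_stat : mfunT marked_stat.
rewrite (_ : marked_stat = fun w => fine (A w - B w)%E); last by apply/funext => w; exact: marked_statE.
apply: mcomp => //; exact: emeasurable_funB.
Qed.

(** With [A] and [B] the integrals of the positive and negative parts, the squared statistic plus
    [2 A B] is [A^2 + B^2]. The Palm formula applies to both sides; the excess of one integrand over
    the other is bounded by the correlation, and the expectation of [2 A B], finite by [near_bound],
    cancels. *)
Lemma marked_stat_le :
 (\int[P]_w (marked_stat w ^+ 2)%:E <=
  (M ^+ 2 * (2 * r) ^+ n)%:E * \int[alpha]_y (palm_corr y * (\1_(cube (2 * r)) y)%:E))%E.
pose K (u v : E -> E -> R) (t : (E * E) * (E * E)) : \bar R := (u t.1.1 t.2.1 * v t.1.2 t.2.2)%:E.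
pose Hp t := (K gp gp t + K gm gm t)%E.
pose Hm t := (K gp gm t + K gm gp t)%E.
have K0 u v : (forall x z, 0 <= u x z) -> (forall x z, 0 <= v x z) -> forall t, (0 <= K u v t)%E
 by move=> u0 v0 t; rewrite lee_fin mulr_ge0.
have m1 := mgp mproj1 mproj3; have m2 := mgp mproj2 mproj4.
have m3 := mgm mproj1 mproj3; have m4 := mgm mproj2 mproj4.
have mpp : mfunT (K gp gp) by apply/mEFin; exact: mfunM m1 m2.
have mmm : mfunT (K gm gm) by apply/mEFin; exact: mfunM m3 m4.
have mpm : mfunT (K gp gm) by apply/mEFin; exact: mfunM m1 m4.
have mmp : mfunT (K gm gp) by apply/mEFin; exact: mfunM m3 m2.
have Kpp0 := K0 _ _ gp0 gp0; have Kmm0 := K0 _ _ gm0 gm0.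
have Kpm0 := K0 _ _ gp0 gm0; have Kmp0 := K0 _ _ gm0 gp0.
have Hp0 t : (0 <= Hp t)%E by exact: adde_ge0.
have Hm0 t : (0 <= Hm t)%E by exact: adde_ge0.
have mHp : mfunT Hp by exact: emeasurable_funD.
have mHm : mfunT Hm by exact: emeasurable_funD.
have prodE (u v : E -> E -> R) w : (forall x z, 0 <= u x z) -> (forall x z, 0 <= v x z) ->
  mfunT (fun x => u x (Z (w, x))) -> mfunT (fun x => v x (Z (w, x))) ->
  (\int[Phi w]_x \int[Phi w]_y K u v ((x, y), (Z (w, x), Z (w, y))) =
   \int[Phi w]_x (u x (Z (w, x)))%:E * \int[Phi w]_x (v x (Z (w, x)))%:E)%E.
 move=> u0 v0 mu mv; rewrite (int_nu_prod Phi w (f := fun x => (u x (Z (w, x)))%:E) (g := fun x => (v x (Z (w, x)))%:E))//.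
 - by move=> t; rewrite lee_fin.
 - exact/mEFin.
 - by move=> t; rewrite lee_fin.
 - exact/mEFin.
have mpw w : mfunT (fun x => gp x (Z (w, x))) by exact: mgp.
have mmw w : mfunT (fun x => gm x (Z (w, x))) by exact: mgm.
have IHp w : (\int[Phi w]_x \int[Phi w]_y Hp ((x, y), (Z (w, x), Z (w, y))) = A w * A w + B w * B w)%E
 by rewrite (int_nu_pairD w Kpp0 Kmm0 mpp mmm) !prodE.
have IHm w : (\int[Phi w]_x \int[Phi w]_y Hm ((x, y), (Z (w, x), Z (w, y))) = A w * B w + B w * A w)%E
 by rewrite (int_nu_pairD w Kpm0 Kmp0 mpm mmp) !prodE.
have pHp := pair_palm Hp0 mHp; have pHm := pair_palm Hm0 mHm.
(* An identity of reals, available where [near] is finite and hence almost surely; elsewhere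
   infinite values could interfere. *)
have eqP' : (\int[P]_w (marked_stat w ^+ 2)%:E + \int[P]_w (A w * B w + B w * A w) =
      \int[P]_w (A w * A w + B w * B w))%E.
 have mS : mfunT (fun w => (marked_stat w ^+ 2)%:E)
  by apply/mEFin; apply: mfunX; exact: measurable_marked_stat.
 have mAB : mfunT (fun w => A w * B w + B w * A w)%E by apply: emeasurable_funD; exact: emfunM.
 rewrite -ge0_integralD//; last 2 first.
 - by move=> w _; rewrite lee_fin sqr_ge0.
 - by move=> w _; rewrite adde_ge0// mule_ge0.
 apply: ge0_ae_eq_integral => //.
 - exact: emeasurable_funD.
 - by apply: emeasurable_funD; exact: emfunM.
 - by move=> w _; rewrite !adde_ge0 ?mule_ge0// lee_fin sqr_ge0.
 - by move=> w _; rewrite adde_ge0// mule_ge0.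
 apply: filterS ae_near_sum_lty => w nw _.
 have fin (a : \bar R) : (0 <= a)%E -> (a <= (M * M')%:E * near w)%E -> (a = (fine a)%:E)%E.
  move=> a0 ale; rewrite fineK// ge0_fin_numE//; apply: le_lt_trans ale _.
  by rewrite lte_mul_pinfty// lee_fin mulr_ge0.
 rewrite marked_statE (fin _ (A0 w) (A_le w)) (fin _ (B0 w) (B_le w)) /=.
 rewrite -!EFinM -!EFinD; congr (_%:E); ring.
have finM : (\int[P]_w (A w * B w + B w * A w))%E \is a fin_num.
 rewrite ge0_fin_numE; last by apply: int_ge0 => w _; rewrite adde_ge0// mule_ge0.
 have [C C0' hC] := near_bound.
 pose a := M * M'; have a0 : 0 <= a by exact: mulr_ge0.
 apply: (@le_lt_trans _ _ (\int[P]_w ((2 * a ^+ 2)%:E * (near w * near w)))%E).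
  apply: le_intT => w; first by rewrite adde_ge0// mule_ge0.
  rewrite [(B w * A w)%E]muleC addee_mul2 ?mule_ge0// EFinM -muleA lee_wpmul2l//.
  have -> : ((a ^+ 2)%:E * (near w * near w) = (a%:E * near w) * (a%:E * near w))%E
   by rewrite expr2 EFinM muleACA.
  by apply: lee_pmul; rewrite ?A_le ?B_le.
 have mn := measurable_near_sum.
 rewrite int_Zl ?mulr_ge0 ?sqr_ge0//; last 2 first.
 - by move=> w _; rewrite mule_ge0.
 - exact: emfunM.
 rewrite lte_mul_pinfty// ?lee_fin ?mulr_ge0 ?sqr_ge0//.
 by apply: le_lt_trans (hC _ r1) (ltry _).
rewrite -(leeD2rE _ _ finM) eqP'.
rewrite (eq_integral (fun w => \int[Phi w]_x \int[Phi w]_y Hp ((x, y), (Z (w, x), Z (w, y)))))%E; last by move=> w _; rewrite IHp.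
rewrite pHp [X in (_ <= _ + X)%E](_ : _ =
 \int[lambda]_x \int[alpha]_y \int[P2 y]_w Hm ((x, (x + y)%R), (Z (w, 0%R), Z (w, y))))%E; last first.
 by rewrite -pHm; apply: eq_integral => w _; rewrite IHm.
pose Im x y := (\int[P2 y]_w Hm ((x, (x + y)%R), (Z (w, 0%R), Z (w, y))))%E.
have Im0 x y : (0 <= Im x y)%E by exact: int_ge0.
have mIm : mfunT (fun q : E * E => Im q.1 q.2) by exact: measurable_palm2_mark.
have mIm1 x : mfunT (Im x) by exact: (mcomp mIm (measurable_pair1 x)).
have mpc := measurable_palm_corr.
have pc0 y : (0 <= palm_corr y)%E by exact: abse_ge0.
pose J := (\int[alpha]_y (palm_corr y * (\1_(cube (2 * r)) y)%:E))%E.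
have J0 : (0 <= J)%E by apply: int_ge0 => y _; rewrite mule_ge0// lee_fin.
have inner x : (\int[alpha]_y \int[P2 y]_w Hp ((x, (x + y)%R), (Z (w, 0%R), Z (w, y))) <=
  (M ^+ 2 * \1_(cube r) x)%:E * J + \int[alpha]_y Im x y)%E.
 have c0' : (0 <= M ^+ 2 * \1_(cube r) x)%R by rewrite mulr_ge0// sqr_ge0.
 rewrite /J -int_Zl//; last 2 first.
 - by move=> y _; rewrite mule_ge0// lee_fin.
 - by apply: emfunM => //; apply/mEFin; exact: mindic (mcub _).
 rewrite -ge0_integralD//; last 2 first.
 - by move=> y _; rewrite !mule_ge0// lee_fin.
 - apply: emfunM => //; apply: emfunM => //; apply/mEFin; exact: mindic (mcub _).
 apply: le_intT => y; first exact: int_ge0.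
 have mu : mfunT (fun w => g (Z (w, 0)) * g (Z (w, y))) by exact: (mcomp measurable_palm_product (measurable_pair1 y)).
 have := integral_pos_le (P2 y) (h x * h (x + y)) mu.
 have -> : (\int[P2 y]_w (Num.max (h x * h (x + y) * (g (Z (w, 0)) * g (Z (w, y)))) 0)%:E =
   \int[P2 y]_w Hp ((x, (x + y)%R), (Z (w, 0%R), Z (w, y))))%E.
  apply: eq_integral => w _; rewrite /Hp /K /gp /gm/= -EFinD maxrN_mul.
  by congr (Num.max _ _)%:E; ring.
 have -> : (\int[P2 y]_w (Num.max (- (h x * h (x + y) * (g (Z (w, 0)) * g (Z (w, y))))) 0)%:E = Im x y)%E.
  apply: eq_integral => w _; rewrite /Hm /K /gp /gm/= -EFinD maxrN_mulN.
  by congr (Num.max (- _) _)%:E; ring.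
 move=> /le_trans; apply; apply: leeD2r.
 rewrite -/(palm_corr y) [X in (_ <= _ * X)%E]muleC muleA -EFinM lee_wpmul2r// lee_fin.
 rewrite !cube_indicE; case: ltP => xr; last by rewrite hr// mul0r normr0 mulr0 mul0r.
 case: ltP => yr; first by rewrite !mulr1 normrM expr2 ler_pM.
 rewrite (hr (x := x + y)) ?mulr0 ?normr0//.
 have : `|y| <= `|x + y| + `|x| by have := ler_normB (x + y) x; rewrite [x + y]addrC addrK.
 lra.
via (\int[lambda]_x ((M ^+ 2 * \1_(cube r) x)%:E * J + \int[alpha]_y Im x y))%E.
 by apply: le_intT => x //; apply: int_ge0 => y _; exact: int_ge0.
have mI : mfunT (fun x => \int[alpha]_y Im x y)%E.
 exact: (@measurable_fun_fubini_tonelli_F _ _ E E R (sf_of reduced_moment_locally_finite) (fun q => Im q.1 q.2) mIm (fun q => Im0 _ _)).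
have mMc : mfunT (fun x : E => (M ^+ 2 * \1_(cube r) x)%:E)
 by apply/mEFin; apply: mfunM => //; exact: mindic (mcub _).
rewrite ge0_integralD//; last 3 first.
- by move=> x _; rewrite mule_ge0// lee_fin mulr_ge0// sqr_ge0.
- exact: emfunM.
- by move=> x _; exact: int_ge0.
apply: leeD2r; rewrite ge0_integralZr//; last by move=> x _; rewrite lee_fin mulr_ge0// sqr_ge0.
apply: lee_wpmul2r => //; under eq_integral do rewrite EFinM.
rewrite int_Zl ?sqr_ge0//; last by apply/mEFin; exact: mindic (mcub _).
rewrite int_indic//; last exact: mcub.
rewrite setIT [X in (_ <= X)%E]EFinM lee_wpmul2l ?lee_fin ?sqr_ge0//.
have r0 : 0 < r by exact: lt_le_trans r1.
have := lebesgue_rV_cube_le (0 : E) r0.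
by under [X in lambda X]eq_set do rewrite addr0.
Qed.
End signed.

(** * Moments of the mark at the second point *)

Lemma lebesgue_unit_cube : lambda unit_cube = 1%E.
have := @lebesgue_rV_box R n (fun=> 0) (fun=> 1) (fun=> ler01).
by under eq_bigr do rewrite subr0; rewrite big1.
Qed.
(** The mark is taken at [y], whereas the assumed bound concerns the mark at 0. *)
Definition far_moment y : \bar R := (\int[P2 y]_w (`|Z (w, y)| `^ gamma)%:E)%E.

Lemma measurable_far_moment : mfunT far_moment.
apply: (@measurable_fun_integral_sfinite_kernel _ _ E Om R (fun t => (`|Z (t.2, t.1)| `^ gamma)%:E) P2).
 by move=> t; rewrite lee_fin powR_ge0.
by apply/mEFin; apply: (mcomp (measurable_powR gamma)); exact: mnorm mZs.
Qed.

(** Exchanging the two points moves the mark from [y] to 0. The same exchange is carried out for the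
    constant mark [k2], which evaluates to [alpha B]; the two results are then compared pointwise,
    without discussing the reflection of [alpha]. *)
Lemma far_moment_set B : measurable B ->
 (\int[alpha]_y (far_moment y * (\1_B y)%:E) <= c%:E * alpha B)%E.
move=> mB.
have mU : mfunT (\1_(@unit_cube R n) : E -> R) by exact: mindic measurable_unit_cube.
have mI : mfunT (\1_B : E -> R) by exact: mindic.
pose H (k : E -> R) (t : (E * E) * (E * E)) : \bar R :=
 (\1_unit_cube t.1.1 * \1_B (t.1.2 - t.1.1) * k t.2.2)%:E.
have H0 k : (forall z, 0 <= k z) -> forall t, (0 <= H k t)%E by move=> k0 t; rewrite lee_fin !mulr_ge0.
have mH k : mfunT k -> mfunT (H k).
 move=> mk; apply/mEFin; apply: mfunM; last exact: mcomp.
 apply: mfunM; first exact: mcomp.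
 by apply: (mcomp mI); exact: measurable_funB_rV.
have val (k : E -> R) : (forall z, 0 <= k z) -> mfunT k ->
  (\int[lambda]_x \int[alpha]_y \int[P2 y]_w H k ((x, (x + y)%R), (Z (w, 0%R), Z (w, y))) =
   \int[alpha]_y (\int[P2 y]_w (k (Z (w, y)))%:E * (\1_B y)%:E))%E.
 move=> k0 mk.
 have mky y : mfunT (fun w => (k (Z (w, y)))%:E) by apply/mEFin; exact: mcomp.
 transitivity (\int[lambda]_x ((\1_unit_cube x)%:E * \int[alpha]_y (\int[P2 y]_w (k (Z (w, y)))%:E * (\1_B y)%:E)))%E.
  apply: eq_integral => x _; rewrite -int_Zl//; last 2 first.
  - by move=> y _; rewrite mule_ge0 ?lee_fin//; apply: int_ge0 => w _; rewrite lee_fin.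
  - apply: emfunM; last exact/mEFin.
   apply: (@measurable_fun_integral_sfinite_kernel _ _ E Om R (fun t => (k (Z (t.2, t.1)))%:E) P2).
    by move=> t; rewrite lee_fin.
   by apply/mEFin; exact: (mcomp mk mZs).
  apply: eq_integral => y _; rewrite [X in (_ * X)%E]muleC muleA -EFinM.
  rewrite -int_Zl ?mulr_ge0//; last by move=> w _; rewrite lee_fin.
  by apply: eq_integral => w _; rewrite -EFinM /H/= [x + y]addrC addrK.
 rewrite ge0_integralZr//; last 2 first.
 - exact/mEFin.
 - by apply: int_ge0 => y _; rewrite mule_ge0 ?lee_fin//; apply: int_ge0 => w _; rewrite lee_fin.
 by rewrite int_indic ?measurable_unit_cube// ?setIT ?lebesgue_unit_cube ?mul1e//; exact: measurable_unit_cube.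
pose k1 (z : E) : R := `|z| `^ gamma; pose k2 (z : E) : R := 1.
have k10 z : 0 <= k1 z by exact: powR_ge0.
have k20 z : 0 <= k2 z by [].
have mk1 : mfunT k1 by have := mcomp (measurable_powR gamma) (@measurable_norm_rV R n).
have mk2 : mfunT k2 by exact: mcst.
have e1 := val k1 k10 mk1; have e2 := val k2 k20 mk2.
have p1 := pair_palm (H0 _ k10) (mH _ mk1); have p2 := pair_palm (H0 _ k20) (mH _ mk2).
have mH1 := mcomp (mH _ mk1) measurable_swap; have mH2 := mcomp (mH _ mk2) measurable_swap.
have s1 := pair_swap (H0 _ k10) (mH _ mk1); have s2 := pair_swap (H0 _ k20) (mH _ mk2).
have q1 := pair_palm (fun t => H0 _ k10 (swap t)) mH1.
have q2 := pair_palm (fun t => H0 _ k20 (swap t)) mH2.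
have f1 : (\int[alpha]_y (far_moment y * (\1_B y)%:E) = \int[lambda]_x \int[alpha]_y \int[P2 y]_w
  H k1 (swap (x, (x + y)%R, (Z (w, 0%R), Z (w, y)))))%E.
 exact: (etrans (esym e1) (etrans (esym p1) (etrans s1 q1))).
have f2 : (\int[alpha]_y (\int[P2 y]_w (k2 (Z (w, y)))%:E * (\1_B y)%:E) = \int[lambda]_x \int[alpha]_y \int[P2 y]_w
  H k2 (swap (x, (x + y)%R, (Z (w, 0%R), Z (w, y)))))%E.
 exact: (etrans (esym e2) (etrans (esym p2) (etrans s2 q2))).
have f3 : alpha B = (\int[alpha]_y (\int[P2 y]_w (k2 (Z (w, y)))%:E * (\1_B y)%:E))%E.
 apply: (etrans (measure_int_indic _ mB)); apply: eq_integral => y _.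
 rewrite -[LHS]mul1e; congr (_ * _)%E.
 by have := integral_cst (P2 y) mtop (1%E : \bar R); rewrite prob_kernel mule1.
rewrite f1 f3 f2 {f1 f2 f3 e1 e2 p1 p2 s1 s2 q1 q2}.
have m2s : mfunT (fun q : E * E => \int[P2 q.2]_w
  H k2 (swap (q.1, (q.1 + q.2)%R, (Z (w, 0%R), Z (w, q.2)))))%E.
 exact: (measurable_palm2_mark (fun t => H0 _ k20 (swap t)) mH2).
have pos2 x y : (0 <= \int[P2 y]_w H k2 (swap (x, (x + y)%R, (Z (w, 0%R), Z (w, y)))))%E
 by apply: int_ge0 => w _; exact: H0.
rewrite -int_Zl//; last 2 first.
- by move=> x _; exact: int_ge0.
- exact: (@measurable_fun_fubini_tonelli_F _ _ E E R (sf_of reduced_moment_locally_finite) _ m2s (fun q => pos2 _ _)).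
apply: le_intT => x.
 by apply: int_ge0 => y _; apply: int_ge0 => w _; exact: H0.
rewrite -int_Zl//; last first.
 exact: (mcomp m2s (measurable_pair1 x)).
apply: le_intT => y; first by apply: int_ge0 => w _; exact: H0.
pose a : R := \1_unit_cube (x + y) * \1_B (x - (x + y)).
have a0 : 0 <= a by rewrite mulr_ge0.
rewrite (_ : (\int[P2 y]_w _ = a%:E * \int[P2 y]_w (k1 (Z (w, 0%R)))%:E)%E); last first.
 rewrite -int_Zl//; last 2 first.
 - by move=> w _; rewrite lee_fin.
 - by apply/mEFin; exact: mcomp.
rewrite [X in (_ <= _ * X)%E](_ : _ = a%:E); last first.
 rewrite /H/= /k2; under eq_integral do rewrite mulr1.
 by have := integral_cst (P2 y) mtop (a%:E : \bar R); rewrite prob_kernel mule1.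
by rewrite muleC lee_wpmul2r ?lee_fin//; exact: moment2.
Qed.

(** Where the moment exceeds [c] by a fixed amount, the integrated bound forces [alpha]-mass 0. The
    intersection with a cube makes this mass finite beforehand, and countably many such sets exhaust
    the exceptional one. *)
Lemma ae_far_moment : {ae alpha, forall y, (far_moment y <= c%:E)%E}.
have mf := measurable_far_moment.
have lfa := reduced_moment_locally_finite.
pose N (q : nat) : set E := [set y | ((c + q.+1%:R^-1)%:E <= far_moment y)%E] `&` cube q%:R.
have mN q : measurable (N q).
 apply: measurableI; last exact: mcub.
 by rewrite -[X in measurable X]setTI; apply: emeasurable_fun_c_infty.
have N0 q : alpha (N q) = 0%E.
 have fin : (alpha (N q) < +oo)%E.
  have mc := @mcub R n q%:R.
  apply: (@le_lt_trans _ _ (alpha (cube q%:R))); last by apply: lfa => //; exact: bounded_cube.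
  by apply: le_measure; rewrite ?inE// => x [].
 have := far_moment_set (mN q).
 have h : ((c + q.+1%:R^-1)%:E * alpha (N q) <= \int[alpha]_y (far_moment y * (\1_(N q) y)%:E))%E.
  rewrite -[X in alpha X]setIT -int_indic// -int_Zl//; last 2 first.
  - by apply/mEFin; exact: mindic.
  - by rewrite addr_ge0// invr_ge0.
  apply: le_intT => y; first by rewrite mule_ge0// lee_fin// addr_ge0// invr_ge0.
  rewrite indicE; case: (boolP (y \in N q)) => yN; last by rewrite !mule0.
  by rewrite !mule1; have [] := set_mem yN.
 have bc : c < c + q.+1%:R^-1 by rewrite ltrDl invr_gt0.
 by move=> /(le_trans h); apply: (ereal_null _ fin bc); exact: measure_ge0.
apply: (@negligibleS _ _ _ alpha (\bigcup_q N q)).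
 move=> y /= /negP; rewrite -ltNge => hy.
 have [q1 hq1] : exists q : nat, ((c + q.+1%:R^-1)%:E <= far_moment y)%E.
  move: hy; case: (far_moment y) => [x||]//; last by exists 0%N; rewrite leey.
  rewrite lte_fin => cx; have e0 : 0 < x - c by rewrite subr_gt0.
  exists (Num.truncn (x - c)^-1); rewrite lee_fin -lerBrDl.
  rewrite -[leRHS]invrK lef_pV2 ?posrE ?invr_gt0//; exact: ltW (truncnS_gt _).
 have yq := truncnS_gt `|y|.
 exists (maxn q1 (Num.truncn `|y|).+1) => //; split => /=.
  apply: le_trans hq1; rewrite lee_fin lerD2l lef_pV2 ?posrE// ler_nat ltnS; exact: leq_maxl.
 by rewrite /cube/=; apply: (lt_le_trans yq); rewrite ler_nat; exact: leq_maxr.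
by apply: negligible_bigcup => q; apply/(negligibleP _ (mN q)); exact: N0.
Qed.

Lemma intensity_lty : (\int[P]_w Phi w unit_cube < +oo)%E.
have su := sqint_cube htheta hPhi hPhi2 2.
have sub : (@unit_cube R n) `<=` cube 2.
 move=> x ux; rewrite /cube/=; apply: (@le_lt_trans _ _ 1); last by rewrite ltr1n.
 by apply: norm_le_coord => // i; have /andP[h1 h2] := ux i; rewrite ger0_norm// ltW.
have mu := @measurable_unit_cube R n.
apply: (@le_lt_trans _ _ (\int[P]_w `|(lstat Phi \1_(cube 2) w)%:E|)%E).
  apply: le_intT => w //; rewrite /= ger0_norm -?random_measure_cube.
   by apply: le_measure; rewrite ?inE//; exact: mcub.
  by apply: int_tf_ge0 => x; rewrite indicE.
by have /integrableP[] := sqint1 su.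
Qed.

(** With intensity 0 the Palm measure has mass 0 instead of 1 and the comparison through [kappa]
    breaks down; but then the unit cube is almost surely not charged and [alpha] vanishes. *)
Lemma intensity0_null B : intensity P Phi = 0 -> measurable B -> alpha B = 0%E.
move=> i0; have mu := @measurable_unit_cube R n.
have fin := intensity_lty.
have I0 : (\int[P]_w Phi w unit_cube = 0)%E.
 have p0 : (0 <= \int[P]_w Phi w unit_cube)%E by exact: int_ge0.
 by rewrite -[LHS]fineK ?ge0_fin_numE// -[fine _]/(intensity P Phi) i0.
have mk : mfunT (fun w => Phi w unit_cube) by exact: measurable_kernel.
have ae0 : ae_eq P setT (fun w => Phi w unit_cube) (cst 0%E)
 by apply/(ae_eq_integral_abs P mtop mk); under eq_integral do rewrite gee0_abs//.
move=> mB; have mi := mdiff mB.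
rewrite -(integral0 P setT); apply: ge0_ae_eq_integral => //.
- by apply: (measurable_integral_locally_finite lfPhi mu _ mi) => q; exact: int_ge0.
- by move=> w _; apply: int_ge0 => x _; exact: int_ge0.
- apply: filterS ae0 => w /(_ I)/= h _; apply: null_set_integral => //.
 by apply: measurable_funTS; exact: (mcomp mi (measurable_pair1 w)).
Qed.

Lemma palm_setT : intensity P Phi != 0 -> palm1 setT = 1%E.
move=> i0; rewrite /palm.
rewrite (eq_integral (fun w => Phi w unit_cube)); last first.
 move=> w _; under eq_integral do rewrite indicT.
 have := integral_cst (Phi w) (@measurable_unit_cube R n) (1%E : \bar R).
 by rewrite mul1e.
have p0 : (0 <= \int[P]_w Phi w unit_cube)%E by exact: int_ge0.
rewrite -[X in (_ * X)%E]fineK ?ge0_fin_numE ?intensity_lty//.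
by rewrite -[fine _]/(intensity P Phi) -EFinM mulVf.
Qed.
Variable c1 : R.
Hypothesis moment1 : (\int[palm1]_w (`|Z (w, 0)%R| `^ gamma)%:E <= c1%:E)%E.

(** * Correlations of marks bounded by [kappa] *)

Section kappa.
Hypothesis i0 : intensity P Phi != 0.
Let disc y A1 A2 : R := `|fine (P2 y [set w | A1 (Z (w, y)) /\ A2 (Z (w, 0))])
 - fine (palm1 [set w | A1 (Z (w, 0))]) * fine (palm1 [set w | A2 (Z (w, 0))])|.
Let fine01 dT (T : measurableType dT) (m : meas T R) A : m setT = 1%E -> measurable A ->
 0 <= fine (m A) <= 1.
move=> m1 mA; have le1 : (m A <= 1)%E by rewrite -m1; apply: le_measure; rewrite ?inE.
have fin : m A \is a fin_num by rewrite ge0_fin_numE//; exact: le_lt_trans le1 (ltry _).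
by rewrite fine_ge0//= -lee_fin fineK.
Qed.
Let disc_le1 y A1 A2 : measurable A1 -> measurable A2 -> disc y A1 A2 <= 1.
move=> m1 m2.
have mz A x : measurable A -> measurable [set w | A (Z (w, x))]
 by move=> mA; rewrite -[X in measurable X]setTI; exact: measurable_Z.
have p2 : P2 y setT = 1%E by exact: prob_kernel.
apply: norm_sub_mul_le1; first exact: fine01 p2 (measurableI _ _ (mz _ y m1) (mz _ 0 m2)).
 exact: fine01 (palm_setT i0) (mz _ 0 m1).
exact: fine01 (palm_setT i0) (mz _ 0 m2).
Qed.
(** The real supremum in [kappa] dominates the discrepancies only if they are bounded; the bound 1
    uses that both Palm measures have mass 1. *)
Let has_sup_disc y : has_sup [set r | exists A1 A2 : set E, [/\ measurable A1, measurable A2 & r = disc y A1 A2]].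
split; first by exists (disc y set0 set0); exists set0, set0; split.
by exists 1 => _ [A1 [A2 [m1 m2 ->]]]; exact: disc_le1.
Qed.

Lemma kappa_ge y A1 A2 : measurable A1 -> measurable A2 -> disc y A1 A2 <= kap y.
Proof. by move=> m1 m2; apply: (ub_le_sup (has_sup_disc y).2); exists A1, A2; split. Qed.
Lemma kappa_le1 y : kap y <= 1.
Proof. by apply: (ge_sup (has_sup_disc y).1) => _ [A1 [A2 [m1 m2 ->]]]; exact: disc_le1. Qed.
Lemma kappa_ge0 y : 0 <= kap y.
Proof. by apply: le_trans (kappa_ge y measurable0 measurable0); exact: normr_ge0. Qed.
Variables (g : E -> R) (q C : R).
Hypothesis mg : mfunT g.
Hypothesis q0 : 0 < q.
Hypothesis qg : 2 * q < gamma.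
Hypothesis C0 : 0 <= C.
Hypothesis gC : forall z, `|g z| `^ (gamma / q) <= C * (1 + `|z| `^ gamma).
Hypothesis g0 : \int[palm1]_w g (Z (w, 0)) = 0.

(** A function of degree [q] in the mark has moments of order [G = gamma / q > 2], and [1 - 2 / G]
    is the exponent of [kappa] in the hypothesis. *)
Lemma palm_corr_le : exists2 K : R, 0 <= K & forall y, (far_moment y <= c%:E)%E ->
 (palm_corr g y <= (K * kap y `^ ((gamma - 2 * q) / gamma))%:E)%E.
have mom dT (T : measurableType dT) (m : meas T R) (U : T -> E) a : m setT = 1%E -> mfunT U ->
  (\int[m]_w (`|U w| `^ gamma)%:E <= a%:E)%E ->
  (\int[m]_w (`|g (U w)| `^ (gamma / q))%:E <= (C * (1 + a))%:E)%E.
 move=> m1 mU ha.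
 have mp : mfunT (fun w => (`|U w| `^ gamma)%:E)
  by apply/mEFin; apply: (mcomp (measurable_powR gamma)); exact: mnorm.
 via (\int[m]_w (C%:E * (1%:E + (`|U w| `^ gamma)%:E)))%E.
  by apply: le_intT => w; rewrite ?lee_fin ?powR_ge0// -EFinD -EFinM lee_fin.
 rewrite int_Zl//; last 2 first.
 - by move=> w _; rewrite -EFinD lee_fin addr_ge0// powR_ge0.
 - exact: emeasurable_funD.
 rewrite EFinM lee_wpmul2l// ge0_integralD//.
 by rewrite integral_cst// m1 mule1 EFinD leeD2l.
pose a2 := C * (1 + c); pose a1 := C * (1 + c1).
exists (8 + (a1 ^+ 2 + 4 * a2)).
 by rewrite addr_ge0// addr_ge0 ?sqr_ge0// mulr_ge0// mulr_ge0// addr_ge0.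
move=> y fy; have p2 : P2 y setT = 1%E by exact: prob_kernel.
have mZ x := measurable_Z x.
have G2 : 2 < gamma / q by rewrite ltr_pdivlMr.
have hU := mom _ _ _ _ _ p2 (mZ y) fy; have hV := mom _ _ _ _ _ p2 (mZ 0) (moment2 y).
have hW := mom _ _ _ _ _ (palm_setT i0) (mZ 0) moment1.
have ig := correlation_integrable p2 (mZ y) (mZ 0) mg G2 hU hV.
have := correlation_le p2 (palm_setT i0) (mZ y) (mZ 0) (mZ 0) (kappa_ge0 y) (@kappa_ge y) mg G2 hU hV hW g0 (kappa_le1 y).
have -> : 1 - 2 / (gamma / q) = (gamma - 2 * q) / gamma by field; rewrite !gt_eqF.
move=> h; rewrite /palm_corr.
have e : (\int[P2 y]_w (g (Z (w, 0)) * g (Z (w, y)))%:E = (\int[P2 y]_w (g (Z (w, y)) * g (Z (w, 0))))%R%:E)%E.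
 rewrite /Rintegral fineK; first by apply: eq_integral => w _; rewrite mulrC.
 exact: integrable_fin_num.
by rewrite e /= lee_fin.
Qed.
End kappa.

(** * Random measures built from the marks *)

Section marked_measure.
Variables (H : E -> R) (tau : R) (m : Om -> (meas E R)).
Hypotheses (mH : mfunT H) (H0 : forall z, 0 <= H z).
(* The mark [z] gives its point the weight [H z] and moves it by [tau *: z]. *)
Hypothesis mE : forall w A, measurable A ->
 (m w A = \int[Phi w]_x (H (Z (w, x)) * \1_A (x + tau *: Z (w, x)))%:E)%E.
Let mF A : measurable A -> mfunT (fun t : Om * E => (H (Z (t.1, t.2)) * \1_A (t.2 + tau *: Z (t.1, t.2)))%:E).
move=> mA; have mz : mfunT (fun t : Om * E => Z (t.1, t.2)).
 by under eq_fun do rewrite -surjective_pairing; exact: mfunP.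
apply/mEFin; apply: mfunM; first exact: mcomp.
apply: mcomp => //; apply: mfunD_rV; first exact: msnd.
exact: (mcomp (measurable_scale tau) mz).
Qed.

Lemma measurable_marked_measure A : measurable A -> mfunT (fun w => m w A).
move=> mA; under eq_fun do rewrite mE//.
by apply: (measurable_int_nu Phi) (mF mA) => t; rewrite lee_fin mulr_ge0.
Qed.

Lemma marked_measure_invariant w x A : measurable A -> m (theta x w) A = m w [set b + x | b in A].
move=> mA.
have eA : [set b + x | b in A] = (fun y : E => y - x) @^-1` A.
 apply/seteqP; split => [_ [b bA <-]|y yA]; first by rewrite /= addrK.
 by exists (y - x) => //; rewrite subrK.
have mA' : measurable [set b + x | b in A] by rewrite eA -[X in measurable X]setTI; exact: measurable_funB_rV.
rewrite !mE// (ge0_integral_nu_flow hPhi); last 2 first.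
- exact: (mcomp (mF mA) (measurable_pair1 (theta x w))).
- by move=> y; rewrite lee_fin mulr_ge0.
apply: eq_integral => y _; rewrite hZ subrK eA; congr (_ * _)%:E.
by rewrite addrAC !indicE; congr (_%:R).
Qed.
End marked_measure.

Notation near := near_sum.
Notation far := far_sum.
Lemma near_sum_ge0 r w : (0 <= near r w)%E.
Proof. by apply: int_ge0 => x _; rewrite lee_fin mulr_ge0// addr_ge0// powR_ge0. Qed.
Lemma far_sum_ge0 r w : (0 <= far r w)%E.
Proof. by apply: int_ge0 => x _; rewrite lee_fin. Qed.
Lemma measurable_far_sum r : mfunT (far r).
apply: (measurable_int_nu Phi (F := fun t => ((2 * r <= `|t.2|) && (`|t.2 + Z (t.1, t.2)| < r))%R%:R%:E)).
 by move=> t; rewrite lee_fin.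
apply/mEFin; apply: mbool_natr; apply: measurable_and.
 by apply: measurable_fun_ler => //; apply: mnorm; exact: msnd.
apply: measurable_fun_ltr => //; apply: mnorm; apply: mfunD_rV => //; exact: msnd.
Qed.

Lemma near_far_square (C a b : R) : 0 < C ->
 (\int[P]_w ((C%:E * near a w + far b w) * (C%:E * near a w + far b w)) <=
  (2 * C ^+ 2)%:E * \int[P]_w (near a w * near a w) + 2%:E * \int[P]_w (far b w * far b w))%E.
move=> C0; have mn := measurable_near_sum a; have mf := measurable_far_sum b.
have C1 : 0 <= 2 * C ^+ 2 by rewrite mulr_ge0// sqr_ge0.
have n0 w : (0 <= near a w * near a w)%E by rewrite mule_ge0// near_sum_ge0.
have f0 w : (0 <= far b w * far b w)%E by rewrite mule_ge0// far_sum_ge0.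
rewrite -int_Zl//; last exact: emfunM.
rewrite -int_Zl//; last exact: emfunM.
rewrite -ge0_integralD//; last 4 first.
- by move=> w _; rewrite mule_ge0.
- by apply: emfunM => //; exact: emfunM.
- by move=> w _; rewrite mule_ge0.
- by apply: emfunM => //; exact: emfunM.
apply: le_intT => w.
 by rewrite mule_ge0// adde_ge0 ?far_sum_ge0// mule_ge0 ?near_sum_ge0// lee_fin ltW.
by apply: sqe_addC_le; rewrite ?near_sum_ge0 ?far_sum_ge0.
Qed.

Lemma near_far_lty (m : Om -> (meas E R)) C : 0 < C ->
 (forall k w, 1 <= k -> (m w (cube k) <= C%:E * near (2 * k) w + far k w)%E) ->
 forall k : nat, (\int[P]_w (m w (cube k%:R) ^+ 2) < +oo)%E.
(* The shift by 1 meets the condition [1 <= r] of the bounds for [near] and [far]. *)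
move=> C0 hm k; pose r : R := k%:R + 1; have r1 : 1 <= r by rewrite lerDr.
have [D D0 hD] := near_bound.
have [D' D'0 hD'] := far_bound.
apply: (@le_lt_trans _ _ (\int[P]_w ((C%:E * near (2 * r) w + far r w) * (C%:E * near (2 * r) w + far r w)))%E).
 apply: le_intT => w; rewrite expe2 ?mule_ge0//.
 have h : (m w (cube k%:R) <= C%:E * near (2 * r) w + far r w)%E.
  apply: le_trans (hm _ w r1); apply: le_measure; rewrite ?inE; try exact: mcub.
  by apply: le_cube; rewrite lerDl.
 exact: lee_pmul.
apply: le_lt_trans (near_far_square _ _ C0) _.
have r2 : 1 <= 2 * r by lra.
have C1 : 0 <= 2 * C ^+ 2 by rewrite mulr_ge0// sqr_ge0.
apply: (le_lt_trans (leeD (lee_wpmul2l _ (hD _ r2)) (lee_wpmul2l _ (hD' _ r1)))); rewrite ?lee_fin//.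
by rewrite -!EFinM -EFinD ltry.
Qed.

Section density.
Variable H : E -> R.
Hypotheses (mH : mfunT H) (H0 : forall z, 0 <= H z).
Variable M : R.
Hypothesis M0 : 0 < M.
Hypothesis HM : forall z, H z <= M * (1 + `|z| `^ (gamma / 2)).
Let mHZ w : mfunT (fun x => H (Z (w, x))).
Proof. by apply: (mcomp mH); exact: (mZw w). Qed.
(** The points stay in place and receive the weight [H] of their mark. The positive and negative
    parts of a monomial thus define stationary random measures, whose linear statistics recover the
    marked ones. *)
Definition weighted w : meas E R := density_measure (Phi w) (mHZ w) (fun x => H0 _).
Let weightedE w A : measurable A ->
 (weighted w A = \int[Phi w]_x (H (Z (w, x)) * \1_A (x + 0 *: Z (w, x)))%:E)%E.
Proof. by move=> mA; apply: eq_integral => x _; rewrite scale0r addr0. Qed.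
Lemma measurable_weighted A : measurable A -> mfunT (fun w => weighted w A).
Proof. exact: (measurable_marked_measure mH H0 weightedE). Qed.
Lemma weighted_invariant w x A : measurable A -> weighted (theta x w) A = weighted w [set b + x | b in A].
Proof. exact: (marked_measure_invariant mH H0 weightedE). Qed.
Lemma weighted_square : forall k : nat, (\int[P]_w (weighted w (cube k%:R) ^+ 2) < +oo)%E.
apply: (near_far_lty M0) => k w k1.
via (M%:E * near (2 * k) w)%E; last by rewrite leeDl// far_sum_ge0.
rewrite /near_sum -int_Zl ?(ltW M0)//.
rewrite /weighted/=; apply: le_intT => x; rewrite -?EFinM !lee_fin ?mulr_ge0// mulrA.
apply: ler_pM => //; rewrite !cube_indicE ler_nat.
by case: (ltP `|x| k) => // xk; rewrite (@lt_le_trans _ _ k)//; lra.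
Qed.
End density.
Let transportE w A : measurable A ->
 (transport Z Phi w A = \int[Phi w]_x (1 * \1_A (x + 1 *: Z (w, x)))%:E)%E.
move=> mA; rewrite -[LHS]/(Phi w (displace Z w @^-1` A)).
have mD : measurable (displace Z w @^-1` A) by rewrite -[X in measurable X]setTI; exact: mfunP.
rewrite -[X in Phi w X]setIT -int_indic//; apply: eq_integral => x _.
by rewrite mul1r scale1r !indicE; congr (_%:R%:E); apply/idP/idP => h; apply: mem_set; exact: set_mem h.
Qed.

Lemma measurable_transport A : measurable A -> mfunT (fun w => transport Z Phi w A).
Proof. by apply: (measurable_marked_measure (H := cst 1) _ _ transportE). Qed.
Lemma transport_invariant w x A : measurable A ->
 transport Z Phi (theta x w) A = transport Z Phi w [set b + x | b in A].
Proof. by apply: (marked_measure_invariant (H := cst 1) _ _ transportE). Qed.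
Lemma transport_square : forall k : nat, (\int[P]_w (transport Z Phi w (cube k%:R) ^+ 2) < +oo)%E.
apply: (near_far_lty (m := transport Z Phi) (@ltr01 R)) => k w k1; rewrite mul1e transportE; last exact: mcub.
rewrite /near_sum /far_sum -ge0_integralD//; last first.
 apply/mEFin; apply: mbool_natr; apply: measurable_and.
  by apply: measurable_fun_ler => //; exact: measurable_norm_rV.
 by apply: measurable_fun_ltr => //; apply: mnorm; exact: mfunD_rV.
apply: le_intT => x; rewrite -?EFinD !lee_fin ?mulr_ge0// mul1r scale1r !cube_indicE.
case: (ltP `|x| (2 * k)) => xk; rewrite /= ?mulr0 ?add0r ?addr0 ?mulr1//.
have := powR_ge0 `|Z (w, x)| (gamma / 2).
by case: (_ < k)%R => /=; lra.
Qed.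

(** * Rates for the centred terms of the expansion *)

Variables (m K : nat).
Hypothesis nK : (2 * n < (2 * K).-1)%N.
Implicit Types j : @mindex n m.
(** In degree 0 the value is set to 1 instead of integrated, so that the centred monomial is
    identically 0 even when the intensity vanishes and the Palm measure is zero. *)
Definition palm_moment j : R := if mdeg j == 0%N then 1 else \int[palm1]_w monomial j (Z (w, 0)).
Definition centered_monomial j (z : E) : R := monomial j z - palm_moment j.

Lemma measurable_monomial j : mfunT (@monomial R n m j).
Proof. by apply: measurable_prod => i _; apply: mfunX; exact: measurable_coord. Qed.
Lemma measurable_centered j : mfunT (centered_monomial j).
Proof. by apply: mfunB => //; exact: measurable_monomial. Qed.
Lemma centered0 j z : mdeg j = 0%N -> centered_monomial j z = 0.
move=> j0; rewrite /centered_monomial /palm_moment j0 eqxx /monomial big1 ?subrr// => i _.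
by move: j0; rewrite /mdeg => /eqP; rewrite sum_nat_eq0 => /forallP/(_ i)/= /eqP ->; rewrite expr0.
Qed.

Lemma monomial_le_powR j (z : E) (q : R) : 0 <= q -> (mdeg j)%:R <= q -> `|monomial j z| <= 1 + `|z| `^ q.
move=> q0 jq; apply: le_trans (monomial_le j z) _.
by rewrite -powR_mulrn//; exact: powR_le_1D.
Qed.

Lemma centered_le j : 2 * (mdeg j)%:R <= gamma -> exists2 M, 0 <= M &
 forall z, `|centered_monomial j z| <= M * (1 + `|z| `^ (gamma / 2)).
move=> jg; exists (1 + `|palm_moment j|); first by rewrite addr_ge0.
move=> z; apply: le_trans (ler_normB _ _) _; rewrite mulrDl mul1r; apply: lerD.
 by apply: monomial_le_powR; [rewrite divr_ge0// ltW|rewrite ler_pdivlMr// mulrC].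
by rewrite ler_peMr// lerDl powR_ge0.
Qed.

(** [kappa] need not be measurable, so it is only compared pointwise with the measurable
    [palm_corr], on the set [G] of full measure where the mark at [y] has its moment. *)
Lemma corr_weight_fin j (s : R) : (0 < mdeg j)%N -> 2 * (mdeg j)%:R < gamma ->
 (\int[alpha]_y (kap y `^ ((gamma - 2 * (mdeg j)%:R) / gamma) / (1 + norm2 y `^ s))%:E < +oo)%E ->
 (\int[alpha]_y (palm_corr (centered_monomial j) y * (weight_at s y)%:E) < +oo)%E.
move=> j0 jg hk; set q : R := (mdeg j)%:R in jg hk *; set g := centered_monomial j.
have mg : mfunT g by exact: measurable_centered.
have mpc := measurable_palm_corr mg.
have pc0 y : (0 <= palm_corr g y)%E by exact: abse_ge0.
have w0 (y : E) : 0 < weight_at s y by exact: weight_at_gt0.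
have mw := @measurable_weight_at R n s.
have [i0|i0] := eqVneq (intensity P Phi) 0.
 have aT : alpha setT = 0%E by apply: (intensity0_null i0).
 rewrite null_set_integral ?ltry//.
 by apply: emfunM => //; exact/mEFin.
have q0 : 0 < q by rewrite ltr0n.
pose mu := palm_moment j.
(* From [(a + b)^G <= 2^G * (a^G + b^G)] with [a = |z|^q] and [b = |mu|], where [G = gamma / q]. *)
pose C := 2 `^ (gamma / q) * (1 + `|mu| `^ (gamma / q)).
have G0 : 0 <= gamma / q by rewrite divr_ge0// ltW.
have C0 : 0 <= C by rewrite mulr_ge0 ?powR_ge0// addr_ge0// powR_ge0.
have gC z : `|g z| `^ (gamma / q) <= C * (1 + `|z| `^ gamma).
 via ((`|z| `^ q + `|mu|) `^ (gamma / q)).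
  apply: ge0_ler_powR => //; rewrite ?nnegrE ?addr_ge0 ?powR_ge0//.
  apply: le_trans (ler_normB _ _) _; rewrite lerD2r powR_mulrn//; exact: monomial_le.
 apply: (le_trans (powR_add_le (powR_ge0 _ _) (normr_ge0 _) G0)).
 rewrite -powRrM mulrCA divff ?gt_eqF// mulr1 /C -mulrA ler_wpM2l ?powR_ge0//.
 have := powR_ge0 `|z| gamma; have := powR_ge0 `|mu| (gamma / q).
 set a := `|mu| `^ _; set b := `|z| `^ _ => a0 b0.
 have -> : (1 + a) * (1 + b) = b + a + (1 + a * b) by ring.
 by rewrite lerDl addr_ge0// mulr_ge0.
have p1 := palm_setT i0.
have iz : intR palm1 (fun w => monomial j (Z (w, 0))).
 apply/integrableP; split.
  by apply/mEFin; apply: (mcomp (measurable_monomial j)).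
 apply: (@le_lt_trans _ _ (\int[palm1]_w (1%:E + (`|Z (w, 0)%R| `^ gamma)%:E))%E).
  apply: le_intT => w //=; rewrite -EFinD lee_fin; apply: monomial_le_powR; first exact: ltW.
  by apply: ltW; apply: le_lt_trans jg; rewrite ler_peMl// ler1n.
 rewrite ge0_integralD//; last by apply/mEFin; apply: (mcomp (measurable_powR gamma)); exact: mnorm.
 rewrite [X in (X + _)%E](_ : _ = 1%E); last first.
  by have := integral_cst palm1 mtop (1%E : \bar R); rewrite mul1e => ->; exact: p1.
 apply: lte_add_pinfty; first exact: ltry.
 exact: le_lt_trans moment1 (ltry _).
have g0 : \int[palm1]_w g (Z (w, 0)) = 0.
 have ic : intR palm1 (fun=> mu) by apply: (bnd_integrable p1 (C := `|mu|)).
 rewrite /g /centered_monomial (RintegralB mtop iz ic) (Rintegral_unit_cst p1).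
 by rewrite /mu /palm_moment gtn_eqF// subrr.
have [K' K'0 hK'] := palm_corr_le i0 mg q0 jg C0 gC g0.
have K1 : 0 < K' + 1 by rewrite ltr_wpDl.
have ae := ae_far_moment.
pose G := [set y : E | (far_moment y <= c%:E)%E].
have mG : measurable G.
 rewrite -[X in measurable X]setTI; apply: emeasurable_fun_infty_c => //; exact: measurable_far_moment.
pose F y : \bar R := ((K' + 1)^-1%:E * (palm_corr g y * (weight_at s y)%:E))%E.
have F0 y : (0 <= F y)%E by rewrite mule_ge0 ?lee_fin ?invr_ge0 ?(ltW K1)// mule_ge0// lee_fin ltW.
have mF : mfunT F by apply: measurable_funeM; apply: emfunM => //; exact/mEFin.
have h1 : (\int[alpha]_y F y < +oo)%E.
 rewrite (_ : (\int[alpha]_y F y) = \int[alpha]_y (F y * (\1_G y)%:E))%E; last first.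
  apply: ge0_ae_eq_integral => //.
  - apply: emfunM => //; apply/mEFin; exact: mindic.
  - by move=> y _; rewrite mule_ge0// lee_fin.
  - by apply: filterS ae => y Gy _; rewrite indicE mem_set// mule1.
 apply: le_lt_trans hk; apply: le_intT => y; first by rewrite mule_ge0// lee_fin.
 rewrite indicE; case: (boolP (y \in G)) => yG; last first.
  by rewrite mule0 lee_fin divr_ge0 ?powR_ge0// addr_ge0// powR_ge0.
 rewrite mule1 /F muleA; rewrite [X in (_ <= X)%E]EFinM.
 have wE : (weight_at s y)%:E = ((1 + norm2 y `^ s)^-1)%:E by [].
 rewrite wE lee_wpmul2r ?lee_fin ?invr_ge0 ?addr_ge0 ?powR_ge0//.
 via ((K' + 1)^-1%:E * (K' * kap y `^ ((gamma - 2 * q) / gamma))%:E)%E.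
  by rewrite lee_wpmul2l ?lee_fin ?invr_ge0 ?(ltW K1)//; apply: hK'; exact: (set_mem yG).
 rewrite -EFinM lee_fin mulrA ler_piMl ?powR_ge0//.
 by rewrite mulrC ler_pdivrMr// mul1r lerDl.
move: h1; rewrite /F int_Zl ?invr_ge0 ?(ltW K1)//; last 2 first.
- by move=> y _; rewrite mule_ge0// lee_fin ltW.
- by apply: emfunM => //; exact/mEFin.
have : (0 <= \int[alpha]_y (palm_corr g y * (weight_at s y)%:E))%E
 by apply: int_ge0 => y _; rewrite mule_ge0// lee_fin ltW.
move=> h0 h1; apply: (mule_ltyW _ h0 h1); by rewrite invr_gt0.
Qed.
Definition centered_stat j r w : R :=
 marked_stat (centered_monomial j) (fun x => bump_coef K j (r^-1 *: x)) w.

Lemma measurable_scaled_coef j r : mfunT (fun x : E => bump_coef K j (r^-1 *: x)).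
have [mb _ _] := @tf_bump_coef R n m K j.
exact: (mcomp mb (measurable_scale _)).
Qed.

Lemma scaled_coef_support j r (r0 : 0 < r) : off_cube r (fun x : E => bump_coef K j (r^-1 *: x)).
Proof. by move=> x xr; rewrite bump_coef_support// scale_norm// ler_pdivlMr// mul1r. Qed.
(** [marked_stat_le] yields [r^n] times the growth [r^(2q - p)] of the integrated correlations, and
    the scaling [r^(-2q)] leaves [r^(n - p)]. *)
Lemma centered_rate j (p : R) (strong : bool) : (0 < mdeg j)%N -> 2 * (mdeg j)%:R < gamma ->
 p <= 2 * (mdeg j)%:R -> (strong -> p < 2 * (mdeg j)%:R) ->
 (\int[alpha]_y (kap y `^ ((gamma - 2 * (mdeg j)%:R) / gamma) / (1 + norm2 y `^ (2 * (mdeg j)%:R - p)))%:E < +oo)%E ->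
 rate strong (n%:R - p) (fun r => (r `^ (- (2 * (mdeg j)%:R)))%:E * \int[P]_w (centered_stat j r w ^+ 2)%:E)%E.
move=> j0 jg jp sp hk; set q : R := (mdeg j)%:R in jg jp sp hk *; set g := centered_monomial j.
have mg : mfunT g by exact: measurable_centered.
have s0 : 0 <= 2 * q - p by rewrite subr_ge0.
have pc0 y : (0 <= palm_corr g y)%E by exact: abse_ge0.
have wg := weighted_growth (measurable_palm_corr mg) pc0 s0 (corr_weight_fin j0 jg hk) (strong := strong).
have {}wg : rate strong (2 * q - p) (fun r => \int[alpha]_y (palm_corr g y * (\1_(cube (2 * r)) y)%:E))%E
 by apply: wg => hs; rewrite subr_gt0; exact: sp.
have [M M1 hM] := @bump_coef_le R n m K.
have M0 : 0 <= M by exact: le_trans M1.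
have [M' M'0 hM'] := centered_le (ltW jg).
have C0 : 0 <= M ^+ 2 * 2 ^+ n by rewrite mulr_ge0 ?sqr_ge0// exprn_ge0.
have H := rate_scale C0 (rate_shift (n%:R - 2 * q) wg).
have -> : n%:R - p = 2 * q - p + (n%:R - 2 * q) by ring.
apply: rate_le H => r r1; have r0 : 0 < r by exact: lt_le_trans r1.
have := marked_stat_le mg (measurable_scaled_coef j r)
 (fun x => hM j _) (@scaled_coef_support j r r0) hM' M'0 r1.
move=> h; apply: (le_trans (lee_wpmul2l _ h)); first by rewrite lee_fin powR_ge0.
rewrite !muleA -!EFinM; apply: lee_wpmul2r; first by apply: int_ge0 => y _; rewrite mule_ge0// lee_fin.
rewrite lee_fin exprMn; apply: eq_ler.
have -> : r `^ (n%:R - 2 * q) = r `^ (- (2 * q)) * r ^+ n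
 by rewrite -powR_mulrn ?(ltW r0)// -powRD ?(gt_eqF r0) ?implybT// addrC.
ring.
Qed.

(** * The borderline degree *)

Section borderline.
Lemma near_integrable r w (f : E -> R) C : 0 <= C -> (near r w < +oo)%E -> mfunT f ->
 (forall x, `|f x| <= C * ((1 + `|Z (w, x)| `^ (gamma / 2)) * \1_(cube r) x)) ->
 intR (Phi w) f.
move=> C0 nf mf fC.
have mk := mweight (gamma / 2) r w.
have k0 x : 0 <= (1 + `|Z (w, x)| `^ (gamma / 2)) * \1_(cube r) x by rewrite mulr_ge0// addr_ge0// powR_ge0.
have ik : (Phi w).-integrable setT (fun x => ((1 + `|Z (w, x)| `^ (gamma / 2)) * \1_(cube r) x)%:E).
 apply/integrableP; split => //; under eq_integral do rewrite gee0_abs ?lee_fin//.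
 exact: nf.
apply: (le_integrable mtop _ _ (integrableZl mtop C ik)); first exact/mEFin.
move=> x _; rewrite /= lee_fin; apply: le_trans (fC x) _.
by rewrite ger0_norm// mulr_ge0.
Qed.
Variable j : @mindex n m.
Hypothesis jg : 2 * (mdeg j)%:R <= gamma.
Let pos (z : E) : R := Num.max (monomial j z) 0.
Let neg (z : E) : R := Num.max (- monomial j z) 0.
Let pos0 z : 0 <= pos z. Proof. by rewrite le_max lexx orbT. Qed.
Let neg0 z : 0 <= neg z. Proof. by rewrite le_max lexx orbT. Qed.
Let mpos : mfunT pos.
Proof. by apply: measurable_maxr => //; exact: measurable_monomial. Qed.
Let mneg : mfunT neg.
Proof. by apply: measurable_maxr => //; apply: measurable_funN; exact: measurable_monomial. Qed.
Let mono_le (z : E) : `|monomial j z| <= 1 * (1 + `|z| `^ (gamma / 2)).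
have h1 : 0 <= gamma / 2 by rewrite divr_ge0// ltW.
have h2 : (mdeg j)%:R <= gamma / 2 by rewrite ler_pdivlMr// mulrC.
by rewrite mul1r; exact: monomial_le_powR h1 h2.
Qed.
Let pos_le z : pos z <= 1 * (1 + `|z| `^ (gamma / 2)).
Proof. by apply: le_trans (mono_le z); rewrite ge_max normr_ge0 ler_norm. Qed.
Let neg_le z : neg z <= 1 * (1 + `|z| `^ (gamma / 2)).
Proof. by apply: le_trans (mono_le z); rewrite ge_max normr_ge0 -normrN ler_norm. Qed.
Let mmp := measurable_weighted mpos pos0.
Let mmn := measurable_weighted mneg neg0.
Let nup := regular_measure mmp.
Let nun := regular_measure mmn.
Let sqp := weighted_square mpos pos0 ltr01 pos_le.
Let sqn := weighted_square mneg neg0 ltr01 neg_le.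
Let invp : invariant_measure theta nup := regular_invariant mmp (weighted_invariant mpos pos0).
Let invn : invariant_measure theta nun := regular_invariant mmn (weighted_invariant mneg neg0).
Let lsip : locally_square_integrable P nup := regular_square_integrable mmp sqp.
Let lsin : locally_square_integrable P nun := regular_square_integrable mmn sqn.
Let mu : R := palm_moment j.
(** Almost surely the regular versions agree with the weighted measures, and finiteness of [near]
    allows the integral to be split. *)
Let split_stat r : 1 <= r -> let h := fun x : E => bump_coef K j (r^-1 *: x) in
 {ae P, forall w, centered_stat j r w =
  lstat nup h w - lstat nun h w - mu * lstat Phi h w}.
move=> r1 h; have r0 : 0 < r by exact: lt_le_trans r1.
have tfh : tf h by apply: tf_scale => //; exact: tf_bump_coef.
have [mh _ _] := tfh.
have [M M1 hM] := @bump_coef_le R n m K; have M0 : 0 <= M by exact: le_trans M1.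
have aen := ae_near_sum_lty r1.
have aep := ae_locally_finite mmp sqp; have aeN := ae_locally_finite mmn sqn.
apply: filterS3 aen aep aeN => w nf lp ln.
have int (k : E -> R) : mfunT k -> (forall z, `|k z| <= 1 * (1 + `|z| `^ (gamma / 2))) ->
  intR (Phi w) (fun x => k (Z (w, x)) * h x).
 move=> mk kle; apply: (near_integrable M0 nf).
  by apply: mfunM => //; exact: (mcomp mk (mZw w)).
 move=> x; rewrite normrM cube_indicE; case: ltP => xr; last by rewrite /h scaled_coef_support// normr0 !mulr0.
 by rewrite mulr1 mulrC ler_pM//; [exact: hM|rewrite -[leRHS]mul1r; exact: kle].
have ip : intR (Phi w) (fun x => pos (Z (w, x)) * h x) by apply: int => // z; rewrite ger0_norm.
have iN : intR (Phi w) (fun x => neg (Z (w, x)) * h x) by apply: int => // z; rewrite ger0_norm.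
have ih : intR (Phi w) h by apply: tf_integrable tfh; exact: random_measure_locally_finite.
have ep : lstat nup h w = \int[Phi w]_x (pos (Z (w, x)) * h x)
 by rewrite /lstat/= regularizeE// Rintegral_density.
have en : lstat nun h w = \int[Phi w]_x (neg (Z (w, x)) * h x)
 by rewrite /lstat/= regularizeE// Rintegral_density.
rewrite ep en /lstat -(RintegralZl mu mtop ih) -(RintegralB mtop ip iN).
rewrite -(RintegralB mtop (integrableB mtop ip iN) (integrableZl mtop mu ih)).
apply: eq_Rint => x _; rewrite /centered_monomial -/mu /pos /neg -/(h x).
rewrite [X in _ * (X - _)](_ : _ = Num.max (monomial j (Z (w, x))) 0 - Num.max (- monomial j (Z (w, x))) 0); last first.
 by rewrite !maxEle; case: leP => ?; case: leP => ?; lra.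
ring.
Qed.

(** The rate [o(r^(2n))] holds for every square-integrable stationary random measure tested on
    coefficients of integral zero. It is applied to the measures weighted by the two parts of the
    monomial and to [Phi]; their combination is the centred statistic, without recourse to
    [kappa]. *)
Lemma borderline_rate : (0 < mdeg j)%N ->
 rate true (2 * n)%:R (fun r => \int[P]_w (centered_stat j r w ^+ 2)%:E)%E.
move=> j0.
have rp := second_moment_rate htheta nK invp lsip j0.
have rn := second_moment_rate htheta nK invn lsin j0.
have rP := second_moment_rate htheta nK hPhi hPhi2 j0.
have H := rate_scale (ler0n R 3) (rate_add (rate_add rp rn) (rate_scale (sqr_ge0 mu) rP)).
apply: rate_le H => r r1; have r0 : 0 < r by exact: lt_le_trans r1.
set h := fun x : E => _; have tfh : tf h by apply: tf_scale => //; exact: tf_bump_coef.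
have sq (nu : random_measure Om R n) : invariant_measure theta nu -> locally_square_integrable P nu ->
  intR P (fun w => lstat nu h w * lstat nu h w).
 by move=> h1 h2; have s := sqint_stat htheta h1 h2 tfh; exact: sqintM.
have i1 := sq _ invp lsip; have i2 := sq _ invn lsin; have i3 := sq _ hPhi hPhi2.
have i12 := integrableD mtop i1 i2; have i3' := integrableZl mtop (mu ^+ 2) i3.
have i123 := integrableD mtop i12 i3'; have iall := integrableZl mtop 3 i123.
rewrite [leRHS](_ : _ = (3 * (second_moment P nup h h + second_moment P nun h h + mu ^+ 2 * second_moment P Phi h h))%:E)//.
rewrite /second_moment -(RintegralZl _ mtop i3) -(RintegralD mtop i1 i2).
rewrite -(RintegralD mtop i12 i3') -(RintegralZl _ mtop i123).
rewrite /Rintegral fineK; last exact: integrable_fin_num iall.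
have mX (nu : random_measure Om R n) : mfunT (lstat nu h) by exact: measurable_stat.
apply: ae_ge0_le_integral => //.
- by move=> w _; rewrite lee_fin sqr_ge0.
- apply/mEFin; apply: mfunX; apply: measurable_marked_stat; first exact: measurable_centered.
 exact: measurable_scaled_coef.
- by move=> w _; rewrite lee_fin -!expr2 mulr_ge0// !addr_ge0 ?sqr_ge0// mulr_ge0 ?sqr_ge0.
- by case/integrableP: iall.
have := split_stat r1; apply: filterS => w -> _; rewrite lee_fin -/h.
set a := lstat _ _ _; set b := lstat _ _ _; set e := lstat _ _ _.
have := sqr_ge0 (a + b); have := sqr_ge0 (a + mu * e); have := sqr_ge0 (b - mu * e).
rewrite !expr2; set me := mu * e; have -> : mu * mu * (e * e) = me * me by rewrite /me; ring.
nra.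
Qed.
End borderline.

(** * Remainder of the expansion and variance of the displaced measure *)

Notation mu := palm_moment.
Notation T := centered_stat.
Variable p : R.
Hypothesis m0 : (0 < m)%N.
Hypothesis npm : n%:R + p < 2 * m%:R.
Hypothesis mnp : forall q : nat, (q < m)%N -> 2 * q%:R <= n%:R + p.
Hypothesis npg : n%:R + p < gamma.
(** The exponent of the remainder: [m] from Taylor's formula, capped at [gamma / 2], the power of
    the mark with a controlled square. Both exceed [(n + p) / 2], as [nps] records. *)
Let s : R := Num.min m%:R (gamma / 2).
Let s0 : 0 <= s. Proof. by rewrite le_min ler0n divr_ge0// ltW. Qed.
Let nps : n%:R + p < 2 * s.
Proof. by rewrite /s mulrC minr_pMl// lt_min mulrC npm mulrVK// unitfE. Qed.
Let m1s : m.-1%:R <= s.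
have jm : (m.-1 < m)%N by rewrite prednK.
have h := mnp jm; rewrite le_min ler_nat leq_pred/= ler_pdivlMr// mulrC.
exact: le_trans h (ltW npg).
Qed.

(** The two regimes of [bump_rem_le] merge into the single power [s], which lies between [m - 1] and
    [m]. Beyond radius [2 * r] all coefficients vanish, and a point contributes only if it lands in
    the cube. *)
Lemma bump_rem_scaled : exists2 C, 0 < C & forall r (x z : E), 1 <= r ->
 `|bump_rem m K (r^-1 *: x) (r^-1 *: z)| <=
 C * r `^ (- s) * ((1 + `|z| `^ (gamma / 2)) * \1_(cube (2 * r)) x) + ((2 * r <= `|x|) && (`|x + z| < r))%:R.
have [C C0 hC] := @bump_rem_le R n m K m0; exists C => // r x z r1; have r0 : 0 < r by exact: lt_le_trans r1.
rewrite cube_indicE; case: (ltP `|x| (2 * r)) => xr /=; last first.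
 rewrite !mulr0 add0r /bump_rem big1 => [|j _].
  rewrite subr0 -scalerDr; case: ltP => xzr; first by rewrite ger0_norm ?bumps_ge0// bumps_le1.
  by rewrite bumps_support ?normr0// scale_norm// ler_pdivlMr// mul1r.
 by rewrite bump_coef_support ?mul0r// scale_norm// ler_pdivlMr// mul1r; apply: le_trans xr; lra.
rewrite mulr1 addr0; set u := `|r^-1 *: z|.
have uE : u `^ s = r `^ (- s) * `|z| `^ s
 by rewrite /u scale_norm// mulrC powRM ?invr_ge0 ?(ltW r0)// -[r^-1]powR_inv1 ?(ltW r0)// -powRrM mulN1r.
via (C * u `^ s); last first.
 rewrite uE mulrA ler_wpM2l ?mulr_ge0 ?powR_ge0 ?(ltW C0)//; apply: powR_le_1D => //.
 by rewrite /s ge_min lexx orbT.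
have [h1 h2] := hC (r^-1 *: x) (r^-1 *: z); have [u1|u1] := leP u 1.
 apply: le_trans (h1 u1) _; rewrite ler_pM2l// -powR_mulrn// -/u.
 have [->|u0] := eqVneq u 0; first by rewrite powR0 ?powR_ge0// pnatr_eq0 -lt0n.
 by apply: ger_powR; [rewrite lt_def u0 normr_ge0 u1|rewrite /s ge_min lexx].
apply: le_trans (h2 (ltW u1)) _; rewrite ler_pM2l// -powR_mulrn//.
by apply: ler_powR => //; exact: ltW.
Qed.
Let small (j : @mindex n m) : (mdeg j < m)%N -> 2 * (mdeg j)%:R < gamma.
Proof. by move=> /mnp h; exact: le_lt_trans h npg. Qed.
Lemma transport_statE r w : 1 <= r ->
 lstat (transport Z Phi) (bumpr m K r) w = \int[Phi w]_x bumpr m K r (x + Z (w, x)).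
move=> r1; have r0 : 0 < r by exact: lt_le_trans r1.
have [mf _ _] : tf (bumpr m K r : E -> R) by exact: tf_bumpr.
rewrite /lstat /Rintegral; congr fine.
have := @ge0_integral_pushforward _ _ _ _ R (displace Z w) (mfunP (displace Z w)) (Phi w) setT
 (fun x => (bumpr m K r x)%:E) mtop.
move=> ->; first by rewrite preimage_setT.
- exact/mEFin.
- by move=> x _; rewrite lee_fin bumps_ge0.
Qed.

(** The finiteness conditions, true almost surely, make every term integrable against [Phi w], so
    that the pointwise expansion may be integrated term by term. *)
Lemma remainder_le : exists2 C, 0 < C & forall r w, 1 <= r ->
 (near r w < +oo)%E -> (near (2 * r) w < +oo)%E -> (far r w < +oo)%E ->
 (`|lstat (transport Z Phi) (bumpr m K r) w -
   \sum_(j : @mindex n m | (mdeg j < m)%N) r^-1 ^+ mdeg j *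
    (T j r w + mu j * lstat Phi (fun x => bump_coef K j (r^-1 *: x)) w)|%:E
  <= (C * r `^ (- s))%:E * near (2 * r) w + far r w)%E.
have [C C0 hC] := bump_rem_scaled; exists C => // r w r1 nf nf2 ff; have r0 : 0 < r by exact: lt_le_trans r1.
rewrite transport_statE//; pose h j (x : E) := @bump_coef R n m K j (r^-1 *: x).
have [M M1 hM] := @bump_coef_le R n m K; have M0 : 0 <= M by exact: le_trans M1.
have lf := random_measure_locally_finite Phi w.
have int (j : @mindex n m) (k : E -> R) M' : 0 <= M' -> mfunT k ->
  (forall z, `|k z| <= M' * (1 + `|z| `^ (gamma / 2))) ->
  intR (Phi w) (fun x => h j x * k (Z (w, x))).
 move=> M'0 mk kle; apply: (near_integrable (mulr_ge0 M0 M'0) nf).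
  by apply: mfunM; [exact: measurable_scaled_coef|exact: (mcomp mk (mZw w))].
 move=> x; rewrite normrM cube_indicE; case: ltP => xr; last by rewrite /h scaled_coef_support// normr0 !mul0r !mulr0.
 by rewrite mulr1 -mulrA ler_pM//; exact: hM.
have imono j : (mdeg j < m)%N -> intR (Phi w) (fun x => h j x * monomial j (Z (w, x))).
 move=> /small jg; apply: (int j _ 1) => //; first exact: measurable_monomial.
 by move=> z; rewrite mul1r; apply: monomial_le_powR; [rewrite divr_ge0// ltW|rewrite ler_pdivlMr// mulrC ltW].
have TE j : (mdeg j < m)%N -> T j r w + mu j * lstat Phi (h j) w = \int[Phi w]_x (h j x * monomial j (Z (w, x))).
 move=> jm; have [M' M'0 hM'] := centered_le (ltW (small jm)).
 have ic := int j _ M' M'0 (measurable_centered j) hM'.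
 have ih : intR (Phi w) (h j) by apply: tf_integrable; [exact: lf|apply: tf_scale => //; exact: tf_bump_coef].
 rewrite /centered_stat /marked_stat /lstat -(RintegralZl _ mtop ih).
 rewrite -(RintegralD mtop ic (integrableZl mtop (mu j) ih)).
 by apply: eq_Rint => x _; rewrite /centered_monomial -/(h j x); ring.
pose F (j : @mindex n m) x := if (mdeg j < m)%N then r^-1 ^+ mdeg j * (h j x * monomial j (Z (w, x))) else 0.
have iF j : intR (Phi w) (F j).
 rewrite /F; case: (mdeg j < m)%N (imono j) => im; last exact: integrable0.
 exact: (integrableZl mtop _ (im isT)).
have [SE iS] := Rintegral_sum (index_enum _) iF.
rewrite [X in _ - X](_ : _ = \int[Phi w]_x (\sum_j F j x)); last first.
 rewrite SE [LHS]big_mkcond/=; apply: eq_bigr => j _; rewrite /F; case: ifP => jm; last by rewrite Rintegral_cst// mul0r.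
 by rewrite TE// -(RintegralZl _ mtop (imono j jm)).
pose rem x := bumpr m K r (x + Z (w, x)) - \sum_j F j x.
have remE x : rem x = bump_rem m K (r^-1 *: x) (r^-1 *: Z (w, x)).
 rewrite /rem /bump_rem /bumpr -scalerDr; congr (_ - _); rewrite [RHS]big_mkcond/=.
 apply: eq_bigr => j _; rewrite /F; case: ifP => // _; rewrite monomial_scale /h; ring.
have mrem : mfunT rem.
 apply: mfunB; last by apply/mEFin; case/integrableP: iS.
 have [mf _ _] : tf (bumpr m K r : E -> R) by exact: tf_bumpr.
 by apply: (mcomp mf); exact: mfunD_rV.
have rem_le : (\int[Phi w]_x (`|rem x|)%:E <= (C * r `^ (- s))%:E * near (2 * r) w + far r w)%E.
 have Cs0 : 0 <= C * r `^ (- s) by rewrite mulr_ge0 ?powR_ge0// ltW.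
 have mn := mweight (gamma / 2) (2 * r) w.
 have n0 x : (0 <= ((1 + `|Z (w, x)| `^ (gamma / 2)) * \1_(cube (2 * r)) x)%:E)%E
  by rewrite lee_fin mulr_ge0// addr_ge0// powR_ge0.
 rewrite /near_sum /far_sum -int_Zl// -ge0_integralD//; last 3 first.
 - by move=> x _; exact: mule_ge0.
 - exact: emfunM.
 - apply/mEFin; apply: mbool_natr; apply: measurable_and.
   by apply: measurable_fun_ler => //; exact: measurable_norm_rV.
  by apply: measurable_fun_ltr => //; apply: mnorm; exact: mfunD_rV.
 apply: le_intT => x; first by rewrite lee_fin.
 by rewrite -EFinM -EFinD lee_fin remE; exact: hC.
have irem : intR (Phi w) rem.
 apply/integrableP; split; first exact/mEFin.
 apply: (le_lt_trans rem_le); rewrite lte_add_pinfty//.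
 by rewrite lte_mul_pinfty// lee_fin mulr_ge0 ?powR_ge0// ltW.
have -> : \int[Phi w]_x bumpr m K r (x + Z (w, x)) = \int[Phi w]_x (rem x + \sum_j F j x)
 by apply: eq_Rint => x _; rewrite /rem subrK.
rewrite (RintegralD mtop irem iS) addrK.
apply: le_trans rem_le; rewrite -abse_EFin /Rintegral fineK; last exact: integrable_fin_num irem.
apply: le_abse_integral => //; exact/mEFin.
Qed.

Notation coef j r := (fun x : E => @bump_coef R n m K j (r^-1 *: x)).
Notation q j := (@GRing.natmul R 1 (mdeg j)).
Let nuT := regular_measure measurable_transport.
Let sqT := transport_square.
Let invT : invariant_measure theta nuT := regular_invariant measurable_transport transport_invariant.
Let lsiT : locally_square_integrable P nuT := regular_square_integrable measurable_transport sqT.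

Lemma ae_remainder_le : exists2 C, 0 < C & forall r, 1 <= r -> {ae P, forall w,
 (`|lstat nuT (bumpr m K r) w -
   \sum_(j : @mindex n m | (mdeg j < m)%N) r^-1 ^+ mdeg j *
    (T j r w + mu j * lstat Phi (coef j r) w)|%:E
  <= (C * r `^ (- s))%:E * near (2 * r) w + far r w)%E}.
have [C C0 hC] := remainder_le; exists C => // r r1; have r2 : 1 <= 2 * r by lra.
have n1 := ae_near_sum_lty r1.
have n2 := ae_near_sum_lty r2.
have f1 : {ae P, forall w, (far r w < +oo)%E}.
 have [D D0 hD] := far_bound.
 have mf := measurable_far_sum r.
 have fl := le_lt_trans (hD r r1) (ltry _).
 have := measurable_nonneg_lty (emfunM mf mf) (fun w => mule_ge0 (far_sum_ge0 r w) (far_sum_ge0 r w)) fl.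
 apply: filterS => w; have := far_sum_ge0 r w.
 by case: (far r w) => [a||]//=; rewrite ?ltry// mulyy.
have lT := ae_locally_finite measurable_transport sqT.
apply: filterS2 (filterI n1 n2) (filterI f1 lT) => w [h1 h2] [h3 h4].
have := hC r w r1 h1 h2 h3.
by rewrite /lstat /= regularizeE.
Qed.
(** Degree 0 contributes nothing, the degree with [2q = n + p] falls under [borderline_rate], and
    all others satisfy the hypothesis on [kappa]. As [q >= 1], the bound [p <= 2] makes the weight
    exponent [2q - p] nonnegative, and [p < 2] makes it positive, as the strong rate requires. *)
Let coef_rate_j (strong : bool) (j : @mindex n m) : p <= 2 -> (strong -> p < 2) ->
 (forall q : nat, (0 < q)%N -> q%:R < (n%:R + p) / 2 ->
  (\int[reduced_moment P Phi]_y
   (kappa P theta Phi P2 Z y `^ ((gamma - 2 * q%:R) / gamma) / (1 + norm2 y `^ (2 * q%:R - p)))%:E < +oo)%E) ->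
 (mdeg j < m)%N ->
 rate strong (n%:R - p) (fun r => (r `^ (- (2 * q j)))%:E * \int[P]_w (T j r w ^+ 2)%:E)%E.
move=> p2 sp hk jm; have [j0|j0] := posnP (mdeg j).
 apply: (@rate_pow _ _ _ (n%:R - p - 1) _ 0); first by lra.
 move=> r r1; rewrite integral0_eq ?mule0 ?mul0r// => w _.
 rewrite /centered_stat /marked_stat; under eq_Rint do rewrite centered0// mulr0.
 by rewrite Rintegral_cst// mul0r expr0n.
have q1 : 1 <= q j by rewrite ler1n.
have := mnp jm; rewrite le_eqVlt => /orP[/eqP e|lt].
 have := rate_shift (- (2 * q j)) (borderline_rate (ltW (small jm)) j0).
 have -> : (2 * n)%:R + - (2 * q j) = n%:R - p by rewrite natrM e; lra.
 exact: rate_weaken.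
have h1 : p <= 2 * q j by lra.
have h2 : strong -> p < 2 * q j by move=> /sp; lra.
apply: (centered_rate j0 (small jm) h1 h2).
apply: hk => //; lra.
Qed.

(** Three contributions meet the rate: the centred marks, the variances of [Phi] on the Taylor
    coefficients, and the remainder, whose exponents [2n - 2s] and [2n - gamma] are both below
    [n - p]. *)
Lemma transport_rate (strong : bool) : p <= 2 -> (strong -> p < 2) ->
 (forall q : nat, (0 < q)%N -> q%:R < (n%:R + p) / 2 ->
  (\int[reduced_moment P Phi]_y
   (kappa P theta Phi P2 Z y `^ ((gamma - 2 * q%:R) / gamma) / (1 + norm2 y `^ (2 * q%:R - p)))%:E < +oo)%E) ->
 (forall j, rate strong (n%:R - p) (fun r => (cov_stat P Phi (coef j r) (coef j r))%:E)) ->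
 rate strong (n%:R - p) (fun r => (cov_stat P nuT (bumpr m K r) (bumpr m K r))%:E).
move=> p2 sp hk hV; have [C C0 hC] := ae_remainder_le.
pose N : R := #|{: @mindex n m}|%:R.
pose B r w := ((C * r `^ (- s))%:E * near (2 * r) w + far r w)%E.
pose X j r w := lstat Phi (coef j r) w.
pose EX j r := \int[P]_w X j r w.
have rB : rate strong (n%:R - p) (fun r => \int[P]_w (B r w * B r w))%E.
 have [D D0 hD] := near_bound.
 have [D' D'0 hD'] := far_bound.
 have h1 : rate strong (n%:R - p) (fun r => ((2 * C ^+ 2 * D * 2 ^+ (2 * n)) * r `^ ((2 * n)%:R - 2 * s))%:E)
  by apply: (@rate_pow _ _ _ ((2 * n)%:R - 2 * s)) => [|r r1]; [rewrite natrM; have := nps; lra|exact: lexx].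
 have h2 : rate strong (n%:R - p) (fun r => ((2 * D') * r `^ ((2 * n)%:R - gamma))%:E)
  by apply: (@rate_pow _ _ _ ((2 * n)%:R - gamma)) => [|r r1]; [rewrite natrM; have := npg; lra|exact: lexx].
 apply: rate_le (rate_add h1 h2) => r r1; have r0 : 0 < r by exact: lt_le_trans r1.
 have r2 : 1 <= 2 * r by lra.
 have Cs : 0 < C * r `^ (- s) by rewrite mulr_gt0// powR_gt0.
 apply: le_trans (near_far_square (2 * r) r Cs) _; apply: leeD.
  apply: (le_trans (lee_wpmul2l _ (hD _ r2))); first by rewrite lee_fin mulr_ge0 ?sqr_ge0.
  rewrite -EFinM lee_fin; apply: eq_ler.
  have -> : r `^ ((2 * n)%:R - 2 * s) = r ^+ (2 * n) * (r `^ (- s)) ^+ 2.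
   rewrite -!powR_mulrn ?powR_ge0 ?(ltW r0)// -powRrM -powRD ?(gt_eqF r0) ?implybT//.
   by congr (_ `^ (_ + _)); lra.
  by rewrite !exprMn; ring.
 apply: (le_trans (lee_wpmul2l _ (hD' _ r1))); first by rewrite lee_fin.
 rewrite -EFinM lee_fin; apply: eq_ler.
 by rewrite powRB ?(gt_eqF r0) ?implybT// powR_mulrn ?(ltW r0)// !mulrA.
pose S j r w := ((r `^ (- (2 * q j)))%:E * (T j r w ^+ 2)%:E + (r `^ (- (2 * q j)) * mu j ^+ 2)%:E * ((X j r w - EX j r) ^+ 2)%:E)%E.
have S0 j r w : (0 <= S j r w)%E
 by rewrite adde_ge0// -?EFinM lee_fin mulr_ge0 ?sqr_ge0 ?powR_ge0// mulr_ge0 ?sqr_ge0 ?powR_ge0.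
have mT j r : mfunT (fun w => (T j r w ^+ 2)%:E).
 apply/mEFin; apply: mfunX; apply: measurable_marked_stat; first exact: measurable_centered.
 exact: measurable_scaled_coef.
have tfc j r : 1 <= r -> tf (coef j r) by move=> r1; apply: tf_scale; [exact: lt_le_trans r1|exact: tf_bump_coef].
have sX j r : 1 <= r -> sqint P (X j r) by move=> r1; exact: (sqint_stat htheta hPhi hPhi2 (tfc j r r1)).
have mX j r : 1 <= r -> mfunT (fun w => ((X j r w - EX j r) ^+ 2)%:E).
 move=> /(sX j) [mX _]; apply/mEFin; apply: mfunX; exact: mfunB.
have mS j r : 1 <= r -> mfunT (S j r) by move=> r1; apply: emeasurable_funD; apply: emfunM => //; exact: mX.
have rS j : (mdeg j < m)%N -> rate strong (n%:R - p) (fun r => \int[P]_w S j r w)%E.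
 move=> jm; have h1 := coef_rate_j p2 sp hk jm; have h2 := rate_scale (sqr_ge0 (mu j)) (hV j).
 apply: rate_le (rate_add h1 h2) => r r1; have r0 : 0 < r by exact: lt_le_trans r1.
 rewrite ge0_integralD//; last 4 first.
 - by move=> w _; rewrite -EFinM lee_fin mulr_ge0 ?sqr_ge0 ?powR_ge0.
 - exact: emfunM.
 - by move=> w _; rewrite -EFinM lee_fin mulr_ge0 ?sqr_ge0// mulr_ge0 ?sqr_ge0 ?powR_ge0.
 - by apply: emfunM => //; exact: mX.
 rewrite int_Zl ?powR_ge0//; last by move=> w _; rewrite lee_fin sqr_ge0.
 apply: leeD => //; rewrite int_Zl//; last 3 first.
 - by move=> w _; rewrite lee_fin sqr_ge0.
 - exact: mX.
 - by rewrite mulr_ge0 ?sqr_ge0 ?powR_ge0.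
 rewrite (centered_sqr _ (sX j r r1)) subrr expr0n addr0.
 have cov0 := covariance_stat_ge0 htheta hPhi hPhi2 (tfc j r r1).
 apply: lee_wpmul2r; first by rewrite lee_fin; exact: cov0.
 rewrite lee_fin ler_piMl ?sqr_ge0//.
 by via (r `^ 0); [rewrite ler_powR// oppr_le0 mulr_ge0|rewrite powRr0].
have N0 : 0 <= 3 * N by rewrite mulr_ge0// ler0n.
have H := rate_add (rate_scale N0 (rate_sum (index_enum {: @mindex n m}) rS)) (rate_scale (ler0n R 3) rB).
apply: rate_le H => r r1; have r0 : 0 < r by exact: lt_le_trans r1.
have tfb : tf (bumpr m K r : E -> R) by exact: tf_bumpr.
have sY := sqint_stat htheta invT lsiT tfb.
(* The variance is at most the mean square distance to any constant; this one centres the linear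
   statistics of [Phi] in the expansion. *)
pose a := \sum_(j : @mindex n m | (mdeg j < m)%N) r^-1 ^+ mdeg j * (mu j * EX j r).
via (\int[P]_w ((lstat nuT (bumpr m K r) w - a) ^+ 2)%:E)%E.
 by rewrite (centered_sqr a sY) lee_fin lerDl sqr_ge0.
have mB : mfunT (B r).
 apply: emeasurable_funD; last exact: measurable_far_sum.
 by apply: emfunM => //; exact: measurable_near_sum.
have B0 w : (0 <= B r w)%E
 by rewrite adde_ge0 ?far_sum_ge0// mule_ge0 ?near_sum_ge0// lee_fin mulr_ge0 ?powR_ge0// ltW.
have mBB := emfunM mB mB.
have BB0 w : (0 <= B r w * B r w)%E by exact: mule_ge0.
have mSS : mfunT (fun w => \sum_(j : @mindex n m | (mdeg j < m)%N) S j r w)%E.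
 under eq_fun do rewrite -big_filter.
 by apply: emeasurable_sum => j; exact: mS.
have SS0 w : (0 <= \sum_(j : @mindex n m | (mdeg j < m)%N) S j r w)%E by exact: sume_ge0.
have sumE : (\sum_(j : @mindex n m | (mdeg j < m)%N) \int[P]_w S j r w =
  \int[P]_w \sum_(j : @mindex n m | (mdeg j < m)%N) S j r w)%E.
 rewrite -big_filter -ge0_integral_sum//; last by move=> j; exact: mS.
 by apply: eq_integral => w _; rewrite big_filter.
rewrite sumE.
rewrite -int_Zl// -int_Zl// -ge0_integralD//; last 4 first.
- by move=> w _; rewrite mule_ge0.
- exact: emfunM.
- by move=> w _; rewrite mule_ge0.
- exact: emfunM.
apply: ae_ge0_le_integral => //.
- by move=> w _; rewrite lee_fin sqr_ge0.
- by apply/mEFin; apply: mfunX; apply: mfunB => //; exact: sY.1.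
- by move=> w _; rewrite adde_ge0// mule_ge0.
- by apply: emeasurable_funD; exact: emfunM.
have := hC r r1; apply: filterS => w hw _.
set Y := lstat nuT _ w in hw *; set Q := \sum_(j | _) _ in hw.
via ((3 * N)%:E * \sum_(j : @mindex n m | (mdeg j < m)%N) S j r w + 3%:E * (`|Y - Q|%:E * `|Y - Q|%:E))%E; last first.
 apply: leeD => //; apply: lee_wpmul2l => //.
 by apply: lee_pmul => //; rewrite lee_fin.
have QE : Q - a = \sum_(j : @mindex n m | (mdeg j < m)%N) r^-1 ^+ mdeg j * T j r w +
  \sum_(j : @mindex n m | (mdeg j < m)%N) r^-1 ^+ mdeg j * (mu j * (X j r w - EX j r)).
 rewrite /Q /a -sumrB -big_split/=; apply: eq_bigr => j _; rewrite -/(X j r w); ring.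
have SE j : S j r w = ((r^-1 ^+ mdeg j * T j r w) ^+ 2 + (r^-1 ^+ mdeg j * (mu j * (X j r w - EX j r))) ^+ 2)%:E.
 have e : r `^ (- (2 * q j)) = (r^-1 ^+ mdeg j) ^+ 2
  by rewrite powRN mulrC -natrM powR_mulrn ?(ltW r0)// exprM !exprVn.
 by rewrite /S -!EFinM -EFinD e !exprMn mulrA.
under eq_bigr do rewrite SE.
rewrite sumEFin -!EFinM -EFinD lee_fin -expr2 real_normK ?num_real// big_split/=.
have := sqr_sum_cond_le (fun j : @mindex n m => (mdeg j < m)%N) (fun j => r^-1 ^+ mdeg j * T j r w).
have := sqr_sum_cond_le (fun j : @mindex n m => (mdeg j < m)%N) (fun j => r^-1 ^+ mdeg j * (mu j * (X j r w - EX j r))).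
rewrite -/N; move: QE; set u := \sum_(j | _) _ * T j r w; set v := \sum_(j | _) _ * (_ * _) => QE.
set U := \sum_(j | _) _; set V := \sum_(j | _) _ => h1 h2.
have -> : Y - a = Y - Q + (u + v) by rewrite -QE; ring.
exact: sqr3_le.
Qed.
End displaced_measure.

Lemma near_right0 (R : realType) (Q : R -> Prop) :
 (\forall e \near (0 : R)^'+, Q e) <-> exists2 a : R, 0 < a & forall e, 0 < e -> e < a -> Q e.
split=> [|[a a0 h]].
 rewrite /at_right near_withinE => /nbhs_ballP[a /= a0 h]; exists a => // e e0 ea; apply: h => //.
 by rewrite /ball/= sub0r normrN gtr0_norm.
near=> e; apply: h; first by near: e; exact: nbhs_right_gt.
by near: e; exact: nbhs_right_lt.
Unshelve. all: by end_near. Qed.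

(** * Spectral mass of balls and the definition of [p]-uniformity *)

Section ball_mass.
Context {R : realType} {n : nat}.
Notation E := 'rV[R]_n.
Variable beta : meas E R.
Hypothesis lfb : loc_fin beta.
Definition ball_mass (strong : bool) (u : R) :=
 if strong then forall A, 0 < A -> exists2 e, 0 < e & forall t, 0 < t -> t < e -> (beta (ball2 t) <= (A * t `^ u)%:E)%E
 else exists2 A, 0 < A & exists2 e, 0 < e & forall t, 0 < t -> t < e -> (beta (ball2 t) <= (A * t `^ u)%:E)%E.
Let ball2_sub_cube (t : R) : @ball2 R n t `<=` cube t.
Proof. by move=> x; apply: le_lt_trans; exact: norm_le_norm2. Qed.
Let normalized (p k t : R) : 0 < t ->
 (`|t ^- n * fine (beta (ball2 t))| <= k * `|t `^ p|) <-> (beta (ball2 t) <= (k * t `^ (n%:R + p))%:E)%E.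
move=> t0; have bf : beta (ball2 t) \is a fin_num.
 rewrite ge0_fin_numE//; apply: lfb; first exact: measurable_ball2.
 have [M [Mr hM]] := @bounded_cube R n t; exists M; split => // M' MM' x /ball2_sub_cube; exact: hM.
rewrite -(fineK bf) lee_fin ger0_norm ?mulr_ge0 ?invr_ge0 ?exprn_ge0 ?(ltW t0) ?fine_ge0//.
rewrite ger0_norm ?powR_ge0// mulrC ler_pdivrMr ?exprn_gt0// powRD ?(gt_eqF t0) ?implybT//.
by rewrite powR_mulrn ?(ltW t0)// -mulrA [t `^ p * _]mulrC.
Qed.

Lemma bigO_ball_mass p : (fun e : R => e ^- n * fine (beta (ball2 e))) =O_ ((0 : R)^'+) (fun e => e `^ p) <->
 ball_mass false (n%:R + p).
split=> [/eqO_exP[k k0 /near_right0[a a0 h]]|[k k0 [a a0 h]]].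
 by exists k => //; exists a => // t t0 ta; apply/normalized => //; exact: h.
by apply/eqO_exP; exists k => //; apply/near_right0; exists a => // t t0 ta; apply/normalized => //; exact: h.
Qed.

Lemma littleo_ball_mass p : (fun e : R => e ^- n * fine (beta (ball2 e))) =o_ ((0 : R)^'+) (fun e => e `^ p) <->
 ball_mass true (n%:R + p).
split=> [/eqoP H k k0|H].
 have /near_right0[a a0 h] := H k k0.
 by exists a => // t t0 ta; apply/normalized => //; exact: h.
apply/eqoP => k k0; have [a a0 h] := H k k0.
by apply/near_right0; exists a => // t t0 ta; apply/normalized => //; exact: h.
Qed.

(** The cube of half-width [t] lies in the open ball of radius [(n + 1) * t], since the Euclidean
    norm is at most [n] times the sup norm; the constant is absorbed in [A]. *)
Lemma small_mass_of_ball strong u : ball_mass strong u -> small_mass strong u beta.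
pose D : R := n.+1%:R; have D0 : 0 < D by rewrite ltr0n.
have Du0 : 0 < D `^ u by rewrite powR_gt0.
have H (A a : R) : 0 < a -> (forall t, 0 < t -> t < a -> (beta (ball2 t) <= (A * t `^ u)%:E)%E) ->
  exists2 e, 0 < e & forall t, 0 < t -> t <= e -> (beta (cube t) <= ((A * D `^ u) * t `^ u)%:E)%E.
 move=> a0 h; exists (a / (2 * D)); first by rewrite divr_gt0// mulr_gt0.
 move=> t t0; rewrite ler_pdivlMr ?mulr_gt0// => ta.
 rewrite -mulrA -powRM ?(ltW t0) ?(ltW D0)//.
 have Dt0 : 0 < D * t by rewrite mulr_gt0.
 apply: (le_trans _ (h (D * t) Dt0 _)); last by nra.
 apply: le_measure; rewrite ?inE; [exact: mcub|exact: measurable_ball2|move=> x xt].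
 rewrite /ball2/=; apply: le_lt_trans (norm2_le x) _; rewrite /D.
 apply: (@le_lt_trans _ _ (n%:R * t)); first by rewrite ler_wpM2l// ltW.
 by rewrite ltr_pM2r// ltr_nat.
case: strong => [h A A0|[A A0 [a a0 h]]].
 have A'0 : 0 < A / D `^ u by rewrite divr_gt0.
 have [a a0 ha] := h _ A'0; have [e e0 he] := H _ a a0 ha; exists e => // t t0 te.
 by have := he t t0 te; rewrite mulfVK// gt_eqF.
by exists (A * D `^ u); [rewrite mulr_gt0|exact: H h].
Qed.

(** With [t = dl / r] the factors [r^(-2n)] and [r^(n - p)] combine to a multiple of [t^(n + p)]. *)
Lemma ball_mass_of_rate (strong : bool) (p C dl : R) (V : R -> R) : 0 < C -> 0 < dl ->
 (forall r, 0 < r -> (beta (cube (dl / r)) <= (C * r^-1 ^+ (2 * n) * V r)%:E)%E) ->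
 rate strong (n%:R - p) (fun r => (V r)%:E) -> ball_mass strong (n%:R + p).
move=> C0 dl0 hb; pose D := C * dl `^ (- (n%:R + p)).
have D0 : 0 < D by rewrite mulr_gt0// powR_gt0.
have H A r0 : 1 <= r0 -> (forall r, r0 <= r -> ((V r)%:E <= (A * r `^ (n%:R - p))%:E)%E) ->
  exists2 e, 0 < e & forall t, 0 < t -> t < e -> (beta (ball2 t) <= ((A * D) * t `^ (n%:R + p))%:E)%E.
 move=> r01 h; have r00 : 0 < r0 by exact: lt_le_trans r01.
 exists (dl / r0); first by rewrite divr_gt0.
 move=> t t0 te; pose r := dl / t; have r1 : 0 < r by rewrite divr_gt0.
 have rr0 : r0 <= r by rewrite /r ler_pdivlMr// mulrC -ler_pdivlMr// ltW.
 have tE : t = dl / r by rewrite /r; field; rewrite !gt_eqF.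
 via (beta (cube t)).
  by apply: le_measure; rewrite ?inE; [exact: measurable_ball2|exact: mcub|exact: ball2_sub_cube].
 rewrite {1}tE; apply: (le_trans (hb r r1)).
 have := h r rr0; rewrite !lee_fin => hV.
 via (C * r^-1 ^+ (2 * n) * (A * r `^ (n%:R - p))).
  by rewrite ler_wpM2l// mulr_ge0 ?exprn_ge0 ?invr_ge0 ?ltW.
 rewrite tE powRM ?invr_ge0 ?(ltW dl0) ?(ltW r1)// -[r^-1 `^ _]/((r^-1) `^ (n%:R + p)).
 rewrite -!powR_inv1 ?(ltW r1)// -powRrM -powR_mulrn ?powR_ge0// -powRrM /D.
 have -> : dl `^ (n%:R + p) = (dl `^ (- (n%:R + p)))^-1 by rewrite powRN invrK.
 have e1 : r `^ (-1 * (2 * n)%:R) * r `^ (n%:R - p) = r `^ (-1 * (n%:R + p))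
  by rewrite -powRD ?(gt_eqF r1) ?implybT//; congr (_ `^ _); rewrite natrM; ring.
 have d0 : dl `^ (- (n%:R + p)) != 0 by rewrite gt_eqF// powR_gt0.
 rewrite -e1; apply: eq_ler; field; exact: d0.
case: strong => [h A A0|[A A0 [r0 r01 h]]].
 have A'0 : 0 < A / D by rewrite divr_gt0.
 have [r0 r01 hr] := h _ A'0; have [e e0 he] := H _ r0 r01 hr; exists e => // t t0 te.
 by have := he t t0 te; rewrite mulfVK// gt_eqF.
by exists (A * D); [rewrite mulr_gt0|exact: H h].
Qed.
End ball_mass.

(** * Bartlett spectral measures of random measures *)

Section bartlett.
Context d (Om : measurableType d) (R : realType) (n : nat).
Variables (P : probability Om R) (theta : measurable_flow Om R n).
Hypothesis htheta : preserves theta P.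
Notation E := 'rV[R]_n.

Lemma bartlett_fpow (Phi : random_measure Om R n) beta f : invariant_measure theta Phi ->
 locally_square_integrable P Phi -> is_bartlett_spectral_measure P Phi beta -> tf f ->
 (\int[beta]_k (fpow f k)%:E = ((2 * pi) ^+ n * cov_stat P Phi f f)%:E)%E.
move=> hPhi hPhi2 [_ hb] tff; have [h1 h2] := hb f f (tf_test_function tff) (tf_test_function tff).
by apply: cintegral_fpow => //; rewrite -h2 (covariance_statE htheta hPhi hPhi2 tff tff).
Qed.

(** Covariances see a measure only up to null events, so the spectral measure of the regular version
    serves the original one. *)
Lemma bartlett_regular (m : Om -> (meas E R))
  (mm : forall A, measurable A -> mfunT (fun w => m w A)) :
 (forall w x A, measurable A -> m (theta x w) A = m w [set b + x | b in A]) ->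
 (forall k : nat, (\int[P]_w (m w (cube k%:R) ^+ 2) < +oo)%E) ->
 exists beta, is_bartlett_spectral_measure P m beta /\ forall f, tf f ->
  (\int[beta]_k (fpow f k)%:E = ((2 * pi) ^+ n * cov_stat P (regular_measure mm) f f)%:E)%E.
move=> minv m2; have inv := regular_invariant mm minv; have lsi := regular_square_integrable mm m2.
have [beta [lfb hb]] := bochner (covariance_stat_form htheta inv lsi).
exists beta; split; last by move=> f tff; have [h1 h2] := hb f f tff tff; exact: cintegral_fpow.
split=> // f g /test_function_tf tff /test_function_tf tfg; have [h1 h2] := hb f g tff tfg; split => //.
have [mf _ _] := tff; have [mg _ _] := tfg.
by rewrite (covariance_regular mm m2 mf mg) (covariance_statE htheta inv lsi tff tfg).
Qed.
End bartlett.

(** The reason for [K = d + 2]: the exponent [2K - 1] has to exceed the growth exponent [2d] of the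
    spectral mass and also [d + p], which is at most [d + 2]. *)
Lemma smoothness_bound (d : nat) : (2 * d < (2 * d.+2).-1)%N /\ (d.+2 < (2 * d.+2).-1)%N.
Proof. by split; lia. Qed.

Theorem proposition5p27 (R : realType) (d : nat) (hd : (0 < d)%N)
    (disp : measure_display) (Omega : measurableType disp)
    (P : probability Omega R) (theta : measurable_flow Omega R d)
    (htheta : preserves theta P)
    (p : R) (hp : - d%:R <= p <= 2)
    (Z : random_field Omega R d) (hZ : invariant_field theta Z)
    (Phi : random_measure Omega R d) (hPhi : invariant_measure theta Phi)
    (hPhi2 : locally_square_integrable P Phi)
    (P2 : R.-pker 'rV[R]_d ~> Omega) (hP2 : is_palm2 P theta Phi P2)
    (gamma c : R) (hgamma : d%:R + Num.max p 0 < gamma) (hc : 0 < c)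
    (hmoment : (\int[palm P theta Phi]_w (norm2 (Z (w, 0)) `^ gamma)%:E < +oo)%E)
    (hmoment2 : forall y : 'rV[R]_d,
      (\int[P2 y]_w (norm2 (Z (w, 0%R)) `^ gamma)%:E <= c%:E)%E)
    (hkappa : forall q : nat, (0 < q)%N -> q%:R < (d%:R + p) / 2 ->
      (\int[reduced_moment P Phi]_y
        (kappa P theta Phi P2 Z y `^ ((gamma - 2 * q%:R) / gamma)
          / (1 + norm2 y `^ (2 * q%:R - p)))%:E < +oo)%E) :
  (p_uniform P Phi p -> p_uniform P (transport Z Phi) p) /\
  (p < 2 ->
    beyond_p_uniform P Phi p -> beyond_p_uniform P (transport Z Phi) p).
Proof.
have /andP[pd p2] := hp.
have pmax0 : 0 <= Num.max p 0 by rewrite le_max lexx orbT.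
have pmaxp : p <= Num.max p 0 by rewrite le_max lexx.
have ngamma : d%:R < gamma by apply: le_lt_trans hgamma; rewrite lerDl.
have npg : d%:R + p < gamma by apply: le_lt_trans hgamma; rewrite lerD2l.
have gamma0 : 0 < gamma by apply: le_lt_trans ngamma; exact: ler0n.
have c0 := ltW hc; have u0 : 0 <= d%:R + p by lra.
(* The sup norm is at most the Euclidean one, so the moment hypotheses pass to the norm of the
   estimates. *)
have norm_le (w : Omega) : `|Z (w, 0)| `^ gamma <= norm2 (Z (w, 0)) `^ gamma
 by apply: ge0_ler_powR; rewrite ?nnegrE ?norm2_ge0 ?norm_le_norm2// ltW.
have moment2 y : (\int[P2 y]_w (`|Z (w, 0)%R| `^ gamma)%:E <= c%:E)%E
 by apply: le_trans (hmoment2 y); apply: le_intT => w; rewrite lee_fin ?powR_ge0.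
pose c1 := fine (\int[palm P theta Phi]_w (norm2 (Z (w, 0)) `^ gamma)%:E)%E.
have moment1 : (\int[palm P theta Phi]_w (`|Z (w, 0)%R| `^ gamma)%:E <= c1%:E)%E.
 rewrite fineK; last by rewrite ge0_fin_numE//; apply: int_ge0 => w _; rewrite lee_fin powR_ge0.
 by apply: le_intT => w; rewrite lee_fin ?powR_ge0.
(* [m] is the least integer with [2 * m > d + p]: the degrees kept are those with [2 * q <= d + p],
   the borderline included. *)
pose m := (Num.truncn ((d%:R + p) / 2)).+1; pose K := d.+2.
have [nK dK] := smoothness_bound d; rewrite -/K in nK dK.
have npm : d%:R + p < 2 * m%:R by rewrite mulrC -ltr_pdivrMr// truncnS_gt.
have mnp (q : nat) : (q < m)%N -> 2 * q%:R <= d%:R + p.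
 rewrite ltnS => qm; rewrite mulrC -ler_pdivlMr//; apply: (@le_trans _ _ (Num.truncn ((d%:R + p) / 2))%:R); first by rewrite ler_nat.
 by rewrite truncn_le divr_ge0.
have uK : d%:R + p < (2 * K).-1%:R.
 apply: (@le_lt_trans _ _ (d.+2)%:R); first by rewrite -addn2 natrD lerD2l.
 by rewrite ltr_nat.
have mmT := measurable_transport Phi Z.
have sqT := transport_square htheta hPhi hPhi2 hZ hP2 c0 gamma0 moment2 ngamma.
have lsT : locally_square_integrable P (transport Z Phi) := square_integrable_of_cube mmT sqT.
(* The spectral measure of the displaced measure exists in any case; only its mass near the origin
   remains to be compared with that of [Phi]. *)
have [beta' [hb' betaV']] := bartlett_regular htheta mmT (transport_invariant hPhi hZ) sqT.
have [lfb' _] := hb'.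
have key (strong : bool) beta : (strong -> p < 2) -> is_bartlett_spectral_measure P Phi beta ->
  ball_mass beta strong (d%:R + p) -> ball_mass beta' strong (d%:R + p).
 move=> sp hb bm; have [lfb _] := hb.
 have sm := small_mass_of_ball bm.
 have hV (j : @mindex d m) := covariance_rate htheta nK hPhi hPhi2 j lfb (fun f => bartlett_fpow htheta hPhi hPhi2 hb (f := f)) u0 uK sm.
 have e : (2 * d)%:R - (d%:R + p) = d%:R - p :> R by rewrite natrM; ring.
 rewrite e in hV.
 have rT := transport_rate htheta hPhi hPhi2 hZ hP2 c0 gamma0 moment2 ngamma moment1 nK (ltn0Sn _) npm mnp npg p2 sp hkappa hV.
 have [C C0 hC] := spectral_mass_le betaV' m K.
 apply: (ball_mass_of_rate C0 _ hC rT).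
 by rewrite invr_gt0 ltr_wpDl// mulr_ge0.
split=> [[_ [beta hb hO]]|plt [_ [beta hb ho]]]; split => //; exists beta' => //; have [lfb _] := hb.
 by apply/(bigO_ball_mass lfb')/(key false beta _ hb) => //; apply/bigO_ball_mass.
by apply/(littleo_ball_mass lfb')/(key true beta _ hb) => //; apply/littleo_ball_mass.
Qed.
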